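(* Let $k\ge3$ and $0<d<d_{\rm cond}$, and let $\mathbf m\sim{\rm Po}(dn/k)$. Then $$\lim_{n\to\infty}\frac1n\,\mathbb E\Big[\big\langle|\boldsymbol\sigma\cdot\boldsymbol\tau|\big\rangle_{\mathbb F_k(n,\mathbf m)}\ \Big|\ Z(\mathbb F_k(n,\mathbf m))>0\Big]=0.$$
   Context: $\mathbb F_k(n,m)$ is the random $k$-CNF formula over $x_1,\dots,x_n$ with $m$ independent uniformly random clauses of length $k$, no variable appearing twice in a clause. An assignment is NAE-satisfying if it and its binary inverse satisfy all clauses; $Z(\mathbb F)$ is the number of NAE-satisfying assignments. Given $\mathbb F$ with $Z(\mathbb F)>0$, $\boldsymbol\sigma,\boldsymbol\tau$ are two independent uniformly random NAE-satisfying assignments, viewed as vectors in $\{\pm1\}^n$ (false/true $=\pm1$), and $\langle\cdot\rangle_{\mathbb F}$ denotes expectation over $\boldsymbol\sigma,\boldsymbol\tau$; $\boldsymbol\sigma\cdot\boldsymbol\tau$ is the inner product. $d_{\rm cond}$ is defined as follows: with $\Lambda(x)=x\ln x$, $\Lambda(0)=0$, $\mathcal P_*[0,1]$ the probability measures on $[0,1]$ with mean $1/2$, $\gamma\sim{\rm Po}(d)$ and $\rho_1,\rho_2,\dots$ i.i.d. from $\pi$ independent of $\gamma$, $$\mathcal B(d,\pi)=\mathbb E\left[\frac{\Lambda\big(\prod_{i=1}^{\gamma}(1-\prod_{j=1}^{k-1}\rho_{ki+j})+\prod_{i=1}^{\gamma}(1-\prod_{j=1}^{k-1}(1-\rho_{ki+j}))\big)}{2(1-2^{1-k})^{\gamma}}-\frac{d(k-1)\Lambda\big(1-\prod_{j=1}^k\rho_j-\prod_{j=1}^k(1-\rho_j)\big)}{k(1-2^{1-k})}\right],$$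 and $d_{\rm cond}=\inf\{d>0:\sup_{\pi\in\mathcal P_*[0,1]}\mathcal B(d,\pi)>\ln2+\frac dk\ln(1-2^{1-k})\}$. *)

(* Defs.v *)
From HB Require Import structures.
From mathcomp Require Import all_boot all_order all_algebra.
From mathcomp Require Import all_classical all_reals all_analysis.
Set Implicit Arguments. Unset Strict Implicit. Unset Printing Implicit Defensive.
Import Order.TTheory GRing.Theory Num.Theory.
Import numFieldNormedType.Exports.
Local Open Scope classical_set_scope.
Local Open Scope ring_scope.

Section Defs.
Variable R : realType.

(* A literal is a pair (variable, sign); sign true = positive literal x_v,
   sign false = negative literal (not x_v). *)
Definition clause (k n : nat) := {ffun 'I_k -> 'I_n * bool}.
Definition valid_clause k n (c : clause k n) : bool :=
  injectiveb (fun i : 'I_k => (c i).1).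
Definition formula (k n m : nat) := {ffun 'I_m -> clause k n}.
Definition valid_formula k n m (F : formula k n m) : bool :=
  [forall j, valid_clause (F j)].

Definition assignment (n : nat) := {ffun 'I_n -> bool}.
Definition lit_true n (s : assignment n) (l : 'I_n * bool) : bool := s l.1 == l.2.
Definition satisfies_clause k n (s : assignment n) (c : clause k n) : bool :=
  [exists i, lit_true s (c i)].
Definition satisfies k n m (s : assignment n) (F : formula k n m) : bool :=
  [forall j, satisfies_clause s (F j)].
Definition inverse n (s : assignment n) : assignment n := [ffun v => ~~ s v].
Definition NAE k n m (s : assignment n) (F : formula k n m) : bool :=
  satisfies s F && satisfies (inverse s) F.
Definition Z k n m (F : formula k n m) : nat := #|[set s : assignment n | NAE s F]|.

Definition spin (b : bool) : R := if b then -1 else 1.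
Definition dot n (s t : assignment n) : R := \sum_(v < n) spin (s v) * spin (t v).

Definition gibbs_abs_overlap k n m (F : formula k n m) : R :=
  (\sum_(s : assignment n | NAE s F) \sum_(t : assignment n | NAE t F) `|dot s t|)
    / ((Z F)%:R ^+ 2).

Definition avgF k n m (X : formula k n m -> R) : R :=
  (\sum_(F : formula k n m | valid_formula F) X F) / #|[set F : formula k n m | valid_formula F]|%:R.

Definition rseries (a : nat -> R) : R := limn (fun N => \sum_(0 <= i < N) a i).

Definition cond_overlap (k : nat) (d : R) (n : nat) : R :=
  let lam := d * n%:R / k%:R in
  rseries (fun m => poisson_pmf lam m *
      avgF (fun F : formula k n m => (0 < Z F)%:R * gibbs_abs_overlap F))
  / rseries (fun m => poisson_pmf lam m *
      avgF (fun F : formula k n m => (0 < Z F)%:R)).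

Definition Lambda (x : R) : R := if x == 0 then 0 else x * ln x.

Definition Pstar : set (probability R R) :=
  [set mu : probability R R | mu [set` `[(0:R), 1]%R] = 1%E /\ (\int[mu]_x (x%:E) = (2^-1)%:E)%E].

(* iterated integral against mu of f over the coordinates 0,...,N-1
   (coordinates >= N are set to 0): the expectation of f(rho) with
   rho_0,...,rho_{N-1} i.i.d. from mu *)
Fixpoint iint (mu : probability R R) (N : nat) (f : (nat -> R) -> R) : R :=
  match N with
  | 0 => f (fun _ => 0)
  | N'.+1 => iint mu N' (fun r =>
        Rintegral mu setT (fun x => f (fun t => if t == N' then x else r t)))
  end.

Definition B_integrand (k : nat) (d : R) (g : nat) (rho : nat -> R) : R :=
  Lambda (\prod_(1 <= i < g.+1) (1 - \prod_(1 <= j < k) rho (k * i + j)%N)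
        + \prod_(1 <= i < g.+1) (1 - \prod_(1 <= j < k) (1 - rho (k * i + j)%N)))
    / (2 * (1 - 2 ^- k.-1) ^+ g)
  - d * (k.-1)%:R * Lambda (1 - \prod_(1 <= j < k.+1) rho j
                              - \prod_(1 <= j < k.+1) (1 - rho j))
    / (k%:R * (1 - 2 ^- k.-1)).

(* B(d,mu): expectation over gamma ~ Po(d) and i.i.d. rho_1, rho_2, ... ~ mu;
   given gamma = g only rho_1,...,rho_{k g + k} are used *)
Definition B (k : nat) (d : R) (mu : probability R R) : R :=
  rseries (fun g => poisson_pmf d g * iint mu (k * g + k + 1) (B_integrand k d g)).

Definition dcond (k : nat) : \bar R :=
  ereal_inf [set x%:E | x in [set d : R | 0 < d /\
     (ereal_sup [set (B k d mu)%:E | mu in Pstar]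
        > (ln 2 + d / k%:R * ln (1 - 2 ^- k.-1))%:E)%E]].

End Defs.

(* Submission.v *)
Require Import Defs.
From HB Require Import structures.
From mathcomp Require Import all_boot all_order all_algebra.
From mathcomp Require Import all_classical all_reals all_analysis.
From mathcomp Require Import ring lra zify.
From mathcomp Require Import measurable_realfun.
Set Implicit Arguments. Unset Strict Implicit. Unset Printing Implicit Defensive.
Import Order.TTheory GRing.Theory Num.Theory.
Import numFieldNormedType.Exports.
Local Open Scope classical_set_scope.
Local Open Scope ring_scope.

(** Normalise every clause to the likelihood [1{NAE} / q], [q = 1 - 2^(1-k)], so
    that with [mu] uniform on assignments the number of solutions becomes a
    density [A] of expectation one.  Clauses are drawn with i.i.d. literals: all
    [m = O(n)] of them have distinct variables with probability bounded below,
    so null events of that model stay null for the paper's model.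

    1. Below [d_cond] the planted relative entropy [E[A ln A]] is [o(n)]: adding
       one variable changes it by a Bethe functional at the law of the posterior
       marginals, once a few pinned literals have decorrelated the posterior, and
       [sup B <= ln 2 + (d/k) ln q] says that this change is not positive.
    2. [E[A^(1+lam)] <= exp(lam a n)] by a bounded-difference estimate for
       softened clauses; since [E[A^(1+lam)]] would grow exponentially if the
       mean squared overlap were not small, that overlap is small with
       exponentially high planted probability.  High even moments of the overlap
       then grow geometrically with the number of clauses unless they are
       exponentially small.
    3. Two-point distributions near [1/2] in [B] give the Kesten-Stigum bound
       [d (k-1) <= (2^(k-1) - 1)^2], so [E[A^2 <exp(a n R^2)>]], restricted to
       small overlaps [R], is bounded.
    4. The potential [ln (1 + 1/(A + c))] increases by [O(1/n)] per clause in the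
       null model, hence [A] is bounded away from [0] with high probability and
       the planted overlap estimate transfers. *)

(** With the normalised factors, adding a clause acts on functionals of the density [W] through the
    averaging operator [Tr]. These operators commute, and convexity makes entropies and overlap
    energies grow under them. Since [d] may be replaced by a slightly larger value below the
    threshold, a quantity at density [d] can be bounded by letting it grow through linearly many
    further clauses until it would contradict an estimate at the larger density.

    The obstacle is that pairs of large overlap may dominate the full second moment of [A]. The
    second moment is therefore taken over small overlaps only, where Kesten-Stigum makes it a
    convergent Gaussian-type moment; large overlaps are controlled only under the planted weight
    [A]. Removing that weight needs a lower bound on [A]. The logarithmic potential supplies it
    without a variance asymptotics: its second-order error per clause is again an overlap moment,
    bounded by the potential itself and by the truncated second moment.

    Entropy estimates are obtained for Poisson many clauses, where adding a variable is a thinning,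
    and pass to a fixed number of clauses by convexity. *)

(** * Expectations under finite laws *)

Section FiniteExpectation.
Variable R : realType.

(** A finite law is a list of weighted atoms, repetitions allowed, so laws on lists and on functions
    need no equality or finiteness structure. Linearity and exchange hold for arbitrary weights;
    positivity is asked for through [isprob]. *)
Definition fd (T : Type) := seq (R * T).
Definition ex T (p : fd T) (f : T -> R) : R := \sum_(z <- p) z.1 * f z.2.
Definition isprob T (p : fd T) :=
  all (fun z => 0 <= z.1) p /\ ex p (fun=> 1) = 1.

Section Ex.
Variables (T : Type) (p : fd T).

Lemma exD f g : ex p (fun x => f x + g x) = ex p f + ex p g.
Proof. by rewrite /ex -big_split; apply: eq_bigr => z _; rewrite mulrDr. Qed.

Lemma exZ c f : ex p (fun x => c * f x) = c * ex p f.
Proof. by rewrite /ex mulr_sumr; apply: eq_bigr => z _; rewrite mulrCA. Qed.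

Lemma exZr c f : ex p (fun x => f x * c) = ex p f * c.
Proof. by rewrite mulrC -exZ; congr ex; apply/funext => x; rewrite mulrC. Qed.

Lemma exN f : ex p (fun x => - f x) = - ex p f.
Proof. by rewrite /ex -sumrN; apply: eq_bigr => z _; rewrite mulrN. Qed.

Lemma exB f g : ex p (fun x => f x - g x) = ex p f - ex p g.
Proof. by rewrite exD exN. Qed.

Lemma ex0 : ex p (fun=> 0) = 0.
Proof. by rewrite /ex big1 // => z _; rewrite mulr0. Qed.

Lemma eq_ex f g : f =1 g -> ex p f = ex p g.
Proof. by move=> fg; congr ex; apply/funext. Qed.

Hypothesis pP : isprob p.

Lemma ex_le f g : (forall x, f x <= g x) -> ex p f <= ex p g.
Proof.
case: pP => + _; rewrite /ex => + fg; elim: p => [|z r IH] /=; first by rewrite !big_nil.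
case/andP=> z0 /IH {}IH; rewrite !big_cons lerD //.
exact: ler_wpM2l.
Qed.

Lemma ex_cst c : ex p (fun=> c) = c.
Proof.
case: pP => _ h; rewrite -[RHS]mulr1 -h -exZ; apply: eq_ex => x; by rewrite mulr1.
Qed.

Lemma ex_ge0 f : (forall x, 0 <= f x) -> 0 <= ex p f.
Proof. by move=> f0; rewrite -ex0; apply: ex_le. Qed.

Lemma ex_norm f : `|ex p f| <= ex p (fun x => `|f x|).
Proof.
rewrite ler_norml -exN; apply/andP; split; apply: ex_le => x; last exact: ler_norm.
by rewrite lerNl ler_normr lexx orbT.
Qed.

End Ex.

Lemma ex_exchange T U (p : fd T) (r : fd U) (f : T -> U -> R) :
  ex p (fun x => ex r (fun y => f x y)) = ex r (fun y => ex p (fun x => f x y)).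
Proof.
rewrite /ex; under eq_bigr do rewrite mulr_sumr.
rewrite exchange_big /=; apply: eq_bigr => z _; rewrite mulr_sumr.
by apply: eq_bigr => w _; rewrite mulrCA.
Qed.

Definition fbind T U (p : fd T) (r : T -> fd U) : fd U :=
  flatten [seq [seq (z.1 * w.1, w.2) | w <- r z.2] | z <- p].

Lemma ex_bind T U (p : fd T) (r : T -> fd U) f :
  ex (fbind p r) f = ex p (fun x => ex (r x) f).
Proof.
rewrite /ex /fbind; elim: p => [|z p IH] /=; first by rewrite !big_nil.
rewrite big_cat IH big_cons; congr (_ + _).
by rewrite big_map mulr_sumr; apply: eq_bigr => w _; rewrite mulrA.
Qed.

Lemma isprob_bind T U (p : fd T) (r : T -> fd U) :
  isprob p -> (forall x, isprob (r x)) -> isprob (fbind p r).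
Proof.
move=> pP rP; split; last first.
  rewrite ex_bind -[RHS](ex_cst pP); apply: eq_ex => x; by case: (rP x).
case: pP => + _; rewrite /fbind; elim: p => [|z p IH] //= => /andP[z0 /IH {}IH].
rewrite all_cat IH andbT all_map; case: (rP z.2) => h _.
by apply: sub_all h => w /= w0; rewrite mulr_ge0.
Qed.

Definition fmap T U (h : T -> U) (p : fd T) : fd U := [seq (z.1, h z.2) | z <- p].

Lemma ex_map T U (h : T -> U) p f : ex (fmap h p) f = ex p (fun x => f (h x)).
Proof. by rewrite /ex big_map. Qed.

Lemma isprob_map T U (h : T -> U) p : isprob p -> isprob (fmap h p).
Proof.
case=> p0 p1; split; last by rewrite ex_map.
by rewrite all_map; apply: sub_all p0.
Qed.

Definition unif T (s : seq T) : fd T := [seq ((size s)%:R^-1, x) | x <- s].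

Lemma ex_unif T (s : seq T) f : ex (unif s) f = (size s)%:R^-1 * \sum_(x <- s) f x.
Proof. by rewrite /ex big_map mulr_sumr. Qed.

Lemma isprob_unif T (s : seq T) : (0 < size s)%N -> isprob (unif s).
Proof.
move=> s0; split; first by rewrite all_map (eq_all (a2 := predT)) ?all_predT // => x /=; rewrite invr_ge0 ler0n.
rewrite ex_unif big_const_seq count_predT iter_addr addr0.
by rewrite mulVf // pnatr_eq0 -lt0n.
Qed.

Fixpoint iid T (p : fd T) (n : nat) : fd (seq T) :=
  if n is n'.+1 then fbind p (fun x => fmap (cons x) (iid p n')) else [:: (1, [::])].

Lemma ex_iid0 T (p : fd T) f : ex (iid p 0) f = f [::].
Proof. by rewrite /ex big_seq1 mul1r. Qed.

Lemma ex_iidS T (p : fd T) n f :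
  ex (iid p n.+1) f = ex p (fun x => ex (iid p n) (fun l => f (x :: l))).
Proof. by rewrite /= ex_bind; apply: eq_ex => x; rewrite ex_map. Qed.

Lemma isprob_iid T (p : fd T) n : isprob p -> isprob (iid p n).
Proof.
move=> pP; elim: n => [|n IH]; last by apply: isprob_bind => // x; exact: isprob_map.
by split; rewrite /= ?ler01 // ex_iid0.
Qed.

Lemma ex_iidD T (p : fd T) m n f :
  ex (iid p (m + n)) f = ex (iid p m) (fun l => ex (iid p n) (fun l' => f (l ++ l'))).
Proof.
elim: m f => [|m IH] f; first by rewrite ex_iid0.
by rewrite addSn !ex_iidS; apply: eq_ex => x; rewrite IH.
Qed.

Lemma ex_iid_map T U (h : T -> U) (p : fd T) n f :
  ex (iid (fmap h p) n) f = ex (iid p n) (fun l => f (map h l)).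
Proof.
elim: n f => [|n IH] f; first by rewrite !ex_iid0.
by rewrite !ex_iidS ex_map; apply: eq_ex => x; rewrite IH.
Qed.

(* Only lists of length [n] carry weight. *)
Lemma eq_ex_iid T (p : fd T) n f g :
  (forall l, size l = n -> f l = g l) -> ex (iid p n) f = ex (iid p n) g.
Proof.
elim: n f g => [|n IH] f g fg; first by rewrite !ex_iid0 fg.
by rewrite !ex_iidS; apply: eq_ex => x; apply: IH => l ln; rewrite fg //= ln.
Qed.

Lemma ex_le_iid T (p : fd T) n f g : isprob p ->
  (forall l, size l = n -> f l <= g l) -> ex (iid p n) f <= ex (iid p n) g.
Proof.
move=> pP; elim: n f g => [|n IH] f g fg; first by rewrite !ex_iid0 fg.
by rewrite !ex_iidS; apply: ex_le => // x; apply: IH => l ln; rewrite fg //= ln.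
Qed.

Lemma ex_prod T (p : fd T) n (f : T -> R) :
  ex (iid p n) (fun l => \prod_(x <- l) f x) = ex p f ^+ n.
Proof.
elim: n => [|n IH]; first by rewrite ex_iid0 big_nil.
rewrite ex_iidS exprS -exZr; apply: eq_ex => x; rewrite -IH -exZ.
by apply: eq_ex => l; rewrite big_cons.
Qed.

End FiniteExpectation.

(** * Relative entropy and the log-sum inequality *)

Section LogTools.
Variable R : realType.

Lemma LambdaE (x : R) : Lambda x = x * ln x.
Proof. by rewrite /Lambda; case: eqP => // ->; rewrite mul0r. Qed.

Lemma ln_ge1V (x : R) : 0 < x -> 1 - x^-1 <= ln x.
Proof.
move=> x0; have := le_ln1Dx (x := x^-1 - 1).
have xV : 0 < x^-1 by rewrite invr_gt0.
rewrite (_ : 1 + (x^-1 - 1) = x^-1); last by ring.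
rewrite lnV ?posrE // => h; have := h _; lra.
Qed.

(** The perspective of [x ln x], the density of relative entropy. Its value at [x = 0] is 0 whatever
    the logarithms are. *)
Definition xl (x y : R) := x * (ln x - ln y).

(* The tangent plane of the jointly convex function [xl] at slope [c]. *)
Lemma xl_tangent (x y c : R) : 0 <= x -> 0 <= y -> (y = 0 -> x = 0) ->
  x * c + x - y * expR c <= xl x y.
Proof.
move=> x0 y0 yx; rewrite /xl; have [->|xn] := eqVneq x 0.
  by rewrite !mul0r !add0r oppr_le0 mulr_ge0 ?expR_ge0.
have xp : 0 < x by rewrite lt_def xn.
have yp : 0 < y by rewrite lt_def y0 andbT; apply: contra xn => /eqP/yx ->.
have e0 := expR_gt0 c.
have := @ln_ge1V (x / (y * expR c)); rewrite divr_gt0 ?mulr_gt0 // => /(_ isT).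
rewrite ln_div ?posrE ?mulr_gt0 // lnM ?posrE // expRK => h.
have := ler_wpM2l x0 h; rewrite invf_div.
have -> : x * (1 - y * expR c / x) = x - y * expR c by field.
lra.
Qed.

Lemma ex_null T (p : fd R T) (f g : T -> R) : isprob p -> (forall x, 0 <= f x) ->
  (forall x, f x = 0 -> g x = 0) -> ex p f = 0 -> ex p g = 0.
Proof.
case=> + _ f0 fg; rewrite /ex; elim: p => [|z r IH] /=; first by rewrite !big_nil.
case/andP=> z0 r0; rewrite !big_cons => /eqP.
rewrite paddr_eq0 ?mulr_ge0 //; last first.
  elim: r r0 {IH} => [|w r IH] /=; first by rewrite big_nil.
  by case/andP=> w0 /IH h; rewrite big_cons addr_ge0 // mulr_ge0.
case/andP=> /eqP h1 /eqP /(IH r0) ->; rewrite addr0.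
by case/eqP: h1; rewrite mulf_eq0 => /orP[/eqP->|/eqP/fg->]; rewrite ?mul0r ?mulr0.
Qed.

(** Take the slope [ln E[x] - ln E[y]]: the tangent plane of [xl] is then exact at the two means and
    below [xl] at every atom. *)
Lemma log_sum T (p : fd R T) (x y : T -> R) : isprob p ->
  (forall i, 0 <= x i) -> (forall i, 0 <= y i) -> (forall i, y i = 0 -> x i = 0) ->
  xl (ex p x) (ex p y) <= ex p (fun i => xl (x i) (y i)).
Proof.
move=> pP x0 y0 yx.
have X0 : 0 <= ex p x by apply: ex_ge0.
have Y0 : 0 <= ex p y by apply: ex_ge0.
have [X00|Xn] := eqVneq (ex p x) 0.
  rewrite {1}/xl X00 mul0r (ex_null pP x0 _ X00) // => i xi0.
  by rewrite /xl xi0 mul0r.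
have Xp : 0 < ex p x by rewrite lt_def Xn.
have Yp : 0 < ex p y.
  rewrite lt_def Y0 andbT; apply: contra Xn => /eqP h.
  by apply/eqP; apply: (ex_null pP y0 _ h).
set c := ln (ex p x) - ln (ex p y).
have -> : xl (ex p x) (ex p y) = ex p (fun i => x i * c + x i - y i * expR c).
  rewrite exB exD !exZr /xl -/c expRD expRN !lnK ?posrE //.
  by field; rewrite gt_eqF.
by apply: ex_le => // i; apply: xl_tangent => //; exact: yx.
Qed.

End LogTools.

(** * Random likelihood factors and the growth of entropy *)

Section Channels.
Variables (R : realType) (S : Type) (mu : fd R S).
Hypothesis muP : isprob mu.
Implicit Types (W : S -> R) (Phi Psi : (S -> R) -> R).

Definition nn W := forall s, 0 <= W s.
Definition A W := ex mu W.
Definition wmul W (V : S -> R) := fun s => W s * V s.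
(** Mean of [Phi] after one more factor drawn from the null law [p]; its iterates are null
    expectations over independent factors. *)
Definition Tr I (p : fd R I) (L : I -> S -> R) Phi W := ex p (fun i => Phi (wmul W (L i))).
(** Its null expectation is the relative entropy of the planted law with respect to the null law. *)
Definition Ent W := Lambda (A W).
(** Up to the weight [A W], the relative entropy of the predictive law of the next factor with
    respect to [p]. *)
Definition Inc I (p : fd R I) (L : I -> S -> R) W :=
  ex p (fun i => xl (A (wmul W (L i))) (A W)).
(** By the last condition [L ^~ s] is a density with respect to [p] for each [s]: the law of a
    factor planted at [s]. *)
Definition channel I (p : fd R I) (L : I -> S -> R) :=
  [/\ isprob p, forall i, nn (L i) & forall s, ex p (L ^~ s) = 1].

Lemma nn_wmul W V : nn W -> nn V -> nn (wmul W V).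
Proof. by move=> w v s; rewrite mulr_ge0. Qed.

Lemma nn1 : nn (fun=> 1).
Proof. by move=> s; exact: ler01. Qed.

Lemma A_ge0 W : nn W -> 0 <= A W.
Proof. by move=> w; apply: ex_ge0. Qed.

Lemma A1 : A (fun=> 1) = 1.
Proof. by case: muP. Qed.

Lemma A_null W V : nn W -> A W = 0 -> A (wmul W V) = 0.
Proof. by move=> w; apply: ex_null => // s ws0; rewrite /wmul ws0 mul0r. Qed.

Lemma wmulA W V U : wmul (wmul W V) U = wmul W (wmul V U).
Proof. by apply/funext => s; rewrite /wmul mulrA. Qed.

Lemma wmulAC W V U : wmul (wmul W V) U = wmul (wmul W U) V.
Proof. by apply/funext => s; rewrite /wmul mulrAC. Qed.

Lemma wmul1r W : wmul W (fun=> 1) = W.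
Proof. by apply/funext => s; rewrite /wmul mulr1. Qed.

Section OneChannel.
Variables (I : Type) (p : fd R I) (L : I -> S -> R).

Lemma TrD Phi Psi : Tr p L (fun W => Phi W + Psi W) = fun W => Tr p L Phi W + Tr p L Psi W.
Proof. by apply/funext => W; rewrite /Tr exD. Qed.

Lemma TrZ c Phi : Tr p L (fun W => c * Phi W) = fun W => c * Tr p L Phi W.
Proof. by apply/funext => W; rewrite /Tr exZ. Qed.

Hypothesis chP : channel p L.
Let pP : isprob p. Proof. by case: chP. Qed.
Let L0 i : nn (L i). Proof. by case: chP. Qed.
Let L1 s : ex p (L ^~ s) = 1. Proof. by case: chP. Qed.

Lemma Tr_le Phi Psi W : nn W -> (forall V, nn V -> Phi V <= Psi V) ->
  Tr p L Phi W <= Tr p L Psi W.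
Proof. by move=> w h; apply: ex_le => // i; apply: h; exact: nn_wmul. Qed.

Lemma ex_AL W : ex p (fun i => A (wmul W (L i))) = A W.
Proof.
rewrite /A ex_exchange; apply: eq_ex => s.
by rewrite /wmul exZ L1 mulr1.
Qed.

Lemma Tr_A : Tr p L A = A.
Proof. by apply/funext => W; rewrite /Tr ex_AL. Qed.

Lemma Tr_cst c : Tr p L (fun=> c) = fun=> c.
Proof. by apply/funext => W; rewrite /Tr ex_cst. Qed.

Lemma Tr_Ent W : Tr p L Ent W = Ent W + Inc p L W.
Proof.
rewrite /Tr /Inc /Ent LambdaE -{1}(ex_AL W) -exZr -exD; apply: eq_ex => i.
rewrite LambdaE /xl; ring.
Qed.

Lemma Inc_ge0 W : nn W -> 0 <= Inc p L W.
Proof.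
move=> w; have := @log_sum R I p (fun i => A (wmul W (L i))) (fun=> A W) pP.
rewrite ex_AL ex_cst // {1}/xl subrr mulr0; apply.
- by move=> i; apply: A_ge0; exact: nn_wmul.
- by move=> i; exact: A_ge0.
- by move=> i; exact: A_null.
Qed.

Lemma Inc_le B W : 1 <= B -> (forall i s, L i s <= B) -> nn W -> Inc p L W <= ln B * A W.
Proof.
move=> B1 LB w; rewrite -(ex_AL W) -exZ; apply: ex_le => // i.
have a0 : 0 <= A (wmul W (L i)) by apply: A_ge0; exact: nn_wmul.
rewrite /xl; have [->|an] := eqVneq (A (wmul W (L i))) 0; first by rewrite mul0r mulr0.
have ap : 0 < A (wmul W (L i)) by rewrite lt_def an.
have Wp : 0 < A W.
  by rewrite lt_def A_ge0 // andbT; apply: contra an => /eqP h; rewrite A_null.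
rewrite [leRHS]mulrC ler_pM2l // lerBlDr -lnM ?posrE //; last exact: lt_le_trans B1.
rewrite ler_ln ?posrE ?mulr_gt0 //; last exact: lt_le_trans B1.
by rewrite /A -exZ; apply: ex_le => // s; rewrite /wmul mulrC ler_wpM2r.
Qed.

Lemma iterTr_le m Phi Psi W : nn W -> (forall V, nn V -> Phi V <= Psi V) ->
  iter m (Tr p L) Phi W <= iter m (Tr p L) Psi W.
Proof.
elim: m W => [|m IH] W w h /=; first exact: h.
by apply: Tr_le => // V v; exact: IH.
Qed.

Lemma iterTr_A m : iter m (Tr p L) A = A.
Proof. by elim: m => //= m ->; exact: Tr_A. Qed.

Lemma iterTr_cst m c : iter m (Tr p L) (fun=> c) = fun=> c.
Proof. by elim: m => //= m ->; exact: Tr_cst. Qed.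

End OneChannel.

Lemma iterTrD I (p : fd R I) L m Phi Psi : iter m (Tr p L) (fun W => Phi W + Psi W) =
  fun W => iter m (Tr p L) Phi W + iter m (Tr p L) Psi W.
Proof. by elim: m => //= m ->; exact: TrD. Qed.

Lemma iterTrZ I (p : fd R I) L m c Phi : iter m (Tr p L) (fun W => c * Phi W) =
  fun W => c * iter m (Tr p L) Phi W.
Proof. by elim: m => //= m ->; exact: TrZ. Qed.

Lemma Tr_comm I J (p : fd R I) L (p' : fd R J) L' Phi :
  Tr p L (Tr p' L' Phi) = Tr p' L' (Tr p L Phi).
Proof.
apply/funext => W; rewrite /Tr ex_exchange; apply: eq_ex => j; apply: eq_ex => i.
by rewrite wmulAC.
Qed.

Lemma Tr_iter_comm I J (p : fd R I) L (p' : fd R J) L' m Phi :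
  Tr p L (iter m (Tr p' L') Phi) = iter m (Tr p' L') (Tr p L Phi).
Proof. by elim: m => //= m IH; rewrite Tr_comm IH. Qed.

Lemma iter_iter_comm I J (p : fd R I) L (p' : fd R J) L' j m Phi :
  iter j (Tr p L) (iter m (Tr p' L') Phi) = iter m (Tr p' L') (iter j (Tr p L) Phi).
Proof. by elim: j => //= j ->; rewrite Tr_iter_comm. Qed.

Section TwoChannels.
Variables (I J : Type) (p : fd R I) (L : I -> S -> R) (p' : fd R J) (L' : J -> S -> R).
Hypothesis chP : channel p L.
Hypothesis chP' : channel p' L'.

(** Before the second observation is seen, the predictive law is a mixture over its outcomes, and
    relative entropy is convex: this is the log-sum inequality over [j]. *)
Lemma Tr_Inc_ge W : nn W -> Inc p L W <= Tr p' L' (Inc p L) W.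
Proof.
case: chP => pP L0 _; case: chP' => pP' L0' L1' w.
rewrite /Tr /Inc ex_exchange; apply: ex_le => // i.
rewrite -(ex_AL chP' (wmul W (L i))) -[in X in xl _ X](ex_AL chP' W).
rewrite [X in _ <= X](@eq_ex _ _ _ _ (fun j =>
  xl (A (wmul (wmul W (L i)) (L' j))) (A (wmul W (L' j))))); last by move=> j; rewrite wmulAC.
apply: log_sum => // j; do ?[by apply: A_ge0; do !apply: nn_wmul].
by rewrite wmulAC; apply: A_null; exact: nn_wmul.
Qed.

Lemma iterTr_Inc_ge m W : nn W -> Inc p L W <= iter m (Tr p' L') (Inc p L) W.
Proof.
elim: m W => //= m IH W w; apply: le_trans (Tr_Inc_ge w) _.
exact: Tr_le.
Qed.

End TwoChannels.

(** Later increments are on average no smaller than the first one, so entropy is convex in the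
    number of factors. *)
Lemma iter_Ent_ge I (p : fd R I) L : channel p L -> forall m W, nn W ->
  Ent W + m%:R * Inc p L W <= iter m (Tr p L) Ent W.
Proof.
move=> ch; elim=> [|m IH] W w; first by rewrite mul0r addr0.
rewrite iterSr; have -> : Tr p L Ent = fun W => Ent W + Inc p L W.
  by apply/funext => V; rewrite (Tr_Ent ch).
rewrite iterTrD -natr1 mulrDl mul1r addrA; apply: lerD; first exact: IH.
exact: iterTr_Inc_ge.
Qed.

End Channels.

(** * Comparisons of expectations on the support of a law *)

Section Support.
Variable R : realType.

Definition fsupp T (P : T -> bool) (p : fd R T) := all (fun z => P z.2) p.

Lemma eq_ex_supp T (P : T -> bool) (p : fd R T) (f g : T -> R) :
  fsupp P p -> (forall x, P x -> f x = g x) -> ex p f = ex p g.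
Proof.
rewrite /ex => + fg; elim: p => [|z p IH] /=; first by rewrite !big_nil.
by case/andP=> Pz /IH h; rewrite !big_cons h fg.
Qed.

Lemma ex_le_supp T (P : T -> bool) (p : fd R T) (f g : T -> R) : isprob p ->
  fsupp P p -> (forall x, P x -> f x <= g x) -> ex p f <= ex p g.
Proof.
case=> + _; rewrite /ex => + + fg; elim: p => [|z p IH] /=; first by rewrite !big_nil.
case/andP=> z0 p0 /andP[Pz Pp]; rewrite !big_cons lerD //; last exact: IH.
by apply: ler_wpM2l => //; exact: fg.
Qed.

Lemma fsupp_bind T U (P : T -> bool) (Q : U -> bool) (p : fd R T) (r : T -> fd R U) :
  fsupp P p -> (forall x, P x -> fsupp Q (r x)) -> fsupp Q (fbind p r).
Proof.
move=> + h; rewrite /fbind; elim: p => //= z p IH /andP[Pz /IH {}IH].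
have := IH; rewrite /fsupp all_cat => ->; rewrite andbT all_map; exact: h.
Qed.

Lemma fsupp_iid T (P : T -> bool) (p : fd R T) n : fsupp P p -> fsupp (all P) (iid p n).
Proof.
move=> Pp; elim: n => //= n IH; apply: fsupp_bind Pp _ => x Px.
by rewrite /fsupp all_map; apply: sub_all IH => z /= ->; rewrite Px.
Qed.

End Support.

(** * Spins, literals, pins and clauses *)

Section Spins.
Variable R : realType.

Definition upd (s : nat -> bool) (n : nat) b := fun v => if v == n then b else s v.
Definition coin : fd R bool := [:: (2^-1, true); (2^-1, false)].

Lemma ex_coin f : ex coin f = (f true + f false) / 2.
Proof. by rewrite /ex !big_cons big_nil /= addr0; field. Qed.

Lemma isprob_coin : isprob coin.
Proof. by split; rewrite /= ?invr_ge0 ?ler0n // ex_coin; field. Qed.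

(** States are total functions on [nat], false from [n] on, so that systems of [n] and of [n + 1]
    variables share one type and densities need no transport in the cavity step. *)
Fixpoint spins n : fd R (nat -> bool) :=
  if n is n'.+1 then fbind (spins n') (fun s => fmap (upd s n') coin)
  else [:: (1, fun=> false)].

Lemma ex_spinsS n W :
  ex (spins n.+1) W = ex (spins n) (fun s => (W (upd s n true) + W (upd s n false)) / 2).
Proof.
rewrite -[spins n.+1]/(fbind (spins n) (fun s => fmap (upd s n) coin)) ex_bind.
by apply: eq_ex => s; rewrite ex_map ex_coin.
Qed.

Lemma isprob_spins n : isprob (spins n).
Proof.
elim: n => [|n IH]; first by split; rewrite /= ?ler01 // /ex big_seq1 mul1r.
by apply: isprob_bind => // s; apply: isprob_map; exact: isprob_coin.
Qed.

Definition local n (W : (nat -> bool) -> R) :=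
  forall s s', (forall v, (v < n)%N -> s v = s' v) -> W s = W s'.

Lemma local_upd n W s b : local n W -> W (upd s n b) = W s.
Proof. by move=> h; apply: h => v vn; rewrite /upd ltn_eqF. Qed.

Lemma local_wmul n W V : local n W -> local n V -> local n (wmul W V).
Proof. by move=> w v s s' h; rewrite /wmul (w _ _ h) (v _ _ h). Qed.

Lemma A_localS n W : local n W -> A (spins n.+1) W = A (spins n) W.
Proof.
by move=> h; rewrite /A ex_spinsS; apply: eq_ex => s; rewrite !local_upd //; field.
Qed.

Definition vars n : fd R nat := unif R (iota 0 n).

Lemma isprob_vars n : (0 < n)%N -> isprob (vars n).
Proof. by move=> n0; apply: isprob_unif; rewrite size_iota. Qed.

Lemma ex_vars n f : ex (vars n) f = n%:R^-1 * \sum_(v < n) f v.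
Proof. by rewrite ex_unif size_iota -[n in iota 0 n]subn0 -/(index_iota 0 n) big_mkord. Qed.

Definition lit := (nat * bool)%type.
Definition lits n : fd R lit := fbind (vars n) (fun v => fmap (pair v) coin).

Lemma isprob_lits n : (0 < n)%N -> isprob (lits n).
Proof.
move=> n0; apply: isprob_bind; first exact: isprob_vars.
by move=> v; apply: isprob_map; exact: isprob_coin.
Qed.

Lemma ex_lits n f :
  ex (lits n) f = ex (vars n) (fun v => (f (v, true) + f (v, false)) / 2).
Proof. by rewrite ex_bind; apply: eq_ex => v; rewrite ex_map ex_coin. Qed.

Lemma ex_litsS n f : ex (lits n.+1) f = n%:R / n.+1%:R * ex (lits n) f +
  n.+1%:R^-1 * ((f (n, true) + f (n, false)) / 2).
Proof.
rewrite !ex_lits !ex_vars big_ord_recr /= mulrDr; congr (_ + _).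
case: n => [|n]; first by rewrite !big_ord0 !mulr0.
rewrite mulrA; congr (_ * _); rewrite mulrAC mulfV ?mul1r // pnatr_eq0.
Qed.

Definition lneg (l : lit) : lit := (l.1, ~~ l.2).

Lemma ex_lits_neg n f : ex (lits n) (fun l => f (lneg l)) = ex (lits n) f.
Proof. by rewrite !ex_lits; apply: eq_ex => v; rewrite /lneg /= [f _ + _]addrC. Qed.

Definition lit_lt n (l : lit) := (l.1 < n)%N.

Lemma fsupp_lits n : fsupp (lit_lt n) (lits n).
Proof.
apply: (@fsupp_bind R _ _ (fun v => (v < n)%N)).
  by rewrite /fsupp /vars /unif all_map; apply/allP => v; rewrite mem_iota.
by move=> v vn; rewrite /fsupp /= /lit_lt /= vn.
Qed.

Definition tr (s : nat -> bool) (l : lit) := s l.1 == l.2.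

Lemma tr_neg s l : tr s (lneg l) = ~~ tr s l.
Proof. by rewrite /tr /lneg /=; case: (s _) (l.2) => [] []. Qed.

Lemma ex_lits_tr n s f : (0 < n)%N -> ex (lits n) (fun l => f (tr s l)) = (f true + f false) / 2.
Proof.
move=> n0; rewrite ex_lits -[RHS](ex_cst (isprob_vars n0)); apply: eq_ex => v.
by rewrite /tr /=; case: (s v); rewrite ?eqxx //= addrC.
Qed.

(** Revealing that [l] is true, divided by its probability [1 / 2]. With a random literal this
    reveals a random spin. *)
Definition Lpin (l : lit) (s : nat -> bool) : R := 2 * (tr s l)%:R.

Lemma channel_pin n : (0 < n)%N -> channel (lits n) Lpin.
Proof.
move=> n0; split; first exact: isprob_lits.
  by move=> l s; rewrite mulr_ge0 ?ler0n.
by move=> s; rewrite (ex_lits_tr s (fun b => 2 * b%:R)) // mulr0 addr0 mulr1 divff.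
Qed.

Lemma Lpin_le l s : Lpin l s <= 2.
Proof. by rewrite /Lpin; case: tr; rewrite ?mulr1 ?mulr0 ?ler0n. Qed.

Section Clause.
Variable k : nat.
Hypothesis k3 : (3 <= k)%N.

Definition qk : R := 1 - 2 ^- k.-1.
Definition mono (bs : seq bool) := all id bs || all negb bs.
Definition Lcl (c : seq lit) s : R := if mono (map (tr s) c) then 0 else qk^-1.

(** The source of the bound [4 / 3] on clause factors used in the quadratic estimates. *)
Lemma qk_ge : 3 / 4 <= qk.
Proof.
rewrite /qk; case: k k3 => [|[|[|n]]] // _ /=.
have : (2 : R) ^- n.+2 <= 2 ^- 2.
  by rewrite lef_pV2 ?posrE ?exprn_gt0 // ler_weXn2l // ler1n.
have -> : (2 : R) ^- 2 = 1 / 4 by field.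
move=> h; lra.
Qed.

Lemma qk_gt0 : 0 < qk. Proof. have := qk_ge; lra. Qed.
Lemma qk_lt1 : qk < 1.
Proof. by rewrite /qk ltrBlDr ltrDl invr_gt0 exprn_gt0. Qed.
Lemma qkV_ge1 : 1 <= qk^-1.
Proof. by rewrite invf_ge1 ?qk_gt0 // ltW ?qk_lt1. Qed.
Lemma qkV_le : qk^-1 <= 4 / 3.
Proof.
rewrite (_ : 4 / 3 = (3 / 4)^-1); last by field.
by rewrite lef_pV2 ?posrE ?qk_gt0 ?qk_ge //; lra.
Qed.

Lemma Lcl_ge0 c s : 0 <= Lcl c s.
Proof. by rewrite /Lcl; case: ifP => // _; rewrite invr_ge0 ltW ?qk_gt0. Qed.

Lemma Lcl_le c s : Lcl c s <= qk^-1.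
Proof. by rewrite /Lcl; case: ifP => // _; rewrite invr_ge0 ltW ?qk_gt0. Qed.

Lemma prod_bool (bs : seq bool) : \prod_(b <- bs) (b%:R : R) = (all id bs)%:R.
Proof. by elim: bs => [|[] bs IH]; rewrite ?big_nil ?big_cons //= ?IH ?mul1r ?mul0r. Qed.

Lemma prod_negb (bs : seq bool) : \prod_(b <- bs) (1 - b%:R : R) = (all negb bs)%:R.
Proof.
by elim: bs => [|[] bs IH]; rewrite ?big_nil ?big_cons //= ?IH ?subr0 ?subrr ?mul1r ?mul0r.
Qed.

(** The empty list is excluded because it is all true and all false at once, so that the two
    products would add up to 2. *)
Lemma monoE bs : bs != [::] -> ((mono bs)%:R : R) =
  \prod_(b <- bs) b%:R + \prod_(b <- bs) (1 - b%:R).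
Proof.
rewrite prod_bool prod_negb /mono; case: bs => [|b bs] // _.
by case: b => /=; rewrite ?orbF ?addr0 ?add0r.
Qed.

Lemma LclE c s : Lcl c s = (1 - (mono (map (tr s) c))%:R) / qk.
Proof. by rewrite /Lcl; case: ifP => _; rewrite ?subrr ?mul0r ?subr0 ?mul1r. Qed.

Lemma ex_mono n s : (0 < n)%N ->
  ex (iid (lits n) k) (fun c => (mono (map (tr s) c))%:R) = 1 - qk.
Proof.
move=> n0.
rewrite (@eq_ex_iid _ _ _ _ _ (fun c => \prod_(l <- c) (tr s l)%:R +
   \prod_(l <- c) (1 - (tr s l)%:R))); last first.
  move=> c ck; rewrite monoE ?big_map //.
  by rewrite -size_eq0 size_map ck; case: k k3.
rewrite exD !ex_prod (ex_lits_tr s (fun b => b%:R)) //.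
rewrite (ex_lits_tr s (fun b => 1 - b%:R)) // subrr subr0 addr0 add0r mul1r /qk.
have [m ->] : exists m, k = m.+1 by case: k k3 => // m; exists m.
rewrite /= subKr -exprVn exprS.
by set x := 2^-1 ^+ m; field.
Qed.

Lemma channel_cl n : (0 < n)%N -> channel (iid (lits n) k) Lcl.
Proof.
move=> n0; have pP := isprob_iid k (isprob_lits n0); split => //.
  by move=> c s; exact: Lcl_ge0.
move=> s; rewrite (@eq_ex _ _ _ _ (fun c => (1 - (mono (map (tr s) c))%:R) * qk^-1)).
  by rewrite exZr exB ex_cst // ex_mono // subKr divff // gt_eqF ?qk_gt0.
by move=> c; exact: LclE.
Qed.

Lemma local_Lcl n c : all (lit_lt n) c -> local n (Lcl c).
Proof.
move=> cn s s' h; rewrite /Lcl; congr (if mono _ then _ else _).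
by apply/eq_in_map => l lc; rewrite /tr h //; exact: (allP cn).
Qed.

End Clause.

Lemma local_Lpin n l : lit_lt n l -> local n (Lpin l).
Proof. by move=> ln s s' h; rewrite /Lpin /tr h. Qed.

End Spins.

(** * Poisson expectations and thinning *)

Section Poisson.
Variable R : realType.
Implicit Types (lam mu C K : R) (a b : nat -> R).

Definition pois lam i : R := lam ^+ i / i`!%:R * expR (- lam).
Definition psum lam a N : R := \sum_(0 <= i < N) pois lam i * a i.
Definition pe lam a : R := limn (psum lam a).
(** At most geometric growth makes the Poisson series converge absolutely at every rate, so that the
    [limn] in [pe] is a genuine limit. *)
Definition dom a := exists C K, [/\ 0 <= C, 0 <= K & forall i, `|a i| <= C * K ^+ i].

Lemma pois_ge0 lam i : 0 <= lam -> 0 <= pois lam i.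
Proof. by move=> l0; rewrite /pois !mulr_ge0 ?exprn_ge0 ?invr_ge0 ?expR_ge0. Qed.

Lemma psum_exp lam K N : psum lam (fun i => K ^+ i) N =
  expR (- lam) * series (exp_coeff (lam * K)) N.
Proof.
rewrite /psum /series /= mulr_sumr; apply: eq_bigr => i _.
rewrite /pois /exp_coeff /= exprMn; ring.
Qed.

Lemma cvg_psum_exp lam K : psum lam (fun i => K ^+ i) @ \oo --> expR (lam * (K - 1)).
Proof.
have -> : lam * (K - 1) = - lam + lam * K by ring.
rewrite expRD (_ : psum _ _ = fun N => expR (- lam) * series (exp_coeff (lam * K)) N).
  by apply: cvgMr; exact: is_cvg_series_exp_coeff.
by apply/funext => N; exact: psum_exp.
Qed.

Lemma psum_nd lam a : 0 <= lam -> (forall i, 0 <= a i) -> nondecreasing_seq (psum lam a).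
Proof.
by move=> l0 a0; apply: nondecreasing_series => i _ _; rewrite mulr_ge0 ?pois_ge0.
Qed.

Lemma pcv lam a : 0 <= lam -> dom a -> cvgn (psum lam a).
Proof.
move=> l0 [C [K [C0 K0 h]]].
apply: (@normed_cvg R R (fun i => pois lam i * a i)).
apply: (@series_le_cvg R _ (fun i => C * (pois lam i * K ^+ i))) => [i|i|i|].
- exact: normr_ge0.
- by rewrite mulr_ge0 ?mulr_ge0 ?pois_ge0 ?exprn_ge0.
- rewrite /= normrM ger0_norm ?pois_ge0 // mulrCA; apply: ler_wpM2l; [exact: pois_ge0|exact: h].
- apply: (@is_cvg_seriesZ R _ C).
  by apply/cvg_ex; exists (expR (lam * (K - 1))); exact: cvg_psum_exp.
Qed.

Lemma pe_psum lam a N : 0 <= lam -> dom a -> (forall i, 0 <= a i) -> psum lam a N <= pe lam a.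
Proof.
by move=> l0 da a0; apply: nondecreasing_cvgn_le; [exact: psum_nd|exact: pcv].
Qed.

Lemma pe_le_bound lam a M : 0 <= lam -> dom a -> (forall N, psum lam a N <= M) -> pe lam a <= M.
Proof. by move=> l0 da h; apply: limr_le; [exact: pcv|near=> N; exact: h].
Unshelve. all: by end_near. Qed.

Lemma pe_le lam a b : 0 <= lam -> dom a -> dom b -> (forall i, a i <= b i) ->
  pe lam a <= pe lam b.
Proof.
move=> l0 da db h; apply: ler_lim; [exact: pcv|exact: pcv|near=> N].
by apply: ler_sum => i _; apply: ler_wpM2l; [exact: pois_ge0|exact: h].
Unshelve. all: by end_near. Qed.

Lemma peD lam a b : 0 <= lam -> dom a -> dom b ->
  pe lam (fun i => a i + b i) = pe lam a + pe lam b.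
Proof.
move=> l0 da db; rewrite /pe -limD; [|exact: pcv|exact: pcv].
congr (lim (_ @ \oo)); apply/funext => N.
transitivity (psum lam a N + psum lam b N) => //; rewrite /psum -big_split /=.
by apply: eq_bigr => i _; rewrite mulrDr.
Qed.

Lemma peZ lam C a : 0 <= lam -> dom a -> pe lam (fun i => C * a i) = C * pe lam a.
Proof.
move=> l0 da; apply/cvg_lim => //.
rewrite (_ : psum _ _ = fun N => C * psum lam a N); first by apply: cvgMr; exact: pcv.
apply/funext => N; rewrite /psum mulr_sumr.
by apply: eq_bigr => i _; rewrite mulrCA.
Qed.

Lemma pe_exp lam K : pe lam (fun i => K ^+ i) = expR (lam * (K - 1)).
Proof. by apply/cvg_lim => //; exact: cvg_psum_exp. Qed.

Lemma dom_exp C K : 0 <= K -> dom (fun i => C * K ^+ i).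
Proof.
move=> K0; exists `|C|, K; split=> // i.
by rewrite normrM [`|K ^+ _|]ger0_norm // exprn_ge0.
Qed.

Lemma dom_le a b : dom b -> (forall i, `|a i| <= b i) -> dom a.
Proof.
case=> C [K [C0 K0 h]] ab; exists C, K; split=> // i.
by apply: le_trans (ab i) _; apply: le_trans (h i); exact: ler_norm.
Qed.

Lemma dom_cst C : dom (fun=> C).
Proof.
rewrite (_ : (fun=> C) = fun i => C * 1 ^+ i); first exact: dom_exp.
by apply/funext => i; rewrite expr1n mulr1.
Qed.

Lemma domD a b : dom a -> dom b -> dom (fun i => a i + b i).
Proof.
case=> C [K [C0 K0 h]] [C' [K' [C0' K0' h']]].
exists (C + C'), (K + K'); split=> [||i]; rewrite ?addr_ge0 //.
rewrite mulrDl; apply: le_trans (ler_normD _ _) _; apply: lerD.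
  apply: le_trans (h i) _; apply: ler_wpM2l => //.
  by rewrite lerXn2r ?nnegrE ?addr_ge0 // lerDl.
apply: le_trans (h' i) _; apply: ler_wpM2l => //.
by rewrite lerXn2r ?nnegrE ?addr_ge0 // lerDr.
Qed.

Lemma domZ C a : dom a -> dom (fun i => C * a i).
Proof.
case=> C' [K [C0 K0 h]]; exists (`|C| * C'), K; split=> [||i]; rewrite ?mulr_ge0 //.
by rewrite normrM -mulrA ler_wpM2l.
Qed.

Lemma dom_id : dom (fun i => i%:R).
Proof.
exists 1, 2; split=> // i; rewrite mul1r ger0_norm // -natrX ler_nat.
exact/ltnW/ltn_expl.
Qed.

Lemma pe_cst lam C : 0 <= lam -> pe lam (fun=> C) = C.
Proof.
move=> l0; rewrite -[RHS]mulr1 -expR0 -(mulr0 lam) -(subrr (1 : R)) -pe_exp -peZ //.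
  by congr pe; apply/funext => i; rewrite expr1n mulr1.
by have := dom_exp 1 (@ler01 R); congr dom; apply/funext => i; rewrite mul1r.
Qed.

Lemma psum_idS lam N : psum lam (fun i => i%:R) N.+1 = lam * psum lam (fun=> 1) N.
Proof.
rewrite /psum big_nat_recl // mulr0 add0r mulr_sumr; apply: eq_bigr => i _.
rewrite /pois factS exprS natrM; field.
by rewrite nat1r !pnatr_eq0 /= -lt0n fact_gt0.
Qed.

Lemma pe_id lam : 0 <= lam -> pe lam (fun i => i%:R) = lam.
Proof.
move=> l0; transitivity (lam * pe lam (fun=> 1)); last by rewrite pe_cst ?mulr1.
rewrite -peZ //; last exact: dom_cst.
apply/cvg_lim => //; rewrite -(cvg_shiftS (psum lam _)).
rewrite (_ : [sequence _]_n = psum lam (fun=> lam * 1)).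
  by apply: pcv => //; exact: dom_cst.
apply/funext => N; transitivity (psum lam (fun i => i%:R) N.+1) => //.
by rewrite psum_idS /psum mulr_sumr; apply: eq_bigr => i _; ring.
Qed.

Lemma pe_ge0 lam a : 0 <= lam -> dom a -> (forall i, 0 <= a i) -> 0 <= pe lam a.
Proof.
move=> l0 da a0; rewrite -(pe_cst 0 l0); apply: pe_le => //; exact: dom_cst.
Qed.

(** Binomial mean: [m] items are marked independently, [i] of them with probability [p1] and the
    other [m - i] with probability [p0]. *)
Definition thin p0 p1 (a : nat -> nat -> R) m : R :=
  \sum_(0 <= i < m.+1) 'C(m, i)%:R * (p0 ^+ (m - i) * p1 ^+ i) * a (m - i)%N i.

(** A binomial theorem for commuting operators: [h m j i] stands for [m] unclassified items after
    [j] and [i] items of the two types. *)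
Lemma thin_rec p0 p1 (h : nat -> nat -> nat -> R) :
  (forall m j i, h m.+1 j i = p0 * h m j.+1 i + p1 * h m j i.+1) ->
  forall m, h m 0%N 0%N = thin p0 p1 (h 0%N) m.
Proof.
move=> hS m.
suff H j i : h m j i = \sum_(0 <= l < m.+1)
    'C(m, l)%:R * (p0 ^+ (m - l) * p1 ^+ l) * h 0%N (j + (m - l))%N (i + l)%N by exact: H.
elim: m j i => [|m IH] j i.
  by rewrite big_nat1 bin0 !expr0 !mul1r !addn0.
rewrite hS !IH.
rewrite [in X in p0 * X]big_nat_recl // [in X in p1 * X]big_nat_recr //.
rewrite [RHS]big_nat_recr // [X in _ = X + _]big_nat_recl //=.
rewrite !bin0 !binn !subn0 !subnn !expr0 !mul1r !mulr1 !addn0 !addSnnS.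
rewrite !mulrDr !addrA; congr (_ + _); last first.
  by rewrite mulrA -exprS.
rewrite -addrA; congr (_ + _); first by rewrite mulrA -exprS.
rewrite !mulr_sumr -big_split /=; apply: eq_big_nat => l /andP[_ lm].
rewrite binS natrD subSS -(subnSK lm) !exprS !addSnnS !addnS; ring.
Qed.

Lemma pois_thin lam p0 p1 m i : (i <= m)%N -> p0 + p1 = 1 ->
  pois lam m * ('C(m, i)%:R * (p0 ^+ (m - i) * p1 ^+ i)) =
  pois (lam * p0) (m - i) * pois (lam * p1) i.
Proof.
move=> im p01; rewrite /pois.
have -> : expR (- lam) = expR (- (lam * p0)) * expR (- (lam * p1)).
  by rewrite -expRD -opprD -mulrDr p01 mulr1.
have -> : lam ^+ m = lam ^+ (m - i) * lam ^+ i by rewrite -exprD subnK.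
rewrite -(bin_fact im) !natrM !exprMn; field.
by rewrite !pnatr_eq0 -!lt0n !fact_gt0 /= bin_gt0 im.
Qed.

Lemma triangle_sum (f : nat -> nat -> R) N :
  \sum_(0 <= m < N) \sum_(0 <= i < m.+1) f (m - i)%N i =
  \sum_(0 <= i < N) \sum_(0 <= j < N - i) f j i.
Proof.
transitivity (\sum_(0 <= m < N) \sum_(0 <= i < N | (i <= m)%N) f (m - i)%N i).
  apply: eq_big_nat => m /andP[_ mN].
  rewrite [RHS](big_cat_nat _ (n := m.+1)) //= [X in _ + X]big_nat_cond.
  rewrite [X in _ + X]big1 ?addr0 => [|i /andP[/andP[mi _] im]]; last first.
    by move: (leq_trans mi im); rewrite ltnn.
  by rewrite [RHS]big_nat_cond [LHS]big_nat_cond; apply: eq_bigl => i; rewrite ltnS /=; case: (i <= m)%N; rewrite ?andbF.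
rewrite (exchange_big_dep predT) //=; apply: eq_big_nat => i /andP[_ iN].
rewrite (big_cat_nat _ (n := i)) //=; last exact: ltnW.
rewrite [X in X + _]big_nat_cond big1 ?add0r => [|m /andP[/andP[_ mi] im]]; last first.
  by move: (leq_ltn_trans im mi); rewrite ltnn.
rewrite -{1}[i]add0n big_addn big_nat_cond [RHS]big_nat_cond.
by apply: eq_big => [m|m _]; rewrite ?leq_addl ?andbT ?addnK.
Qed.

Section Thinning.
Variables (lam p0 p1 : R) (a : nat -> nat -> R) (C K : R).
Hypotheses (l0 : 0 <= lam) (p00 : 0 <= p0) (p10 : 0 <= p1) (p01 : p0 + p1 = 1).
Hypotheses (C0 : 0 <= C) (K0 : 0 <= K) (a0 : forall j i, 0 <= a j i).
Hypothesis aK : forall j i, a j i <= C * K ^+ (j + i).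

Lemma dom_thin : dom (thin p0 p1 a).
Proof.
exists C, K; split=> // m; rewrite ger0_norm; last first.
  by rewrite sumr_ge0 // => i _; rewrite !mulr_ge0 ?exprn_ge0.
have -> : C * K ^+ m = \sum_(0 <= i < m.+1) 'C(m, i)%:R * (p0 ^+ (m - i) * p1 ^+ i) * (C * K ^+ m).
  rewrite -mulr_suml big_mkord -[LHS]mul1r -{1}(expr1n R m) -{1}p01 exprDn; congr (_ * _).
  by apply: eq_bigr => i _; rewrite mulr_natl.
rewrite [leLHS]big_nat_cond [leRHS]big_nat_cond; apply: ler_sum => i /andP[/andP[_ im] _].
apply: ler_wpM2l; first by rewrite !mulr_ge0 ?exprn_ge0.
by apply: le_trans (aK _ _) _; rewrite subnK.
Qed.

Lemma dom_row j : dom (a j).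
Proof.
exists (C * K ^+ j), K; split=> [||i]; rewrite ?mulr_ge0 ?exprn_ge0 //.
by rewrite ger0_norm // -mulrA -exprD.
Qed.

Let l00 : 0 <= lam * p0. Proof. exact: mulr_ge0. Qed.
Let l10 : 0 <= lam * p1. Proof. exact: mulr_ge0. Qed.

Lemma dom_pe_row : dom (fun j => pe (lam * p1) (a j)).
Proof.
apply: dom_le (_ : dom (fun j => C * expR (lam * p1 * (K - 1)) * K ^+ j)) _.
  exact: dom_exp.
move=> j; rewrite ger0_norm; last by apply: pe_ge0 => //; exact: dom_row.
rewrite mulrAC -pe_exp -peZ //; last by have := dom_exp 1 K0; congr dom; apply/funext => i; rewrite mul1r.
apply: pe_le => //; [exact: dom_row|exact: dom_exp|].
by move=> i; apply: le_trans (aK _ _) _; rewrite exprD mulrA.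
Qed.

Lemma psum_thin N : psum lam (thin p0 p1 a) N =
  \sum_(0 <= i < N) \sum_(0 <= j < N - i) pois (lam * p0) j * pois (lam * p1) i * a j i.
Proof.
rewrite -triangle_sum; apply: eq_bigr => m _; rewrite mulr_sumr.
rewrite [LHS]big_nat_cond [RHS]big_nat_cond; apply: eq_bigr => i /andP[/andP[_ im] _].
by rewrite mulrA pois_thin.
Qed.

(** The terms are nonnegative, and the triangular partial sums of the left side and the rectangular
    ones of the right side are contained in one another up to a larger index. *)
Lemma pe_thin : pe lam (thin p0 p1 a) = pe (lam * p0) (fun j => pe (lam * p1) (a j)).
Proof.
have t0 j i : 0 <= pois (lam * p0) j * pois (lam * p1) i * a j i.
  by apply: mulr_ge0 => //; apply: mulr_ge0; exact: pois_ge0.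
apply/eqP; rewrite eq_le; apply/andP; split.
  apply: pe_le_bound => // [|N]; first exact: dom_thin.
  apply: le_trans (pe_psum N l00 dom_pe_row _); last first.
    by move=> j; apply: pe_ge0 => //; exact: dom_row.
  rewrite psum_thin.
  apply: le_trans (_ : \sum_(0 <= i < N) \sum_(0 <= j < N) pois (lam * p0) j * pois (lam * p1) i * a j i <= _).
    apply: ler_sum => i _; rewrite [leRHS](big_cat_nat _ (n := (N - i)%N)) ?leq_subr //=.
    by rewrite lerDl sumr_ge0.
  rewrite exchange_big /=; apply: ler_sum => j _.
  under eq_bigr do rewrite -mulrA; rewrite -mulr_sumr; apply: ler_wpM2l; first exact: pois_ge0.
  by apply: (pe_psum N) => //; exact: dom_row.
apply: pe_le_bound => // [|N]; first exact: dom_pe_row.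
(* Only finitely many values of [j] are kept, so the limit in [i] may be taken outside their sum. *)
have lin M : dom (fun i => \sum_(0 <= j < M) pois (lam * p0) j * a j i) /\
   psum (lam * p0) (fun j => pe (lam * p1) (a j)) M =
   pe (lam * p1) (fun i => \sum_(0 <= j < M) pois (lam * p0) j * a j i).
  elim: M => [|M [IHd IH]].
    rewrite /psum big_nil; under eq_fun do rewrite big_nil; rewrite pe_cst //; split=> //.
    exact: dom_cst.
  have dM : dom (fun i => pois (lam * p0) M * a M i) by apply: domZ; exact: dom_row.
  split.
    have := domD IHd dM; congr dom; apply/funext => i.
    by rewrite big_nat_recr.
  rewrite /psum big_nat_recr //= -/(psum _ _ _) IH -peZ //; last exact: dom_row.
  by rewrite -peD //; congr pe; apply/funext => i; rewrite big_nat_recr.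
have [dN ->] := lin N.
apply: pe_le_bound => // N'; apply: le_trans (pe_psum (N + N') l0 dom_thin _); last first.
  by move=> m; rewrite sumr_ge0 // => i _; rewrite !mulr_ge0 ?exprn_ge0.
rewrite psum_thin [leRHS](big_cat_nat _ (n := N')) ?leq_addl //=.
apply: le_trans (_ : \sum_(0 <= i < N') \sum_(0 <= j < N + N' - i) pois (lam * p0) j * pois (lam * p1) i * a j i <= _); last first.
  by rewrite lerDl sumr_ge0 // => i _; rewrite sumr_ge0.
rewrite [leLHS]big_nat_cond [leRHS]big_nat_cond; apply: ler_sum => i /andP[/andP[_ iN'] _].
rewrite [leRHS](big_cat_nat _ (n := N)) //=; last by rewrite -addnBA ?leq_addr // ltnW.
rewrite mulr_sumr; apply: le_trans (_ : \sum_(0 <= j < N) pois (lam * p0) j * pois (lam * p1) i * a j i <= _).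
  by apply: ler_sum => j _; rewrite mulrA [X in X * _ <= _]mulrC.
by rewrite lerDl sumr_ge0.
Qed.

End Thinning.

End Poisson.

(** * Finitely supported laws as probability measures *)

Section Discrete.
Variable R : realType.
Implicit Types (pi : fd R R).

Definition atom pi (i : nat) := nth (0, 0) pi i.
(** The absolute values here and the normalisation in [disc] produce a probability measure from any
    list; both are invisible when [isprob pi] holds. *)
Definition pre_disc pi := [the measure _ _ of msum (fun i : nat =>
  [the measure _ _ of mscale (`|(atom pi i).1|)%:nng (@dirac _ R (atom pi i).2 R)]) (size pi)].

Definition disc pi : probability R R :=
  [the probability _ _ of mnormalize (pre_disc pi) (@dirac _ R 0 R)].

Lemma atom_ge0 pi i : isprob pi -> `|(atom pi i).1| = (atom pi i).1.
Proof.
case=> /(all_nthP (0, 0)) h _; apply: ger0_norm; rewrite /atom.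
by case: (ltnP i (size pi)) => [|si]; [exact: h|rewrite nth_default].
Qed.

Lemma ex_atom pi f : ex pi f = \sum_(i < size pi) (atom pi i).1 * f (atom pi i).2.
Proof. by rewrite /ex (big_nth (0, 0)) big_mkord. Qed.

Lemma pre_discE pi U : isprob pi ->
  pre_disc pi U = (\sum_(i < size pi) ((atom pi i).1%:E * \d_(atom pi i).2 U)%E)%E.
Proof.
move=> pP; transitivity (\sum_(i < size pi) ((`|(atom pi i).1|)%:E * \d_(atom pi i).2 U)%E)%E => //.
by apply: eq_bigr => i _; rewrite atom_ge0.
Qed.

Lemma pre_disc_setT pi : isprob pi -> pre_disc pi setT = 1%E.
Proof.
move=> pP; rewrite pre_discE //; case: (pP) => _ <-; rewrite ex_atom -sumEFin.
by apply: eq_bigr => i _; rewrite diracT mule1 mulr1.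
Qed.

Lemma discE pi U : isprob pi -> disc pi U = pre_disc pi U.
Proof.
move=> pP; rewrite /disc /= /mnormalize pre_disc_setT //=.
by rewrite onee_eq0 /= invr1 mule1.
Qed.

Lemma ge0_integral_disc pi (f : R -> \bar R) : isprob pi -> @measurable_fun _ _ R (\bar R) setT f ->
  (forall x, 0 <= f x)%E ->
  (\int[disc pi]_x f x = \sum_(i < size pi) (atom pi i).1%:E * f (atom pi i).2)%E.
Proof.
move=> pP mf f0.
rewrite (@eq_measure_integral _ _ _ setT (pre_disc pi)); last by move=> U _ _; exact: discE.
rewrite ge0_integral_measure_sum //; apply: eq_bigr => i _.
rewrite ge0_integral_mscale //= integral_dirac // diracT mul1e.
by rewrite atom_ge0.
Qed.

Lemma integral_disc pi (f : R -> R) : isprob pi -> @measurable_fun _ _ R R setT f ->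
  (\int[disc pi]_x (f x)%:E = (ex pi f)%:E)%E.
Proof.
move=> pP mf; rewrite integralE.
have mfE : measurable_fun setT (EFin \o f) by exact/measurable_EFinP.
rewrite !ge0_integral_disc //; [|exact: measurable_funeneg|exact: measurable_funepos].
rewrite ex_atom.
have E g : (\sum_(i < size pi) (atom pi i).1%:E * (EFin \o g) (atom pi i).2 =
  (\sum_(i < size pi) (atom pi i).1 * g (atom pi i).2)%:E)%E by rewrite -sumEFin.
rewrite funerpos funerneg !E -EFinB -sumrB; congr EFin; apply: eq_bigr => i _.
by rewrite -mulrBr; have := congr1 (fun h => h (atom pi i).2) (funrposBneg f) => <-.
Qed.

Lemma Rintegral_disc pi (f : R -> R) : isprob pi -> @measurable_fun _ _ R R setT f ->
  Rintegral (disc pi) setT f = ex pi f.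
Proof. by move=> pP mf; rewrite /Rintegral integral_disc. Qed.

Lemma disc_Pstar pi : isprob pi -> all (fun z => 0 <= z.2 <= 1) pi ->
  ex pi id = 2^-1 -> Pstar (disc pi).
Proof.
move=> pP p01 pm; split; last by rewrite integral_disc // pm.
rewrite discE // pre_discE // -(pre_disc_setT pP) pre_discE //.
apply: eq_bigr => i _; congr (_ * _)%E; rewrite diracT diracE mem_set //=.
by rewrite in_itv /=; exact: (all_nthP _ p01).
Qed.

Fixpoint iintd pi (N : nat) (f : (nat -> R) -> R) : R :=
  if N is N'.+1 then iintd pi N' (fun r => ex pi (fun x => f (fun t => if t == N' then x else r t)))
  else f (fun=> 0).

Definition setc (r : nat -> R) N x := fun t => if t == N then x else r t.
Definition cmeas (f : (nat -> R) -> R) :=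
  forall N r, @measurable_fun _ _ R R setT (fun x => f (setc r N x)).

Lemma cmeas_ex pi f N : cmeas f -> cmeas (fun r => ex pi (fun x => f (setc r N x))).
Proof.
move=> mf M r; rewrite /ex; apply: measurable_sum => z; apply: measurable_funM => //.
have [->|NM] := eqVneq M N.
  rewrite (_ : (fun x => _) = fun=> f (setc r N z.2)) //; apply/funext => x; congr f.
  by apply/funext => t; rewrite /setc; case: eqP.
rewrite (_ : (fun x => _) = fun x => f (setc (setc r N z.2) M x)) //; apply/funext => x; congr f.
apply/funext => t; rewrite /setc; case: (eqVneq t N) => [->|//].
by rewrite eq_sym (negbTE NM).
Qed.

Lemma iint_disc pi N f : isprob pi -> cmeas f -> iint (disc pi) N f = iintd pi N f.
Proof.
move=> pP; elim: N f => [|N IH] f mf //=.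
rewrite -(IH _ (cmeas_ex pi N mf)); congr iint; apply/funext => r.
by rewrite Rintegral_disc //; exact: mf.
Qed.

Lemma measurable_Lambda : @measurable_fun _ _ R R setT (@Lambda R).
Proof.
rewrite (_ : @Lambda R = fun x => x * ln x); first by apply: measurable_funM => //; exact: measurable_ln.
by apply/funext => x; exact: LambdaE.
Qed.

Lemma measurable_setc r N t : @measurable_fun _ _ R R setT (fun x => setc r N x t).
Proof. by rewrite /setc; case: eqP. Qed.

Lemma cmeas_B k (d : R) g : cmeas (B_integrand k d g).
Proof.
move=> N r; rewrite /B_integrand.
have mL f : @measurable_fun _ _ R R setT f -> @measurable_fun _ _ R R setT (fun x => Lambda (f x)).
  by move=> mf; apply: measurableT_comp => //; exact: measurable_Lambda.
apply: measurable_funB; apply: measurable_funM => //.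
  apply: mL; apply: measurable_funD; apply: measurable_prod => i _; apply: measurable_funB => //;
    apply: measurable_prod => j _; [exact: measurable_setc|apply: measurable_funB => //; exact: measurable_setc].
apply: measurable_funM => //; apply: mL; do 2?apply: measurable_funB => //;
  apply: measurable_prod => j _; [exact: measurable_setc|apply: measurable_funB => //; exact: measurable_setc].
Qed.

End Discrete.

(** * Elementary properties of [Lambda] *)

Section LambdaFacts.
Variable R : realType.

Lemma LambdaM (c b : R) : 0 < c -> 0 <= b -> Lambda (c * b) = c * Lambda b + c * b * ln c.
Proof.
move=> c0; rewrite le_eqVlt => /orP[/eqP <-|b0]; first by rewrite !LambdaE !(mulr0, mul0r) addr0.
by rewrite !LambdaE lnM ?posrE //; ring.
Qed.

Lemma Lambda_ge (x : R) : 0 <= x -> x - 1 <= Lambda x.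
Proof.
rewrite le_eqVlt => /orP[/eqP <-|x0]; first by rewrite LambdaE mul0r; lra.
rewrite LambdaE; have := ler_wpM2l (ltW x0) (ln_ge1V x0).
by rewrite mulrBr mulr1 divff ?gt_eqF.
Qed.

Lemma Lambda_le (x B : R) : 0 <= x <= B -> Lambda x <= x * ln B.
Proof.
case/andP; rewrite le_eqVlt => /orP[/eqP <-|x0] xB; first by rewrite LambdaE !mul0r.
rewrite LambdaE ler_pM2l // ler_ln ?posrE //; exact: lt_le_trans xB.
Qed.

End LambdaFacts.

(** * The Bethe functional at finitely supported laws *)

Section BetheFinite.
Variables (R : realType) (k : nat).
Hypothesis k3 : (3 <= k)%N.
Implicit Types (pi : fd R R).
Let q : R := qk R k.

Lemma ex_iidSr T (p : fd R T) n f :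
  ex (iid p n.+1) f = ex (iid p n) (fun l => ex p (fun x => f (rcons l x))).
Proof.
rewrite -addn1 ex_iidD; apply: eq_ex => l; rewrite ex_iidS; apply: eq_ex => x.
by rewrite ex_iid0 cats1.
Qed.

Lemma sorted_rcons_ltn l x : sorted ltn (rcons l x) -> sorted ltn l /\ all (fun y => (y < x)%N) l.
Proof.
case: l => [|y l] //=; rewrite rcons_path => /andP[pl lx]; split=> //.
have := pl; rewrite (path_sortedE ltn_trans) => /andP[yl _].
elim: l y lx pl {yl} => [|z l IH] y /= lx; first by rewrite lx.
case/andP=> yz zl; have /andP[zx lx'] := IH z lx zl.
by rewrite (ltn_trans yz zx) zx.
Qed.

Lemma iintd_sub pi N l (F : seq R -> R) : isprob pi -> sorted ltn l -> all (fun y => (y < N)%N) l ->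
  iintd pi N (fun r => F (map r l)) = ex (iid pi (size l)) F.
Proof.
move=> pP; elim: N l F => [|N IH] l F.
  by case: l => //= _ _; rewrite ex_iid0.
case/lastP: l => [|l x] sl al.
  rewrite /= -[RHS](IH [::]) //; congr iintd; apply/funext => r /=; exact: ex_cst.
have [sl' lx] := sorted_rcons_ltn sl.
move: al; rewrite all_rcons ltnS => /andP[xN al].
have map_lt r y (l' : seq nat) : all (fun y => (y < N)%N) l' -> map (fun t => if t == N then y else r t) l' = map r l' :> seq R.
  by move=> h; apply/eq_in_map => t /(allP h) tN; rewrite ltn_eqF.
move: xN; rewrite leq_eqVlt => /orP[/eqP xN|xN].
  rewrite /= size_rcons ex_iidSr -(IH l) //; last by rewrite -xN.
  congr iintd; apply/funext => r; apply: eq_ex => y.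
  by rewrite map_rcons xN eqxx map_lt // -xN.
have ab : all (fun y => (y < N)%N) (rcons l x).
  by rewrite all_rcons xN /=; apply: sub_all lx => t /ltn_trans; apply.
rewrite /= -(IH (rcons l x)) //; congr iintd; apply/funext => r.
by rewrite -[RHS](ex_cst pP); apply: eq_ex => y; rewrite map_lt.
Qed.

Lemma iintdB pi N f g : iintd pi N (fun r => f r - g r) = iintd pi N f - iintd pi N g.
Proof.
elim: N f g => [|N IH] f g //=; rewrite -IH; congr iintd; apply/funext => r.
by rewrite -exB.
Qed.

(** The coordinates [k i + j] with [1 <= j < k]. Multiples of [k] are skipped and the blocks are
    disjoint, so they carry independent samples. *)
Definition blk i := iota (k * i + 1) k.-1.
Fixpoint idx i g : seq nat := if g is g'.+1 then blk i ++ idx i.+1 g' else [::].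

(** Product of [h] over [g] consecutive blocks of length [k - 1]. Polymorphic because it is applied
    both to marginals in [[0, 1]] and to truth values. *)
Fixpoint pb (T : Type) (h : seq T -> R) g (l : seq T) : R :=
  if g is g'.+1 then h (take k.-1 l) * pb h g' (drop k.-1 l) else 1.

Lemma size_idx i g : size (idx i g) = (g * k.-1)%N.
Proof. by elim: g i => //= g IH i; rewrite size_cat size_iota IH mulSn. Qed.

Lemma path_idx i g : path ltn (k * i) (idx i g).
Proof.
elim: g i => //= g IH i; rewrite cat_path; apply/andP; split.
  by rewrite /blk addn1; have pi n a : path ltn a (iota a.+1 n) by elim: n a => //= n IHn a; rewrite IHn andbT /= ltnSn.
have lb : (last (k * i) (blk i) <= k * i.+1)%N.
  rewrite /blk addn1 mulnS; have -> a n : last a (iota a.+1 n) = (a + n)%N.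
    by elim: n a => [|n IHn] a /=; rewrite ?addn0 // IHn addSnnS.
  by rewrite addnC leq_add2r leq_pred.
case: (idx i.+1 g) (IH i.+1) => //= x l /andP[ix ->]; rewrite andbT.
exact: leq_ltn_trans lb ix.
Qed.

Lemma idx_lt i g : all (fun y => (y < k * (i + g))%N) (idx i g).
Proof.
elim: g i => //= g IH i; rewrite all_cat; apply/andP; split; last by rewrite addnS -addSn.
apply/allP => y; rewrite mem_iota => /andP[_ h]; apply: leq_trans h _.
have -> : (k * i + 1 + k.-1 = k * i.+1)%N by rewrite mulnS; lia.
by rewrite leq_mul2l addnS ltnS leq_addr orbT.
Qed.

Lemma pb_idx h i g (r : nat -> R) :
  pb h g (map r (idx i g)) = \prod_(i <= a < i + g) h [seq r (k * a + j)%N | j <- iota 1 k.-1].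
Proof.
elim: g i => [|g IH] i /=; first by rewrite addn0 big_geq.
rewrite map_cat take_cat drop_cat size_map size_iota ltnn subnn take0 drop0 cats0.
rewrite IH addnS -addSn [RHS]big_ltn ?leq_addr //; congr (h _ * _).
rewrite /blk iotaDl -map_comp //.
Qed.

Definition h1 (l : seq R) : R := 1 - \prod_(x <- l) x.
Definition h2 (l : seq R) : R := 1 - \prod_(x <- l) (1 - x).
(** The likelihood of a new variable with [g] clauses; [cl] below is that of a new clause. Both are
    scaled to mean one over laws of mean [1 / 2], so that [VP] and [TP] are relative entropies. *)
Definition bl g (l : seq R) : R := (pb h1 g l + pb h2 g l) / (2 * q ^+ g).
Definition cl (l : seq R) : R := (1 - \prod_(x <- l) x - \prod_(x <- l) (1 - x)) / q.
Definition VP pi g := ex (iid pi (g * k.-1)) (fun l => Lambda (bl g l)).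
Definition TP pi := ex (iid pi k) (fun l => Lambda (cl l)).

Lemma B_integrandE d g r : B_integrand k d g r =
  Lambda (pb h1 g (map r (idx 1 g)) + pb h2 g (map r (idx 1 g))) / (2 * q ^+ g)
  - d * (k.-1)%:R * Lambda (1 - \prod_(x <- map r (iota 1 k)) x
     - \prod_(x <- map r (iota 1 k)) (1 - x)) / (k%:R * q).
Proof.
have E (F : nat -> R) n : \prod_(1 <= j < n.+1) F j = \prod_(j <- iota 1 n) F j.
  by rewrite /index_iota subSS subn0.
have kS : k = k.-1.+1 by case: k k3.
have E' (F : nat -> R) : \prod_(1 <= j < k) F j = \prod_(j <- iota 1 k.-1) F j.
  by rewrite {1}kS E.
rewrite /B_integrand !big_map !E /q /qk.
have -> : pb h1 g (map r (idx 1 g)) = \prod_(i <- iota 1 g) (1 - \prod_(1 <= j < k) r (k * i + j)%N).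
  rewrite pb_idx add1n E; apply: eq_bigr => i _; by rewrite /h1 big_map E'.
have -> : pb h2 g (map r (idx 1 g)) = \prod_(i <- iota 1 g) (1 - \prod_(1 <= j < k) (1 - r (k * i + j)%N)).
  rewrite pb_idx add1n E; apply: eq_bigr => i _; by rewrite /h2 big_map E'.
by [].
Qed.

Section OnePi.
Variable pi : fd R R.
Hypothesis pP : isprob pi.
Let in01 (x : R) := 0 <= x <= 1.
Hypothesis p01 : fsupp in01 pi.
Hypothesis pm : ex pi id = 2^-1.

Let q0 : 0 < q. Proof. exact: qk_gt0. Qed.

Lemma prod_01 (l : seq R) : all in01 l -> in01 (\prod_(x <- l) x).
Proof.
elim: l => [|x l IH] /=; first by rewrite big_nil /in01 ler01 lexx.
case/andP=> /andP[x0 x1] /IH /andP[l0 l1]; rewrite big_cons /in01.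
by apply/andP; split; [exact: mulr_ge0|exact: mulr_ile1].
Qed.

Lemma prod1B_01 (l : seq R) : all in01 l -> in01 (\prod_(x <- l) (1 - x)).
Proof.
move=> al; rewrite -(big_map (fun x => 1 - x) predT id); apply: prod_01.
by rewrite all_map; apply: sub_all al => x /andP[x0 x1] /=; rewrite /in01; apply/andP; split; lra.
Qed.

Lemma h1_01 l : all in01 l -> in01 (h1 l).
Proof. by move/prod_01 => /andP[a b]; rewrite /in01 /h1; apply/andP; split; lra. Qed.
Lemma h2_01 l : all in01 l -> in01 (h2 l).
Proof. by move/prod1B_01 => /andP[a b]; rewrite /in01 /h2; apply/andP; split; lra. Qed.

Lemma all_take_drop n (l : seq R) : all in01 l -> all in01 (take n l) && all in01 (drop n l).
Proof. by rewrite -{1}(cat_take_drop n l) all_cat. Qed.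

Lemma pb_01 h g l : (forall l, all in01 l -> in01 (h l)) -> all in01 l -> in01 (pb h g l).
Proof.
move=> hh; elim: g l => [|g IH] l al /=; first by rewrite /in01 ler01 lexx.
have /andP[/hh /andP[a b] /IH /andP[c e]] := all_take_drop k.-1 al.
by apply/andP; split; [exact: mulr_ge0|exact: mulr_ile1].
Qed.

Lemma bl_bounds g l : all in01 l -> 0 <= bl g l <= (q^-1) ^+ g.
Proof.
move=> al; have /andP[a b] := pb_01 g h1_01 al; have /andP[c e] := pb_01 g h2_01 al.
have qg : 0 < q ^+ g by rewrite exprn_gt0.
rewrite /bl divr_ge0 ?addr_ge0 ?mulr_ge0 ?(ltW qg) //=.
rewrite exprVn invfM mulrA ler_pdivrMr ?ltr0n // mulVf ?gt_eqF //.
by rewrite ler_pdivrMr ?ltr0n //; lra.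
Qed.

Lemma ex_pb h g c : ex (iid pi k.-1) h = c -> ex (iid pi (g * k.-1)) (pb h g) = c ^+ g.
Proof.
move=> hc; elim: g => [|g IH]; first by rewrite ex_iid0.
rewrite mulSn ex_iidD exprS -{1}hc -exZr.
apply: eq_ex_iid => l ls; rewrite -IH -exZ; apply: eq_ex => l' /=.
by rewrite take_cat drop_cat ls ltnn subnn take0 drop0 cats0.
Qed.

Lemma ex_1B : ex pi (fun x => 1 - x) = 2^-1.
Proof. by rewrite exB ex_cst // pm; field. Qed.

Lemma ex_h1 : ex (iid pi k.-1) h1 = q.
Proof.
rewrite /h1 exB ex_cst; last exact: isprob_iid.
by rewrite (ex_prod pi k.-1 (fun x => x)) pm exprVn.
Qed.

Lemma ex_h2 : ex (iid pi k.-1) h2 = q.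
Proof.
rewrite /h2 exB ex_cst; last exact: isprob_iid.
by rewrite (ex_prod pi k.-1 (fun x => 1 - x)) ex_1B exprVn.
Qed.

Lemma ex_bl g : ex (iid pi (g * k.-1)) (bl g) = 1.
Proof.
rewrite /bl exZr exD (ex_pb g ex_h1) (ex_pb g ex_h2).
have : q ^+ g != 0 by rewrite expf_neq0 // gt_eqF.
by move: (q ^+ g) => x x0; field.
Qed.

Lemma ex_cl : ex (iid pi k) cl = 1.
Proof.
rewrite /cl exZr !exB ex_cst; last exact: isprob_iid.
rewrite (ex_prod pi k (fun x => x)) (ex_prod pi k (fun x => 1 - x)) ex_1B pm.
have -> : 1 - 2^-1 ^+ k - 2^-1 ^+ k = q.
  rewrite /q /qk; have [m ->] : exists m, k = m.+1 by case: k k3 => // m; exists m.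
  by rewrite /= -exprVn exprS; set x := 2^-1 ^+ m; field.
by rewrite divff // gt_eqF.
Qed.

(** For a first entry [x] the two products are at most [x] and [1 - x]; on the empty list [cl] would
    be [- q^-1]. *)
Lemma cl_bounds l : all in01 l -> l != [::] -> 0 <= cl l <= q^-1.
Proof.
move=> al ln; have /andP[a b] := prod_01 al; have /andP[c e] := prod1B_01 al.
have h : 0 <= 1 - \prod_(x <- l) x - \prod_(x <- l) (1 - x).
  case: l al ln {a b c e} => // x l /= /andP[/andP[x0 x1] al] _; rewrite !big_cons.
  have /andP[a b] := prod_01 al; have /andP[c e] := prod1B_01 al.
  have : x * \prod_(y <- l) y <= x by rewrite ler_piMr.
  have : (1 - x) * \prod_(y <- l) (1 - y) <= 1 - x by rewrite ler_piMr // subr_ge0.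
  lra.
rewrite /cl divr_ge0 ?(ltW q0) //= ler_piMl ?invr_ge0 ?(ltW q0) //; lra.
Qed.

Let fs n : fsupp (all in01) (iid pi n). Proof. exact: fsupp_iid. Qed.
Let iP n : isprob (iid pi n). Proof. exact: isprob_iid. Qed.

Lemma VP_ge0 g : 0 <= VP pi g.
Proof.
rewrite /VP -(subrr (1 : R)) -{1}(ex_bl g) -{1}(ex_cst (iP (g * k.-1)) 1) -exB.
apply: ex_le_supp (fs _) _ => // l al; apply: Lambda_ge.
by case/andP: (bl_bounds g al).
Qed.

Lemma VP_le g : VP pi g <= ln q^-1 * g%:R.
Proof.
have -> : ln q^-1 * g%:R = ex (iid pi (g * k.-1)) (fun l => bl g l * (ln q^-1 * g%:R)).
  by rewrite exZr ex_bl mul1r.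
apply: ex_le_supp (fs _) _ => // l al.
apply: le_trans (Lambda_le (bl_bounds g al)) _.
by rewrite lnXn ?invr_gt0 // mulr_natr.
Qed.

Lemma dom_VP : dom (VP pi).
Proof.
apply: dom_le (_ : dom (fun g => ln q^-1 * g%:R)) _; first by apply: domZ; exact: dom_id.
by move=> g; rewrite ger0_norm ?VP_ge0 ?VP_le.
Qed.

Lemma iintd_B d g : iintd pi (k * g + k + 1) (B_integrand k d g) =
  VP pi g + (ln 2 + g%:R * ln q) - d * (k.-1)%:R / k%:R * (TP pi + ln q).
Proof.
have kn : (k%:R : R) != 0 by rewrite pnatr_eq0; case: k k3.
pose F1 l := Lambda (pb h1 g l + pb h2 g l) / (2 * q ^+ g).
pose F2 l := d * (k.-1)%:R * Lambda (1 - \prod_(x <- l) x - \prod_(x <- l) (1 - x)) / (k%:R * q).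
rewrite (_ : B_integrand k d g = fun r => F1 (map r (idx 1 g)) - F2 (map r (iota 1 k))); last first.
  by apply/funext => r; rewrite B_integrandE.
rewrite (iintdB pi _ (fun r => F1 (map r (idx 1 g))) (fun r => F2 (map r (iota 1 k)))).
rewrite (iintd_sub F1 pP) //; last first.
- by apply: sub_all (idx_lt 1 g) => y yl; apply: leq_trans yl _; rewrite add1n mulnS addn1 addnC leqnSn.
- by have := path_idx 1 g; case: (idx 1 g) => //= a l /andP[].
rewrite (iintd_sub F2 pP) //; [|exact: iota_ltn_sorted|]; last first.
  by apply/allP => y; rewrite mem_iota; lia.
rewrite size_idx size_iota; congr (_ - _).
  rewrite (@eq_ex_supp _ _ (all in01) _ _ (fun l => Lambda (bl g l) + bl g l * ln (2 * q ^+ g))) //.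
    rewrite exD exZr ex_bl mul1r; congr (_ + _).
    by rewrite lnM ?posrE ?exprn_gt0 // lnXn // mulr_natl.
  move=> l al; have /andP[b0 _] := bl_bounds g al.
  have c0 : 0 < 2 * q ^+ g by rewrite mulr_gt0 ?exprn_gt0.
  rewrite /F1 (_ : pb h1 g l + pb h2 g l = 2 * q ^+ g * bl g l); last first.
    by rewrite /bl mulrCA divff ?mulr1 // gt_eqF.
  by rewrite LambdaM //; field; rewrite expf_neq0 // gt_eqF.
rewrite (@eq_ex_supp _ _ (fun l => all in01 l && (l != [::])) _ _
   (fun l => d * (k.-1)%:R / k%:R * (Lambda (cl l) + cl l * ln q))) //.
- by rewrite exZ exD exZr ex_cl mul1r.
- have := fs k; have : fsupp (fun l : seq R => l != [::]) (iid pi k).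
    case: k k3 => // m _; apply: fsupp_bind (_ : fsupp predT pi) _; first by rewrite /fsupp all_predT.
    by move=> x _; rewrite /fsupp all_map all_predT.
  rewrite /fsupp; elim: (iid pi k) => //= z r IH /andP[-> /IH {}IH] /andP[-> /IH].
  by [].
- move=> l /andP[al ln]; have /andP[b0 _] := cl_bounds al ln.
  rewrite /F2 (_ : 1 - _ - _ = q * cl l); last by rewrite /cl mulrCA divff ?mulr1 // gt_eqF.
  by rewrite LambdaM //; field; rewrite kn gt_eqF.
Qed.

(** The scaling constants contribute [ln 2 + d ln q - d (k - 1) / k ln q], which is exactly the
    right-hand side in the definition of [dcond]. *)
Lemma B_disc d : 0 < d -> B k d (disc pi) =
  pe d (VP pi) - d * (k.-1)%:R / k%:R * TP pi + (ln 2 + d / k%:R * ln q).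
Proof.
move=> d0; have d0' := ltW d0.
have kn : (k%:R : R) != 0 by rewrite pnatr_eq0; case: k k3.
transitivity (pe d (fun g => VP pi g + (ln q * g%:R + (ln 2 - d * (k.-1)%:R / k%:R * (TP pi + ln q))))).
  rewrite /B /rseries /pe; congr (limn _); apply/funext => N; apply: eq_bigr => g _.
  rewrite iint_disc //; last exact: cmeas_B.
  rewrite iintd_B; congr (_ * _); last by ring.
  by rewrite /poisson_pmf d0.
have dl : dom (fun g : nat => ln q * g%:R) by apply: domZ; exact: dom_id.
rewrite peD //; [|exact: dom_VP|by apply: domD dl (dom_cst _)].
rewrite peD //; [|exact: dom_cst]; rewrite peZ ?pe_id ?pe_cst //; last exact: dom_id.
have -> : (k.-1)%:R = k%:R - 1 :> R by case: k k3 => // m _; rewrite -natr1 addrK.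
by field.
Qed.

End OnePi.

(** Apart from the freedom to enlarge [d], the threshold enters the proof only through this
    inequality: a violating law would put [d] into the set whose infimum is [dcond]. *)
Lemma VP_TP_bound d pi : 0 < d -> (d%:E < dcond R k)%E -> isprob pi ->
  fsupp (fun x : R => 0 <= x <= 1) pi -> ex pi id = 2^-1 ->
  pe d (VP pi) <= d * (k.-1)%:R / k%:R * TP pi.
Proof.
move=> d0 dlt pP p01 pm.
suff : B k d (disc pi) <= ln 2 + d / k%:R * ln q by rewrite (B_disc pP p01 pm d0); lra.
rewrite -lee_fin leNgt; apply/negP => h.
suff : (dcond R k <= d%:E)%E by rewrite leNgt dlt.
apply: ereal_inf_lbound; exists d => //; split=> //.
apply: lt_le_trans h _; apply: ereal_sup_ubound; exists (disc pi) => //.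
exact: disc_Pstar.
Qed.

End BetheFinite.

(** * A modulus of continuity for [Lambda] *)

Section LambdaContinuity.
Variable R : realType.

(** [Lambda] is not Lipschitz at 0; an additive error [1 / kap] buys a Lipschitz constant of order
    [kap]. For [y <= x], the lower bound on the difference uses
    [Lambda (x - y) <= Lambda x - Lambda y] and the tangent of slope parameter [- ln kap], the upper
    bound uses the tangent at [x]. *)
Lemma Lambda_modulus (B kap x y : R) : 1 <= B -> 1 <= kap -> 0 <= x <= B -> 0 <= y <= B ->
  `|Lambda x - Lambda y| <= (1 + B) * kap * `|x - y| + kap^-1.
Proof.
move=> B1 k1; wlog xy : x y / y <= x => [H hx hy|].
  have [yx|/ltW yx] := leP y x; first exact: H.
  by rewrite distrC [`|x - y|]distrC; exact: H.
case/andP=> x0 xB /andP[y0 yB].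
have k0 : 0 < kap by apply: lt_le_trans k1.
have kV : 0 < kap^-1 by rewrite invr_gt0.
have [->|tn] := eqVneq x y; first by rewrite !subrr normr0 mulr0 add0r ltW.
have tp : 0 < x - y by rewrite subr_gt0 lt_def tn.
have xp : 0 < x by lra.
rewrite [`|x - y|]gtr0_norm //.
have kt : 0 <= kap * (x - y) by rewrite mulr_ge0 // ltW.
have Bt : B * (x - y) <= B * (kap * (x - y)).
  by rewrite ler_pM2l; [rewrite ler_peMl // ltW|exact: lt_le_trans B1].
have kB : kap * (x - y) <= B * (kap * (x - y)) by rewrite ler_peMl.
have Bk : (1 + B) * kap * (x - y) = kap * (x - y) + B * (kap * (x - y)) by ring.
rewrite ler_norml; apply/andP; split.
  have : Lambda (x - y) <= Lambda x - Lambda y.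
    rewrite !LambdaE.
    have l2 : ln (x - y) <= ln x by rewrite ler_ln ?posrE //; lra.
    have := ler_wpM2l (ltW tp) l2.
    have [->|yn] := eqVneq y 0; first by rewrite !subr0 mul0r subr0.
    have yp : 0 < y by rewrite lt_def yn.
    have l1 : ln y <= ln x by rewrite ler_ln ?posrE.
    have := ler_wpM2l y0 l1; lra.
  have := @xl_tangent R (x - y) 1 (- ln kap) (ltW tp) ler01.
  rewrite /xl ln1 subr0 -LambdaE expRN lnK ?posrE // mul1r.
  have n10 : (1 : R) = 0 -> x - y = 0 by move/eqP; rewrite oner_eq0.
  move=> /(_ n10) h1 h2.
  have lk : ln kap <= kap - 1 by have := @le_ln1Dx R (kap - 1); rewrite addrCA subrr addr0; apply; lra.
  have := ler_wpM2l (ltW tp) lk; lra.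
have : Lambda x - Lambda y <= B * (x - y).
  have := @xl_tangent R y 1 (ln x) y0 ler01; rewrite /xl ln1 subr0 lnK ?posrE // mul1r -LambdaE.
  have n10 : (1 : R) = 0 -> y = 0 by move/eqP; rewrite oner_eq0.
  move=> /(_ n10) h1.
  have lx : ln x <= x - 1 by have := @le_ln1Dx R (x - 1); rewrite addrCA subrr addr0; apply; lra.
  have h2 : ln x + 1 <= B by lra.
  have := ler_wpM2l (ltW tp) h2; rewrite [Lambda x]LambdaE; lra.
lra.
Qed.
End LambdaContinuity.

(** * Decorrelation of the posterior by pinning *)

Section Decorrelation.
Variables (R : realType) (n : nat).
Hypothesis n0 : (0 < n)%N.
Implicit Types (W : (nat -> bool) -> R) (f g : seq bool -> R).

Let mu := spins R n.
Let muP : isprob mu. Proof. exact: isprob_spins. Qed.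
Let lP N : isprob (iid (lits R n) N). Proof. by apply: isprob_iid; exact: isprob_lits. Qed.
Let l1P : isprob (lits R n). Proof. exact: isprob_lits. Qed.
Let chpin := channel_pin R n0.
Notation A := (A mu).
Notation Tpin := (Tr (lits R n) (@Lpin R)).

(** Posterior mean of [f], equal to 0 when [A W = 0]. *)
Definition br W (f : (nat -> bool) -> R) := A (wmul W f) / A W.
Definition trs (ls : seq lit) s := map (tr s) ls.
Definition J W f ls := br W (fun s => f (trs ls s)).
Definition rho W l := br W (fun s => (tr s l)%:R).
Definition cs b f := fun bs => f (b :: bs).
(** Mean of [f] over independent bits that are true with probabilities [xs]. *)
Fixpoint pr f (xs : seq R) : R :=
  if xs is x :: xs' then x * pr (cs true f) xs' + (1 - x) * pr (cs false f) xs' else f [::].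

Lemma AD W V : A (fun s => W s + V s) = A W + A V.
Proof. exact: exD. Qed.

Lemma AZ c W : A (fun s => c * W s) = c * A W.
Proof. exact: exZ. Qed.

Lemma A_le W V : (forall s, W s <= V s) -> A W <= A V.
Proof. by move=> h; apply: ex_le. Qed.

Lemma rho_01 W l : nn W -> 0 <= rho W l <= 1.
Proof.
move=> w; have a0 := A_ge0 muP w; rewrite /rho /br; apply/andP; split.
  by rewrite divr_ge0 ?A_ge0 //; apply: nn_wmul => // s; exact: ler0n.
have [->|an] := eqVneq (A W) 0; first by rewrite invr0 mulr0.
rewrite ler_pdivrMr ?mul1r; last by rewrite lt_def an.
by apply: A_le => s; rewrite /wmul ler_piMr // lern1 leq_b1.
Qed.

Lemma rho_neg W l : 0 < A W -> rho W (lneg l) = 1 - rho W l.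
Proof.
move=> a0; apply: (mulIf (lt0r_neq0 a0)).
rewrite mulrBl mul1r /rho /br !divfK ?lt0r_neq0 // -[LHS](addrK (A (wmul W (fun s => (tr s l)%:R)))).
rewrite -AD; congr (A _ - _); apply/funext => s; rewrite /wmul tr_neg -mulrDr.
by case: tr; rewrite ?add0r ?addr0 mulr1.
Qed.

(** [A W] times the mean squared posterior expectation of [g] at random literals. It is bounded and
    does not decrease under pinning on average, so its increments along many pins are small on
    average. *)
Definition Qf N g W := ex (iid (lits R n) N) (fun ls => A (wmul W (fun s => g (trs ls s))) ^+ 2 / A W).
(** Comes from [t <= kap t^2 / 2 + 1 / (2 kap)] applied to a conditional deviation [t]: the squares
    make up the increment of [Qf], which telescopes, and [1 / kap] is the price. *)
Definition Dk kap N g W := kap / 4 * (Tpin (Qf N g) W - Qf N g W) + A W / (4 * kap).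

Lemma Qf_ge0 N g W : nn W -> 0 <= Qf N g W.
Proof. by move=> w; apply: ex_ge0 => // ls; rewrite divr_ge0 ?sqr_ge0 // A_ge0. Qed.

Lemma Qf_le B N g W : (forall bs, `|g bs| <= B) -> nn W -> Qf N g W <= B ^+ 2 * A W.
Proof.
move=> gB w; rewrite -[leRHS](ex_cst (lP N)); apply: ex_le => // ls.
have a0 := A_ge0 muP w.
have [->|an] := eqVneq (A W) 0; first by rewrite invr0 !mulr0.
rewrite ler_pdivrMr ?lt_def ?an // -mulrA -expr2 -exprMn.
rewrite -real_normK ?num_real // lerXn2r ?nnegrE ?mulr_ge0 //.
  exact: le_trans (gB [::]).
apply: le_trans (ex_norm muP _) _; rewrite /Submission.A -exZ; apply: ex_le => // s.
by rewrite /wmul normrM [B * _]mulrC ger0_norm // ler_wpM2l.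
Qed.

Lemma pin_A W l : A (wmul W (Lpin R l)) = 2 * A (wmul W (fun s => (tr s l)%:R)).
Proof. by rewrite -AZ; congr A; apply/funext => s; rewrite /wmul /Lpin mulrCA. Qed.

Lemma pin_half W V : ex (lits R n) (fun l => A (wmul (wmul W (fun s => (tr s l)%:R)) V)) = A (wmul W V) / 2.
Proof.
rewrite -[A (wmul W V)](ex_AL mu chpin) -exZr; apply: eq_ex => l.
by rewrite wmulAC pin_A; field.
Qed.

Lemma pin_half1 W : ex (lits R n) (fun l => A (wmul W (fun s => (tr s l)%:R))) = A W / 2.
Proof. by have := pin_half W (fun=> 1); rewrite wmul1r => <-; apply: eq_ex => l; rewrite wmul1r. Qed.

(* Revealing one random spin changes [Qf] by its conditional variance, which
   dominates the covariance of that spin with [g]. *)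
Lemma cov_le kap N g W : 0 < kap -> nn W ->
  A W * ex (lits R n) (fun l => ex (iid (lits R n) N) (fun ls =>
    `|br W (fun s => (tr s l)%:R * g (trs ls s)) - rho W l * J W g ls|)) <= Dk kap N g W.
Proof.
move=> k0 w; have a0 := A_ge0 muP w; rewrite /Dk.
have [az|an] := eqVneq (A W) 0.
  rewrite az !mul0r addr0 /Tr /Qf; rewrite (_ : ex _ _ = 0).
    rewrite (_ : ex _ _ = 0) ?subrr ?mulr0 // -[RHS](ex_cst (lP N)); apply: eq_ex => ls.
    by rewrite az invr0 mulr0.
  rewrite -[RHS](ex_cst l1P); apply: eq_ex => l; rewrite -[RHS](ex_cst (lP N)); apply: eq_ex => ls.
  by rewrite [A (wmul W _)](A_null muP) // invr0 mulr0.
have ap : 0 < A W by rewrite lt_def an.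
set a := A W in ap an *.
pose y l := A (wmul W (fun s => (tr s l)%:R)).
pose u l ls := A (wmul (wmul W (fun s => (tr s l)%:R)) (fun s => g (trs ls s))).
pose v ls := A (wmul W (fun s => g (trs ls s))).
have y0 l : 0 <= y l by apply: A_ge0 => // s; rewrite mulr_ge0 ?ler0n.
have yu l ls : y l = 0 -> u l ls = 0.
  by move=> h; apply: A_null => // s; rewrite mulr_ge0 ?ler0n.
have Ey : ex (lits R n) y = a / 2 by rewrite /y pin_half1.
have Eu ls : ex (lits R n) (u ^~ ls) = v ls / 2 by rewrite /u pin_half.
have -> : Tpin (Qf N g) W - Qf N g W = ex (lits R n) (fun l => ex (iid (lits R n) N) (fun ls =>
    2 * (u l ls ^+ 2 / y l - 2 * u l ls * (v ls / a) + y l * (v ls / a) ^+ 2))).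
  rewrite ex_exchange /Tr /Qf ex_exchange -exB; apply: eq_ex => ls.
  rewrite exZ exD exB (_ : ex _ (fun l => 2 * u l ls * _) = 2 * (v ls / a) * (v ls / 2)); last first.
    by rewrite -Eu -exZ; apply: eq_ex => l; ring.
  rewrite [ex _ (fun l => y l * _)]exZr Ey -/(v ls) -/a.
  rewrite (_ : ex _ (fun l => A (wmul _ _) ^+ 2 / _) = 2 * ex (lits R n) (fun l => u l ls ^+ 2 / y l)).
    by field.
  rewrite -exZ; apply: eq_ex => l; rewrite pin_A -/(y l).
  have -> : A (wmul (wmul W (Lpin R l)) (fun s => g (trs ls s))) = 2 * u l ls.
    by rewrite /u -AZ; congr A; apply/funext => s; rewrite /wmul /Lpin; ring.
  have [yz|yn] := eqVneq (y l) 0; first by rewrite yu // mulr0 expr0n /= !mul0r mulr0.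
  by field.
have -> : a / (4 * kap) = ex (lits R n) (fun l => ex (iid (lits R n) N) (fun ls => y l / (2 * kap))).
  rewrite (@eq_ex _ _ _ _ (fun l => y l / (2 * kap))); last by move=> l; rewrite ex_cst.
  by rewrite exZr Ey; field; rewrite gt_eqF.
rewrite -!exZ -exD; apply: ex_le => // l; rewrite -!exZ -exD; apply: ex_le => // ls.
have -> : br W (fun s => (tr s l)%:R * g (trs ls s)) = u l ls / a.
  by rewrite /br /u wmulA.
rewrite /rho /J /br -/(y l) -/(v ls) -/a.
rewrite -[X in X * `|_|]gtr0_norm // -normrM mulrBr.
have -> : a * (u l ls / a) - a * (y l / a * (v ls / a)) = u l ls - y l * (v ls / a) by field.
have [yz|yn] := eqVneq (y l) 0.
  by rewrite yz yu // !mul0r !mulr0 !mul0r subr0 normr0 !addr0 expr0n /= mul0r subr0 !mulr0.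
have yp : 0 < y l by rewrite lt_def yn y0.
set w' := v ls / a; set dl := u l ls / y l - w'.
have -> : u l ls - y l * w' = y l * dl by rewrite /dl; field.
have -> : u l ls ^+ 2 / y l - 2 * u l ls * w' + y l * w' ^+ 2 = y l * dl ^+ 2 by rewrite /dl; field.
rewrite normrM gtr0_norm // -[dl ^+ 2]real_normK ?num_real //; set t := `|dl|.
have : 0 <= y l * ((kap * t - 1) ^+ 2 / (2 * kap)).
  by rewrite mulr_ge0 ?y0 // divr_ge0 ?sqr_ge0 // mulr_ge0 // ltW.
have -> : y l * ((kap * t - 1) ^+ 2 / (2 * kap)) =
   kap / 4 * (2 * (y l * t ^+ 2)) + y l / (2 * kap) - y l * t.
  by field; rewrite gt_eqF.
by rewrite subr_ge0.
Qed.

End Decorrelation.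

(** * Calculus of product laws on bits *)

Section ProductEvaluation.
Variable R : realType.
Implicit Types (f u w : seq bool -> R) (xs : seq R).

Lemma pr_lin a c f (g : seq bool -> R) xs : pr (fun bs => a * f bs + c * g bs) xs = a * pr f xs + c * pr g xs.
Proof.
elim: xs f g => //= x xs IH f g.
have := IH (cs true f) (cs true g); have := IH (cs false f) (cs false g).
rewrite /cs => -> ->; ring.
Qed.

Lemma pr_cst c xs : pr (fun=> c) xs = c.
Proof. by elim: xs => //= x xs; rewrite /cs => ->; ring. Qed.

Lemma pr_scale a f xs : pr (fun bs => a * f bs) xs = a * pr f xs.
Proof.
have := pr_lin a 0 f f xs; rewrite mul0r addr0 => <-; congr pr.
by apply/funext => bs; rewrite mul0r addr0.
Qed.

Lemma pr_split u w j xs : (j <= size xs)%N ->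
  pr (fun bs => u (take j bs) * w (drop j bs)) xs = pr u (take j xs) * pr w (drop j xs).
Proof.
elim: j u xs => [|j IH] u xs.
  move=> _; rewrite take0 drop0 /= -pr_scale; congr pr.
  by apply/funext => bs; rewrite take0 drop0.
case: xs => // x xs /= js; have := IH (cs true u) xs js; have := IH (cs false u) xs js.
rewrite /cs => -> ->; ring.
Qed.

Lemma pr_prod (h : bool -> R) xs :
  pr (fun bs => \prod_(b <- bs) h b) xs = \prod_(x <- xs) (x * h true + (1 - x) * h false).
Proof.
elim: xs => [|x xs IH] /=; first by rewrite !big_nil.
rewrite big_cons -IH (_ : cs true _ = fun bs => h true * \prod_(b <- bs) h b); last first.
  by apply/funext => bs; rewrite /cs big_cons.
rewrite (_ : cs false _ = fun bs => h false * \prod_(b <- bs) h b); last first.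
  by apply/funext => bs; rewrite /cs big_cons.
rewrite !pr_scale; ring.
Qed.

Lemma pr_pb k h (H : seq R -> R) g xs : size xs = (g * k.-1)%N ->
  (forall ys, size ys = k.-1 -> pr h ys = H ys) -> pr (pb k h g) xs = pb k H g xs.
Proof.
move=> + hH; elim: g xs => [|g IH] xs sx /=; first by rewrite pr_cst.
rewrite mulSn in sx; rewrite pr_split ?sx ?leq_addr //.
rewrite hH ?IH // ?size_drop ?sx ?addKn //.
by rewrite size_takel // sx leq_addr.
Qed.

Lemma pr_bounds f B N xs : (forall bs, size bs = N -> 0 <= f bs <= B) -> size xs = N ->
  all (fun x => 0 <= x <= 1) xs -> 0 <= pr f xs <= B.
Proof.
elim: xs f N => [|x xs IH] f N fB; first by move=> N0 _ /=; apply: fB.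
case: N fB => // N fB [sx] /= /andP[/andP[x0 x1] ax].
have /andP[a b] := IH (cs true f) N (fun bs h => fB (true :: bs) (congr1 succn h)) sx ax.
have /andP[c d] := IH (cs false f) N (fun bs h => fB (false :: bs) (congr1 succn h)) sx ax.
have y0 : 0 <= 1 - x by lra.
apply/andP; split; first by rewrite addr_ge0 ?mulr_ge0.
have := ler_wpM2l x0 b; have := ler_wpM2l y0 d; lra.
Qed.

End ProductEvaluation.

(** * Averaging over the number of pins *)

Section PinnedAverage.
Variables (R : realType) (n : nat).
Hypothesis n0 : (0 < n)%N.
Variables (I : Type) (p : fd R I) (L : I -> (nat -> bool) -> R).
Hypothesis chP : channel p L.
Implicit Types (W : (nat -> bool) -> R) (f g : seq bool -> R).

Let mu := spins R n.
Let muP : isprob mu. Proof. exact: isprob_spins. Qed.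
Let lP N : isprob (iid (lits R n) N). Proof. by apply: isprob_iid; exact: isprob_lits. Qed.
Let l1P : isprob (lits R n). Proof. exact: isprob_lits. Qed.
Let chpin := channel_pin R n0.
Notation A := (A mu).
Notation Tpin := (Tr (lits R n) (@Lpin R)).

(** [m] factors and a uniformly random number of pins below [T]. The average over the number of pins
    turns a bounded telescoping sum into an error [1 / T]. *)
Definition EE m T Phi : R :=
  T%:R^-1 * \sum_(0 <= th < T) iter m (Tr p L) (iter th Tpin Phi) (fun=> 1).

Lemma EED m T Phi Psi : EE m T (fun W => Phi W + Psi W) = EE m T Phi + EE m T Psi.
Proof.
rewrite /EE -mulrDr -big_split; congr (_ * _); apply: eq_bigr => th _.
by rewrite iterTrD iterTrD.
Qed.

Lemma EEZ m T c Phi : EE m T (fun W => c * Phi W) = c * EE m T Phi.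
Proof.
rewrite /EE mulrCA; congr (_ * _); rewrite mulr_sumr; apply: eq_bigr => th _.
by rewrite iterTrZ iterTrZ.
Qed.

Lemma EE_le m T Phi Psi : (forall W, nn W -> Phi W <= Psi W) -> EE m T Phi <= EE m T Psi.
Proof.
move=> h; apply: ler_wpM2l; first by rewrite invr_ge0.
apply: ler_sum => th _; apply: (iterTr_le chP); first exact: nn1.
by move=> V v; apply: (iterTr_le chpin).
Qed.

Lemma EE_A m T : (0 < T)%N -> EE m T A = 1.
Proof.
move=> T0; rewrite /EE (@eq_bigr _ _ _ _ _ _ _ (fun=> 1)); last first.
  move=> th _; rewrite (iterTr_A _ chpin) (iterTr_A _ chP); exact: A1.
by rewrite sumr_const_nat subn0 -mulr_natr mul1r mulVf // pnatr_eq0 -lt0n.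
Qed.

Lemma EE_telescope m T Phi B : (forall W, nn W -> 0 <= Phi W <= B * A W) -> (0 < T)%N ->
  EE m T (fun W => Tpin Phi W - Phi W) <= B / T%:R.
Proof.
move=> h T0; rewrite mulrC; apply: ler_wpM2l; first by rewrite invr_ge0.
rewrite (@eq_bigr _ _ _ _ _ _ _ (fun th => iter m (Tr p L) (iter th.+1 Tpin Phi) (fun=> 1) -
  iter m (Tr p L) (iter th Tpin Phi) (fun=> 1))); last first.
  move=> th _; rewrite (_ : (fun W => _) = fun W => Tpin Phi W + (-1) * Phi W); last first.
    by apply/funext => W; rewrite mulN1r.
  by rewrite !iterTrD !iterTrZ -iterSr mulN1r.
rewrite telescope_sumr //= lerBlDr.
have h0 : 0 <= iter m (Tr p L) (iter 0 Tpin Phi) (fun=> 1).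
  rewrite -(congr1 (fun F => F (fun=> 1)) (iterTr_cst chP m 0)).
  by apply: (iterTr_le chP m (@nn1 R _)) => V v; case/andP: (h V v).
apply: le_trans (_ : B <= _); last by rewrite lerDl.
have h1 : forall V, nn V -> iter T Tpin Phi V <= B * A V.
  move=> V v; apply: le_trans (_ : iter T Tpin (fun W => B * A W) V <= _).
    by apply: (iterTr_le chpin T v) => U u; case/andP: (h U u).
  by rewrite iterTrZ (iterTr_A _ chpin).
apply: le_trans (iterTr_le chP m (@nn1 R _) h1) _.
by rewrite iterTrZ (iterTr_A _ chP) A1 ?mulr1.
Qed.

Definition Err N f W := A W * ex (iid (lits R n) N)
  (fun ls => `|J n W f ls - pr f (map (rho n W) ls)|).

(** Split off the first literal: [f] is the sum of its restrictions to that literal being true and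
    false, each decoupled at the cost of one covariance. The false case is the true case for the
    negated literal, which has the same law. *)
Lemma Err_step kap N f W : 0 < kap -> nn W ->
  Err N.+1 f W <= Dk n kap N (cs true f) W + Dk n kap N (cs false f) W +
     (Err N (cs true f) W + Err N (cs false f) W).
Proof.
move=> k0 w.
have t0 := A_ge0 muP w.
have lift b : A W * ex (lits R n) (fun l => ex (iid (lits R n) N) (fun ls =>
    `|br n W (fun s => (tr s l)%:R * cs b f (trs ls s)) - rho n W l * J n W (cs b f) ls|)) <= Dk n kap N (cs b f) W.
  exact: cov_le.
have l1 := lift true; have := lift false; rewrite -ex_lits_neg => l2.
have [az|an] := eqVneq (A W) 0.
  rewrite /Err az !mul0r !addr0 addr_ge0 //.
    by apply: le_trans l1; rewrite az mul0r.
  by apply: le_trans l2; rewrite az mul0r.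
have ap : 0 < A W by rewrite lt_def an.
apply: le_trans (lerD (lerD l1 l2) (lexx _)).
rewrite /Err -!mulrDr ler_pM2l // ex_iidS -exD.
have K (g : seq bool -> R) : ex (iid (lits R n) N) (fun ls => `|J n W g ls - pr g (map (rho n W) ls)|) =
  ex (lits R n) (fun=> ex (iid (lits R n) N) (fun ls => `|J n W g ls - pr g (map (rho n W) ls)|)).
  by rewrite ex_cst.
rewrite (K (cs true f)) (K (cs false f)) -!exD; apply: ex_le => // l.
rewrite -!exD; apply: ex_le => // ls /=.
have /andP[r0 r1] := rho_01 n l w.
rewrite rho_neg //.
have -> : J n W f (l :: ls) = br n W (fun s => (tr s l)%:R * cs true f (trs ls s)) +
    br n W (fun s => (tr s (lneg l))%:R * cs false f (trs ls s)).
  rewrite /J /br -mulrDl -AD; congr (Submission.A _ _ / _); apply/funext => s.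
  by rewrite /wmul -mulrDr tr_neg /cs /=; case: tr; rewrite ?mul1r ?mul0r ?addr0 ?add0r.
set a := br n W _; set b := br n W _; set r := rho n W l in r0 r1 *.
set jt := J n W _ _; set jf := J n W _ _; set pt := pr _ _; set pf := pr _ _.
have -> : a + b - (r * pt + (1 - r) * pf) =
  (a - r * jt) + (b - (1 - r) * jf) + (r * (jt - pt) + (1 - r) * (jf - pf)) by ring.
apply: le_trans (ler_normD _ _) _; apply: lerD; first exact: ler_normD.
clearbody r jt jf pt pf.
apply: le_trans (ler_normD _ _) _; rewrite !normrM [`|r|]ger0_norm // [`|1 - r|]ger0_norm ?subr_ge0 //.
by apply: lerD; rewrite ler_piMl // gerBl.
Qed.

Lemma EE_Dk kap N g B m T : 0 < kap -> (0 < T)%N -> (forall bs, `|g bs| <= B) ->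
  EE m T (Dk n kap N g) <= kap / 4 * (B ^+ 2 / T%:R) + (4 * kap)^-1.
Proof.
move=> k0 T0 gB.
rewrite (_ : Dk n kap N g = fun W => kap / 4 * (Tpin (Qf n N g) W - Qf n N g W) + (4 * kap)^-1 * A W); last first.
  by apply/funext => W; rewrite /Dk [_^-1 * A W]mulrC.
rewrite EED !EEZ EE_A // mulr1 lerD2r ler_pM2l ?divr_gt0 //.
apply: EE_telescope => // W w; rewrite Qf_ge0 //=; exact: Qf_le.
Qed.

(** Each literal split off replaces [f] by two test functions, so there are [2^N - 1] pairs of
    covariance terms. *)
Lemma EE_Err kap N f B m T : 0 < kap -> (0 < T)%N -> (forall bs, `|f bs| <= B) ->
  EE m T (Err N f) <= (2 ^+ N - 1) * (2 * (kap / 4 * (B ^+ 2 / T%:R) + (4 * kap)^-1)).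
Proof.
move=> k0 T0; set e := kap / 4 * _ + _.
elim: N f => [|N IH] f fB.
  rewrite expr0 subrr mul0r; apply: le_trans (_ : EE m T (fun W => 0 * A W) <= _); last by rewrite EEZ mul0r.
  apply: EE_le => W w; rewrite /Err ex_iid0 mul0r /J /br /=.
  have [->|an] := eqVneq (A W) 0; first by rewrite mul0r.
  rewrite (_ : wmul W _ = fun s => f [::] * W s); last by apply/funext => s; rewrite /wmul mulrC.
  by rewrite AZ mulfK // subrr normr0 mulr0.
apply: le_trans (_ : EE m T (fun W => Dk n kap N (cs true f) W + Dk n kap N (cs false f) W +
     (Err N (cs true f) W + Err N (cs false f) W)) <= _).
  by apply: EE_le => W w; exact: Err_step.
rewrite EED [EE m T (fun W => Dk _ _ _ _ W + _)]EED [EE m T (fun W => Err _ _ W + _)]EED.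
have := @EE_Dk kap N (cs true f) B m T k0 T0 (fun bs => fB (true :: bs)).
have := @EE_Dk kap N (cs false f) B m T k0 T0 (fun bs => fB (false :: bs)).
have := IH (cs true f) (fun bs => fB (true :: bs)).
have := IH (cs false f) (fun bs => fB (false :: bs)).
rewrite -/e (exprS 2 N); lra.
Qed.

(* With [T = t ^ 4] pins the posterior of [N] random spins is a product up to [1 / t]. *)
Lemma EE_Lambda N F B m t : (0 < t)%N -> 1 <= B -> (forall bs, `|F bs| <= B) ->
  (forall bs, size bs = N -> 0 <= F bs <= B) ->
  EE m (t ^ 4) (fun W => A W * ex (iid (lits R n) N) (fun ls =>
    `|Lambda (J n W F ls) - Lambda (pr F (map (rho n W) ls))|)) <= 3 * B ^+ 3 * 2 ^+ N / t%:R.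
Proof.
move=> t0 B1 FB F0.
have tr0 : 0 < t%:R :> R by rewrite ltr0n.
have tr1 : 1 <= t%:R :> R by rewrite ler1n.
have k0 : 0 < t%:R ^+ 2 :> R by rewrite exprn_gt0.
have T0 : (0 < t ^ 4)%N by rewrite expn_gt0 t0.
(* [Lambda_modulus] is used with [kap = t], the decorrelation below with [kap = t^2]: its error is
   of order [t^-2] and survives the factor [t]. *)
apply: le_trans (_ : EE m (t ^ 4) (fun W => (1 + B) * t%:R * Err N F W + t%:R^-1 * A W) <= _).
  apply: EE_le => W w; have t00 := A_ge0 muP w.
  rewrite /Err mulrCA [t%:R^-1 * _]mulrC -mulrDr ler_wpM2l // -exZ.
  rewrite -[X in _ <= _ + X](ex_cst (lP N)) -exD; apply: ex_le_iid => // ls ln.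
  apply: Lambda_modulus => //; last first.
    apply: pr_bounds F0 _ _; first by rewrite size_map.
    by rewrite all_map; apply/allP => l _; exact: rho_01.
  have hb s : 0 <= F (trs ls s) <= B by apply: F0; rewrite size_map.
  rewrite /J /br; have [->|an] := eqVneq (A W) 0; first by rewrite invr0 mulr0 lexx (le_trans ler01).
  have ap : 0 < A W by rewrite lt_def an.
  rewrite divr_ge0 //=; last by apply: A_ge0 => // s; rewrite mulr_ge0 //; case/andP: (hb s).
  rewrite ler_pdivrMr // -AZ; apply: A_le => // s; rewrite /wmul mulrC.
  by apply: ler_wpM2r => //; case/andP: (hb s).
rewrite EED !EEZ EE_A // mulr1.
have := EE_Err N m k0 T0 FB; set E := EE _ _ _ => hE.
have B0 : 0 < B by apply: lt_le_trans B1.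
have e2 : t%:R ^+ 2 / 4 * (B ^+ 2 / (t ^ 4)%:R) + (4 * t%:R ^+ 2)^-1 = (B ^+ 2 + 1) / 4 / t%:R ^+ 2 :> R.
  by rewrite natrX; field; rewrite gt_eqF.
rewrite e2 in hE.
have BB : 1 <= B ^+ 2 by rewrite exprn_ege1.
have x2 : 1 <= 2 ^+ N :> R by rewrite exprn_ege1 // ler1n.
have hE' : E <= 2 ^+ N * B ^+ 2 / t%:R ^+ 2.
  apply: le_trans hE _; set b := B ^+ 2 in BB *; set x := 2 ^+ N in x2 *.
  have -> : (x - 1) * (2 * ((b + 1) / 4 / t%:R ^+ 2)) = (x - 1) * ((b + 1) / 2) / t%:R ^+ 2.
    by field; rewrite gt_eqF.
  rewrite ler_pM2r ?invr_gt0 //; apply: ler_pM; rewrite ?subr_ge0 ?gerBl //; lra.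
have cc : 0 <= (1 + B) * t%:R by rewrite mulr_ge0 ?addr_ge0 // ltW.
have := ler_wpM2l cc hE'.
have -> : (1 + B) * t%:R * (2 ^+ N * B ^+ 2 / t%:R ^+ 2) = (1 + B) * (2 ^+ N * B ^+ 2) / t%:R.
  by field; rewrite gt_eqF.
move=> h; apply: le_trans (lerD h (lexx _)) _.
rewrite (_ : _ / t%:R + t%:R^-1 = ((1 + B) * (2 ^+ N * B ^+ 2) + 1) / t%:R); last by rewrite [RHS]mulrDl mul1r.
rewrite ler_pM2r ?invr_gt0 //.
have B3 : 1 <= B ^+ 3 by rewrite exprn_ege1.
have h1 : (1 + B) * (2 ^+ N * B ^+ 2) <= 2 * B * (2 ^+ N * B ^+ 2).
  by apply: ler_wpM2r; [rewrite mulr_ge0 ?exprn_ge0 // ltW|lra].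
have h2 : 1 <= B ^+ 3 * 2 ^+ N by apply: mulr_ege1.
have -> : 3 * B ^+ 3 * 2 ^+ N = 2 * B * (2 ^+ N * B ^+ 2) + B ^+ 3 * 2 ^+ N by ring.
exact: lerD.
Qed.

End PinnedAverage.

(** * The cavity step: one new variable against lost clauses *)

Section Cavity.
Variables (R : realType) (k n : nat).
Hypothesis k3 : (3 <= k)%N.
Hypothesis n0 : (0 < n)%N.
Implicit Types (W : (nat -> bool) -> R).

Let q := qk R k.
Let q0 : 0 < q. Proof. exact: qk_gt0. Qed.
Let mu := spins R n.
Let mu' := spins R n.+1.
Let muP : isprob mu. Proof. exact: isprob_spins. Qed.
Let muP' : isprob mu'. Proof. exact: isprob_spins. Qed.
Let lP N : isprob (iid (lits R n) N). Proof. by apply: isprob_iid; exact: isprob_lits. Qed.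
Let l1P : isprob (lits R n). Proof. exact: isprob_lits. Qed.
Let chpin := channel_pin R n0.
Let chcl := channel_cl R k3 n0.
Let fs N : fsupp (all (lit_lt n)) (iid (lits R n) N).
Proof. by apply: fsupp_iid; exact: fsupp_lits. Qed.
Notation A := (A mu).
Notation A' := (Submission.A mu').
Notation Tpin := (Tr (lits R n) (@Lpin R)).
Notation Tcl := (Tr (iid (lits R n) k) (@Lcl R k)).
Notation E T m := (EE n (iid (lits R n) k) (@Lcl R k) m T).

Definition hb1 (bs : seq bool) : R := 1 - \prod_(b <- bs) b%:R.
Definition hb2 (bs : seq bool) : R := 1 - \prod_(b <- bs) (1 - b%:R).
Definition bitsF g bs : R := (pb k hb1 g bs + pb k hb2 g bs) / (2 * q ^+ g).
Definition fcl (bs : seq bool) : R := (1 - \prod_(b <- bs) b%:R - \prod_(b <- bs) (1 - b%:R)) / q.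
(** A clause through the new variable [n]. Its sign is fixed to true, since negating a whole clause
    does not change the NAE constraint. *)
Definition L1 (l : seq lit) s : R := Lcl R k ((n, true) :: l) s.
Notation T1 := (Tr (iid (lits R n) k.-1) L1).

(** Factors on old variables keep [W] local, and summing out the new spin is only meaningful for
    local densities. *)
Lemma iterTr_le_local I (P : I -> bool) (p : fd R I) (L : I -> (nat -> bool) -> R) m
   (Phi Psi : ((nat -> bool) -> R) -> R) W :
  channel p L -> fsupp P p -> (forall i, P i -> local n (L i)) -> nn W -> local n W ->
  (forall V, nn V -> local n V -> Phi V <= Psi V) ->
  iter m (Tr p L) Phi W <= iter m (Tr p L) Psi W.
Proof.
move=> [pP L0 _] Pp Ll w lw h; elim: m W w lw => [|m IH] W w lw /=; first exact: h.
by apply: ex_le_supp pP Pp _ => i Pi; apply: IH; [exact: nn_wmul|apply: local_wmul => //; exact: Ll].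
Qed.

Lemma E_le_local m T (Phi Psi : ((nat -> bool) -> R) -> R) :
  (forall V, nn V -> local n V -> Phi V <= Psi V) -> E T m Phi <= E T m Psi.
Proof.
move=> h; apply: ler_wpM2l; first by rewrite invr_ge0.
apply: ler_sum => th _.
apply: (iterTr_le_local _ chcl (fs k)) => //; [by move=> c; exact: local_Lcl|].
move=> V v lv; apply: (iterTr_le_local _ chpin (fsupp_lits R n)) => //.
by move=> l; exact: local_Lpin.
Qed.

Lemma hb1_01 bs : 0 <= hb1 bs <= 1.
Proof. by rewrite /hb1 prod_bool; case: (all id bs); rewrite ?subrr ?subr0 lexx ler01. Qed.
Lemma hb2_01 bs : 0 <= hb2 bs <= 1.
Proof. by rewrite /hb2 prod_negb; case: (all negb bs); rewrite ?subrr ?subr0 lexx ler01. Qed.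

Lemma pb_bits_01 (h : seq bool -> R) g bs : (forall cs, 0 <= h cs <= 1) -> 0 <= pb k h g bs <= 1.
Proof.
move=> hh; elim: g bs => [|g IH] bs /=; first by rewrite ler01 lexx.
have /andP[a b] := hh (take k.-1 bs); have /andP[c d] := IH (drop k.-1 bs).
by apply/andP; split; [exact: mulr_ge0|exact: mulr_ile1].
Qed.

Lemma bitsF_bounds g bs : 0 <= bitsF g bs <= (q^-1) ^+ g.
Proof.
have /andP[a b] := pb_bits_01 g bs hb1_01; have /andP[c e] := pb_bits_01 g bs hb2_01.
have qg : 0 < q ^+ g by rewrite exprn_gt0.
rewrite /bitsF divr_ge0 ?addr_ge0 ?mulr_ge0 ?(ltW qg) //=.
rewrite exprVn invfM mulrA ler_pdivrMr // mulVf ?gt_eqF //.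
by rewrite ler_pdivrMr ?ltr0n //; lra.
Qed.

Lemma pr_hb1 ys : pr hb1 ys = h1 ys.
Proof.
rewrite /hb1 /h1 (_ : (fun bs : seq bool => _) = fun bs => 1 * 1 + (-1) * \prod_(b <- bs) b%:R).
  rewrite pr_lin pr_cst (pr_prod (fun b => b%:R)) mulr1 mulN1r; congr (_ - _).
  by apply: eq_bigr => y _; rewrite mulr1 mulr0 addr0.
by apply/funext => bs; rewrite mulr1 mulN1r.
Qed.

Lemma pr_hb2 ys : pr hb2 ys = h2 ys.
Proof.
rewrite /hb2 /h2 (_ : (fun bs : seq bool => _) = fun bs => 1 * 1 + (-1) * \prod_(b <- bs) (1 - b%:R)).
  rewrite pr_lin pr_cst (pr_prod (fun b => 1 - b%:R)) mulr1 mulN1r; congr (_ - _).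
  by apply: eq_bigr => y _; rewrite subrr mulr0 add0r subr0 mulr1.
by apply/funext => bs; rewrite mulr1 mulN1r.
Qed.

Lemma pr_bitsF g xs : size xs = (g * k.-1)%N -> pr (bitsF g) xs = bl k g xs.
Proof.
move=> sx; rewrite /bitsF /bl -/q.
rewrite (_ : (fun bs => _) = fun bs => (2 * q ^+ g)^-1 * pb k hb1 g bs + (2 * q ^+ g)^-1 * pb k hb2 g bs).
  rewrite pr_lin (@pr_pb R k hb1 (@h1 R)) // ?(@pr_pb R k hb2 (@h2 R)) //.
  - by rewrite -mulrDr mulrC.
  - by move=> ys _; exact: pr_hb2.
  - by move=> ys _; exact: pr_hb1.
by apply/funext => bs; rewrite -mulrDr mulrC.
Qed.

Lemma pr_fcl xs : pr fcl xs = cl k xs.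
Proof.
rewrite /fcl /cl -/q (_ : (fun bs : seq bool => _) = fun bs => q^-1 * (1 - \prod_(b <- bs) b%:R) + (- q^-1) * \prod_(b <- bs) (1 - b%:R)).
  rewrite pr_lin (pr_prod (fun b => 1 - b%:R)).
  rewrite (_ : (fun bs : seq bool => 1 - _) = fun bs => 1 * 1 + (-1) * \prod_(b <- bs) b%:R).
    rewrite pr_lin pr_cst (pr_prod (fun b => b%:R)).
    rewrite (@eq_bigr _ _ _ _ _ _ _ id); last by move=> y _; rewrite mulr1 mulr0 addr0.
    rewrite [X in - q^-1 * X](@eq_bigr _ _ _ _ _ _ _ (fun y => 1 - y)); last first.
      by move=> y _; rewrite subrr mulr0 add0r subr0 mulr1.
    ring.
  by apply/funext => bs; rewrite mulr1 mulN1r.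
by apply/funext => bs; ring.
Qed.

Lemma L1E l s : L1 l s = (if s n then hb1 (trs l s) else hb2 (trs l s)) / q.
Proof.
rewrite /L1 LclE -/q; congr (_ / _); rewrite /mono /= /tr /=.
rewrite /hb1 /hb2 prod_bool prod_negb /trs.
by case: (s n) => /=; rewrite ?orbF.
Qed.

Lemma channel_L1 : channel (iid (lits R n) k.-1) L1.
Proof.
split; first exact: lP.
  by move=> l s; exact: Lcl_ge0.
move=> s; rewrite (@eq_ex _ _ _ _ (fun l => (if s n then hb1 (trs l s) else hb2 (trs l s)) / q)); last by move=> l; exact: L1E.
rewrite exZr; apply: (canLR (mulfK _)); first by rewrite gt_eqF.
rewrite mul1r; case: (s n); rewrite /hb1 /hb2 exB ex_cst //.
  rewrite (@eq_ex _ _ _ _ (fun l => \prod_(x <- l) (tr s x)%:R)); last by move=> l; rewrite big_map.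
  by rewrite ex_prod (ex_lits_tr s (fun b => b%:R)) // addr0 mul1r exprVn.
rewrite (@eq_ex _ _ _ _ (fun l => \prod_(x <- l) (1 - (tr s x)%:R))); last by move=> l; rewrite big_map.
by rewrite ex_prod (ex_lits_tr s (fun b => 1 - b%:R)) // subrr subr0 add0r mul1r exprVn.
Qed.

Definition Vw g ls (s : nat -> bool) : R :=
  pb k (fun bs => if s n then hb1 bs else hb2 bs) g (trs ls s) / q ^+ g.

Lemma iter_T1 g (Phi : ((nat -> bool) -> R) -> R) W :
  iter g T1 Phi W = ex (iid (lits R n) (g * k.-1)) (fun ls => Phi (wmul W (Vw g ls))).
Proof.
elim: g W => [|g IH] W.
  by rewrite ex_iid0 /=; congr Phi; apply/funext => s; rewrite /wmul /Vw /= divr1 mulr1.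
rewrite iterS /Tr mulSn ex_iidD; apply: eq_ex_iid => l ll; rewrite IH.
apply: eq_ex => ls; congr Phi; apply/funext => s; rewrite /wmul -mulrA; congr (_ * _).
rewrite /Vw /= /trs map_cat take_cat drop_cat size_map ll ltnn subnn take0 drop0 cats0 L1E exprS.
by rewrite /trs; field; rewrite expf_neq0 ?gt_eqF.
Qed.

Lemma A_Vw g ls W : local n W -> all (lit_lt n) ls ->
  A' (wmul W (Vw g ls)) = A (wmul W (fun s => bitsF g (trs ls s))).
Proof.
move=> lw al; rewrite /Submission.A ex_spinsS; apply: eq_ex => s.
have tu b : trs ls (upd s n b) = trs ls s.
  by apply/eq_in_map => l /(allP al) ln; rewrite /tr /upd ltn_eqF.
rewrite /wmul /Vw !tu !(local_upd _ _ lw) /upd eqxx /bitsF; field.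
by rewrite expf_neq0 ?gt_eqF.
Qed.

(** Summing out the new spin turns its [g] clauses into the single factor [bitsF g]. Its posterior
    mean [J] has mean one over the literals, so [Ent mu W] splits off. *)
Lemma T1_Ent g W : nn W -> local n W -> iter g T1 (Ent mu') W =
  Ent mu W + A W * ex (iid (lits R n) (g * k.-1)) (fun ls => Lambda (J n W (bitsF g) ls)).
Proof.
move=> w lw; have a0 := A_ge0 muP w.
have EJ : ex (iid (lits R n) (g * k.-1)) (fun ls => A (wmul W (fun s => bitsF g (trs ls s)))) = A W.
  transitivity (iter g T1 A' W); last by rewrite (iterTr_A _ channel_L1) A_localS.
  by rewrite iter_T1; apply: eq_ex_supp (fs _) _ => ls al; rewrite A_Vw.
rewrite iter_T1 (@eq_ex_supp _ _ _ _ _ (fun ls => Lambda (A (wmul W (fun s => bitsF g (trs ls s))))) (fs _)); last first.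
  by move=> ls al; rewrite /Ent A_Vw.
have [az|an] := eqVneq (A W) 0.
  rewrite /Ent az mul0r addr0 -[RHS](ex_cst (lP (g * k.-1))); apply: eq_ex => ls.
  by rewrite A_null.
have ap : 0 < A W by rewrite lt_def an.
rewrite /Ent [Lambda (A W)]LambdaE -{1}EJ -exZr -exZ -exD; apply: eq_ex => ls.
have j0 : 0 <= J n W (bitsF g) ls.
  rewrite /J /br divr_ge0 // A_ge0 //; apply: nn_wmul => // s.
  by case/andP: (bitsF_bounds g (trs ls s)).
have -> : A (wmul W (fun s => bitsF g (trs ls s))) = A W * J n W (bitsF g) ls.
  by rewrite /J /br mulrC divfK.
by rewrite LambdaM // addrC.
Qed.

Lemma Inc_cl W : nn W -> Inc mu (iid (lits R n) k) (@Lcl R k) W =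
  A W * ex (iid (lits R n) k) (fun ls => Lambda (J n W fcl ls)).
Proof.
move=> w; have a0 := A_ge0 muP w; rewrite /Inc -exZ; apply: eq_ex_iid => c ck.
have -> : Lcl R k c = fun s => fcl (trs c s).
  apply/funext => s; rewrite LclE -/q /fcl monoE ?opprD ?addrA //.
  by rewrite -size_eq0 size_map ck; case: k k3.
rewrite /J /br -/mu; have [az|an] := eqVneq (A W) 0.
  by rewrite az (A_null muP) // /xl !mul0r.
have ap : 0 < A W by rewrite lt_def an.
set x := A (wmul _ _).
have x0 : 0 <= x.
  apply: A_ge0 => // s; rewrite mulr_ge0 //.
  have := Lcl_ge0 R k3 c s; rewrite LclE -/q /fcl /trs monoE ?opprD ?addrA //.
  by rewrite -size_eq0 size_map ck; case: k k3.
rewrite LambdaE /xl; have [->|xn] := eqVneq x 0; first by rewrite !mul0r mulr0.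
rewrite ln_div ?posrE ?lt_def ?xn //; first by field.
by rewrite an.
Qed.

(** The law of the posterior marginal of a random literal. The random sign makes its mean [1 / 2],
    so it is admissible in the supremum defining [dcond]. *)
Definition piW W : fd R R := fmap (rho n W) (lits R n).

Lemma piW_prob W : isprob (piW W).
Proof. exact: isprob_map. Qed.

Lemma piW_01 W : nn W -> fsupp (fun x : R => 0 <= x <= 1) (piW W).
Proof.
move=> w; rewrite /fsupp all_map (eq_all (a2 := predT)) ?all_predT // => z /=.
exact: rho_01.
Qed.

Lemma piW_mean W : 0 < A W -> ex (piW W) id = 2^-1.
Proof.
move=> ap; rewrite ex_map /rho /br exZr pin_half1 //; field.
by rewrite gt_eqF.
Qed.

Lemma VP_piW W g : VP k (piW W) g =
  ex (iid (lits R n) (g * k.-1)) (fun ls => Lambda (pr (bitsF g) (map (rho n W) ls))).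
Proof.
by rewrite /VP ex_iid_map; apply: eq_ex_iid => ls sl; rewrite pr_bitsF ?size_map.
Qed.

Lemma TP_piW W : TP k (piW W) = ex (iid (lits R n) k) (fun ls => Lambda (pr fcl (map (rho n W) ls))).
Proof. by rewrite /TP ex_iid_map; apply: eq_ex => ls; rewrite pr_fcl. Qed.

Lemma qV1 : 1 <= q^-1. Proof. exact: qkV_ge1. Qed.

(** Growth per clause of the constant [B^3 2^N] of [EE_Lambda] with [B = q^-g] and
    [N = g (k - 1)]. *)
Definition K0 : R := (q^-1) ^+ 3 * 2 ^+ k.-1.

(** After pinning, the joint posterior of the [g (k - 1)] neighbours may be replaced by the product
    of marginals, which is the variable term of the Bethe functional at [piW W]. The error is
    geometric in [g], hence Poisson summable. *)
Lemma E_vertex m t g : (0 < t)%N -> E (t ^ 4)%N m (iter g T1 (Ent mu')) <=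
  E (t ^ 4)%N m (fun W => Ent mu W + A W * VP k (piW W) g) + 3 / t%:R * K0 ^+ g.
Proof.
move=> t0.
have B1 : 1 <= (q^-1) ^+ g by rewrite exprn_ege1 ?qV1.
have Fb bs : `|bitsF g bs| <= (q^-1) ^+ g.
  by case/andP: (bitsF_bounds g bs) => a b; rewrite ger0_norm.
have h := @EE_Lambda R n n0 _ _ _ chcl (g * k.-1) (bitsF g) _ m t t0 B1 Fb (fun bs _ => bitsF_bounds g bs).
apply: le_trans (lerD (lexx _) (_ : _ <= 3 / t%:R * K0 ^+ g)); last first.
  have e : (q^-1 ^+ g) ^+ 3 * 2 ^+ (g * k.-1) = K0 ^+ g.
    by rewrite /K0 exprMn -!exprM [(3 * g)%N]mulnC [(k.-1 * g)%N]mulnC.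
  by apply: le_trans h _; rewrite -e [leRHS]mulrAC [X in _ <= X / _]mulrA.
rewrite -EED; apply: E_le_local => W w lw; rewrite T1_Ent // -addrA lerD2l -mulrDr.
apply: ler_wpM2l; first exact: A_ge0.
rewrite VP_piW -exD; apply: ex_le => // ls; rewrite -lerBlDl; exact: ler_norm.
Qed.

Lemma E_clause m t : (0 < t)%N -> E (t ^ 4)%N m (fun W => A W * TP k (piW W)) <=
  E (t ^ 4)%N m (Inc mu (iid (lits R n) k) (@Lcl R k)) + 3 * (q^-1) ^+ 3 * 2 ^+ k / t%:R.
Proof.
move=> t0.
have fb (bs : seq bool) : bs != [::] -> 0 <= fcl bs <= q^-1.
  move=> bn; rewrite /fcl -addrA -opprD -monoE //; case: (mono bs).
    by rewrite subrr mul0r lexx invr_ge0 ltW.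
  by rewrite subr0 mul1r lexx invr_ge0 ltW.
have Fb (bs : seq bool) : `|fcl bs| <= q^-1.
  case: (eqVneq bs [::]) => [->|/fb /andP[a b]]; last by rewrite ger0_norm.
  by rewrite /fcl !big_nil subrr add0r mulN1r normrN gtr0_norm ?invr_gt0.
have Fs (bs : seq bool) : size bs = k -> 0 <= fcl bs <= q^-1.
  by move=> sb; apply: fb; rewrite -size_eq0 sb; case: k k3.
have h := @EE_Lambda R n n0 _ _ _ chcl k fcl _ m t t0 qV1 Fb Fs.
apply: le_trans (lerD (lexx _) h); rewrite -EED; apply: E_le_local => W w lw.
rewrite Inc_cl // -mulrDr; apply: ler_wpM2l; first exact: A_ge0.
rewrite TP_piW -exD; apply: ex_le => // ls; rewrite -lerBlDl distrC; exact: ler_norm.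
Qed.

Lemma K0_ge0 : 0 <= K0.
Proof. by rewrite /K0 mulr_ge0 ?exprn_ge0 // invr_ge0 ltW. Qed.

(** The condensation inequality is applied for each density [W] to its own law [piW W]; averaging
    then compares the entropy of attaching a variable with that of single clauses. *)
Lemma cavity_step d m t N : 0 < d -> (d%:E < dcond R k)%E -> (0 < t)%N ->
  \sum_(0 <= g < N) pois d g * (E (t ^ 4)%N m (iter g T1 (Ent mu')) - E (t ^ 4)%N m (Ent mu)) <=
  d * (k.-1)%:R / k%:R * E (t ^ 4)%N m (Inc mu (iid (lits R n) k) (@Lcl R k)) +
  (3 * expR (d * (K0 - 1)) + d * (k.-1)%:R / k%:R * (3 * (q^-1) ^+ 3 * 2 ^+ k)) / t%:R.
Proof.
move=> d0 dc t0; have d0' := ltW d0.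
have c0 : 0 <= d * (k.-1)%:R / k%:R by rewrite !mulr_ge0 ?invr_ge0.
have tV : 0 <= t%:R^-1 :> R by rewrite invr_ge0.
apply: le_trans (_ : \sum_(0 <= g < N) (E (t ^ 4)%N m (fun W => pois d g * (A W * VP k (piW W) g)) + 3 / t%:R * (pois d g * K0 ^+ g)) <= _).
  apply: ler_sum => g _; rewrite EEZ [3 / _ * _]mulrCA -mulrDr; apply: ler_wpM2l; first exact: pois_ge0.
  have := E_vertex m g t0; rewrite EED; lra.
rewrite (_ : \sum_(0 <= g < N) (_ + _) =
  \sum_(0 <= g < N) E (t ^ 4)%N m (fun W => pois d g * (A W * VP k (piW W) g)) +
  3 / t%:R * psum d (fun g => K0 ^+ g) N); last by rewrite big_split /psum mulr_sumr.
have h1 : psum d (fun g => K0 ^+ g) N <= expR (d * (K0 - 1)).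
  rewrite -pe_exp; apply: pe_psum => //; last by move=> i; rewrite exprn_ge0 ?K0_ge0.
  by have := dom_exp 1 K0_ge0; congr dom; apply/funext => i; rewrite mul1r.
have h2 : \sum_(0 <= g < N) E (t ^ 4)%N m (fun W => pois d g * (A W * VP k (piW W) g)) <=
    E (t ^ 4)%N m (fun W => d * (k.-1)%:R / k%:R * (A W * TP k (piW W))).
  have -> : \sum_(0 <= g < N) E (t ^ 4)%N m (fun W => pois d g * (A W * VP k (piW W) g)) =
    E (t ^ 4)%N m (fun W => \sum_(0 <= g < N) pois d g * (A W * VP k (piW W) g)).
    elim: N {h1} => [|N IH].
      rewrite big_nil (_ : (fun W => _) = fun W => 0 * A W) ?EEZ ?mul0r //.
      by apply/funext => W; rewrite big_nil mul0r.
    by rewrite big_nat_recr //= IH -EED; congr EE; apply/funext => W; rewrite big_nat_recr.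
  apply: E_le_local => W w _; have a0 := A_ge0 muP w.
  rewrite (@eq_bigr _ _ _ _ _ _ _ (fun g => A W * (pois d g * VP k (piW W) g))); last by move=> g _; ring.
  rewrite -mulr_sumr mulrCA; have [->|an] := eqVneq (A W) 0; first by rewrite !mul0r.
  have ap : 0 < A W by rewrite lt_def an.
  apply: ler_wpM2l => //.
  have pP := piW_prob W; have p01 := piW_01 w; have pm := piW_mean ap.
  apply: le_trans (VP_TP_bound k3 d0 dc pP p01 pm).
  by apply: (pe_psum N) => //; [exact: dom_VP|exact: VP_ge0].
have t3 : 0 <= 3 / t%:R :> R by rewrite mulr_ge0.
apply: le_trans (lerD h2 (ler_wpM2l t3 h1)) _.
rewrite EEZ; have := ler_wpM2l c0 (E_clause m t0).
set a := E _ _ _; set b := E _ _ _; set c := d * _ / _; set X := expR _; set Y := 3 * _ * _.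
set z := t%:R^-1; move=> h; apply: le_trans (lerD h (lexx _)) _.
by rewrite le_eqVlt; apply/orP; left; apply/eqP; ring.
Qed.

End Cavity.

(** * Replacing and mixing channels *)

Section Mixtures.
Variables (R : realType) (S : Type) (mu : fd R S).
Hypothesis muP : isprob mu.
Notation A := (A mu).

(** The factors are exchanged one at a time. As channels commute, each can be exchanged right next
    to [Phi], at cost [c] times the conserved quantity [A]. *)
Lemma iter_mix I J (p : fd R I) (L : I -> S -> R) (p1 : fd R J) (L1 : J -> S -> R) c Phi m W :
  channel p L -> channel p1 L1 -> nn W ->
  (forall V, nn V -> Tr p L Phi V <= Tr p1 L1 Phi V + c * A V) ->
  iter m (Tr p L) Phi W <= iter m (Tr p1 L1) Phi W + m%:R * (c * A W).
Proof.
move=> ch ch1 + h; elim: m W => [|m IH] W w; first by rewrite mul0r addr0.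
rewrite iterSr; apply: le_trans (_ : iter m (Tr p L) (fun V => Tr p1 L1 Phi V + c * A V) W <= _).
  exact: (iterTr_le ch).
rewrite iterTrD iterTrZ (iterTr_A _ ch) -natr1 mulrDl mul1r addrA lerD2r -Tr_iter_comm /=.
apply: le_trans (_ : Tr p1 L1 (fun V => iter m (Tr p1 L1) Phi V + m%:R * (c * A V)) W <= _).
  by apply: (Tr_le ch1) => // V v; exact: IH.
by rewrite TrD TrZ TrZ (Tr_A _ ch1).
Qed.

Definition mixp I J (x : R) (p1 : fd R I) (p2 : fd R J) : fd R (I + J) :=
  fbind [:: (x, true); (1 - x, false)]
    (fun b : bool => if b then fmap inl p1 else fmap inr p2).
Definition mixL I J (L1 : I -> S -> R) (L2 : J -> S -> R) (i : I + J) :=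
  match i with inl i => L1 i | inr j => L2 j end.

Lemma ex_mixp I J x (p1 : fd R I) (p2 : fd R J) f :
  ex (mixp x p1 p2) f = x * ex p1 (fun i => f (inl i)) + (1 - x) * ex p2 (fun j => f (inr j)).
Proof. by rewrite ex_bind {1}/ex !big_cons big_nil /= !ex_map addr0. Qed.

Lemma channel_mix I J x (p1 : fd R I) (p2 : fd R J) (L1 : I -> S -> R) (L2 : J -> S -> R) :
  0 <= x <= 1 -> channel p1 L1 -> channel p2 L2 -> channel (mixp x p1 p2) (mixL L1 L2).
Proof.
case/andP=> x0 x1 [pP1 L10 L11] [pP2 L20 L21]; split.
- apply: isprob_bind; last by case; exact: isprob_map.
  split; first by rewrite /= x0 subr_ge0 x1.
  by rewrite /ex !big_cons big_nil /=; ring.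
- by case.
- by move=> s; rewrite ex_mixp /= L11 L21; ring.
Qed.

Lemma Tr_mix I J x (p1 : fd R I) (p2 : fd R J) (L1 : I -> S -> R) (L2 : J -> S -> R) Phi :
  Tr (mixp x p1 p2) (mixL L1 L2) Phi = fun W => x * Tr p1 L1 Phi W + (1 - x) * Tr p2 L2 Phi W.
Proof. by apply/funext => W; rewrite /Tr ex_mixp. Qed.

Lemma Tr_Ent_ge I (p : fd R I) (L : I -> S -> R) : channel p L ->
  forall W, nn W -> Ent mu W <= Tr p L (Ent mu) W.
Proof. by move=> ch W w; rewrite (Tr_Ent _ ch) lerDl; exact: (Inc_ge0 muP ch). Qed.

Lemma Ent_wmul_le B W V : 1 <= B -> (forall s, 0 <= V s <= B) -> nn W ->
  Ent mu (wmul W V) <= A (wmul W V) * ln (A W) + ln B * A (wmul W V).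
Proof.
move=> B1 VB w.
have v : nn V by move=> s; case/andP: (VB s).
have x0 : 0 <= A (wmul W V) by apply: A_ge0 => //; exact: nn_wmul.
have B0 : 0 < B by apply: lt_le_trans B1.
rewrite /Ent LambdaE [ln B * _]mulrC -mulrDr.
have [->|xn] := eqVneq (A (wmul W V)) 0; first by rewrite !mul0r.
have xp : 0 < A (wmul W V) by rewrite lt_def xn.
have Wp : 0 < A W.
  by rewrite lt_def A_ge0 // andbT; apply: contra xn => /eqP h; rewrite A_null.
apply: ler_wpM2l => //; rewrite -lnM ?posrE // ler_ln ?posrE ?mulr_gt0 // mulrC.
rewrite /Submission.A -exZ; apply: ex_le => // s; rewrite /wmul mulrC; apply: ler_wpM2r => //.
by case/andP: (VB s).
Qed.

End Mixtures.

(** * Splitting a random clause by occurrences of the last variable *)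

Section SplitClause.
Variables (R : realType) (n : nat).
Hypothesis n0 : (0 < n)%N.
Implicit Types g : seq lit -> R.

Definition ee : R := n.+1%:R^-1.
Definition lx : fd R lit := fmap (pair n) (coin R).
Let iid_n j := iid (lits R n) j.

Lemma ee_gt0 : 0 < ee. Proof. by rewrite invr_gt0 ltr0n. Qed.
Lemma ee_le1 : ee <= 1. Proof. by rewrite invf_le1 ?ltr0n // ler1n. Qed.
Lemma oneB_ee : 1 - ee = n%:R / n.+1%:R.
Proof. by rewrite /ee -natr1; field; rewrite natr1 pnatr_eq0. Qed.

Let e0 : 0 <= 1 - ee. Proof. by rewrite subr_ge0 ee_le1. Qed.

Lemma isprob_lx : isprob lx.
Proof. exact: isprob_map (isprob_coin R). Qed.

Lemma ex_lits_ee f : ex (lits R n.+1) f = (1 - ee) * ex (lits R n) f + ee * ex lx f.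
Proof. by rewrite ex_litsS oneB_ee ex_map ex_coin. Qed.

(* The parts of the expectation where the new variable occurs exactly once, resp.
   at least twice. *)
Fixpoint X1 j g : R := if j is j'.+1 then
    ee * ex lx (fun x => (1 - ee) ^+ j' * ex (iid_n j') (fun l => g (x :: l))) +
    (1 - ee) * ex (lits R n) (fun a => X1 j' (fun l => g (a :: l)))
  else 0.
Fixpoint X2 j g : R := if j is j'.+1 then
    ee * ex lx (fun x => X1 j' (fun l => g (x :: l)) + X2 j' (fun l => g (x :: l))) +
    (1 - ee) * ex (lits R n) (fun a => X2 j' (fun l => g (a :: l)))
  else 0.

Lemma ex_split j g : ex (iid (lits R n.+1) j) g =
  (1 - ee) ^+ j * ex (iid_n j) g + X1 j g + X2 j g.
Proof.
elim: j g => [|j IH] g; first by rewrite !ex_iid0 expr0 mul1r !addr0.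
rewrite ex_iidS ex_lits_ee /=.
rewrite (@eq_ex _ _ (lits R n) _ (fun a => (1 - ee) ^+ j * ex (iid_n j) (fun l => g (a :: l)) +
  X1 j (fun l => g (a :: l)) + X2 j (fun l => g (a :: l)))); last by move=> a; rewrite IH.
rewrite (@eq_ex _ _ lx _ (fun a => (1 - ee) ^+ j * ex (iid_n j) (fun l => g (a :: l)) +
  (X1 j (fun l => g (a :: l)) + X2 j (fun l => g (a :: l))))); last by move=> a; rewrite IH addrA.
rewrite !exD !exZ -ex_iidS exprS; ring.
Qed.

Lemma X1_le j g g' : (forall l, g l <= g' l) -> X1 j g <= X1 j g'.
Proof.
elim: j g g' => [|j IH] g g' h //=; apply: lerD; apply: ler_wpM2l => //.
- exact: ltW ee_gt0.
- apply: ex_le => [|x]; first exact: isprob_lx.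
  apply: ler_wpM2l; first by rewrite exprn_ge0.
  by apply: ex_le => [|l //]; apply: isprob_iid; exact: isprob_lits.
- by apply: ex_le => [|a]; [exact: isprob_lits|exact: IH].
Qed.

Lemma X2_le j g g' : (forall l, g l <= g' l) -> X2 j g <= X2 j g'.
Proof.
elim: j g g' => [|j IH] g g' h //=; apply: lerD; apply: ler_wpM2l => //.
- exact: ltW ee_gt0.
- apply: ex_le => [|x]; first exact: isprob_lx.
  by apply: lerD; [exact: X1_le|exact: IH].
- by apply: ex_le => [|a]; [exact: isprob_lits|exact: IH].
Qed.

(** For symmetric [g] the single new literal may be moved to the front, and its [j] positions
    contribute equally. *)
Lemma X1_sym j g : (forall l l', perm_eq l l' -> g l = g l') ->
  X1 j g = j%:R * ee * (1 - ee) ^+ j.-1 * ex lx (fun x => ex (iid_n j.-1) (fun l => g (x :: l))).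
Proof.
elim: j g => [|j IH] g gs /=; first by rewrite !mul0r.
rewrite exZ (@eq_ex _ _ (lits R n) _ (fun a => j%:R * ee * (1 - ee) ^+ j.-1 *
   ex lx (fun x => ex (iid_n j.-1) (fun l => g (a :: x :: l))))); last first.
  by move=> a; rewrite IH // => l l' h; apply: gs; rewrite perm_cons.
rewrite exZ [ex (lits R n) _]ex_exchange.
rewrite [X in _ + _ * (_ * X)](@eq_ex _ _ lx _ (fun x => ex (iid_n j.-1.+1) (fun l => g (x :: l)))); last first.
  move=> x; rewrite ex_iidS; apply: eq_ex => a; apply: eq_ex => l; apply: gs.
  by rewrite (perm_catCA [:: a] [:: x] l).
case: j {IH} => [|j] /=; first by rewrite !mul0r mulr0 addr0 !expr0; ring.
rewrite -[j.+2%:R]natr1 exprS; ring.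
Qed.

End SplitClause.

(** * The clause channel on one more variable *)

Section SplitClauseChannel.
Variables (R : realType) (k n : nat).
Hypothesis k3 : (3 <= k)%N.
Hypothesis n0 : (0 < n)%N.
Let mu' := spins R n.+1.
Let muP' : isprob mu'. Proof. exact: isprob_spins. Qed.
Notation A' := (A mu').
Let e := ee R n.
Let p0 := (1 - e) ^+ k.
Let p1 := k%:R * e * (1 - e) ^+ k.-1.
Let p2 := 1 - p0 - p1.

Lemma mono_perm bs bs' : perm_eq bs bs' -> mono bs = mono bs'.
Proof. by move=> h; rewrite /mono !(perm_all _ h). Qed.

Lemma Lcl_perm l l' : perm_eq l l' -> Lcl R k l = Lcl R k l'.
Proof. by move=> h; apply/funext => s; rewrite /Lcl (mono_perm (perm_map _ h)). Qed.

Lemma Lcl_neg l : Lcl R k (map lneg l) = Lcl R k l.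
Proof.
apply/funext => s; rewrite /Lcl -map_comp.
have -> : mono (map (tr s \o lneg) l) = mono (map (tr s) l) => //.
rewrite (eq_map (fun x => tr_neg s x : (tr s \o lneg) x = ~~ tr s x)) /mono.
rewrite (map_comp negb (tr s)) !all_map orbC; congr (_ || _); apply: eq_all => x //=.
by rewrite negbK.
Qed.

Lemma ex_iid_neg j g : ex (iid (lits R n) j) (fun l => g (map lneg l)) = ex (iid (lits R n) j) g.
Proof.
elim: j g => [|j IH] g; first by rewrite !ex_iid0.
rewrite !ex_iidS -[RHS]ex_lits_neg; apply: eq_ex => l /=.
by rewrite -[RHS]IH.
Qed.

(** Negating all literals preserves both the factor and the law of the other literals, so the two
    signs of the new literal contribute equally. *)
Lemma ex_one_new (Phi : ((nat -> bool) -> R) -> R) W :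
  ex (lx R n) (fun x => ex (iid (lits R n) k.-1) (fun l => Phi (wmul W (Lcl R k (x :: l))))) =
  Tr (iid (lits R n) k.-1) (L1 R k n) Phi W.
Proof.
rewrite ex_map ex_coin; apply: (canLR (mulfK _)) => //.
rewrite mulrDr mulr1 /Tr /L1; congr (_ + _).
rewrite -ex_iid_neg; apply: eq_ex => l; congr Phi; congr wmul.
by rewrite -[RHS]Lcl_neg.
Qed.

Lemma Tr_split (Phi : ((nat -> bool) -> R) -> R) W :
  Tr (iid (lits R n.+1) k) (@Lcl R k) Phi W =
  p0 * Tr (iid (lits R n) k) (@Lcl R k) Phi W +
  p1 * Tr (iid (lits R n) k.-1) (L1 R k n) Phi W +
  X2 n k (fun l => Phi (wmul W (Lcl R k l))).
Proof.
rewrite /Tr ex_split X1_sym; last by move=> l l' /Lcl_perm ->.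
by rewrite ex_one_new.
Qed.

Lemma X1Z j c g : X1 n j (fun l => c * g l) = c * X1 n j g :> R.
Proof.
elim: j g => [|j IH] g /=; first by rewrite mulr0.
rewrite (eq_ex (lits R n) (fun a => IH (fun l => g (a :: l)))) exZ.
rewrite (eq_ex (lx R n) (fun x => congr1 (fun y => (1 - ee R n) ^+ j * y) (exZ (iid (lits R n) j) c (fun l => g (x :: l))))).
rewrite (@eq_ex _ _ (lx R n) _ (fun x => c * ((1 - ee R n) ^+ j * ex (iid (lits R n) j) (fun l => g (x :: l))))).
  by rewrite exZ; ring.
by move=> x; rewrite mulrCA.
Qed.

Lemma X2Z j c g : X2 n j (fun l => c * g l) = c * X2 n j g :> R.
Proof.
elim: j g => [|j IH] g /=; first by rewrite mulr0.
rewrite (eq_ex (lits R n) (fun a => IH (fun l => g (a :: l)))) exZ.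
rewrite (@eq_ex _ _ (lx R n) _ (fun x => c * (X1 n j (fun l => g (x :: l)) + X2 n j (fun l => g (x :: l))))).
  by rewrite exZ; ring.
by move=> x; rewrite IH X1Z -mulrDr.
Qed.

Let chS := channel_cl R k3 (ltn0Sn n).
Let chn := channel_cl R k3 n0.
Let ch1 := channel_L1 R k3 n0.

Lemma p2_ge0 : 0 <= p2.
Proof.
have := @Tr_split (fun=> 1) (fun=> 1).
rewrite (Tr_cst chS) (Tr_cst chn) (Tr_cst ch1) !mulr1 => h.
have : X2 n k (fun=> 0 * 1) <= X2 n k (fun l : seq lit => 1 : R).
  by apply: X2_le => // l; rewrite mul0r.
rewrite X2Z mul0r /p2; lra.
Qed.

Lemma X2_A W : X2 n k (fun l => A' (wmul W (Lcl R k l))) = p2 * A' W.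
Proof.
have := @Tr_split A' W; rewrite (Tr_A _ chS) (Tr_A _ chn) (Tr_A _ ch1) /p2; lra.
Qed.

(** Clauses meeting the new variable at least twice have probability [O(n^-2)]; their mass is moved
    to the clauses meeting it once. *)
Definition mixcl := mixp p0 (iid (lits R n) k) (iid (lits R n) k.-1).
Definition mixLcl := mixL (@Lcl R k) (L1 R k n).

Lemma p0_01 : 0 <= p0 <= 1.
Proof.
have a := ltW (ee_gt0 R n); have b := ee_le1 R n.
by rewrite /p0 exprn_ge0 ?subr_ge0 //= exprn_ile1 ?subr_ge0 // gerBl.
Qed.

Lemma channel_mixcl : channel mixcl mixLcl.
Proof. exact: channel_mix p0_01 chn ch1. Qed.

(** A clause with a repeated new variable adds at most [ln q^-1 A] to the entropy, while the clause
    put in its place does not lower it on average. *)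
Lemma Tr_Ent_split W : nn W ->
  Tr (iid (lits R n.+1) k) (@Lcl R k) (Ent mu') W <=
  Tr mixcl mixLcl (Ent mu') W + p2 * ln (qk R k)^-1 * A' W.
Proof.
move=> w; rewrite Tr_split Tr_mix.
have h : X2 n k (fun l => Ent mu' (wmul W (Lcl R k l))) <=
    p2 * (Ent mu' W + ln (qk R k)^-1 * A' W).
  apply: le_trans (_ : X2 n k (fun l => (ln (A' W) + ln (qk R k)^-1) * A' (wmul W (Lcl R k l))) <= _).
    apply: X2_le => // l; rewrite mulrDl [ln (A' W) * _]mulrC.
    apply: Ent_wmul_le => //; first exact: qkV_ge1.
    by move=> s; rewrite Lcl_ge0 ?Lcl_le.
  by rewrite X2Z X2_A /Ent LambdaE le_eqVlt; apply/orP; left; apply/eqP; ring.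
have h1 := Tr_Ent_ge muP' ch1 w.
have := ler_wpM2l p2_ge0 h1; rewrite /p2 in h *; lra.
Qed.

Lemma bern j : 1 - j%:R * e <= (1 - e) ^+ j.
Proof.
have a := ltW (ee_gt0 R n); have b := ee_le1 R n; rewrite -/e in a b.
elim: j => [|j IH]; first by rewrite mul0r subr0 expr0.
rewrite exprS; have e1 : 0 <= 1 - e by lra.
have := ler_wpM2l e1 IH; rewrite -natr1.
have : 0 <= j%:R * e ^+ 2 by rewrite mulr_ge0 ?sqr_ge0.
rewrite expr2; nra.
Qed.

Lemma p1_ge : k%:R * e - k%:R ^+ 2 * e ^+ 2 <= p1.
Proof.
have a := ltW (ee_gt0 R n); rewrite -/e in a.
have h : 1 - k%:R * e <= (1 - e) ^+ k.-1.
  apply: le_trans (bern k.-1); rewrite lerB // ler_wpM2r // ler_nat leq_pred //.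
have ke : 0 <= k%:R * e by rewrite mulr_ge0.
by have := ler_wpM2l ke h; rewrite /p1; nra.
Qed.

Lemma p2_le : p2 <= k%:R ^+ 2 * e ^+ 2.
Proof. have := p1_ge; have := bern k; rewrite /p2 /p0; lra. Qed.

Lemma p0_le : p0 <= 1 - k%:R * e + k%:R ^+ 2 * e ^+ 2.
Proof. have := p1_ge; have := p2_ge0; rewrite /p2; lra. Qed.

Lemma p0_ge : 1 - p0 <= k%:R * e.
Proof. have := bern k; rewrite /p0; lra. Qed.

End SplitClauseChannel.

(** * Superposition and monotonicity of Poisson expectations *)

Section Rates.
Variable R : realType.

Lemma thin_cst (p0 p1 c : R) m : p0 + p1 = 1 -> thin p0 p1 (fun _ _ => c) m = c.
Proof.
move=> p01; rewrite /thin -mulr_suml big_mkord.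
transitivity ((p0 + p1) ^+ m * c); last by rewrite p01 expr1n mul1r.
by rewrite exprDn; congr (_ * _); apply: eq_bigr => i _; rewrite mulr_natl.
Qed.

Lemma thin_add (p0 p1 : R) b m : 0 <= p0 -> 0 <= p1 -> p0 + p1 = 1 ->
  thin p0 p1 (fun j i => b (j + i)%N) m = b m.
Proof.
move=> p00 p10 p01; rewrite -[RHS](thin_cst (b m) m p01) /thin.
by apply: eq_big_nat => i /andP[_ im]; rewrite subnK.
Qed.

Variables (a : nat -> R) (C K : R).
Hypotheses (C0 : 0 <= C) (K1 : 1 <= K) (a0 : forall i, 0 <= a i) (aK : forall i, a i <= C * K ^+ i).
Let K0' : 0 <= K. Proof. exact: le_trans K1. Qed.

Lemma dom_aK : dom a.
Proof. by exists C, K; split=> // i; rewrite ger0_norm. Qed.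

Lemma pe_add lam p : 0 <= lam -> 0 <= p <= 1 ->
  pe lam a = pe (lam * p) (fun j => pe (lam * (1 - p)) (fun i => a (j + i)%N)).
Proof.
move=> l0 /andP[p0 p1].
have p1' : 0 <= 1 - p by rewrite subr_ge0.
have p01 : p + (1 - p) = 1 by rewrite addrC subrK.
rewrite -(pe_thin l0 p0 p1' p01 C0 K0') //.
by congr pe; apply/funext => m; rewrite thin_add.
Qed.

(** Split the larger Poisson variable into the smaller one and an independent rest, which can only
    increase a nondecreasing [a]. *)
Lemma pe_rate lam d : (forall i, a i <= a i.+1) -> 0 <= lam -> 0 < d -> lam <= d ->
  pe lam a <= pe d a.
Proof.
move=> nd l0 d0 ld; have d0' := ltW d0.
have nd' i j : (i <= j)%N -> a i <= a j.
  by move/subnK <-; elim: (j - i)%N => // m IH; rewrite addSn; apply: le_trans IH (nd _).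
have -> : lam = d * (lam / d) by rewrite mulrC divfK // gt_eqF.
set p := lam / d.
have p0 : 0 <= p by rewrite divr_ge0.
have p1 : p <= 1 by rewrite ler_pdivrMr // mul1r.
rewrite (pe_add d0' (_ : 0 <= p <= 1)) ?p0 //.
have q0 : 0 <= d * (1 - p) by rewrite mulr_ge0 // subr_ge0.
have dj j : dom (fun i => a (j + i)%N).
  by apply: (@dom_row _ (fun j i => a (j + i)%N) C K).
apply: pe_le; [exact: mulr_ge0|exact: dom_aK| |].
  by apply: (@dom_pe_row _ d (1 - p) (fun j i => a (j + i)%N) C K) => //; rewrite subr_ge0.
move=> j; rewrite -[leLHS](pe_cst _ q0); apply: pe_le => //; first exact: dom_cst.
by move=> i; apply: nd'; rewrite leq_addr.
Qed.

End Rates.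

(** * Functionals of bounded growth *)

Section Slow.
Variables (R : realType) (S : Type) (mu : fd R S).
Hypothesis muP : isprob mu.
Implicit Types Phi : (S -> R) -> R.

(** The bound 2 covers both pins, whose factors reach 2, and clauses. Unlike a formula for [Ent],
    this property is inherited by [Tr], which gives the a priori bounds on all iterated
    entropies. *)
Definition slow Phi := forall (I : Type) (p : fd R I) (L : I -> S -> R), channel p L ->
  (forall i s, L i s <= 2) -> forall W, nn W ->
  Phi W <= Tr p L Phi W /\ Tr p L Phi W <= Phi W + ln 2 * A mu W.

Lemma slow_Ent : slow (Ent mu).
Proof.
move=> I p L ch L2 W w; split; first exact: Tr_Ent_ge.
by rewrite (Tr_Ent _ ch) lerD2l; apply: (Inc_le muP ch) => //; rewrite ler1n.
Qed.

Lemma slow_Tr J (p' : fd R J) (L' : J -> S -> R) Phi : channel p' L' -> slow Phi -> slow (Tr p' L' Phi).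
Proof.
move=> ch' h I p L ch L2 W w; rewrite Tr_comm; split.
  by apply: (Tr_le ch') => // V v; case: (h I p L ch L2 V v).
apply: le_trans (_ : Tr p' L' (fun V => Phi V + ln 2 * A mu V) W <= _).
  by apply: (Tr_le ch') => // V v; case: (h I p L ch L2 V v).
by rewrite TrD TrZ (Tr_A _ ch').
Qed.

Lemma slow_iter J (p' : fd R J) (L' : J -> S -> R) m Phi : channel p' L' -> slow Phi ->
  slow (iter m (Tr p' L') Phi).
Proof. by move=> ch h; elim: m => //= m IH; exact: slow_Tr. Qed.

Lemma iter_slow I (p : fd R I) (L : I -> S -> R) m Phi W : channel p L ->
  (forall i s, L i s <= 2) -> slow Phi -> nn W ->
  Phi W <= iter m (Tr p L) Phi W <= Phi W + m%:R * (ln 2 * A mu W).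
Proof.
move=> ch L2 h w; elim: m => [|m /andP[a b]] /=; first by rewrite mul0r addr0 lexx.
have [c d] := slow_iter m ch h ch L2 w.
rewrite (le_trans a c) /= -natr1 mulrDl mul1r addrA.
by apply: le_trans d _; rewrite lerD2r.
Qed.

End Slow.

(** * Entropy increment from [n] to [n + 1] variables *)

Section Telescope.
Variables (R : realType) (k : nat).
Hypothesis k3 : (3 <= k)%N.

Definition Dt n t lam : R :=
  pe lam (fun m => EE n (iid (lits R n) k) (@Lcl R k) m (t ^ 4)%N (Ent (spins R n))).

Lemma Lcl2 l s : Lcl R k l s <= 2.
Proof. apply: le_trans (Lcl_le R k3 l s) _; have := qkV_le R k3; lra. Qed.

Lemma ln2_gt0 : 0 < ln 2 :> R. Proof. by rewrite ln_gt0 // ltr1n. Qed.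

Section Step.
Variables (n t : nat).
Hypotheses (n0 : (0 < n)%N) (t0 : (0 < t)%N).
Let T := (t ^ 4)%N.
Let T0 : (0 < T)%N. Proof. by rewrite expn_gt0 t0. Qed.
Let mu := spins R n.
Let mu' := spins R n.+1.
Let muP : isprob mu. Proof. exact: isprob_spins. Qed.
Let muP' : isprob mu'. Proof. exact: isprob_spins. Qed.
Let chS := channel_cl R k3 (ltn0Sn n).
Let chn := channel_cl R k3 n0.
Let ch1 := channel_L1 R k3 n0.
Let chp := channel_pin R n0.
Let chpS := channel_pin R (ltn0Sn n).
Let chm := channel_mixcl R k3 n0.
Let e := ee R n.
Let p0 := (1 - e) ^+ k.
Let p2 := 1 - p0 - k%:R * e * (1 - e) ^+ k.-1.
Notation Tcl := (Tr (iid (lits R n) k) (@Lcl R k)).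
Notation TclS := (Tr (iid (lits R n.+1) k) (@Lcl R k)).
Notation T1 := (Tr (iid (lits R n) k.-1) (L1 R k n)).
Notation Th := (Tr (mixcl R k n) (@mixLcl R k n)).
Notation Tpin := (Tr (lits R n) (@Lpin R)).
Notation TpinS := (Tr (lits R n.+1) (@Lpin R)).
Notation E j Phi := (EE n (iid (lits R n) k) (@Lcl R k) j T Phi).
Let one : (nat -> bool) -> R := fun=> 1.
Let one0 : nn one. Proof. by move=> s; exact: ler01. Qed.

(** Pinned entropy with [j] clauses on old variables and [i] clauses through the new one. *)
Definition aa j i := E j (iter i T1 (Ent mu')).

Lemma pin_step W : nn W -> TpinS (Ent mu') W <= Tpin (Ent mu') W + e * ln 2 * A mu' W.
Proof.
move=> w; rewrite /Tr ex_lits_ee -/(Tr _ _ _ _) -/e.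
have chx : channel (lx R n) (@Lpin R).
  split; [exact: isprob_lx|by case: chp|move=> s].
  by rewrite ex_map ex_coin /Lpin /tr /=; case: (s n); rewrite /= ?mulr0 ?mulr1 ?addr0 ?add0r divff.
have [_ h2] := slow_Ent muP' chx (@Lpin_le R) w.
have [h3 _] := slow_Ent muP' chp (@Lpin_le R) w.
have a := ltW (ee_gt0 R n); have b := ee_le1 R n; rewrite -/e in a b.
have := ler_wpM2l a h2; have := ler_wpM2l a h3; rewrite /Tr; lra.
Qed.

Lemma theta_step th m : iter m TclS (iter th TpinS (Ent mu')) one <=
  iter m Th (iter th Tpin (Ent mu')) one + (m%:R * (p2 * ln (qk R k)^-1) + th%:R * (e * ln 2)).
Proof.
apply: le_trans (_ : iter m TclS (fun W => iter th Tpin (Ent mu') W + th%:R * (e * ln 2 * A mu' W)) one <= _).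
  apply: (iterTr_le chS) => // V v; apply: iter_mix => //; exact: pin_step.
rewrite (_ : (fun W => _) = fun W => iter th Tpin (Ent mu') W + th%:R * (e * ln 2) * A mu' W); last first.
  by apply/funext => W; rewrite mulrA.
rewrite iterTrD iterTrZ (iterTr_A _ chS) A1 // mulr1 addrA lerD2r.
apply: le_trans (_ : iter m Th (iter th Tpin (Ent mu')) one + m%:R * (p2 * ln (qk R k)^-1 * A mu' one) <= _);
  last by rewrite A1 // mulr1.
apply: iter_mix => // V v; rewrite !Tr_iter_comm.
apply: le_trans (_ : iter th Tpin (fun W => Th (Ent mu') W + p2 * ln (qk R k)^-1 * A mu' W) V <= _).
  by apply: (iterTr_le chp) => // U u; exact: Tr_Ent_split.
by rewrite iterTrD iterTrZ (iterTr_A _ chp).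
Qed.

(** Old and new clauses commute, so only their numbers matter and these are binomial. *)
Lemma EE_thin m : T%:R^-1 * \sum_(0 <= th < T) iter m Th (iter th Tpin (Ent mu')) one =
  thin p0 (1 - p0) aa m.
Proof.
pose h m j i := T%:R^-1 * \sum_(0 <= th < T) iter m Th (iter j Tcl (iter i T1 (iter th Tpin (Ent mu')))) one.
rewrite -[LHS]/(h m 0%N 0%N) (thin_rec (p0 := p0) (p1 := 1 - p0) (h := h)).
  congr (thin _ _ _ m); apply/funext => j; apply/funext => i; rewrite /h /aa /EE.
  congr (_ * _); apply: eq_bigr => th _ /=.
  by rewrite (iter_iter_comm _ (@Lpin R)).
move=> m' j i; rewrite /h mulrCA [(1 - p0) * _]mulrCA -mulrDr; congr (_ * _).
rewrite !mulr_sumr -big_split; apply: eq_bigr => th _.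
rewrite iterSr Tr_mix iterTrD !iterTrZ /= -/p0; congr (_ * _ + _ * _).
by congr (iter _ _ _ _); rewrite Tr_iter_comm.
Qed.

Lemma iterated_bounds i j th : 0 <= iter j Tcl (iter th Tpin (iter i T1 (Ent mu'))) one <=
  (j + th + i)%:R * ln 2.
Proof.
have L12 l s : L1 R k n l s <= 2 by exact: Lcl2.
have E1 : Ent mu' one = 0 by rewrite /Ent A1 // LambdaE ln1 mulr0.
have s1 := slow_iter i ch1 (slow_Ent muP').
have s2 := slow_iter th chp s1.
have := iter_slow j chn Lcl2 s2 one0.
have := iter_slow th chp (@Lpin_le R) s1 one0.
have := iter_slow i ch1 L12 (slow_Ent muP') one0.
rewrite E1 !A1 // !mulr1 !natrD !mulrDl => /andP[a b] /andP[c d] /andP[f g].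
apply/andP; split; lra.
Qed.

Lemma aa_bounds j i : 0 <= aa j i <= T.+1%:R * ln 2 * 2 ^+ (j + i).
Proof.
have Ti : 0 < T%:R :> R by rewrite ltr0n.
rewrite /aa /EE mulr_ge0 ?invr_ge0 ?(ltW Ti) //=; last first.
  by rewrite sumr_ge0 // => th _; case/andP: (iterated_bounds i j th).
rewrite ler_pdivrMl //.
apply: le_trans (_ : \sum_(0 <= th < T) T.+1%:R * ln 2 * 2 ^+ (j + i) <= _); last first.
  by rewrite sumr_const_nat subn0 [leRHS]mulr_natl.
rewrite [leLHS]big_nat_cond [leRHS]big_nat_cond; apply: ler_sum => th /andP[/andP[_ thT] _].
have /andP[_ h] := iterated_bounds i j th; apply: le_trans h _.
rewrite mulrAC ler_pM2r ?ln2_gt0 // -natrX -natrM ler_nat.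
apply: leq_trans (_ : T.+1 * (j + i).+1 <= _)%N; first by nia.
by rewrite leq_mul2l /=; apply: ltn_expl.
Qed.

Lemma aa_nd j i : aa j i <= aa j i.+1.
Proof.
rewrite /aa; apply: (EE_le n0 chn) => W w /=.
by case: (slow_iter i ch1 (slow_Ent muP') ch1 (fun l s => Lcl2 _ s) w).
Qed.

Lemma aa0 j : aa j 0%N = E j (Ent mu).
Proof.
apply/eqP; rewrite eq_le; apply/andP; split; apply: E_le_local => // V v lv /=;
  by rewrite /Ent A_localS.
Qed.

Definition cc (d : R) := d * (k.-1)%:R / k%:R.
Definition C1 (d : R) : R := 3 * expR (d * (K0 R k - 1)) + cc d * (3 * ((qk R k)^-1) ^+ 3 * 2 ^+ k).
Definition IncE j : R := E j (Inc mu (iid (lits R n) k) (@Lcl R k)).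

Lemma E_Ent_addn j i : E j (Ent mu) + i%:R * IncE j <= E (j + i)%N (Ent mu).
Proof.
rewrite -EEZ -EED /EE; apply: ler_wpM2l; first by rewrite invr_ge0.
apply: ler_sum => th _; rewrite iterD.
apply: (iterTr_le chn) => // V v; rewrite iter_iter_comm.
by apply: (iterTr_le chp) => // U u; exact: iter_Ent_ge.
Qed.

Lemma IncE_bounds j : 0 <= IncE j <= ln 2.
Proof.
apply/andP; split.
  rewrite -(_ : E j (fun W => 0 * A mu W) = 0); last by rewrite EEZ mul0r.
  by apply: (EE_le n0 chn) => W w; rewrite mul0r; exact: (Inc_ge0 muP chn).
apply: le_trans (_ : E j (fun W => ln 2 * A mu W) <= _); last by rewrite EEZ EE_A // mulr1.
by apply: (EE_le n0 chn) => W w; apply: (Inc_le muP chn) => //; [by rewrite ler1n|exact: Lcl2].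
Qed.

Lemma dom_EEnt : dom (fun j => E j (Ent mu)).
Proof.
exists (T.+1%:R * ln 2), 2; split=> // [|j]; first by rewrite mulr_ge0 // ltW // ln2_gt0.
by rewrite -aa0; have /andP[a b] := aa_bounds j 0; rewrite ger0_norm // -[j in 2 ^+ j]addn0.
Qed.

Lemma inner_step d j : 0 < d -> (d%:E < dcond R k)%E ->
  pe d (aa j) <= E j (Ent mu) + cc d * IncE j + C1 d / t%:R.
Proof.
move=> d0 dc; have d0' := ltW d0.
have da : dom (aa j).
  apply: (@dom_row _ aa (T.+1%:R * ln 2) 2) => // [|j' i|j' i]; first by rewrite mulr_ge0 // ltW // ln2_gt0.
    by case/andP: (aa_bounds j' i).
  by case/andP: (aa_bounds j' i).
have dc' : dom (fun=> - E j (Ent mu)) by exact: dom_cst.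
rewrite -[leRHS]addrA -lerBlDl.
have -> : pe d (aa j) - E j (Ent mu) = pe d (fun i => aa j i + - E j (Ent mu)).
  by rewrite peD // pe_cst.
apply: pe_le_bound => // [|N]; first exact: domD.
exact: cavity_step.
Qed.

Lemma EES_le m : EE n.+1 (iid (lits R n.+1) k) (@Lcl R k) m T (Ent mu') <=
  thin p0 (1 - p0) aa m + (p2 * ln (qk R k)^-1 * m%:R + T%:R * (e * ln 2)).
Proof.
have Ti : 0 < T%:R :> R by rewrite ltr0n.
have e0 := ltW (ee_gt0 R n); have l2 := ltW ln2_gt0.
rewrite -EE_thin /EE -[X in _ <= _ + X](mulKf (lt0r_neq0 Ti)) -mulrDr.
apply: ler_wpM2l; first by rewrite invr_ge0 ltW.
apply: le_trans (_ : \sum_(0 <= th < T) (iter m Th (iter th Tpin (Ent mu')) one +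
    (m%:R * (p2 * ln (qk R k)^-1) + T%:R * (e * ln 2))) <= _).
  rewrite [leLHS]big_nat_cond [leRHS]big_nat_cond; apply: ler_sum => th /andP[/andP[_ thT] _].
  apply: le_trans (theta_step th m) _; rewrite lerD2l lerD2l.
  by apply: ler_wpM2r; [rewrite mulr_ge0|rewrite ler_nat ltnW].
by rewrite big_split /= sumr_const_nat subn0 -[_ *+ T]mulr_natl [m%:R * _]mulrC.
Qed.

Section StepFinal.
Variable d : R.
Hypotheses (d0 : 0 < d) (dc : (d%:E < dcond R k)%E).
Let d0' : 0 <= d. Proof. exact: ltW. Qed.
Let kp : 0 < k%:R :> R. Proof. by rewrite ltr0n; case: k k3. Qed.
Let l1 := d * n.+1%:R / k%:R.
Let l0 := d * n%:R / k%:R.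
Let l10 : 0 <= l1. Proof. by rewrite /l1 !mulr_ge0 ?invr_ge0 ?(ltW kp). Qed.
Let l00 : 0 <= l0. Proof. by rewrite /l0 !mulr_ge0 ?invr_ge0 ?(ltW kp). Qed.
Let p00 : 0 <= p0. Proof. by case/andP: (p0_01 R k n). Qed.
Let p10 : 0 <= 1 - p0. Proof. by rewrite subr_ge0; case/andP: (p0_01 R k n). Qed.
Let p011 : p0 + (1 - p0) = 1. Proof. by rewrite addrC subrK. Qed.
Let C0 : 0 <= T.+1%:R * ln 2 :> R. Proof. by rewrite mulr_ge0 // ltW // ln2_gt0. Qed.
Let two0 : 0 <= 2 :> R. Proof. by []. Qed.
Let a0 j i : 0 <= aa j i. Proof. by case/andP: (aa_bounds j i). Qed.
Let aK j i : aa j i <= T.+1%:R * ln 2 * 2 ^+ (j + i). Proof. by case/andP: (aa_bounds j i). Qed.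
Let e1 : n.+1%:R * e = 1. Proof. by rewrite /e /ee divff // pnatr_eq0. Qed.

Lemma Dt_upper : Dt n.+1 t l1 <= pe (l1 * p0) (fun j => pe (l1 * (1 - p0)) (aa j)) +
    (p2 * ln (qk R k)^-1 * l1 + T%:R * (e * ln 2)).
Proof.
have dT : dom (thin p0 (1 - p0) aa) := dom_thin p00 p10 p011 C0 two0 a0 aK.
have dm : dom (fun m : nat => p2 * ln (qk R k)^-1 * m%:R) by apply: domZ; exact: dom_id.
rewrite -(pe_thin l10 p00 p10 p011 C0 two0 a0 aK).
have -> : p2 * ln (qk R k)^-1 * l1 = pe l1 (fun m : nat => p2 * ln (qk R k)^-1 * m%:R).
  by rewrite peZ ?pe_id //; exact: dom_id.
rewrite -[T%:R * (e * ln 2)](pe_cst _ l10) -!peD //; try exact: dom_cst; last first.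
  by apply: domD => //; exact: dom_cst.
apply: pe_le => //; last exact: EES_le.
  apply: dom_le (_ : dom (fun m => thin p0 (1 - p0) aa m + (p2 * ln (qk R k)^-1 * m%:R + T%:R * (e * ln 2)))) _.
    by apply: domD => //; apply: domD => //; exact: dom_cst.
  move=> m; rewrite ger0_norm; first exact: EES_le.
  rewrite mulr_ge0 ?invr_ge0 // sumr_ge0 // => th _.
  have s2 := slow_iter th chpS (slow_Ent muP').
  have /andP[h _] := iter_slow m chS Lcl2 s2 one0; apply: le_trans h.
  have /andP[h _] := iter_slow th chpS (@Lpin_le R) (slow_Ent muP') one0; apply: le_trans h.
  by rewrite /Ent A1 // LambdaE ln1 mulr0.
by apply: domD => //; apply: domD => //; exact: dom_cst.
Qed.

Let dl := l0 - l1 * p0.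

(** The larger system has [d / k] more clauses, but about [d] of its clauses go through the new
    variable. So [d (k - 1) / k] old clauses are missing, which is the coefficient of the clause
    term of the Bethe functional. *)
Lemma dl_ge : cc d - d * k%:R * e <= dl /\ 0 <= dl.
Proof.
have a := ee_gt0 R n; have b := ee_le1 R n; rewrite -/e in a b.
have P0le : p0 <= 1 - k%:R * e + k%:R ^+ 2 * e ^+ 2 := p0_le R k3 n0.
have nn1 : n%:R = n.+1%:R - 1 :> R by rewrite -natr1 addrK.
have dk : 0 <= d / k%:R by rewrite divr_ge0 // ltW.
have kk : (k.-1)%:R = k%:R - 1 :> R by case: k k3 => // m _; rewrite -natr1 addrK.
have kn : k%:R != 0 :> R by rewrite gt_eqF.
have h0 : 0 <= dl.
  have P : p0 <= 1 - e.
    rewrite /p0; case: k k3 => // m _; rewrite exprS -[leRHS]mulr1.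
    by apply: ler_wpM2l; [lra|apply: exprn_ile1; lra].
  have : n.+1%:R * p0 <= n%:R.
    have := ler_wpM2l (ler0n R n.+1) P; rewrite mulrBr mulr1 e1 nn1; exact.
  move=> /(ler_wpM2l dk) h; rewrite /dl /l0 /l1 subr_ge0.
  by apply: le_trans (le_trans h _); rewrite le_eqVlt; apply/orP; left; apply/eqP; field.
split=> //.
have : n.+1%:R * p0 <= n.+1%:R - k%:R + k%:R ^+ 2 * e.
  have := ler_wpM2l (ler0n R n.+1) P0le.
  have -> : n.+1%:R * (1 - k%:R * e + k%:R ^+ 2 * e ^+ 2) =
    n.+1%:R - k%:R * (n.+1%:R * e) + k%:R ^+ 2 * (n.+1%:R * e) * e by ring.
  by rewrite e1 !mulr1.
move=> /(ler_wpM2l dk) h; rewrite /dl /l0 /l1 /cc kk nn1.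
have -> : d * (n.+1%:R - 1) / k%:R - d * n.+1%:R / k%:R * p0 =
  d * (n.+1%:R - 1) / k%:R - d / k%:R * (n.+1%:R * p0) by field.
have -> : d * (k%:R - 1) / k%:R - d * k%:R * e =
  d * (n.+1%:R - 1) / k%:R - d / k%:R * (n.+1%:R - k%:R + k%:R ^+ 2 * e) by field.
by rewrite lerD2l lerN2.
Qed.

(** A Poisson number of rate [l0] is a superposition of rates [l1 p0] and [dl], and by convexity
    each of the extra clauses gains at least [IncE j]. *)
Lemma Dt_lower : pe (l1 * p0) (fun j => E j (Ent mu) + dl * IncE j) <= Dt n t l0.
Proof.
have [_ dl0] := dl_ge.
have lp0 : 0 <= l1 * p0 by rewrite mulr_ge0.
have b0 j : 0 <= E j (Ent mu) by rewrite -aa0.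
have bK j : E j (Ent mu) <= T.+1%:R * ln 2 * 2 ^+ j by rewrite -aa0; have := aK j 0; rewrite addn0.
have dI : dom (fun j => dl * IncE j).
  apply: domZ; apply: dom_le (dom_cst (ln 2)) _ => j.
  by have /andP[x y] := IncE_bounds j; rewrite ger0_norm.
have two1 : 1 <= 2 :> R by rewrite ler1n.
have [l0z|l0n] := eqVneq l0 0.
  have dz : dl = 0 by apply/eqP; rewrite eq_le dl0 andbT /dl l0z sub0r oppr_le0.
  have lz : l1 * p0 = 0 by have := dz; rewrite /dl l0z sub0r => /eqP; rewrite oppr_eq0 => /eqP.
  rewrite /Dt lz l0z dz; under eq_fun do rewrite mul0r addr0; exact: lexx.
have l0p : 0 < l0 by rewrite lt_def l0n.
set p := l1 * p0 / l0.
have lp : l0 * p = l1 * p0 by rewrite /p mulrC divfK.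
have ldl : l0 * (1 - p) = dl by rewrite mulrBr mulr1 lp.
have p01 : 0 <= p <= 1.
  by rewrite divr_ge0 //= ler_pdivrMr // mul1r -subr_ge0.
rewrite /Dt (pe_add C0 two1 b0 bK l00 p01) lp ldl.
have dj j : dom (fun i => E (j + i)%N (Ent mu)).
  by apply: (@dom_row _ (fun j i => E (j + i)%N (Ent mu)) (T.+1%:R * ln 2) 2).
apply: pe_le => //; first by apply: domD => //; exact: dom_EEnt.
  rewrite -ldl; apply: (@dom_pe_row _ l0 (1 - p) (fun j i => E (j + i)%N (Ent mu)) (T.+1%:R * ln 2) 2) => //.
  by rewrite subr_ge0; case/andP: p01.
move=> j; have -> : E j (Ent mu) + dl * IncE j = pe dl (fun i => E j (Ent mu) + IncE j * i%:R).
  rewrite peD //; [|exact: dom_cst|by apply: domZ; exact: dom_id].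
  by rewrite pe_cst // peZ ?pe_id //; [ring|exact: dom_id].
apply: pe_le => //; first by apply: domD; [exact: dom_cst|apply: domZ; exact: dom_id].
by move=> i; rewrite mulrC; exact: E_Ent_addn.
Qed.

(** The new variable gains at most [cc d] times [IncE] below condensation, and restoring the missing
    clauses gains at least [dl] times [IncE]. These agree up to [O(1 / n)], leaving the
    decorrelation error [1 / t]. *)
Lemma Dt_step : Dt n.+1 t l1 <= Dt n t l0 + C1 d / t%:R +
    ln 2 * (T%:R + 2 * d * k%:R) * e.
Proof.
have a := ee_gt0 R n; have b := ee_le1 R n; rewrite -/e in a b.
have P2le : p2 <= k%:R ^+ 2 * e ^+ 2 := p2_le R k n.
have P2ge : 0 <= p2 := p2_ge0 R k3 n0.
have l2 := ltW ln2_gt0.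
have [h1 h0] := dl_ge.
have lp0 : 0 <= l1 * p0 by rewrite mulr_ge0.
have lnB : ln (qk R k)^-1 <= ln 2.
  rewrite ler_ln ?posrE ?invr_gt0 ?qk_gt0 //; have := qkV_le R k3; lra.
have lnB0 : 0 <= ln (qk R k)^-1 by rewrite ln_ge0 ?qkV_ge1.
have dI : dom IncE.
  apply: dom_le (dom_cst (ln 2)) _ => j.
  by have /andP[x y] := IncE_bounds j; rewrite ger0_norm.
have kn : k%:R != 0 :> R by rewrite gt_eqF.
apply: le_trans Dt_upper _.
have l1p : l1 * (1 - p0) <= d.
  have : 1 - p0 <= k%:R * e := p0_ge R k n.
  move=> /(ler_wpM2l l10) h; apply: le_trans h _.
  have -> : l1 * (k%:R * e) = d * (n.+1%:R * e) by rewrite /l1; field.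
  by rewrite e1 mulr1.
have dj j : dom (aa j) := dom_row C0 two0 a0 aK j.
have two1 : 1 <= 2 :> R by rewrite ler1n.
have step1 : pe (l1 * p0) (fun j => pe (l1 * (1 - p0)) (aa j)) <=
    pe (l1 * p0) (fun j => (E j (Ent mu) + dl * IncE j) + (d * k%:R * e * ln 2 + C1 d / t%:R)).
  apply: pe_le => //; first exact: (dom_pe_row l10 p10 C0 two0 a0 aK).
    apply: domD (dom_cst _); apply: domD (domZ _ dI); exact: dom_EEnt.
  move=> j; apply: le_trans (_ : pe d (aa j) <= _).
    (* The mean number of clauses at the new variable is at most [d]; it may be raised to [d]
       because [aa j] is nondecreasing. *)
    apply: (@pe_rate _ _ (T.+1%:R * ln 2 * 2 ^+ j) 2) => //.
    - by rewrite mulr_ge0 ?exprn_ge0.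
    - by move=> i; rewrite -mulrA -exprD.
    - exact: aa_nd.
    - by rewrite mulr_ge0.
  apply: le_trans (inner_step j d0 dc) _.
  have /andP[x y] := IncE_bounds j.
  have := ler_wpM2r x h1.
  have : d * k%:R * e * IncE j <= d * k%:R * e * ln 2.
    by apply: ler_wpM2l => //; rewrite !mulr_ge0 // ltW.
  lra.
have step2 : pe (l1 * p0) (fun j => (E j (Ent mu) + dl * IncE j) + (d * k%:R * e * ln 2 + C1 d / t%:R)) <=
   Dt n t l0 + (d * k%:R * e * ln 2 + C1 d / t%:R).
  rewrite peD //; [|by apply: domD (domZ _ dI); exact: dom_EEnt|exact: dom_cst].
  by rewrite pe_cst // lerD2r; exact: Dt_lower.
have e3 : p2 * ln (qk R k)^-1 * l1 <= d * k%:R * e * ln 2.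
  have -> : d * k%:R * e * ln 2 = k%:R ^+ 2 * e ^+ 2 * ln 2 * l1.
    transitivity (d * k%:R * e * ln 2 * (n.+1%:R * e)); first by rewrite e1 mulr1.
    by rewrite /l1; field.
  apply: ler_wpM2r => //; exact: ler_pM.
apply: le_trans (lerD (le_trans step1 step2) (lerD e3 (lexx _))) _.
by rewrite le_eqVlt; apply/orP; left; apply/eqP; ring.
Qed.

End StepFinal.
End Step.
End Telescope.

(** * The planted relative entropy is sublinear *)

Section FreeEntropyIid.
Variables (R : realType) (k : nat).
Hypothesis k3 : (3 <= k)%N.

Lemma nat_above (x : R) : exists2 n : nat, (0 < n)%N & x <= n%:R.
Proof.
exists (Num.bound x).+1 => //; have h : x <= `|x| := ler_norm x.
have := archi_boundP (normr_ge0 x).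
rewrite -natr1; have -> : Num.bound `|x| = Num.bound x by rewrite /Num.bound normr_id.
lra.
Qed.

Definition Diid n m : R := iter m (Tr (iid (lits R n) k) (@Lcl R k)) (Ent (spins R n)) (fun=> 1).

Lemma Diid_le_EE n t m : (0 < n)%N -> (0 < t)%N ->
  0 <= Diid n m <= EE n (iid (lits R n) k) (@Lcl R k) m (t ^ 4)%N (Ent (spins R n)).
Proof.
move=> n0 t0; have muP := isprob_spins R n.
have chn := channel_cl R k3 n0; have chp := channel_pin R n0.
have T0 : (0 < t ^ 4)%N by rewrite expn_gt0 t0.
have Tp : 0 < (t ^ 4)%:R :> R by rewrite ltr0n.
have o : nn (fun _ : nat -> bool => 1 : R) by move=> s; exact: ler01.
apply/andP; split.
  have /andP[h _] := iter_slow m chn (@Lcl2 R k k3) (slow_Ent muP) o.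
  by apply: le_trans h; rewrite /Ent A1 // LambdaE ln1 mulr0.
rewrite /EE -ler_pdivrMl ?invr_gt0 // invrK.
apply: le_trans (_ : \sum_(0 <= th < t ^ 4) Diid n m <= _).
  by rewrite sumr_const_nat subn0 mulr_natl.
apply: ler_sum => th _; apply: (iterTr_le chn) => // V v.
by case/andP: (iter_slow th chp (@Lpin_le R) (slow_Ent muP) v).
Qed.

(** First [t] is chosen for the decorrelation error, then [n] large against the [t^4] pins. The
    increments are then at most [eps / 2] and are summed; dropping the pins at the end only lowers
    the entropy. *)
Lemma pe_Diid (d eps : R) : 0 < d -> (d%:E < dcond R k)%E -> 0 < eps ->
  exists N, forall n, (N <= n)%N -> pe (d * n%:R / k%:R) (Diid n) <= eps * n%:R.
Proof.
move=> d0 dc e0.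
have kp : 0 < k%:R :> R by rewrite ltr0n; case: k k3.
have [t t0 ht] := nat_above (4 * C1 k d / eps).
have tp : 0 < t%:R :> R by rewrite ltr0n.
have C1t : C1 k d / t%:R <= eps / 4.
  rewrite ler_pdivrMr //; move: ht; rewrite ler_pdivrMr //; lra.
set c2 := ln 2 * ((t ^ 4)%:R + 2 * d * k%:R).
have [n1 n10 hn1] := nat_above (4 * c2 / eps).
have c2n n : (n1 <= n)%N -> c2 * ee R n <= eps / 4.
  move=> nn; have np : 0 < n.+1%:R :> R by rewrite ltr0n.
  rewrite /ee ler_pdivrMr //; move: hn1; rewrite ler_pdivrMr //.
  have : n1%:R <= n.+1%:R :> R by rewrite ler_nat ltnW.
  move=> /(ler_wpM2r (ltW e0)); lra.
pose x n := Dt k n t (d * n%:R / k%:R).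
have step n : (n1 <= n)%N -> x n.+1 <= x n + eps / 2.
  move=> nn; have n0 : (0 < n)%N := leq_trans n10 nn.
  have := Dt_step k3 n0 t0 d0 dc; rewrite -/(x n.+1) -/(x n) -/c2.
  have := c2n n nn; lra.
have xb j : x (n1 + j)%N <= x n1 + j%:R * (eps / 2).
  elim: j => [|j IH]; first by rewrite addn0 mul0r addr0.
  rewrite addnS; apply: le_trans (step _ (leq_addr _ _)) _.
  by rewrite -[j.+1%:R]natr1 mulrDl mul1r addrA lerD2r.
have [n2 _ hn2] := nat_above (2 * x n1 / eps).
exists (n1 + n2)%N => n nn.
have nn1 : (n1 <= n)%N by apply: leq_trans nn; rewrite leq_addr.
have n0 : (0 < n)%N := leq_trans n10 nn1.
apply: le_trans (_ : x n <= _).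
  have l0 : 0 <= d * n%:R / k%:R by rewrite divr_ge0 ?mulr_ge0 ?(ltW d0) ?(ltW kp).
  have dE := dom_EEnt R k3 n0 t0.
  apply: pe_le => //; last by move=> m; case/andP: (Diid_le_EE m n0 t0).
  by apply: dom_le dE _ => m; case/andP: (Diid_le_EE m n0 t0) => a b; rewrite ger0_norm.
have := xb (n - n1)%N; rewrite subnKC // => h; apply: le_trans h _.
have : n%:R = n1%:R + (n - n1)%:R :> R by rewrite -natrD subnKC.
move: hn2; rewrite ler_pdivrMr //.
have : n2%:R <= n%:R :> R by rewrite ler_nat (leq_trans _ nn) // leq_addl.
move=> /(ler_wpM2r (ltW e0)) h2 h3 h4.
have : 0 <= n1%:R * eps by rewrite mulr_ge0 // ltW.
rewrite h4 in h2 *; lra.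
Qed.

(** The increments are nondecreasing in [m], so the entropy is a discrete convex function and lies
    above its tangents. *)
Lemma Diid_tangent n m j : (0 < n)%N ->
  Diid n m + (j%:R - m%:R) * (Diid n m.+1 - Diid n m) <= Diid n j /\ 0 <= Diid n m.+1 - Diid n m.
Proof.
move=> n0; have muP := isprob_spins R n; have chn := channel_cl R k3 n0.
set T := Tr (iid (lits R n) k) (@Lcl R k).
set mu := spins R n in muP.
have o : nn (fun _ : nat -> bool => 1 : R) by move=> s; exact: ler01.
pose I m := iter m T (Inc mu (iid (lits R n) k) (@Lcl R k)) (fun=> 1).
have DS i : Diid n i.+1 = Diid n i + I i.
  rewrite /Diid iterSr -/T -/mu; have -> : T (Ent mu) = fun W => Ent mu W + Inc mu (iid (lits R n) k) (@Lcl R k) W.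
    by apply/funext => V; rewrite /T (Tr_Ent _ chn).
  by rewrite iterTrD.
have Imono i : I i <= I i.+1.
  rewrite /I iterSr; apply: (iterTr_le chn) => // V v; exact: (Tr_Inc_ge muP chn chn).
have Ile i i' : (i <= i')%N -> I i <= I i'.
  by move/subnK <-; elim: (i' - i)%N => // x IH; rewrite addSn; apply: le_trans IH (Imono _).
have DI : Diid n m.+1 - Diid n m = I m by rewrite DS addrAC subrr add0r.
rewrite DI; split; last first.
  rewrite -[leLHS](congr1 (fun f => f (fun=> 1)) (iterTr_cst chn m 0)).
  by apply: (iterTr_le chn) => // V v; exact: (Inc_ge0 muP chn).
have up i : Diid n m + i%:R * I m <= Diid n (m + i)%N.
  elim: i => [|i IH]; first by rewrite mul0r addr0 addn0.
  rewrite addnS DS -[i.+1%:R]natr1 mulrDl mul1r addrA; apply: lerD => //; apply: Ile; exact: leq_addr.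
have dn : forall a, (a <= m)%N -> Diid n m - a%:R * I m <= Diid n (m - a)%N.
  elim=> [_|a IH am]; first by rewrite mul0r subr0 subn0.
  have := IH (ltnW am).
  have -> : (m - a = (m - a.+1).+1)%N by lia.
  rewrite DS -[a.+1%:R]natr1.
  have : I (m - a.+1)%N <= I m by apply: Ile; rewrite leq_subr.
  by move=> h1 h2; rewrite mulrDl mul1r; lra.
have [mj|jm] := leqP m j.
  by have := up (j - m)%N; rewrite subnKC // natrB.
have := dn (m - j)%N (leq_subr _ _); rewrite subKn; last exact: ltnW.
by rewrite natrB; [rewrite -mulNr opprB|exact: ltnW].
Qed.

(** Jensen's inequality: the tangent at [m], averaged over a Poisson number with mean at least [m],
    is at least the value at [m]. *)
Lemma Diid_small (d eps : R) : 0 < d -> (d%:E < dcond R k)%E -> 0 < eps ->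
  exists N, forall n m, (N <= n)%N -> m%:R <= d * n%:R / k%:R -> Diid n m <= eps * n%:R.
Proof.
move=> d0 dc e0; have [N hN] := pe_Diid d0 dc e0.
exists N.+1 => n m nn md; have n0 : (0 < n)%N by apply: leq_ltn_trans nn.
apply: le_trans (hN n (ltnW nn)).
set lam := d * n%:R / k%:R in md *.
have l0 : 0 <= lam by apply: le_trans md.
set I := Diid n m.+1 - Diid n m.
have [_ I0] := Diid_tangent m 0 n0.
have := @pe_le _ lam (fun j => (Diid n m - m%:R * I) + I * j%:R) (Diid n) l0.
rewrite peD //; [|exact: dom_cst|by apply: domZ; exact: dom_id].
rewrite pe_cst // peZ //; last exact: dom_id.
rewrite pe_id // => h.
apply: le_trans (h _ _ _).
- have := ler_wpM2r I0 md; rewrite -/I; lra.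
- by apply: domD; [exact: dom_cst|apply: domZ; exact: dom_id].
- apply: dom_le (dom_EEnt R k3 n0 (ltn0Sn 0)) _ => j.
  by case/andP: (Diid_le_EE j n0 (ltn0Sn 0)) => a b; rewrite ger0_norm.
move=> j; have [h1 _] := Diid_tangent m j n0; apply: le_trans h1; rewrite -/I; lra.
Qed.

End FreeEntropyIid.

(** * Two-replica averages *)

Section Replicas.
Variables (R : realType) (S : Type) (mu : fd R S).
Hypothesis muP : isprob mu.
Implicit Types (W : S -> R) (f : S -> S -> R).

Definition DE W f := ex mu (fun s => W s * ex mu (fun t => W t * f s t)).

Lemma DED W f g : DE W (fun s t => f s t + g s t) = DE W f + DE W g.
Proof.
rewrite /DE -exD; apply: eq_ex => s /=; rewrite -[RHS]mulrDr -exD.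
by congr (_ * ex _ _); apply/funext => t; rewrite mulrDr.
Qed.

Lemma DEZ W c f : DE W (fun s t => c * f s t) = c * DE W f.
Proof.
rewrite /DE -exZ; apply: eq_ex => s; rewrite mulrCA -[in RHS]exZ; congr (_ * _).
by apply: eq_ex => t; rewrite mulrCA.
Qed.

Lemma DEB W f g : DE W (fun s t => f s t - g s t) = DE W f - DE W g.
Proof.
rewrite (_ : (fun s t => _) = fun s t => f s t + (-1) * g s t); last first.
  by apply/funext => s; apply/funext => t; rewrite mulN1r.
by rewrite DED DEZ mulN1r.
Qed.

Lemma DE_prod W (u v : S -> R) : DE W (fun s t => u s * v t) = A mu (wmul W u) * A mu (wmul W v).
Proof.
rewrite /DE /A -exZr; apply: eq_ex => s; rewrite /wmul -mulrA -[in RHS]exZ; congr (_ * _).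
by apply: eq_ex => t; rewrite mulrCA.
Qed.

Lemma DE1 W : DE W (fun _ _ => 1) = A mu W ^+ 2.
Proof.
rewrite (_ : (fun _ _ => 1) = fun s t : S => (fun=> 1) s * (fun=> 1) t); last first.
  by apply/funext => s; apply/funext => t; rewrite mulr1.
by rewrite DE_prod !wmul1r expr2.
Qed.

Lemma DE_le W f g : nn W -> (forall s t, f s t <= g s t) -> DE W f <= DE W g.
Proof.
move=> w fg; apply: ex_le => // s; apply: ler_wpM2l => //.
by apply: ex_le => // t; exact: ler_wpM2l.
Qed.

Lemma DE_ge0 W f : nn W -> (forall s t, 0 <= f s t) -> 0 <= DE W f.
Proof.
by move=> w f0; apply: ex_ge0 => // s; rewrite mulr_ge0 // ex_ge0 // => t; rewrite mulr_ge0.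
Qed.

Lemma quad I (p : fd R I) (F : I -> S -> R) W :
  ex p (fun c => A mu (wmul W (F c)) ^+ 2) = DE W (fun s t => ex p (fun c => F c s * F c t)).
Proof.
transitivity (ex p (fun c => DE W (fun s t => F c s * F c t))).
  by apply: eq_ex => c; rewrite DE_prod expr2.
rewrite /DE ex_exchange; apply: eq_ex => s; rewrite exZ; congr (_ * _).
by rewrite ex_exchange; apply: eq_ex => t; rewrite exZ.
Qed.

(** For a fixed pair of states the factors are independent, which gives the power [m]. *)
Lemma DE_iter I (p : fd R I) (L : I -> S -> R) m W f :
  iter m (Tr p L) (fun V => DE V f) W =
  DE W (fun s t => ex p (fun c => L c s * L c t) ^+ m * f s t).
Proof.
elim: m W => [|m IH] W; first by congr DE; apply/funext => s; apply/funext => t; rewrite mul1r.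
rewrite /= /Tr; transitivity (ex p (fun c => DE W (fun s t => L c s * L c t *
    (ex p (fun c => L c s * L c t) ^+ m * f s t)))).
  apply: eq_ex => c; rewrite IH; apply: eq_ex => s; rewrite /wmul -[LHS]mulrA -[in LHS]exZ; congr (_ * _).
  apply: eq_ex => t; ring.
rewrite /DE ex_exchange; apply: eq_ex => s; rewrite exZ; congr (_ * _).
rewrite ex_exchange; apply: eq_ex => t; rewrite exZ exZr exprS; congr (_ * _); ring.
Qed.

End Replicas.

(** * The overlap and the clause correlation of two replicas *)

Section Overlap.
Variables (R : realType) (n : nat).
Hypothesis n0 : (0 < n)%N.

Definition ov (s t : nat -> bool) : R := ex (vars R n) (fun v => spin R (s v) * spin R (t v)).

Lemma spin_sqr b : spin R b * spin R b = 1.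
Proof. by case: b; rewrite /spin ?mulrNN mulr1. Qed.

Lemma ov_le1 s t : -1 <= ov s t <= 1.
Proof.
have vP := isprob_vars R n0.
apply/andP; split.
  apply: le_trans (_ : ex (vars R n) (fun=> -1) <= _); first by rewrite (ex_cst vP).
  by apply: (ex_le vP) => v; case: (s v) (t v) => [] []; rewrite /spin; lra.
apply: le_trans (_ : _ <= ex (vars R n) (fun=> 1)) _; last by rewrite (ex_cst vP).
by apply: (ex_le vP) => v; case: (s v) (t v) => [] []; rewrite /spin; lra.
Qed.

(** Exhibits a power of the overlap as a positive definite kernel, so that overlap moments are sums
    of squares of posterior means. *)
Lemma ex_chars r s t :
  ex (iid (vars R n) r) (fun l => (\prod_(v <- l) spin R (s v)) * (\prod_(v <- l) spin R (t v))) = ov s t ^+ r.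
Proof. by rewrite /ov -ex_prod; apply: eq_ex => l; rewrite -big_split. Qed.

Variable k : nat.
Hypothesis k3 : (3 <= k)%N.

Definition Kk : R := 2 ^+ k.-1 - 1.
Definition gk (r : R) := (((1 + r) ^+ k + (1 - r) ^+ k) / 2 - 1) / Kk ^+ 2.

Lemma Kk_gt0 : 0 < Kk.
Proof. by rewrite subr_gt0 exprn_egt1 ?ltr1n //; case: k k3 => [|[]]. Qed.

(** Both replicas make a clause constant in four ways, and a literal has prescribed truth values in
    the two replicas with probability [(1 + r) / 4] or [(1 - r) / 4], where [r] is the overlap. *)
Lemma ex_Lcl2 s t : ex (iid (lits R n) k) (fun c => Lcl R k c s * Lcl R k c t) = 1 + gk (ov s t).
Proof.
have lP := isprob_iid k (isprob_lits R n0).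
have tt (a b : bool) : ex (lits R n) (fun l => (tr s l == a)%:R * (tr t l == b)%:R) =
    (1 + (if a == b then 1 else -1) * ov s t) / 4.
  rewrite ex_lits /ov -exZ -[X in (X + _) / 4](ex_cst (isprob_vars R n0)) -exD -exZr.
  apply: eq_ex => v; rewrite /tr /= /spin.
  by case: (s v) (t v) a b => [] [] [] [] /=; field.
rewrite (@eq_ex_iid _ _ _ _ _ (fun c => (qk R k ^+ 2)^-1 * (1 - (mono (map (tr s) c))%:R - (mono (map (tr t) c))%:R
  + (\prod_(l <- c) ((tr s l == true)%:R * (tr t l == true)%:R) + \prod_(l <- c) ((tr s l == true)%:R * (tr t l == false)%:R)
   + \prod_(l <- c) ((tr s l == false)%:R * (tr t l == true)%:R) + \prod_(l <- c) ((tr s l == false)%:R * (tr t l == false)%:R))))); last first.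
  move=> c ck; have ne u : map (tr u) c != [::] by rewrite -size_eq0 size_map ck; case: k k3.
  rewrite !LclE !monoE // !big_map !big_split /=.
  have E1 u : \prod_(l <- c) ((tr u l == true)%:R : R) = \prod_(l <- c) (tr u l)%:R.
    by apply: eq_bigr => l _; rewrite eqb_id.
  have E2 u : \prod_(l <- c) ((tr u l == false)%:R : R) = \prod_(l <- c) (1 - (tr u l)%:R).
    by apply: eq_bigr => l _; case: (tr u l) => /=; rewrite ?subrr ?subr0.
  rewrite !E1 !E2; field; exact: lt0r_neq0 (qk_gt0 R k3).
rewrite exZ !exD !exN (ex_cst lP) !ex_mono // !ex_prod !tt /= !mul1r !mulN1r.
have -> : qk R k = Kk / 2 ^+ k.-1.
  by rewrite /qk /Kk mulrBl divff ?mul1r // expf_neq0.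
rewrite /gk !expr_div_n; have Kn := lt0r_neq0 Kk_gt0.
have -> : (4 : R) ^+ k = 4 * 2 ^+ k.-1 * 2 ^+ k.-1.
  have -> : (4 : R) = 2 * 2 by ring.
  by case: k k3 => // m _; rewrite exprMn exprS /=; ring.
have P0 : (2 : R) ^+ k.-1 != 0 by rewrite expf_neq0.
have KE : 2 ^+ k.-1 = Kk + 1 by rewrite /Kk subrK.
rewrite KE in P0 *; move: (_ ^+ k) ((1 - _) ^+ k) => a b; field.
by rewrite Kn P0.
Qed.

(** Even and odd parts of [(1 + r)^j] in [r]. They obey a coupled linear recursion, which yields the
    quadratic bounds by induction. *)
Let ek (r : R) j := ((1 + r) ^+ j + (1 - r) ^+ j) / 2.
Let ok (r : R) j := ((1 + r) ^+ j - (1 - r) ^+ j) / 2.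
Let ekS r j : ek r j.+1 = ek r j + r * ok r j.
Proof. by rewrite /ek /ok !exprS; field. Qed.
Let okS r j : ok r j.+1 = ok r j + r * ek r j.
Proof. by rewrite /ek /ok !exprS; field. Qed.
Let ek0 r : ek r 0 = 1. Proof. by rewrite /ek !expr0; field. Qed.
Let ok0 r : ok r 0 = 0. Proof. by rewrite /ok !expr0; field. Qed.

Let bin2S j : ('C(j.+1, 2)%:R : R) = 'C(j, 2)%:R + j%:R.
Proof. by rewrite binS bin1 natrD addrC. Qed.

Lemma ek_ge r : -1 <= r <= 1 -> 1 + 'C(k, 2)%:R * r ^+ 2 <= ek r k.
Proof.
move=> _; suff : forall j, 1 + 'C(j, 2)%:R * r ^+ 2 <= ek r j /\ j%:R * r ^+ 2 <= r * ok r j by move=> /(_ k)[].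
elim=> [|j [h1 h2]]; first by rewrite ek0 ok0 !mul0r mulr0 addr0.
have r2 := sqr_ge0 r.
have e1 : 1 <= ek r j by apply: le_trans h1; rewrite lerDl mulr_ge0.
rewrite ekS okS bin2S -[j.+1%:R]natr1 !mulrDr !mulrDl mul1r; split; first lra.
have := ler_wpM2l r2 e1; lra.
Qed.

Lemma ek_le r eps : 0 <= eps <= 1 -> `|r| <= eps -> ek r k <= 1 + 'C(k, 2)%:R * r ^+ 2 * (1 + eps) ^+ k.
Proof.
move=> /andP[e0 e1] re; suff : forall j, [/\ ek r j <= 1 + 'C(j, 2)%:R * r ^+ 2 * (1 + eps) ^+ j,
   r * ok r j <= j%:R * r ^+ 2 * (1 + eps) ^+ j, ek r j <= (1 + eps) ^+ j & `|ok r j| <= (1 + eps) ^+ j]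
  by move=> /(_ k)[].
have r2 := sqr_ge0 r.
elim=> [|j [h1 h2 h3 h4]]; first by rewrite ek0 ok0 !mul0r mulr0 addr0 normr0.
set M := (1 + eps) ^+ j in h1 h2 h3 h4.
have M1 : 1 <= M by rewrite exprn_ege1 // lerDl.
have M0 : 0 <= M by lra.
have MS : M <= (1 + eps) ^+ j.+1 by rewrite exprS -/M mulrDl mul1r lerDl mulr_ge0.
set M' := (1 + eps) ^+ j.+1 in MS *.
have M'E : M' = M + eps * M by rewrite /M' exprS -/M mulrDl mul1r.
have a1 : 'C(j, 2)%:R * r ^+ 2 * M <= 'C(j, 2)%:R * r ^+ 2 * M' by apply: ler_wpM2l => //; rewrite mulr_ge0.
have a2 : j%:R * r ^+ 2 * M <= j%:R * r ^+ 2 * M' by apply: ler_wpM2l => //; rewrite mulr_ge0.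
have a3 : r ^+ 2 * ek r j <= r ^+ 2 * M' by apply: ler_wpM2l => //; apply: le_trans h3 _.
have re2 x : `|x| <= M -> `|r * x| <= eps * M.
  by move=> h; rewrite normrM ler_pM.
rewrite ekS okS bin2S -[j.+1%:R]natr1 !mulrDr !mulrDl mul1r.
have e1' : 0 <= ek r j.
  move: re; rewrite ler_norml => /andP[x y].
  by rewrite /ek divr_ge0 // addr_ge0 // exprn_ge0; lra.
split.
- lra.
- lra.
- have := ler_norm (r * ok r j); have := re2 _ h4; lra.
- apply: le_trans (ler_normD _ _) _; have := re2 (ek r j); rewrite ger0_norm //; lra.
Qed.

End Overlap.

(** * The planted model, softened clauses and exponential moments *)

Section Planted.
Variables (R : realType) (S : Type) (mu : fd R S).
Hypothesis muP : isprob mu.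
Variables (I : Type) (p : fd R I).
Implicit Types (W : S -> R) (Phi : (S -> R) -> R) (L : I -> S -> R).

(** Expectation over one factor planted at [s]. *)
Definition Ps L s Phi W := ex p (fun i => L i s * Phi (wmul W (L i))).

(** The change of measure: the planted law, mixed over the planted state, has density [A] with
    respect to the null law. *)
Lemma ex_iterPs L m Phi W :
  ex mu (fun s => W s * iter m (Ps L s) Phi W) = iter m (Tr p L) (fun V => A mu V * Phi V) W.
Proof.
elim: m W => [|m IH] W /=; first by rewrite exZr.
rewrite /Tr -(eq_ex _ (fun i => IH (wmul W (L i)))) ex_exchange; apply: eq_ex => s.
by rewrite /Ps -exZ; apply: eq_ex => i; rewrite /wmul mulrA.
Qed.

(** A hard clause can make [A] vanish. Mixing in the constant [e] bounds each factor from below, so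
    that [ln A] has bounded differences. *)
Definition softL (e : R) L i s := (1 - e) * L i s + e.

Section Soft.
Variables (L : I -> S -> R) (e : R).
Hypotheses (chP : channel p L) (e01 : 0 < e < 1).
Let pP : isprob p. Proof. by case: chP. Qed.

Lemma softL_ge i s : e <= softL e L i s.
Proof. case: chP => _ L0 _; case/andP: e01 => a b; rewrite lerDr mulr_ge0 //; [lra|exact: L0]. Qed.

Lemma channel_soft : channel p (softL e L).
Proof.
case: chP => _ L0 L1; split=> // [i s|s].
  by apply: le_trans (softL_ge i s); case/andP: e01 => /ltW.
by rewrite /softL exD exZ L1 ex_cst // mulr1 subrK.
Qed.

Definition cvx Phi := forall W V, nn W -> nn V ->
  Phi (fun s => (1 - e) * W s + e * V s) <= (1 - e) * Phi W + e * Phi V.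

Lemma cvx_Tr J (p' : fd R J) (L' : J -> S -> R) Phi : channel p' L' -> cvx Phi -> cvx (Tr p' L' Phi).
Proof.
case=> pP' L0 _ h W V w v; rewrite /Tr -!exZ -exD; apply: ex_le => // j.
rewrite (_ : wmul _ _ = fun s => (1 - e) * wmul W (L' j) s + e * wmul V (L' j) s); last first.
  by apply/funext => s; rewrite /wmul mulrDl !mulrA.
by apply: h; exact: nn_wmul.
Qed.

Lemma cvx_Ent : cvx (Ent mu).
Proof.
move=> W V w v; case/andP: e01 => e0 e1; rewrite /Ent !LambdaE.
pose q : fd R bool := [:: (1 - e, true); (e, false)].
have exq f : ex q f = (1 - e) * f true + e * f false.
  by rewrite /ex !big_cons big_nil /= addr0.
have qP : isprob q by split; [rewrite /= andbT; apply/andP; split; lra|rewrite exq; ring].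
have a0 := A_ge0 muP w; have b0 := A_ge0 muP v.
have := @log_sum R bool q (fun b => if b then A mu W else A mu V) (fun=> 1) qP.
rewrite !exq /xl ln1 !subr0 /=.
have -> : A mu (fun s => (1 - e) * W s + e * V s) = (1 - e) * A mu W + e * A mu V.
  by rewrite /A exD !exZ.
have -> : (1 - e) * 1 + e * 1 = 1 :> R by ring.
rewrite ln1 subr0; apply=> [[] //|i|i]; first exact: ler01.
by move/eqP; rewrite oner_eq0.
Qed.

(** A softened factor is a mixture of the factor and of no factor; by convexity its effect is at
    most the mixture of the effects, and no factor gains nothing. *)
Lemma soft_step Phi W : cvx Phi -> nn W -> Phi W <= Tr p L Phi W -> Tr p (softL e L) Phi W <= Tr p L Phi W.
Proof.
case: chP => _ L0 _ h w le1; case/andP: e01 => e0 e1.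
apply: le_trans (_ : (1 - e) * Tr p L Phi W + e * Phi W <= _); last first.
  have := ler_wpM2l (ltW e0) le1; lra.
rewrite /Tr -exZ -[e * _](ex_cst pP) -exD; apply: ex_le => // i.
rewrite (_ : wmul _ _ = fun s => (1 - e) * wmul W (L i) s + e * W s).
  by apply: h => //; exact: nn_wmul.
by apply/funext => s; rewrite /wmul /softL; ring.
Qed.

Hypothesis L2 : forall i s, L i s <= 2.

Lemma soft_iter_Ent m W : nn W -> iter m (Tr p (softL e L)) (Ent mu) W <= iter m (Tr p L) (Ent mu) W.
Proof.
elim: m W => //= m IH W w; apply: le_trans (_ : Tr p (softL e L) (iter m (Tr p L) (Ent mu)) W <= _).
  by apply: (Tr_le channel_soft).
apply: soft_step => //; last by case: (slow_iter m chP (slow_Ent muP) chP L2 w).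
by elim: {IH} m => [|m IH] /=; [exact: cvx_Ent|exact: cvx_Tr].
Qed.

End Soft.

Section ExpMoment.
Variables (L : I -> S -> R) (C : (S -> R) -> Prop) (b lam : R) (s : S).
Hypotheses (chP : channel p L) (CL : forall W i, C W -> C (wmul W (L i))).
Hypotheses (b0 : 0 <= b) (l0 : 0 <= lam) (lb : lam * b <= 1 / 2).
Let pP : isprob p. Proof. by case: chP. Qed.
Let L0 i : 0 <= L i s. Proof. by case: chP => _ h _; exact: h. Qed.
Let Ls : ex p (fun i => L i s) = 1. Proof. by case: chP. Qed.

Definition osc Phi := forall W i j, C W -> Phi (wmul W (L i)) - Phi (wmul W (L j)) <= b.

Lemma Ps_le Phi Psi W : C W -> (forall V, C V -> Phi V <= Psi V) -> Ps L s Phi W <= Ps L s Psi W.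
Proof. by move=> w h; apply: ex_le => // i; apply: ler_wpM2l => //; apply: h; exact: CL. Qed.

Lemma PsZ c Phi W : Ps L s (fun V => c * Phi V) W = c * Ps L s Phi W.
Proof. by rewrite /Ps -exZ; apply: eq_ex => i; rewrite mulrCA. Qed.

Lemma osc_Ps Phi : osc Phi -> osc (Ps L s Phi).
Proof.
move=> h W i j w; rewrite /Ps -exB -[leRHS]mulr1 -Ls -exZ; apply: ex_le => // a.
by rewrite -mulrBr [leRHS]mulrC; apply: ler_wpM2l => //; rewrite (wmulAC W (L i)) (wmulAC W (L j)); apply: h; exact: CL.
Qed.

Lemma expR_le_sq (x : R) : x <= 1 / 2 -> expR x <= 1 + x + 2 * x ^+ 2.
Proof.
move=> x1; have h := expR_ge1Dx (- x).
have p0 : 0 < 1 - x by lra.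
rewrite -[expR x]invrK -expRN; apply: le_trans (_ : (1 - x)^-1 <= _).
  by rewrite lef_pV2 ?posrE ?expR_gt0.
rewrite -[leLHS]mul1r ler_pdivrMr //.
have : 0 <= x ^+ 2 * (1 - 2 * x) by rewrite mulr_ge0 ?sqr_ge0 //; lra.
have -> : (1 + x + 2 * x ^+ 2) * (1 - x) = 1 + x ^+ 2 * (1 - 2 * x) by ring.
lra.
Qed.

(** Centred at its planted mean [M], the next value of [Phi] deviates by at most [b]. The linear
    term of the exponential averages out and [expR_le_sq] bounds the rest. *)
Lemma Ps_exp Phi W : C W -> osc Phi ->
  Ps L s (fun V => expR (lam * Phi V)) W <= (1 + 2 * (lam * b) ^+ 2) * expR (lam * Ps L s Phi W).
Proof.
move=> w h; set M := Ps L s Phi W.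
have dev i : `|lam * (Phi (wmul W (L i)) - M)| <= lam * b.
  rewrite normrM (ger0_norm l0); apply: ler_wpM2l => //.
  have -> : Phi (wmul W (L i)) - M = ex p (fun j => L j s * (Phi (wmul W (L i)) - Phi (wmul W (L j)))).
    by under eq_ex => j do rewrite mulrBr; rewrite exB exZr Ls mul1r.
  rewrite ler_norml -[- b]mulr1 -[X in _ && (_ <= X)]mulr1 -Ls -!exZ; apply/andP; split.
    apply: ex_le => // j; rewrite mulrC; apply: ler_wpM2l => //.
    by have := h W j i w; lra.
  by apply: ex_le => // j; rewrite [leRHS]mulrC; apply: ler_wpM2l => //; exact: h.
rewrite [leRHS]mulrC.
apply: le_trans (_ : ex p (fun i => expR (lam * M) * (L i s * (1 + 2 * (lam * b) ^+ 2) +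
   lam * (L i s * Phi (wmul W (L i)) - L i s * M))) <= _); last first.
  by rewrite exZ exD exZ exB !exZr Ls -/(Ps L s Phi W) -/M !mul1r subrr mulr0 addr0.
apply: ex_le => // i; set x := lam * (Phi (wmul W (L i)) - M).
have -> : lam * Phi (wmul W (L i)) = lam * M + x by rewrite /x; ring.
rewrite expRD mulrCA; apply: ler_wpM2l; first exact: expR_ge0.
have -> : L i s * (1 + 2 * (lam * b) ^+ 2) + lam * (L i s * Phi (wmul W (L i)) - L i s * M) =
   L i s * (1 + x + 2 * (lam * b) ^+ 2) by rewrite /x; ring.
apply: ler_wpM2l => //; have xb : `|x| <= lam * b := dev i.
apply: le_trans (expR_le_sq _) _; first exact: le_trans (ler_norm x) (le_trans xb lb).
have : x ^+ 2 <= (lam * b) ^+ 2 by rewrite -[x ^+ 2]real_normK ?num_real // lerXn2r ?nnegrE // mulr_ge0.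
lra.
Qed.

(** An Azuma-type martingale bound: averaging over later factors preserves the oscillation bound, so
    the one-step estimate iterates. *)
Lemma iterPs_exp m Phi W : C W -> osc Phi ->
  iter m (Ps L s) (fun V => expR (lam * Phi V)) W <=
  (1 + 2 * (lam * b) ^+ 2) ^+ m * expR (lam * iter m (Ps L s) Phi W).
Proof.
move=> w h; have om j : osc (iter j (Ps L s) Phi) by elim: j => //= j; exact: osc_Ps.
elim: m W w => [|m IH] W w; first by rewrite mul1r.
rewrite [leLHS]/=; apply: le_trans (Ps_le w IH) _.
rewrite PsZ [_ ^+ m.+1]exprSr -[leRHS]mulrA; apply: ler_wpM2l; last exact: Ps_exp.
by rewrite exprn_ge0 // addr_ge0 // mulr_ge0 // sqr_ge0.
Qed.

End ExpMoment.

Section PowerMoment.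
(** The power [x^(1 + lam)] in a form that vanishes at 0. *)
Definition pw (lam x : R) := x * expR (lam * ln x).

Lemma pw_ge0 lam x : 0 <= x -> 0 <= pw lam x.
Proof. by move=> x0; rewrite mulr_ge0 ?expR_ge0. Qed.

Lemma pw_le lam c x y : 0 <= lam -> 0 < c -> 0 <= y -> 0 <= x <= c * y -> pw lam x <= pw lam c * pw lam y.
Proof.
move=> l0 c0 y0 /andP[x0 xy]; have [xz|xn] := eqVneq x 0.
  by rewrite xz {1}/pw mul0r mulr_ge0 ?pw_ge0 // ltW.
have xp : 0 < x by rewrite lt_def xn.
have yp : 0 < y by move: (lt_le_trans xp xy); rewrite pmulr_rgt0.
rewrite /pw mulrACA -expRD -mulrDr -lnM ?posrE //.
apply: ler_pM; rewrite ?expR_ge0 //.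
by rewrite ler_expR ler_wpM2l // ler_ln ?posrE // mulr_gt0.
Qed.

Variables (L L' : I -> S -> R) (c lam : R).
Hypotheses (chP : channel p L) (chP' : channel p L') (c0 : 0 < c) (l0 : 0 <= lam).
Hypothesis LL : forall i s, L i s <= c * L' i s.

Lemma iter_pw_le m r U V : 0 < r -> nn U -> nn V -> (forall s, U s <= r * V s) ->
  iter m (Tr p L) (fun W => pw lam (A mu W)) U <=
  pw lam (r * c ^+ m) * iter m (Tr p L') (fun W => pw lam (A mu W)) V.
Proof.
case: chP => pP L0 _; case: chP' => _ L0' _.
elim: m r U V => [|m IH] r U V r0 u v uv.
  rewrite mulr1; apply: pw_le => //; first exact: A_ge0.
  by rewrite A_ge0 //= /A -exZ; exact: ex_le.
rewrite /= /Tr -exZ; apply: ex_le => // i; rewrite exprS mulrA; apply: IH.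
- exact: mulr_gt0.
- exact: nn_wmul.
- exact: nn_wmul.
move=> s; rewrite /wmul mulrACA; apply: ler_pM => //; exact: L0.
Qed.

End PowerMoment.

End Planted.

(** * Independence of the planted state *)

Section Gauge.
Variables (R : realType) (k : nat).
Hypothesis k3 : (3 <= k)%N.

Definition flip (u s : nat -> bool) := fun v => s v (+) u v.
Definition flipl (u : nat -> bool) (l : lit) : lit := (l.1, l.2 (+) u l.1).

Lemma ex_spins_flip n u f : (forall v, (n <= v)%N -> u v = false) ->
  ex (spins R n) (fun s => f (flip u s)) = ex (spins R n) f.
Proof.
elim: n u f => [|n IH] u f un.
  by rewrite /ex !big_seq1 /=; congr (_ * f _); apply/funext => v; rewrite /flip un.
have e s b : flip u (upd s n b) = upd (flip (upd u n false) s) n (b (+) u n).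
  by apply/funext => v; rewrite /flip /upd; case: eqP => [->|_].
rewrite !ex_spinsS; under eq_ex => s do rewrite !e.
rewrite -[RHS](IH (upd u n false)); last first.
  by move=> v nv; rewrite /upd; case: eqP => // /eqP vn; apply: un; rewrite ltn_neqAle eq_sym vn.
by apply: eq_ex => s; case: (u n) => //=; rewrite addrC.
Qed.

Lemma ex_flipl n j u (f : seq lit -> R) :
  ex (iid (lits R n) j) (fun c => f (map (flipl u) c)) = ex (iid (lits R n) j) f.
Proof.
elim: j f => [|j IH] f; first by rewrite !ex_iid0.
rewrite !ex_iidS; transitivity (ex (lits R n) (fun l => ex (iid (lits R n) j) (fun c => f (flipl u l :: c)))).
  by apply: eq_ex => l; rewrite -(IH (fun c => f (flipl u l :: c))).
rewrite !ex_lits; apply: eq_ex => v; rewrite /flipl /=.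
by case: (u v) => //=; rewrite addrC.
Qed.

Lemma Lcl_flip u c s : Lcl R k (map (flipl u) c) (flip u s) = Lcl R k c s.
Proof.
rewrite /Lcl -map_comp; congr (if mono _ then _ else _); apply: eq_map => l.
by rewrite /tr /= /flip; case: (s _) (l.2) (u _) => [] [] [].
Qed.

Variable e : R.
Notation P n s := (Ps (iid (lits R n) k) (softL e (@Lcl R k)) s).

Lemma iterPs_flip n m s u Phi W : (forall V, Phi (V \o flip u) = Phi V) ->
  iter m (P n (flip u s)) Phi W = iter m (P n s) Phi (W \o flip u).
Proof.
move=> h; elim: m W => [|m IH] W //=.
rewrite /Ps -[LHS](ex_flipl n k u); apply: eq_ex => c.
rewrite IH {1 3}/softL Lcl_flip.
suff -> : wmul W (softL e (@Lcl R k) (map (flipl u) c)) \o flip u =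
  wmul (W \o flip u) (softL e (@Lcl R k) c) by [].
by apply/funext => t; rewrite /wmul /= /softL Lcl_flip.
Qed.

(** Flipping spins together with the literals on them is a symmetry carrying any planted state to
    the all-false one. *)
Lemma iterPs_gauge n m s : iter m (P n s) (fun V => ln (A (spins R n) V)) (fun=> 1) =
  iter m (P n (fun=> false)) (fun V => ln (A (spins R n) V)) (fun=> 1).
Proof.
(* The flip must be trivial from [n] on to preserve [spins n]; clauses do not read those
   coordinates. *)
pose u v := (v < n)%N && s v.
have un v : (n <= v)%N -> u v = false by move=> nv; rewrite /u ltnNge nv.
transitivity (iter m (P n (flip u (fun=> false))) (fun V => ln (A (spins R n) V)) (fun=> 1)); last first.
  by apply: iterPs_flip => V; congr ln; rewrite /A; exact: (ex_spins_flip V un).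
suff gen W : iter m (P n s) (fun V => ln (A (spins R n) V)) W =
  iter m (P n (flip u (fun=> false))) (fun V => ln (A (spins R n) V)) W by exact: gen.
elim: m W => [|m IH] W //=; rewrite /Ps.
apply: (eq_ex_supp (fsupp_iid k (fsupp_lits R n))) => c cn; rewrite IH; congr (_ * _).
rewrite /softL; congr (_ * _ + _); apply: (@local_Lcl R k n c cn s (flip u (fun=> false))) => v vn.
by rewrite /flip /u vn.
Qed.

End Gauge.

(** * Upper bound on the moment of order [1 + lam] *)

Section UpperMoment.
Variables (R : realType) (k : nat).
Hypothesis k3 : (3 <= k)%N.

Definition Em n m Phi : R := iter m (Tr (iid (lits R n) k) (@Lcl R k)) Phi (fun=> 1).

(** The moment is a planted exponential moment of [ln A]. The three terms of the exponent are the
    cost of softening, the planted mean of [ln A] and the fluctuation around it. *)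
Lemma Em_pw_le n m N lam : (0 < n)%N -> (1 < N)%N -> 0 <= lam -> lam * (4 * N%:R) <= 1 / 2 -> lam <= 1 ->
  Em n m (fun W => pw lam (A (spins R n) W)) <=
  expR (4 * m%:R / N%:R ^+ 4 + lam * Diid R k n m + 2 * (lam * (4 * N%:R)) ^+ 2 * m%:R).
Proof.
move=> n0 N1 l0 lb l1; set mu := spins R n; have muP : isprob mu := isprob_spins R n.
have Np : 0 < N%:R :> R by rewrite ltr0n ltnW.
have N2 : 2 <= N%:R :> R by rewrite ler_nat.
(* A polynomially small [e] makes the softening cost [4 m / N^4], while [ln A] still oscillates by
   at most [ln (4 / 3) + 4 ln N <= 4 N]. *)
set e := (N%:R ^+ 4 : R)^-1.
have e0 : 0 < e by rewrite invr_gt0 exprn_gt0.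
have e2 : e <= 1 / 2.
  have h : 2 <= N%:R ^+ 4 :> R.
    by apply: le_trans N2 _; rewrite -[leLHS]expr1; apply: ler_weXn2l => //; rewrite ler1n ltnW.
  by rewrite mul1r /e lef_pV2 ?posrE ?exprn_gt0.
have e01 : 0 < e < 1 by lra.
have ch := channel_cl R k3 n0; have chs := channel_soft ch e01.
have [pP L0 _] := ch.
have q1 : 0 < (1 - e)^-1 by rewrite invr_gt0; lra.
have one : nn (fun _ : nat -> bool => 1 : R) by move=> s; exact: ler01.
apply: le_trans (iter_pw_le muP ch chs q1 l0 _ m (r := 1) _ one one _) _ => //.
- by move=> c s; rewrite /softL mulrDr mulKf ?lerDl ?mulr_ge0 //; [lra|lra|lra].
- by move=> s; rewrite mulr1.
rewrite mul1r.
have soft m' W : iter m' (Tr (iid (lits R n) k) (softL e (@Lcl R k))) (fun W => pw lam (A mu W)) W =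
   ex mu (fun s => W s * iter m' (Ps (iid (lits R n) k) (softL e (@Lcl R k)) s) (fun V => expR (lam * ln (A mu V))) W).
  by rewrite ex_iterPs.
rewrite soft; set b : R := 4 * N%:R.
pose C W := nn W /\ 0 < A mu W.
have eA W c : C W -> e * A mu W <= A mu (wmul W (softL e (@Lcl R k) c)).
  move=> [w _]; rewrite /A -exZ; apply: ex_le => // s; rewrite /wmul mulrC ler_wpM2l //.
  exact: (softL_ge ch e01).
have CL W c : C W -> C (wmul W (softL e (@Lcl R k) c)).
  move=> [w a0]; split; first by apply: nn_wmul => //; case: chs.
  by apply: lt_le_trans (eA W c (conj w a0)); rewrite mulr_gt0.
have Lle c s : softL e (@Lcl R k) c s <= 4 / 3.
  have := Lcl_le R k3 c s; have := qkV_le R k3; rewrite /softL => h1 h2.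
  have : (1 - e) * Lcl R k c s <= (1 - e) * (4 / 3) by apply: ler_wpM2l; lra.
  lra.
have Ale W c : C W -> A mu (wmul W (softL e (@Lcl R k) c)) <= 4 / 3 * A mu W.
  by move=> [w _]; rewrite /A -exZ; apply: ex_le => // s; rewrite /wmul mulrC; apply: ler_wpM2r.
have oscl : osc (softL e (@Lcl R k)) C b (fun V => ln (A mu V)).
  move=> W c c' w; have [_ a1] := CL W c w; have [_ a2] := CL W c' w; have [_ a3] := w.
  have h1 : ln (A mu (wmul W (softL e (@Lcl R k) c))) <= ln (4 / 3) + ln (A mu W).
    by rewrite -lnM ?posrE // ler_ln ?posrE ?mulr_gt0 //; exact: Ale.
  have h2 : - (4 * ln N%:R) + ln (A mu W) <= ln (A mu (wmul W (softL e (@Lcl R k) c'))).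
    have -> : - (4 * ln N%:R) = ln e :> R.
      by rewrite /e lnV ?posrE ?exprn_gt0 // lnXn // mulr_natl.
    by rewrite -lnM ?posrE // ler_ln ?posrE ?mulr_gt0 //; exact: eA.
  have h3 : ln (N%:R : R) <= N%:R - 1.
    have := @le_ln1Dx R (N%:R - 1); have -> : 1 + (N%:R - 1) = N%:R :> R by ring.
    by apply; lra.
  have h4 : ln (4 / 3 : R) <= 1 / 3.
    have := @le_ln1Dx R (1 / 3); have -> : 1 + 1 / 3 = 4 / 3 :> R by field.
    by apply; lra.
  rewrite /b; lra.
set D := iter m (Ps (iid (lits R n) k) (softL e (@Lcl R k)) (fun=> false)) (fun V => ln (A mu V)) (fun=> 1).
(* By gauge symmetry [D] equals its average over planted states, which is the relative entropy of
   the softened model; softening only lowers it. *)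
have DE : D <= Diid R k n m.
  have -> : D = iter m (Tr (iid (lits R n) k) (softL e (@Lcl R k))) (fun V => A mu V * ln (A mu V)) (fun=> 1).
    rewrite -ex_iterPs -[LHS](ex_cst muP); apply: eq_ex => s.
    by rewrite mul1r (iterPs_gauge k e n m s).
  rewrite (_ : (fun V => A mu V * _) = Ent mu); last by apply/funext => V; rewrite /Ent LambdaE.
  apply: (soft_iter_Ent muP ch e01) => //; exact: (Lcl2 R k3).
have C1 : C (fun=> 1) by split=> //; rewrite A1 // ltr01.
have b0 : 0 <= b by rewrite /b mulr_ge0.
set X := 1 + 2 * (lam * b) ^+ 2.
have X0 : 0 <= X by rewrite addr_ge0 // mulr_ge0 // sqr_ge0.
apply: le_trans (_ : pw lam ((1 - e)^-1 ^+ m) * (X ^+ m * expR (lam * D)) <= _).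
  apply: ler_wpM2l; first by rewrite pw_ge0 // exprn_ge0 // ltW.
  rewrite -[leRHS](ex_cst muP); apply: ex_le => // s; rewrite mul1r.
  have hh := iterPs_exp s chs CL b0 l0 lb m C1 oscl; apply: le_trans hh _.
  by rewrite (iterPs_gauge k e n m s).
have XE : X ^+ m <= expR (2 * (lam * b) ^+ 2 * m%:R).
  rewrite expRM_natr; apply: lerXn2r; rewrite ?nnegrE ?expR_ge0 //; exact: expR_ge1Dx.
have eE : (1 - e)^-1 <= expR (2 * e).
  have h : 1 <= (1 + 2 * e) * (1 - e).
    have : 0 <= e * (1 - 2 * e) by rewrite mulr_ge0; lra.
    lra.
  rewrite -[leLHS]mul1r ler_pdivrMr; last lra.
  by apply: le_trans h _; rewrite ler_wpM2r ?expR_ge1Dx //; lra.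
have PE : pw lam ((1 - e)^-1 ^+ m) <= expR (4 * m%:R / N%:R ^+ 4).
  have i1 : (1 - e)^-1 ^+ m <= expR (2 * e * m%:R).
    by rewrite expRM_natr; apply: lerXn2r; rewrite ?nnegrE ?expR_ge0 // ltW.
  have i0 : 0 < (1 - e)^-1 ^+ m by rewrite exprn_gt0.
  apply: le_trans (_ : expR (2 * e * m%:R) * expR (2 * e * m%:R) <= _); last first.
    by rewrite -expRD ler_expR -/e; lra.
  rewrite /pw; apply: ler_pM; rewrite ?expR_ge0 ?(ltW i0) //.
  rewrite ler_expR; apply: le_trans (_ : 1 * ln ((1 - e)^-1 ^+ m) <= _).
    apply: ler_wpM2r => //; apply: ln_ge0; rewrite exprn_ege1 // invf_ge1; lra.
  by rewrite mul1r -[leRHS]expRK ler_ln ?posrE ?expR_gt0.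
apply: le_trans (_ : expR (4 * m%:R / N%:R ^+ 4) *
    (expR (2 * (lam * b) ^+ 2 * m%:R) * expR (lam * Diid R k n m)) <= _); last first.
  by rewrite -!expRD ler_expR -/b /e; lra.
apply: ler_pM => //.
- by rewrite pw_ge0 // exprn_ge0 // ltW.
- by rewrite mulr_ge0 ?exprn_ge0 ?expR_ge0.
by apply: ler_pM; rewrite ?exprn_ge0 ?expR_ge0 // ler_expR ler_wpM2l.
Qed.

End UpperMoment.

(** * Growth of the tilted moment through further factors *)

Section TiltedGrowth.
Variables (R : realType) (S : Type) (mu : fd R S).
Hypothesis muP : isprob mu.
Variables (I : Type) (p : fd R I) (L : I -> S -> R).
Hypothesis chP : channel p L.
Let pP : isprob p. Proof. by case: chP. Qed.
Let L0 i : nn (L i). Proof. by case: chP. Qed.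

(** Under the weight [A], the mean of [ln A] after [j] factors is at least [v] by convexity of the
    entropy. Jensen's inequality follows from the tangent of the exponential at [v]. *)
Lemma iter_pw_ge lam j W : 0 <= lam -> nn W -> 0 < A mu W ->
  A mu W * expR (lam * (ln (A mu W) + j%:R * (Inc mu p L W / A mu W))) <=
  iter j (Tr p L) (fun V => pw lam (A mu V)) W.
Proof.
move=> l0 w a0; set v := ln (A mu W) + j%:R * (Inc mu p L W / A mu W).
apply: le_trans (_ : iter j (Tr p L) (fun V => expR (lam * v) * (A mu V + lam * (Ent mu V + (- v) * A mu V))) W <= _).
  rewrite iterTrZ iterTrD (iterTr_A mu chP) iterTrZ iterTrD iterTrZ (iterTr_A mu chP) mulrC.
  apply: ler_wpM2l; first exact: expR_ge0.
  rewrite lerDl; apply: mulr_ge0 => //.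
  have := iter_Ent_ge muP chP j w.
  have -> : Ent mu W + j%:R * Inc mu p L W = v * A mu W.
    by rewrite /v /Ent LambdaE; field; exact: lt0r_neq0.
  lra.
apply: (iterTr_le chP) => // V v0; rewrite /pw /Ent LambdaE.
set x := A mu V; have x0 : 0 <= x := A_ge0 muP v0.
have -> : expR (lam * ln x) = expR (lam * v) * expR (lam * (ln x - v)) by rewrite -expRD; congr expR; ring.
rewrite mulrCA; apply: ler_wpM2l; first exact: expR_ge0.
have -> : x + lam * (x * ln x + - v * x) = x * (1 + lam * (ln x - v)) by ring.
by apply: ler_wpM2l => //; exact: expR_ge1Dx.
Qed.

(* [x ln x >= 2 (x - sqrt x)], since [ln (sqrt x) >= 1 - 1 / sqrt x]. *)
Lemma xl_ge_sq (u v : R) : 0 < v -> 0 <= u <= 4 / 3 * v -> (u - v) + (u - v) ^+ 2 / (5 * v) <= xl u v.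
Proof.
move=> v0 /andP[u0 uv]; rewrite /xl; have [->|un] := eqVneq u 0.
  rewrite !sub0r sqrrN mul0r expr2 -mulrA [v / _](_ : _ = 1 / 5); first by lra.
  by field; exact: lt0r_neq0.
have up : 0 < u by rewrite lt_def un.
set y := Num.sqrt (u / v).
have uv0 : 0 < u / v by rewrite divr_gt0.
have y0 : 0 < y by rewrite sqrtr_gt0.
have yy : y ^+ 2 = u / v by rewrite sqr_sqrtr // ltW.
have uE : u = y ^+ 2 * v by rewrite yy divfK ?lt0r_neq0.
have lE : ln u - ln v = 2 * ln y.
  by rewrite -ln_div ?posrE // -yy lnXn // mulr_natl.
have y2 : y ^+ 2 <= 4 / 3 by rewrite yy ler_pdivrMr.
have y3 : y <= 6 / 5.
  rewrite leNgt; apply/negP => h; have : (6 / 5) ^+ 2 < y ^+ 2 by rewrite ltrXn2r ?nnegrE //; lra.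
  have -> : (6 / 5 : R) ^+ 2 = 36 / 25 by field.
  lra.
rewrite lE {1 3}uE; have h := ln_ge1V y0.
have -> : y ^+ 2 * v - v + (u - v) ^+ 2 / (5 * v) = v * (y ^+ 2 - 1 + (y ^+ 2 - 1) ^+ 2 / 5).
  by rewrite {1}uE; field; exact: lt0r_neq0.
have -> : y ^+ 2 * v * (2 * ln y) = v * (y ^+ 2 * (2 * ln y)) by ring.
rewrite ler_pM2l //; apply: le_trans (_ : 2 * (y ^+ 2 - y) <= _); last first.
  have := ler_wpM2l (sqr_ge0 y) h; rewrite mulrBr mulr1.
  have -> : y ^+ 2 * y^-1 = y by field; exact: lt0r_neq0.
  lra.
have -> : y ^+ 2 - 1 + (y ^+ 2 - 1) ^+ 2 / 5 = 2 * (y ^+ 2 - y) - (y - 1) ^+ 2 * (1 - (y + 1) ^+ 2 / 5) by field.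
rewrite lerBlDr lerDl mulr_ge0 ?sqr_ge0 //.
have : (y + 1) ^+ 2 <= (6 / 5 + 1) ^+ 2 by rewrite lerXn2r ?nnegrE //; lra.
have -> : (6 / 5 + 1 : R) ^+ 2 = 121 / 25 by field.
lra.
Qed.

Lemma A_sub1 W V : A mu (wmul W V) - A mu W = A mu (wmul W (fun s => V s - 1)).
Proof. by rewrite /A -exB; apply: eq_ex => s; rewrite /wmul mulrBr mulr1. Qed.

Lemma ex_L1L1 s t : ex p (fun i => (L i s - 1) * (L i t - 1)) = ex p (fun i => L i s * L i t) - 1.
Proof.
have [_ _ L1] := chP.
transitivity (ex p (fun i => (L i s * L i t + 1) - (L i s + L i t))).
  by apply: eq_ex => i; ring.
rewrite exB !exD (ex_cst pP) !L1; ring.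
Qed.

(** Relative entropy dominates a multiple of the chi-square distance for bounded factors. The linear
    term averages to zero and the squares become a two-replica average. *)
Lemma Inc_ge_DE W : (forall i s, L i s <= 4 / 3) -> nn W -> 0 < A mu W ->
  DE mu W (fun s t => ex p (fun i => L i s * L i t) - 1) / (5 * A mu W) <= Inc mu p L W.
Proof.
move=> L43 w a0; have -> : DE mu W (fun s t => ex p (fun i => L i s * L i t) - 1) =
    ex p (fun i => (A mu (wmul W (L i)) - A mu W) ^+ 2).
  rewrite (eq_ex _ (fun i => congr1 (fun x => x ^+ 2) (A_sub1 W (L i)))).
  rewrite (quad mu p (fun i s => L i s - 1)); congr DE; apply/funext => s; apply/funext => t.
  by rewrite ex_L1L1.
rewrite /Inc -exZr.
apply: le_trans (_ : ex p (fun i => (A mu (wmul W (L i)) - A mu W) + (A mu (wmul W (L i)) - A mu W) ^+ 2 / (5 * A mu W)) <= _).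
  by rewrite exD exB (ex_AL mu chP) (ex_cst pP) subrr add0r.
apply: ex_le => // i; apply: xl_ge_sq => //; rewrite A_ge0 //=; last exact: nn_wmul.
by rewrite /A -exZ; apply: ex_le => // s; rewrite /wmul [leRHS]mulrC; apply: ler_wpM2l.
Qed.

End TiltedGrowth.

(** * The mean squared overlap in the planted model *)

Section Clusters.
Variables (R : realType) (k : nat).
Hypothesis k3 : (3 <= k)%N.
Let kp : 0 < k%:R :> R. Proof. by rewrite ltr0n; case: k k3. Qed.

Lemma dcond_room (d : R) : (d%:E < dcond R k)%E -> exists2 d', d < d' & (d'%:E < dcond R k)%E.
Proof.
case: (dcond R k) => [r| |] //.
- rewrite lte_fin => dr; exists ((d + r) / 2); rewrite ?lte_fin; lra.
- by move=> _; exists (d + 1); rewrite ?ltry // ltrDl.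
Qed.

Lemma Em_pw (d a : R) : 0 < d -> (d%:E < dcond R k)%E -> 0 < a ->
  exists2 lam, 0 < lam <= 1 & exists N, forall n m, (N <= n)%N -> m%:R <= d * n%:R / k%:R ->
    Em k n m (fun W => pw lam (A (spins R n) W)) <= expR (lam * a * n%:R).
Proof.
move=> d0 dc a0; set c1 := d / k%:R; have c0 : 0 < c1 by rewrite divr_gt0.
pose y := c1 / a; have y0 : 0 < y by rewrite divr_gt0.
have [M _ hM] := nat_above (100 * y); set N := (M + 2)%N.
have N2 : (1 < N)%N by rewrite /N addn2.
have NM : M%:R <= N%:R :> R by rewrite ler_nat leq_addr.
have Ny : 100 * y <= N%:R by apply: le_trans NM.
have Np : 0 < N%:R :> R by rewrite ltr0n ltnW.
have N1 : 1 <= N%:R :> R by rewrite ler1n ltnW.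
have Npow j : N%:R <= N%:R ^+ j.+1 :> R by rewrite -[leLHS]expr1; apply: ler_weXn2l.
(* Chosen so that the softening cost [4 c1 n / N^4] is exactly one third of [lam a n]. The
   fluctuation term is then [lam a n] times [384 y^2 / N^2], below a third because [N >= 100 y]. *)
pose lam := 12 * y / N%:R ^+ 4.
have l0 : 0 < lam by apply: divr_gt0; [apply: mulr_gt0|exact: exprn_gt0].
have l1 : lam <= 1 by rewrite ler_pdivrMr ?exprn_gt0 // mul1r; have := Npow 3%N; lra.
have lN : lam * (4 * N%:R) <= 1 / 2.
  have -> : lam * (4 * N%:R) = 48 * y / N%:R ^+ 3 by rewrite /lam; field; exact: lt0r_neq0.
  rewrite ler_pdivrMr ?exprn_gt0 //; have := Npow 2%N; lra.
exists lam; first by rewrite l0.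
have [N0 hN0] := Diid_small k3 d0 dc (divr_gt0 a0 (ltr0n R 3 : 0 < 3)).
exists N0.+1 => n m nn md; have n0 : (0 < n)%N by apply: leq_ltn_trans nn.
have D := hN0 n m (ltnW nn) md.
have mc : m%:R <= c1 * n%:R by apply: le_trans md _; rewrite /c1 mulrAC.
apply: le_trans (Em_pw_le k3 m n0 N2 (ltW l0) lN l1) _.
rewrite ler_expR.
have e1 : 4 * m%:R / N%:R ^+ 4 <= lam * a / 3 * n%:R.
  have -> : lam * a / 3 * n%:R = 4 * (c1 * n%:R) / N%:R ^+ 4.
    by rewrite /lam /y; field; rewrite !lt0r_neq0.
  by rewrite ler_pM2r ?invr_gt0 ?exprn_gt0 // ler_pM2l.
have e2 : lam * Diid R k n m <= lam * a / 3 * n%:R.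
  by have := ler_wpM2l (ltW l0) D; rewrite !mulrA.
have e3 : 2 * (lam * (4 * N%:R)) ^+ 2 * m%:R <= lam * a / 3 * n%:R.
  apply: le_trans (_ : 2 * (lam * (4 * N%:R)) ^+ 2 * (c1 * n%:R) <= _).
    by apply: ler_wpM2l => //; rewrite mulr_ge0 // sqr_ge0.
  suff key : 2 * (lam * 4 * N%:R) ^+ 2 * c1 <= lam * a / 3.
    have := ler_wpM2r (ler0n R n) key; clearbody lam c1; lra.
  have -> : 2 * (lam * 4 * N%:R) ^+ 2 * c1 = lam * a * (384 * y ^+ 2 / N%:R ^+ 2).
    rewrite (_ : (lam * 4 * N%:R) ^+ 2 = lam * (16 * N%:R ^+ 2) * lam); last by ring.
    by rewrite {2}/lam /y; field; rewrite !lt0r_neq0.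
  apply: ler_wpM2l; first by rewrite mulr_ge0 ?ltW.
  rewrite -[leRHS]mul1r; have : 384 * y ^+ 2 <= 3^-1 * N%:R ^+ 2.
    have : (100 * y) ^+ 2 <= N%:R ^+ 2.
      by apply: lerXn2r => //; rewrite nnegrE; [apply: mulr_ge0 => //; exact: ltW|exact: ltW].
    rewrite exprMn; have := sqr_ge0 y; have -> : (100 : R) ^+ 2 = 10000 by ring.
    lra.
  by move=> h; rewrite ler_pdivrMr ?exprn_gt0 // mul1r.
lra.
Qed.

Lemma big_enough (c x : R) : 0 < c -> exists N, forall n, (N <= n)%N -> x <= c * n%:R.
Proof.
move=> c0; have [N _ hN] := nat_above (x / c); exists N => n nn.
have : x / c <= n%:R by apply: le_trans hN _; rewrite ler_nat.
by rewrite ler_pdivrMr // mulrC.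
Qed.

Lemma nat_trunc (x : R) : 0 <= x -> exists2 j : nat, j%:R <= x & x <= j%:R + 1.
Proof.
move=> x0; have /andP[a b] := truncn_itv x0; exists (Num.truncn x) => //.
by rewrite natr1 ltW.
Qed.

(** Multiplied out instead of divided by [A W ^+ 2]; it holds trivially when [A W = 0] and is used
    with the weight [A W]. *)
Definition big_overlap n (eps : R) W := eps * A (spins R n) W ^+ 2 <= DE (spins R n) W (fun s t => ov R n s t ^+ 2).

Lemma Lcl43 c s : Lcl R k c s <= 4 / 3.
Proof. by apply: le_trans (Lcl_le R k3 c s) _; exact: qkV_le. Qed.

Lemma gk_ge r : -1 <= r <= 1 -> r ^+ 2 / Kk R k ^+ 2 <= gk k r.
Proof.
move=> r1; rewrite /gk; apply: ler_wpM2r; first by rewrite invr_ge0 sqr_ge0.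
have := ek_ge k r1; have : 1 <= 'C(k, 2)%:R :> R by rewrite ler1n bin_gt0 ltnW.
move=> /(ler_wpM2r (sqr_ge0 r)); lra.
Qed.

Lemma Inc_ge_ov n W : (0 < n)%N -> nn W -> 0 < A (spins R n) W ->
  DE (spins R n) W (fun s t => ov R n s t ^+ 2) / (5 * Kk R k ^+ 2 * A (spins R n) W) <=
  Inc (spins R n) (iid (lits R n) k) (@Lcl R k) W.
Proof.
move=> n0 w a0; have ch := channel_cl R k3 n0; have muP := isprob_spins R n.
have Kp := Kk_gt0 R k3.
apply: le_trans (Inc_ge_DE muP ch Lcl43 w a0).
rewrite (_ : _ / _ = (Kk R k ^+ 2)^-1 * DE (spins R n) W (fun s t => ov R n s t ^+ 2) / (5 * A (spins R n) W)); last first.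
  by field; rewrite !lt0r_neq0.
rewrite ler_pM2r; last by rewrite invr_gt0 mulr_gt0.
rewrite -DEZ; apply: (DE_le muP) => // s t; rewrite ex_Lcl2 // addrAC subrr add0r mulrC.
by apply: gk_ge; exact: ov_le1.
Qed.

(** With a large mean squared overlap each further clause gains a fixed amount of entropy, so
    linearly many of them would push the tilted moment above its bound at density [d']. Densities
    with exponentially small [A] carry little planted weight anyway. *)
Lemma Em_big_overlap (d eps : R) : 0 < d -> (d%:E < dcond R k)%E -> 0 < eps ->
  exists2 c, 0 < c & exists N, forall n m, (N <= n)%N -> m%:R <= d * n%:R / k%:R ->
    Em k n m (fun W => A (spins R n) W * (big_overlap n eps W)%:R) <= 2 * expR (- (c * n%:R)).
Proof.
move=> d0 dc e0; have [d' dd' dc'] := dcond_room dc.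
have d'0 : 0 < d' := lt_trans d0 dd'.
set eta := (d' - d) / (2 * k%:R).
have eta0 : 0 < eta by apply: divr_gt0; [rewrite subr_gt0|apply: mulr_gt0].
have Kp := Kk_gt0 R k3; set c3 := (5 * Kk R k ^+ 2)^-1.
have c30 : 0 < c3 by rewrite invr_gt0; apply: mulr_gt0 => //; exact: exprn_gt0.
(* The entropy gain is then at least [4 a n]. One [a n] pays for the lower bound on [A], one for the
   upper moment bound, and the rest leaves the claimed decay. *)
set a := eta * c3 * eps / 4.
have a0 : 0 < a by apply: divr_gt0 => //; do 2!apply: mulr_gt0 => //.
have etaE : eta = (d' - d) / (2 * k%:R) by [].
have c3E : c3 = (5 * Kk R k ^+ 2)^-1 by [].
have aE : a = eta * c3 * eps / 4 by [].
clearbody eta c3 a.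
have [lam /andP[l0 l1] [N1 hN1]] := Em_pw d'0 dc' a0.
have [N2 hN2] := big_enough 1 eta0.
exists (lam * a); first by rewrite mulr_gt0.
exists (N1 + N2).+1 => n m nN md.
have n0 : (0 < n)%N by apply: leq_ltn_trans nN.
have nN1 : (N1 <= n)%N by rewrite (leq_trans _ nN) // ltnW // ltnS leq_addr.
have nN2 : (N2 <= n)%N by rewrite (leq_trans _ nN) // ltnW // ltnS leq_addl.
have [j j1 j2] : exists2 j : nat, j%:R <= 2 * eta * n%:R & eta * n%:R <= j%:R.
  have [|j h1 h2] := @nat_trunc (2 * eta * n%:R); first by rewrite !mulr_ge0 // ltW.
  by exists j => //; have := hN2 n nN2; lra.
have mj : (m + j)%:R <= d' * n%:R / k%:R.
  rewrite natrD; apply: le_trans (lerD md j1) _; rewrite etaE.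
  by rewrite le_eqVlt; apply/orP; left; apply/eqP; field; rewrite lt0r_neq0.
have ch := channel_cl R k3 n0; have muP := isprob_spins R n; set mu := spins R n in muP *.
set T := Tr (iid (lits R n) k) (@Lcl R k).
have one : nn (fun _ : nat -> bool => 1 : R) by move=> s; exact: ler01.
(* The inverse of the guaranteed growth factor when [A W > expR (- a n)] and [W] has big overlap, so
   that [A W] is at most [X] times the tilted moment after [j] clauses. *)
set X := expR (lam * (a * n%:R) - lam * (j%:R * (c3 * eps))).
apply: le_trans (_ : iter m T (fun W => expR (- (a * n%:R)) + X * iter j T (fun V => pw lam (A mu V)) W) (fun=> 1) <= _).
  apply: (iterTr_le ch) => // W w; have Aw := A_ge0 muP w.
  have pw0 : 0 <= X * iter j T (fun V => pw lam (A mu V)) W.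
    rewrite mulr_ge0 ?expR_ge0 // -(congr1 (fun f => f W) (iterTr_cst ch j 0)).
    by apply: (iterTr_le ch) => // V v; rewrite pw_ge0 // A_ge0.
  have [small|big] := leP (A mu W) (expR (- (a * n%:R))).
    apply: le_trans (_ : A mu W * 1 <= _); last by rewrite mulr1; lra.
    by apply: ler_wpM2l => //; case: (big_overlap _ _ _).
  have Ap : 0 < A mu W by apply: lt_trans big; exact: expR_gt0.
  have eR := expR_ge0 (- (a * n%:R)).
  case: (boolP (big_overlap n eps W)) => [bo|_]; last by rewrite mulr0; lra.
  rewrite mulr1; apply: le_trans (_ : X * iter j T (fun V => pw lam (A mu V)) W <= _); last by lra.
  apply: le_trans (ler_wpM2l (expR_ge0 _) (iter_pw_ge muP ch j (ltW l0) w Ap)).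
  rewrite mulrCA -[leLHS]mulr1 ler_pM2l // -expRD -[leLHS]expR0 ler_expR.
  have i1 : c3 * eps <= Inc mu (iid (lits R n) k) (@Lcl R k) W / A mu W.
    rewrite ler_pdivlMr //; apply: le_trans (Inc_ge_ov n0 w Ap).
    rewrite ler_pdivlMr ?mulr_gt0 ?exprn_gt0 //; apply: le_trans bo.
    rewrite le_eqVlt; apply/orP; left; apply/eqP; rewrite c3E -/mu; field; exact: lt0r_neq0.
  have i2 : - (a * n%:R) <= ln (A mu W) by rewrite -[leLHS]expRK ler_ln ?posrE ?expR_gt0 // ltW.
  have := ler_wpM2l (ler0n R j) i1; move=> i3.
  have : 0 <= lam * ((ln (A mu W) + j%:R * (Inc mu (iid (lits R n) k) (@Lcl R k) W / A mu W)) - (- (a * n%:R) + j%:R * (c3 * eps))).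
    by apply: mulr_ge0; [exact: ltW|rewrite subr_ge0; exact: lerD].
  lra.
rewrite iterTrD (iterTr_cst ch) iterTrZ -iterD.
have := hN1 n (m + j)%N nN1 mj; rewrite /Em -/T -/mu => U.
have h1 : expR (- (a * n%:R)) <= expR (- (lam * a * n%:R)).
  by rewrite ler_expR lerN2 ler_wpM2r // ler_piMl // ltW.
have h2 : X * iter (m + j) T (fun V => pw lam (A mu V)) (fun=> 1) <= expR (- (lam * a * n%:R)).
  apply: le_trans (ler_wpM2l (expR_ge0 _) U) _; rewrite -expRD ler_expR.
  have : lam * (eta * n%:R * (c3 * eps)) <= lam * (j%:R * (c3 * eps)).
    by apply: ler_wpM2l; [exact: ltW|apply: ler_wpM2r => //; rewrite mulr_ge0 // ltW].
  have : eta * n%:R * (c3 * eps) = 4 * (a * n%:R) by rewrite aE; field.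
  move=> ->; have : 0 <= lam * (a * n%:R) by rewrite !mulr_ge0 // ltW.
  lra.
lra.
Qed.

End Clusters.

(** * Growth of quadratic energies of posterior means *)

Section CovarianceGrowth.
Variables (R : realType) (S : Type) (mu : fd R S).
Hypothesis muP : isprob mu.

(* Tangent of [u^2 / v] along the direction of the covariance of [u / v]. *)
Lemma sq_div_ge (a u0 u v : R) : 0 < a -> 0 <= v <= 4 / 3 * a -> (v = 0 -> u = 0) ->
  u0 ^+ 2 / a + 2 * u0 / a * (u - u0) - u0 ^+ 2 / a ^+ 2 * (v - a) <= u ^+ 2 / v /\
  u0 ^+ 2 / a + 2 * u0 / a * (u - u0) - u0 ^+ 2 / a ^+ 2 * (v - a)
    + (3 * a)^-1 * (u - u0) ^+ 2 - 2 / 3 * (u0 ^+ 2 / a ^+ 3) * (v - a) ^+ 2 <= u ^+ 2 / v.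
Proof.
move=> a0 /andP[v0 va] vu; have an := lt0r_neq0 a0.
pose f := u0 / a; pose z := (u - u0) / a; pose x := (v - a) / a; pose e := z - f * x.
have uE : u = a * (f + e + f * x) by rewrite /e /z /f; field.
have vE : v = a * (1 + x) by rewrite /x; field.
have u0E : u0 = a * f by rewrite /f; field.
have x1 : x <= 1 / 3 by rewrite /x ler_pdivrMr //; lra.
have key : a * (f ^+ 2 + 2 * f * e + x * f ^+ 2 + e ^+ 2 * (1 - x)) <= u ^+ 2 / v.
  have [vz|vn] := eqVneq v 0.
    have xz : x = -1 by rewrite /x vz sub0r mulNr divff.
    have ez : e = 0.
      have : f + e + f * x = 0 by apply: (mulfI an); rewrite -uE vu // mulr0.
      by rewrite xz; lra.
    rewrite vz invr0 mulr0 ez xz.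
    have -> : f ^+ 2 + 2 * f * 0 + -1 * f ^+ 2 + 0 ^+ 2 * (1 - -1) = 0 by ring.
    by rewrite mulr0.
  have vp : 0 < v by rewrite lt_def vn.
  rewrite ler_pdivlMr //.
  have : 0 <= (u - (f + e) * v) ^+ 2 by exact: sqr_ge0.
  have -> : (u - (f + e) * v) ^+ 2 = u ^+ 2 - a * (f ^+ 2 + 2 * f * e + x * f ^+ 2 + e ^+ 2 * (1 - x)) * v.
    rewrite uE vE; ring.
  by rewrite subr_ge0.
have -> : u0 ^+ 2 / a + 2 * u0 / a * (u - u0) - u0 ^+ 2 / a ^+ 2 * (v - a) = a * (f ^+ 2 + 2 * f * e + x * f ^+ 2).
  by rewrite uE vE u0E; field.
have -> : (3 * a)^-1 * (u - u0) ^+ 2 = a * (z ^+ 2 / 3) by rewrite /z; field.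
have -> : 2 / 3 * (u0 ^+ 2 / a ^+ 3) * (v - a) ^+ 2 = a * (2 / 3 * f ^+ 2 * x ^+ 2) by rewrite /f /x; field.
rewrite -mulrDr -mulrBr; split; apply: le_trans key; rewrite ler_pM2l //.
  by rewrite lerDl mulr_ge0 ?sqr_ge0 //; lra.
have zE : z = e + f * x by rewrite /e; ring.
have h1 : e ^+ 2 * (2 / 3) <= e ^+ 2 * (1 - x) by apply: ler_wpM2l; [exact: sqr_ge0|lra].
have h2 : z ^+ 2 <= 2 * e ^+ 2 + 2 * f ^+ 2 * x ^+ 2.
  have : 0 <= (e - f * x) ^+ 2 by exact: sqr_ge0.
  rewrite zE; lra.
lra.
Qed.

Variables (I : Type) (p : fd R I) (L : I -> S -> R).
Hypothesis chP : channel p L.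
Hypothesis L43 : forall i s, L i s <= 4 / 3.
Let pP : isprob p. Proof. by case: chP. Qed.
Let L0 i : nn (L i). Proof. by case: chP. Qed.

Definition gch s t := ex p (fun i => L i s * L i t) - 1.

Lemma ex_sqr_AL W : ex p (fun i => (A mu (wmul W (L i)) - A mu W) ^+ 2) = DE mu W gch.
Proof.
rewrite (eq_ex _ (fun i => congr1 (fun x => x ^+ 2) (A_sub1 mu W (L i)))).
rewrite (quad mu p (fun i s => L i s - 1)); congr DE; apply/funext => s; apply/funext => t.
by rewrite (ex_L1L1 chP).
Qed.

Lemma DE_wmul W F f : DE mu (wmul W F) f = DE mu W (fun s t => F s * F t * f s t).
Proof.
rewrite /DE; apply: eq_ex => s; rewrite /wmul -[LHS]mulrA -[in LHS]exZ; congr (_ * _).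
by apply: eq_ex => t; ring.
Qed.

Variables (J : Type) (q : fd R J) (F : J -> S -> R).
Hypothesis qP : isprob q.
Definition fq s t := ex q (fun l => F l s * F l t).
(** [A W] times the mean square of the posterior means of the family [F]; for characters, an even
    overlap moment. *)
Definition family_energy W := DE mu W fq / A mu W.

Lemma ex_DE W h : ex q (fun l => DE mu W (h l)) = DE mu W (fun s t => ex q (fun l => h l s t)).
Proof.
rewrite /DE ex_exchange; apply: eq_ex => s; rewrite exZ; congr (_ * _).
by rewrite ex_exchange; apply: eq_ex => t; rewrite exZ.
Qed.

(** Convexity of [u^2 / v] gives monotonicity. The quantitative version gains from the correlation
    of the factor with [F] and loses through the fluctuation of the normalisation [A], a term
    governed by the mean of [gch]. *)
Lemma Tr_family_energy W : nn W -> 0 < A mu W -> family_energy W <= Tr p L family_energy W /\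
  family_energy W + DE mu W (fun s t => gch s t * fq s t) / (3 * A mu W)
    - 2 / 3 * (DE mu W fq / A mu W ^+ 3) * DE mu W gch <= Tr p L family_energy W.
Proof.
move=> w a0; set a := A mu W in a0 *.
pose u0 l := A mu (wmul W (F l)).
pose u i l := A mu (wmul (wmul W (L i)) (F l)).
pose v i := A mu (wmul W (L i)).
have an := lt0r_neq0 a0.
have wl i : nn (wmul W (L i)) by exact: nn_wmul.
have TE : Tr p L family_energy W = ex q (fun l => ex p (fun i => u i l ^+ 2 / v i)).
  rewrite ex_exchange; apply: eq_ex => i; rewrite /family_energy exZr; congr (_ / _).
  by rewrite /u quad.
have QE : family_energy W = ex q (fun l => u0 l ^+ 2 / a) by rewrite exZr /family_energy /u0 quad.
have Ev : ex p (fun i => v i - a) = 0 by rewrite exB (ex_AL mu chP) (ex_cst pP) subrr.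
have Eu l : ex p (fun i => u i l - u0 l) = 0.
  rewrite exB (ex_cst pP) /u0 -[X in _ - X](ex_AL mu chP) -exB.
  by under eq_ex => i do rewrite /u wmulAC subrr; rewrite ex0.
have vb i : 0 <= v i <= 4 / 3 * a.
  rewrite A_ge0 //= /v /a /A -exZ; apply: ex_le => // s; rewrite /wmul [leRHS]mulrC.
  exact: ler_wpM2l.
have vu i l : v i = 0 -> u i l = 0 by move=> h; rewrite /u A_null.
rewrite TE QE; split.
  apply: ex_le => // l.
  apply: le_trans (_ : ex p (fun i => u0 l ^+ 2 / a + 2 * u0 l / a * (u i l - u0 l) - u0 l ^+ 2 / a ^+ 2 * (v i - a)) <= _).
    by rewrite exB exD !exZ (ex_cst pP) Ev Eu !mulr0 addr0 subr0.
  by apply: ex_le => // i; case: (sq_div_ge (u0 l) a0 (vb i) (vu i l)).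
have sE l : ex p (fun i => (u i l - u0 l) ^+ 2) = DE mu W (fun s t => F l s * F l t * gch s t).
  rewrite -DE_wmul -ex_sqr_AL; apply: eq_ex => i; by rewrite /u wmulAC.
have -> : DE mu W (fun s t => gch s t * fq s t) = ex q (fun l => ex p (fun i => (u i l - u0 l) ^+ 2)).
  rewrite (eq_ex _ sE) ex_DE; congr DE; apply/funext => s; apply/funext => t.
  by rewrite exZr mulrC.
have -> : DE mu W fq = ex q (fun l => u0 l ^+ 2) by rewrite /u0 quad.
rewrite -ex_sqr_AL -/a.
apply: le_trans (_ : ex q (fun l => u0 l ^+ 2 / a + (3 * a)^-1 * ex p (fun i => (u i l - u0 l) ^+ 2)
   - 2 / 3 * (u0 l ^+ 2 / a ^+ 3) * ex p (fun i => (v i - a) ^+ 2)) <= _).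
  rewrite exB exD [ex q (fun l => (3 * a)^-1 * _)]exZ.
  rewrite [ex q (fun l => 2 / 3 * _ * _)]exZr [ex q (fun l => 2 / 3 * _)]exZ.
  by rewrite [ex q (fun l => u0 l ^+ 2 / a ^+ 3)]exZr [X in _ + X - _]mulrC.
apply: ex_le => // l.
apply: le_trans (_ : ex p (fun i => u0 l ^+ 2 / a + 2 * u0 l / a * (u i l - u0 l) - u0 l ^+ 2 / a ^+ 2 * (v i - a)
    + (3 * a)^-1 * (u i l - u0 l) ^+ 2 - 2 / 3 * (u0 l ^+ 2 / a ^+ 3) * (v i - a) ^+ 2) <= _).
  by rewrite exB exD exB exD !exZ (ex_cst pP) Ev Eu !mulr0 addr0 subr0.
by apply: ex_le => // i; case: (sq_div_ge (u0 l) a0 (vb i) (vu i l)).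
Qed.

End CovarianceGrowth.

(** * Exponential decay of large overlaps in the planted model *)

Section OverlapTail.
Variables (R : realType) (k : nat).
Hypothesis k3 : (3 <= k)%N.
Let kp : 0 < k%:R :> R. Proof. by rewrite ltr0n; case: k k3. Qed.

(** With [chi] below, the constants of [clo r^2 <= gk r <= chi r^2] on [[-1, 1]]. *)
Definition clo : R := (Kk R k ^+ 2)^-1.
Definition chi : R := 'C(k, 2)%:R * 2 ^+ k / Kk R k ^+ 2.

Lemma clo_gt0 : 0 < clo. Proof. by rewrite invr_gt0 exprn_gt0 // Kk_gt0. Qed.
Lemma chi_gt0 : 0 < chi.
Proof.
rewrite /chi; apply: divr_gt0; last by rewrite exprn_gt0 // Kk_gt0.
by apply: mulr_gt0; [rewrite ltr0n bin_gt0 ltnW|rewrite exprn_gt0].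
Qed.

Lemma gk_le_chi r : -1 <= r <= 1 -> gk k r <= chi * r ^+ 2.
Proof.
move=> r1; have r1' : `|r| <= 1 by rewrite ler_norml.
have := @ek_le R k r 1 _ r1'; rewrite ler01 lexx => /(_ isT) h.
rewrite /gk /chi mulrAC; apply: ler_wpM2r; first by rewrite invr_ge0 sqr_ge0.
have e : 1 + 1 = 2 :> R by ring.
rewrite e in h; lra.
Qed.

Definition Qr n r W := DE (spins R n) W (fun s t => ov R n s t ^+ (2 * r)) / A (spins R n) W.

Section Growth.
Variables (n r : nat) (eps : R).
Hypotheses (n0 : (0 < n)%N) (e0 : 0 < eps).
Let mu := spins R n.
Let muP : isprob mu. Proof. exact: isprob_spins. Qed.
Let ch := channel_cl R k3 n0.
Notation T := (Tr (iid (lits R n) k) (@Lcl R k)).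
Let kap := clo * eps ^+ 2 / 6.
Let eps' := clo * eps ^+ 2 / (4 * chi).
Let c0 := clo_gt0.
Let h0 := chi_gt0.
Let kap0 : 0 < kap. Proof. by rewrite /kap divr_gt0 // mulr_gt0 // exprn_gt0. Qed.

Lemma ov2r_ge0 s t j : 0 <= ov R n s t ^+ (2 * j).
Proof. by rewrite exprM exprn_ge0 // sqr_ge0. Qed.

Lemma ov2r_le1 s t j : ov R n s t ^+ (2 * j) <= 1.
Proof.
rewrite exprM; apply: exprn_ile1; first exact: sqr_ge0.
have := ov_le1 R n0 s t; rewrite -ler_norml => h.
by rewrite -[_ ^+ 2]real_normK ?num_real // exprn_ile1.
Qed.

Lemma Qr_bounds W : nn W -> 0 <= Qr n r W <= A mu W.
Proof.
move=> w; have a0 := A_ge0 muP w.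
rewrite /Qr divr_ge0 //=; last by apply: (DE_ge0 muP) => // s t; exact: ov2r_ge0.
have [az|an] := eqVneq (A mu W) 0; first by rewrite -/mu az invr0 mulr0.
rewrite ler_pdivrMr; last by rewrite lt_def an.
by rewrite -expr2 -(DE1 mu); apply: (DE_le muP) => // s t; exact: ov2r_le1.
Qed.

(** Overlaps above [eps] gain the relative rate [clo eps^2 / 3 = 2 kap]. When the mean squared
    overlap is below [eps'], the normalisation loses at most the rate [kap]; this fixes [eps'].
    Otherwise monotonicity is used and the event is paid for. *)
Lemma Qr_step W : nn W -> (1 + kap) * Qr n r W +
    (- kap * (2 * eps ^+ (2 * r) * A mu W + A mu W * (big_overlap n eps' W)%:R)) <= T (Qr n r) W.
Proof.
move=> w; have aw := A_ge0 muP w; have /andP[Q0 Q1] := Qr_bounds w.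
have T0 : 0 <= T (Qr n r) W.
  by case: ch => pP L0 _; apply: ex_ge0 => // c; case/andP: (Qr_bounds (nn_wmul w (L0 c))).
have [az|an] := eqVneq (A mu W) 0.
  have -> : Qr n r W = 0 by rewrite /Qr -/mu az invr0 mulr0.
  by rewrite az mulr0 mul0r addr0 !mulr0 addr0.
have ap : 0 < A mu W by rewrite lt_def an.
have er : 0 <= eps ^+ (2 * r) by rewrite exprn_ge0 // ltW.
have vP := isprob_iid (2 * r) (isprob_vars R n0).
pose F (l : seq nat) (s : nat -> bool) : R := \prod_(v <- l) spin R (s v).
have fE : fq (iid (vars R n) (2 * r)) F = fun s t => ov R n s t ^+ (2 * r).
  by apply/funext => s; apply/funext => t; rewrite /fq ex_chars.
have [t1 t2] := Tr_family_energy muP ch (Lcl43 R k3) F vP w ap.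
rewrite /family_energy fE -/(Qr n r) in t1 t2.
case: (boolP (big_overlap n eps' W)) => [_|nb].
  apply: le_trans t1; rewrite mulr1.
  have := ler_wpM2l (ltW kap0) Q1.
  have : 0 <= kap * (2 * eps ^+ (2 * r) * A mu W) by rewrite !mulr_ge0 // ltW.
  rewrite -/(Qr n r W); lra.
apply: le_trans t2; rewrite mulr0 addr0.
set D := DE _ W (fun s t => ov R n s t ^+ (2 * r)); set a := A mu W in ap an *.
have D0 : 0 <= D by apply: (DE_ge0 muP) => // s t; exact: ov2r_ge0.
have g1 : DE mu W (gch (iid (lits R n) k) (@Lcl R k)) <= clo * eps ^+ 2 / 4 * a ^+ 2.
  apply: le_trans (_ : chi * DE mu W (fun s t => ov R n s t ^+ 2) <= _).
    rewrite -DEZ; apply: (DE_le muP) => // s t; rewrite /gch ex_Lcl2 // addrAC subrr add0r.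
    by apply: gk_le_chi; exact: ov_le1.
  move: nb; rewrite /big_overlap -ltNge -/mu -/a => nb.
  apply: le_trans (ler_wpM2l (ltW h0) (ltW nb)) _.
  rewrite /eps' le_eqVlt; apply/orP; left; apply/eqP; field; exact: lt0r_neq0.
have g2 : clo * eps ^+ 2 * (D - eps ^+ (2 * r) * a ^+ 2) <=
    DE mu W (fun s t => gch (iid (lits R n) k) (@Lcl R k) s t * ov R n s t ^+ (2 * r)).
  rewrite /D /a -(DE1 mu W) -DEZ -DEB -DEZ; apply: (DE_le muP) => // s t.
  rewrite mulr1 /gch ex_Lcl2 // [1 + _]addrC addrK.
  have o1 := ov_le1 R n0 s t; have o2 := ov2r_ge0 s t r.
  apply: le_trans (_ : clo * ov R n s t ^+ 2 * ov R n s t ^+ (2 * r) <= _); last first.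
    by apply: ler_wpM2r => //; rewrite mulrC; exact: gk_ge.
  rewrite -[leLHS]mulrA -[leRHS]mulrA; apply: ler_wpM2l; first exact: ltW.
  have [le|lt] := lerP (eps ^+ 2) (ov R n s t ^+ 2).
    apply: le_trans (_ : eps ^+ 2 * ov R n s t ^+ (2 * r) <= _); last exact: ler_wpM2r.
    by apply: ler_wpM2l; [exact: sqr_ge0|lra].
  apply: le_trans (_ : 0 <= _); last by rewrite mulr_ge0 // sqr_ge0.
  rewrite pmulr_rle0 ?exprn_gt0 // subr_le0.
  by rewrite !exprM lerXn2r ?nnegrE ?sqr_ge0 // ltW.
have QE : Qr n r W = D / a by [].
rewrite QE.
have h1 : clo * eps ^+ 2 * (D - eps ^+ (2 * r) * a ^+ 2) / (3 * a) <=
   DE mu W (fun s t => gch (iid (lits R n) k) (@Lcl R k) s t * ov R n s t ^+ (2 * r)) / (3 * a).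
  by rewrite ler_pM2r // invr_gt0 mulr_gt0.
have h2 : 2 / 3 * (D / a ^+ 3) * DE mu W (gch (iid (lits R n) k) (@Lcl R k)) <=
   2 / 3 * (D / a ^+ 3) * (clo * eps ^+ 2 / 4 * a ^+ 2).
  apply: ler_wpM2l => //; apply: mulr_ge0; first by apply: divr_ge0.
  by apply: divr_ge0 => //; exact: exprn_ge0.
have e1 : clo * eps ^+ 2 * (D - eps ^+ (2 * r) * a ^+ 2) / (3 * a) = 2 * kap * (D / a) - 2 * kap * eps ^+ (2 * r) * a.
  rewrite /kap; field; exact: an.
have e2 : 2 / 3 * (D / a ^+ 3) * (clo * eps ^+ 2 / 4 * a ^+ 2) = kap * (D / a).
  rewrite /kap; field; exact: an.
rewrite e1 in h1; rewrite e2 in h2.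
lra.
Qed.

Lemma Em_A j : Em k n j (A mu) = 1.
Proof. by rewrite /Em (iterTr_A mu ch) A1. Qed.

Lemma Em_le j (Phi Psi : ((nat -> bool) -> R) -> R) : (forall W, nn W -> Phi W <= Psi W) -> Em k n j Phi <= Em k n j Psi.
Proof. by move=> h; apply: (iterTr_le ch) => // s; exact: ler01. Qed.

(** [Qr] is at most [A], so its mean stays below one even after [j] more clauses. Since each clause
    multiplies the excess over the error terms by [1 + kap], that excess was at most
    [(1 + kap)^-j]. *)
Lemma Em_Qr m j pp : 0 <= pp -> (forall i, (i < j)%N -> Em k n (m + i) (fun W => A mu W * (big_overlap n eps' W)%:R) <= pp) ->
  Em k n m (Qr n r) <= 2 * eps ^+ (2 * r) + pp + (1 + kap) ^- j.
Proof.
move=> pp0 hp; set b := 2 * eps ^+ (2 * r) + pp.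
have k1 : 0 < 1 + kap by rewrite addr_gt0.
have grow i : (i <= j)%N -> (1 + kap) ^+ i * (Em k n m (Qr n r) - b) <= Em k n (m + i) (Qr n r) - b.
  elim: i => [|i IH] ij; first by rewrite mul1r addn0.
  rewrite exprS -mulrA; apply: le_trans (ler_wpM2l (ltW k1) (IH (ltnW ij))) _.
  have st : Em k n (m + i) (fun W => (1 + kap) * Qr n r W +
    (- kap * (2 * eps ^+ (2 * r) * A mu W + A mu W * (big_overlap n eps' W)%:R))) <= Em k n (m + i.+1) (Qr n r).
    by rewrite addnS /Em iterSr; apply: (iterTr_le ch) => [s|V v]; [exact: ler01|exact: Qr_step].
  rewrite /Em iterTrD !iterTrZ iterTrD iterTrZ -!/(Em _ _ _ _) Em_A mulr1 in st.
  have := ler_wpM2l (ltW kap0) (hp i ij); rewrite /b; lra.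
have := grow j (leqnn _).
have : Em k n (m + j) (Qr n r) <= 1.
  by rewrite -(Em_A (m + j)); apply: Em_le => W w; case/andP: (Qr_bounds w).
have [b0|b0] := leP b (Em k n m (Qr n r)); last first.
  by move=> _ _; apply: le_trans (ltW b0) _; rewrite lerDl invr_ge0; apply: exprn_ge0; exact: ltW.
move=> h1 h2; rewrite -lerBlDl -[leRHS]mul1r ler_pdivlMr ?exprn_gt0 // mulrC.
apply: le_trans h2 _.
have : 0 <= b by rewrite addr_ge0 // mulr_ge0 // exprn_ge0 // ltW.
lra.
Qed.

End Growth.

Lemma quarter_le_expRN1 : (4^-1 : R) <= expR (-1).
Proof.
have h := expR_ge1Dx (- (1 / 2) : R).
have -> : expR (-1) = expR (- (1 / 2)) ^+ 2 :> R.
  by rewrite -expRM_natr; congr expR; field.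
have : (1 / 2 : R) ^+ 2 <= expR (- (1 / 2)) ^+ 2 by rewrite lerXn2r ?nnegrE ?expR_ge0 //; lra.
by apply: le_trans; rewrite le_eqVlt; apply/orP; left; apply/eqP; field.
Qed.

(** Markov's inequality for an overlap moment of order proportional to [n]. With [eps = del / 2] the
    first error of [Em_Qr] becomes [4^-r] after division by [del^(2 r)]. *)
Lemma Em_overlap_tail (d del : R) : 0 < d -> (d%:E < dcond R k)%E -> 0 < del < 1 ->
  exists2 c, 0 < c & exists N, forall n m, (N <= n)%N -> m%:R <= d * n%:R / k%:R ->
    Em k n m (fun W => DE (spins R n) W (fun s t => (del < `|ov R n s t|)%R%:R) / A (spins R n) W) <=
    11 * expR (- (c * n%:R)).
Proof.
move=> d0 dc /andP[e0 e1].
pose eps := del / 2; have eps0 : 0 < eps by apply: divr_gt0.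
pose kap : R := clo * eps ^+ 2 / 6; pose eps' : R := clo * eps ^+ 2 / (4 * chi).
have c0 := clo_gt0; have h0 := chi_gt0.
have kap0 : 0 < kap by apply: divr_gt0 => //; apply: mulr_gt0 => //; exact: exprn_gt0.
have eps'0 : 0 < eps'.
  by apply: divr_gt0; [apply: mulr_gt0 => //; exact: exprn_gt0|apply: mulr_gt0].
have [d' dd' dc'] := dcond_room dc; have d'0 : 0 < d' := lt_trans d0 dd'.
have [c1 c10 [N1 hN1]] := Em_big_overlap k3 d'0 dc' eps'0.
pose eta := (d' - d) / (2 * k%:R).
have eta0 : 0 < eta by apply: divr_gt0; [rewrite subr_gt0|apply: mulr_gt0].
have etaE : eta = (d' - d) / (2 * k%:R) by [].
clearbody eta.
pose l := ln (1 + kap); have l0 : 0 < l by rewrite ln_gt0 // ltrDl.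
have lE : expR l = 1 + kap by rewrite lnK // posrE addr_gt0.
pose LL := - ln del; have LL0 : 0 < LL by rewrite oppr_gt0 ln_lt0 // e0.
have LE : expR (- LL) = del by rewrite opprK lnK ?posrE.
(* With [r] close to [rho n], dividing by [del^(2 r)] costs [expR (2 rho LL n)]; [rho] is so small
   that this uses up at most half of each of the two exponential rates. *)
have [rho rho0 [r1 r2]] : exists2 rho, 0 < rho & 2 * rho * LL <= c1 / 2 /\ 2 * rho * LL <= eta * l / 2.
  exists (Num.min (c1 / 2) (eta * l / 2) / (2 * LL)).
    by rewrite divr_gt0 ?mulr_gt0 // lt_min !divr_gt0 // mulr_gt0.
  have -> : 2 * (Num.min (c1 / 2) (eta * l / 2) / (2 * LL)) * LL = Num.min (c1 / 2) (eta * l / 2).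
    by field; exact: lt0r_neq0.
  by rewrite !ge_min !lexx orbT.
pose c := Num.min rho (Num.min (c1 / 2) (eta * l / 2)).
have cr : c <= rho by rewrite /c ge_min lexx.
have cc1 : c <= c1 / 2 by rewrite /c !ge_min lexx orbT.
have cel : c <= eta * l / 2 by rewrite /c !ge_min lexx !orbT.
exists c; first by rewrite /c !lt_min rho0 !divr_gt0 // mulr_gt0.
have [N2 hN2] := big_enough 1 eta0.
exists (N1 + N2).+1 => n m nN md.
have n0 : (0 < n)%N by apply: leq_ltn_trans nN.
have nN1 : (N1 <= n)%N by rewrite (leq_trans _ nN) // ltnW // ltnS leq_addr.
have nN2 : (N2 <= n)%N by rewrite (leq_trans _ nN) // ltnW // ltnS leq_addl.
have nr : 0 <= n%:R :> R by [].
have [j j1 j2] : exists2 j : nat, j%:R <= 2 * eta * n%:R & eta * n%:R <= j%:R.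
  have [|j h1 h2] := @nat_trunc R (2 * eta * n%:R).
    by apply: mulr_ge0 => //; apply: mulr_ge0 => //; exact: ltW.
  by exists j => //; have := hN2 n nN2; lra.
have [|r rn nr1] := @nat_trunc R (rho * n%:R); first by apply: mulr_ge0 => //; exact: ltW.
have muP := isprob_spins R n; set mu := spins R n in muP *.
set pp := 2 * expR (- (c1 * n%:R)).
have pp0 : 0 <= pp by rewrite /pp mulr_ge0 // expR_ge0.
have hQ : Em k n m (Qr n r) <= 2 * eps ^+ (2 * r) + pp + (1 + kap) ^- j.
  apply: (@Em_Qr n r eps n0 eps0 m j pp pp0) => i ij; apply: hN1 => //.
  rewrite natrD; apply: le_trans (_ : d * n%:R / k%:R + 2 * eta * n%:R <= _).
    by apply: lerD => //; apply: le_trans j1; rewrite ler_nat ltnW.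
  by rewrite etaE le_eqVlt; apply/orP; left; apply/eqP; field; rewrite lt0r_neq0.
have dr0 : 0 < del ^+ (2 * r) by rewrite exprn_gt0.
have mk : Em k n m (fun W => del ^+ (2 * r) * (DE mu W (fun s t => (del < `|ov R n s t|)%R%:R) / A mu W)) <= Em k n m (Qr n r).
  apply: (Em_le n0) => W w; rewrite mulrA /Qr; apply: ler_wpM2r; first by rewrite invr_ge0 (A_ge0 muP).
  rewrite -DEZ; apply: (DE_le muP) => // s t; case: ltP => [h|_]; last by rewrite mulr0 exprM exprn_ge0 // sqr_ge0.
  rewrite mulr1 !exprM; apply: lerXn2r; rewrite ?nnegrE ?sqr_ge0 //.
  by rewrite -[leRHS]real_normK ?num_real // lerXn2r ?nnegrE ?(ltW h) // ltW.
rewrite /Em iterTrZ -/(Em _ _ _ _) in mk.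
set E := Em k n m (fun W => _ / A mu W) in mk *.
have {}mk := le_trans mk hQ.
have h1 : E <= 2 * (1 / 4) ^+ r + expR (2 * rho * LL * n%:R) * (pp + (1 + kap) ^- j).
  have dV : (del ^+ (2 * r))^-1 <= expR (2 * rho * LL * n%:R).
    rewrite -LE -expRM_natr -expRN ler_expR natrM.
    have := ler_wpM2r (ltW LL0) rn; lra.
  have -> : E = (del ^+ (2 * r))^-1 * (del ^+ (2 * r) * E) by rewrite mulKf // lt0r_neq0.
  apply: le_trans (ler_wpM2l (ltW _) mk) _; first by rewrite invr_gt0.
  rewrite -addrA mulrDr; apply: lerD.
    rewrite mulrCA ler_pM2l // mulrC -expr_div_n /eps.
    have -> : del / 2 / del = 1 / 2 by field; exact: lt0r_neq0.
    by rewrite exprM; have -> : (1 / 2) ^+ 2 = 1 / 4 :> R by field.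
  by apply: ler_wpM2r => //; rewrite addr_ge0 // invr_ge0 exprn_ge0 // addr_ge0 // ltW.
apply: le_trans h1 _.
have q4 : (1 / 4) ^+ r <= expR (- r%:R) :> R.
  rewrite -mulN1r expRM_natr; apply: lerXn2r; rewrite ?nnegrE ?expR_ge0 //.
  by rewrite mul1r quarter_le_expRN1.
have e3 : expR (- r%:R) <= 4 * expR (- (c * n%:R)) :> R.
  apply: le_trans (_ : expR (1 - c * n%:R) <= _).
    by rewrite ler_expR; have := ler_wpM2r nr cr; lra.
  rewrite expRD; apply: ler_wpM2r; [exact: expR_ge0|].
  rewrite -[4]invrK -[expR 1]invrK -expRN lef_pV2 ?posrE ?invr_gt0 ?expR_gt0 //.
  exact: quarter_le_expRN1.
have t2 : expR (2 * rho * LL * n%:R) * pp <= 2 * expR (- (c * n%:R)).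
  rewrite /pp mulrCA ler_pM2l // -expRD ler_expR.
  have := ler_wpM2r nr r1; have := ler_wpM2r nr cc1; lra.
have t3 : expR (2 * rho * LL * n%:R) * (1 + kap) ^- j <= expR (- (c * n%:R)).
  rewrite -lE -expRM_natr -expRN -expRD ler_expR.
  have := ler_wpM2r nr r2; have := ler_wpM2r nr cel; have := ler_wpM2r (ltW l0) j2; lra.
rewrite mulrDr; lra.
Qed.

End OverlapTail.

(** * Third-order bounds on the logarithm *)

Section LogBounds.
Variable R : realType.

Lemma mono_pos (f df : R -> R) : (forall x : R, 0 < x -> is_derive x 1 f (df x)) ->
  (forall x, 0 < x -> 0 <= df x) -> forall x y : R, 0 < x -> x <= y -> f x <= f y.
Proof.
move=> h d0 x y x0 xy; have x2 : 0 < x / 2 by apply: divr_gt0.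
apply: (@ger0_derive1_ndecr _ f (x / 2) y) => //; last by lra.
- by move=> z; rewrite in_itv /= => /andP[z1 _]; have [] := h z (lt_trans x2 z1).
- move=> z; rewrite in_itv /= => /andP[z1 _]; have z0 := lt_trans x2 z1.
  by rewrite derive1E (@derive_val _ _ _ _ _ _ _ (h z z0)); exact: d0.
apply: derivable_within_continuous => z; rewrite in_itv /= => /andP[z1 _].
by have [] := h z (lt_le_trans x2 z1).
Qed.

Lemma mono_at1 (f df : R -> R) : (forall x : R, 0 < x -> is_derive x 1 f (df x)) ->
  (forall x, 0 < x -> 0 <= df x) -> f 1 = 0 ->
  forall x : R, 0 < x -> (1 <= x -> 0 <= f x) /\ (x <= 1 -> f x <= 0).
Proof.
move=> h d0 f1 x x0; split=> x1; rewrite -f1; exact: (mono_pos h d0).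
Qed.

Lemma is_derive_shiftV (c x : R) : x + c != 0 ->
  is_derive x 1 (fun y : R => (y + c)^-1) (- (x + c) ^- 2).
Proof.
move=> xc; have dxc : is_derive x 1 (fun y : R => y + c) 1.
  by apply: (is_derive_eq (is_deriveD (is_derive_id x 1) (is_derive_cst c x 1))); rewrite addr0.
have [d1 d2] := dxc; apply: DeriveDef; first exact: derivableV.
by rewrite deriveV // d2 /GRing.scale /= mulr1.
Qed.

(** The difference of the two sides vanishes at 1 and has derivative [(1 - 1 / x)^2]. *)
Lemma ln_sym (v : R) : 0 < v ->
  (1 <= v -> 2 * ln v <= v - v^-1) /\ (v <= 1 -> v - v^-1 <= 2 * ln v).
Proof.
move=> v0; have := @mono_at1 (fun x => x - x^-1 - 2 * ln x) (fun x => 1 + x ^- 2 - 2 * x^-1) _ _ _ v v0.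
case=> [x x0|x x0||h1 h2].
- have xn : x + 0 != 0 by rewrite addr0 lt0r_neq0.
  have h := is_deriveB (is_deriveB (is_derive_id x 1) (is_derive_shiftV xn)) (is_deriveZ 2 (is_derive1_ln x0)).
  have E : (fun x : R => x - x^-1 - 2 * ln x) = (id - (fun y => (y + 0)^-1)) - 2 \*: (@ln R).
    apply/funext => y; have yE : (y + 0)^-1 = y^-1 by rewrite addr0.
    by rewrite -yE.
  rewrite E.
  by apply: (is_derive_eq h); rewrite addr0 opprK.
- have -> : 1 + x ^- 2 - 2 * x^-1 = (1 - x^-1) ^+ 2.
    by field; exact: lt0r_neq0.
  exact: sqr_ge0.
- by rewrite ln1 invr1; ring.
by split=> x1; [have := h1 x1|have := h2 x1]; lra.
Qed.

(** The bound [2 - 4 / (v + 1)] is [2 (v - 1) / (v + 1)], the first Pade approximant of the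
    logarithm at 1, accurate enough to leave a cubic error in [Lambda]. *)
Lemma ln_pade (v : R) : 0 < v ->
  (1 <= v -> 2 - 4 / (v + 1) <= ln v) /\ (v <= 1 -> ln v <= 2 - 4 / (v + 1)).
Proof.
move=> v0; have := @mono_at1 (fun x => ln x + 4 * (x + 1)^-1 - 2) (fun x => x^-1 - 4 * (x + 1) ^- 2) _ _ _ v v0.
case=> [x x0|x x0||h1 h2].
- have xn : x + 1 != 0 by rewrite lt0r_neq0 // addr_gt0.
  have h := is_deriveB (is_deriveD (is_derive1_ln x0) (is_deriveZ 4 (is_derive_shiftV xn))) (is_derive_cst (2 : R) x 1).
  have E : (fun x : R => ln x + 4 * (x + 1)^-1 - 2) = ((@ln R) + 4 \*: (fun y => (y + 1)^-1)) - cst 2 by [].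
  rewrite E.
  by apply: (is_derive_eq h); rewrite subr0 /GRing.scale /= mulrN.
- have x1 : 0 < x + 1 by rewrite addr_gt0.
  have -> : x^-1 - 4 * (x + 1) ^- 2 = (x - 1) ^+ 2 / (x * (x + 1) ^+ 2).
    by field; rewrite !lt0r_neq0.
  by rewrite divr_ge0 ?sqr_ge0 // mulr_ge0 ?sqr_ge0 // ltW.
- by rewrite ln1; field.
by split=> x1; [have := h1 x1|have := h2 x1]; lra.
Qed.

Lemma Lambda_taylor_ge (y : R) : -1 <= y -> y + y ^+ 2 / 2 - `|y| ^+ 3 <= Lambda (1 + y).
Proof.
move=> y1; have [->|yn] := eqVneq y (-1).
  rewrite subrr LambdaE mul0r normrN1 expr1n sqrrN expr1n; lra.
have v0 : 0 < 1 + y by rewrite -[ltLHS](subrr 1) ltrD2l lt_def yn.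
have vn := lt0r_neq0 v0; rewrite LambdaE.
have [y0|y0] := leP 0 y.
  have [+ _] := ln_pade v0; rewrite lerDl => /(_ y0) /(ler_wpM2l (ltW v0)); apply: le_trans.
  have w0 : 0 < 1 + y + 1 by lra.
  have -> : (1 + y) * (2 - 4 / (1 + y + 1)) = y + y ^+ 2 / 2 - y ^+ 3 / (2 * (1 + y + 1)).
    by field; exact: lt0r_neq0.
  rewrite ger0_norm // lerD2l lerN2 ler_pdivrMr ?mulr_gt0 //.
  have : 0 <= y ^+ 3 * (2 * (1 + y + 1) - 1) by rewrite mulr_ge0 ?exprn_ge0 //; lra.
  lra.
have [_ +] := ln_sym v0; have yl : 1 + y <= 1 by lra.
move=> /(_ yl) /(ler_wpM2l (ltW v0)); rewrite mulrBr divff //.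
have : 0 <= `|y| ^+ 3 by rewrite exprn_ge0.
have -> : (1 + y) * (1 + y) - 1 = 2 * (y + y ^+ 2 / 2) by field.
lra.
Qed.

Lemma Lambda_taylor_le (y : R) : -1 <= y -> Lambda (1 + y) <= y + y ^+ 2 / 2 + `|y| ^+ 3.
Proof.
move=> y1; have [->|yn] := eqVneq y (-1).
  rewrite subrr LambdaE mul0r normrN1 expr1n sqrrN expr1n; lra.
have v0 : 0 < 1 + y by rewrite -[ltLHS](subrr 1) ltrD2l lt_def yn.
have vn := lt0r_neq0 v0; rewrite LambdaE.
have ny : 0 <= `|y| ^+ 3 by rewrite exprn_ge0.
have [y0|y0] := leP 0 y.
  have [+ _] := ln_sym v0; rewrite lerDl => /(_ y0) /(ler_wpM2l (ltW v0)).
  rewrite mulrBr divff //.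
  have -> : (1 + y) * (1 + y) - 1 = 2 * (y + y ^+ 2 / 2) by field.
  lra.
have [_ +] := ln_pade v0; have yl : 1 + y <= 1 by lra.
move=> /(_ yl) /(ler_wpM2l (ltW v0)) h; apply: le_trans h _.
have w0 : 0 < 1 + y + 1 by lra.
have -> : (1 + y) * (2 - 4 / (1 + y + 1)) = y + y ^+ 2 / 2 + (- y) ^+ 3 / (2 * (1 + y + 1)).
  by field; exact: lt0r_neq0.
rewrite ltr0_norm // lerD2l ler_pdivrMr ?mulr_gt0 //.
have : 0 <= (- y) ^+ 3 * (2 * (1 + y + 1) - 1) by rewrite mulr_ge0 ?exprn_ge0 //; lra.
lra.
Qed.

Lemma cosh_ge (z : R) : 0 <= z -> 1 + z ^+ 2 / 2 <= (expR z + expR (- z)) / 2.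
Proof.
move=> z0; set w := expR (z / 2); have w0 : 0 < w := expR_gt0 _.
have w1 : 1 <= w by rewrite -[leLHS]expR0 ler_expR divr_ge0.
have [+ _] := ln_sym w0; move=> /(_ w1); rewrite /w expRK -/w => h.
have -> : expR z = w ^+ 2 by rewrite /w -expRM_natr; congr expR; field.
have -> : expR (- z) = w^-1 ^+ 2 by rewrite /w -expRN -expRM_natr; congr expR; field.
have : (2 * (z / 2)) ^+ 2 <= (w - w^-1) ^+ 2.
  by rewrite lerXn2r ?nnegrE ?mulr_ge0 ?divr_ge0 //; apply: le_trans h; rewrite mulr_ge0 ?divr_ge0.
have -> : (w - w^-1) ^+ 2 = w ^+ 2 + w^-1 ^+ 2 - 2 by field; exact: lt0r_neq0.
have -> : (2 * (z / 2)) ^+ 2 = z ^+ 2 by field.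
lra.
Qed.

(** Compares second-order coefficients as [t] tends to 0; the variable [t ^+ 2] is the second-moment
    parameter of the two-point laws. *)
Lemma quad_cubic (X Y C : R) : (forall t, 0 < t <= 1 -> X * (t ^+ 2) ^+ 2 <= Y * (t ^+ 2) ^+ 2 + C * (t ^+ 2) ^+ 3) -> X <= Y.
Proof.
move=> h; rewrite leNgt; apply/negP => YX.
have C0 : 0 < C.
  have := h 1; rewrite ltr01 lexx => /(_ isT); rewrite !expr1n; lra.
pose t := Num.min 1 ((X - Y) / (2 * C)).
have x0 : 0 < (X - Y) / (2 * C) by apply: divr_gt0; [rewrite subr_gt0|apply: mulr_gt0].
have t0 : 0 < t by rewrite /t lt_min ltr01 x0.
have t1 : t <= 1 by rewrite /t ge_min lexx.
have tC : t * (2 * C) <= X - Y by rewrite -ler_pdivlMr ?mulr_gt0 // /t ge_min lexx orbT.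
have := h t; rewrite t0 t1 => /(_ isT).
have s0 : 0 < (t ^+ 2) ^+ 2 by rewrite !exprn_gt0.
have s1 : (t ^+ 2) ^+ 3 <= t * (t ^+ 2) ^+ 2.
  rewrite exprS; apply: ler_wpM2r; first exact: ltW.
  by rewrite expr2 ler_piMl // ltW.
have s2 := ler_wpM2r (ltW s0) tC.
have := ler_wpM2l (ltW C0) s1.
have : 0 < C * (t * (t ^+ 2) ^+ 2) by rewrite !mulr_gt0.
lra.
Qed.

End LogBounds.

(** * The Bethe functional at two-point laws near [1 / 2] *)

Section TwoPoint.
Variables (R : realType) (k : nat).
Hypothesis k3 : (3 <= k)%N.
Let q : R := qk R k.
Let q0 : 0 < q. Proof. exact: qk_gt0. Qed.
Let K := Kk R k.
Let K0 : 0 < K. Proof. exact: Kk_gt0. Qed.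
Let u : R := 2 ^- k.-1.
Let qu : q = 1 - u. Proof. by []. Qed.
Let u0 : 0 < u. Proof. by rewrite /u invr_gt0 exprn_gt0. Qed.
Let Ku : K * u = q.
Proof. by rewrite /K /Kk mulrBl mul1r divff // expf_neq0. Qed.

(** Both numbers are 1 up to order [t] and their first-order terms cancel. The constant is written
    [(M - 1) / 2] because [M] is then multiplicative under products. *)
Definition near (t M x y : R) := [/\ `|x - 1| <= (M - 1) / 2 * t, `|y - 1| <= (M - 1) / 2 * t & `|x + y - 2| <= (M - 1) / 2 * t ^+ 2].

Lemma near_mul t M M' x y x' y' : 0 <= t -> 1 <= M -> 1 <= M' -> t <= 1 ->
  near t M x y -> near t M' x' y' -> near t (M * M') (x * x') (y * y').
Proof.
move=> t0 M1 M1' t1 [h1 h2 h3] [h1' h2' h3'].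
set c := (M - 1) / 2 in h1 h2 h3; set c' := (M' - 1) / 2 in h1' h2' h3'.
have c0 : 0 <= c by rewrite /c; lra.
have c0' : 0 <= c' by rewrite /c'; lra.
rewrite /near; have -> : (M * M' - 1) / 2 = c + c' + 2 * (c * c') by rewrite /c /c'; field.
have pr (a b : R) : `|a| <= c * t -> `|b| <= c' * t -> `|a * b| <= c * c' * t ^+ 2.
  move=> ha hb; rewrite normrM; have -> : c * c' * t ^+ 2 = (c * t) * (c' * t) by ring.
  exact: ler_pM.
have tt : t ^+ 2 <= t by rewrite expr2 ler_piMl.
have cc := mulr_ge0 c0 c0'.
have ctt := ler_wpM2l cc tt.
have ct := mulr_ge0 cc t0.
have one (a b : R) : `|a - 1| <= c * t -> `|b - 1| <= c' * t -> `|a * b - 1| <= (c + c' + 2 * (c * c')) * t.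
  move=> ha hb; have -> : a * b - 1 = (a - 1) * (b - 1) + ((a - 1) + (b - 1)) by ring.
  apply: le_trans (ler_normD _ _) _; have := pr _ _ ha hb; have := ler_normD (a - 1) (b - 1); lra.
split; [exact: one|exact: one|].
have -> : x * x' + y * y' - 2 = (x - 1) * (x' - 1) + (y - 1) * (y' - 1) + ((x + y - 2) + (x' + y' - 2)) by ring.
apply: le_trans (ler_normD _ _) _.
have := ler_normD ((x - 1) * (x' - 1)) ((y - 1) * (y' - 1)).
have := pr _ _ h1 h1'; have := pr _ _ h2 h2'; have := ler_normD (x + y - 2) (x' + y' - 2); lra.
Qed.

Section Fixed_t.
Variable t : R.
Hypothesis t01 : 0 < t <= 1.
Let t0 : 0 <= t. Proof. by case/andP: t01 => /ltW. Qed.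
Let t1 : t <= 1. Proof. by case/andP: t01. Qed.
Let s := t ^+ 2.
Let s0 : 0 <= s. Proof. exact: sqr_ge0. Qed.
Let s1 : s <= 1. Proof. by rewrite /s; apply: exprn_ile1. Qed.

Definition tp : fd R R := [:: (2^-1, (1 + t) / 2); (2^-1, (1 - t) / 2)].
Lemma ex_tp f : ex tp f = (f ((1 + t) / 2) + f ((1 - t) / 2)) / 2.
Proof. by rewrite /ex !big_cons big_nil /= addr0; field. Qed.
Lemma isprob_tp : isprob tp.
Proof. by split; [rewrite /= invr_ge0 ler0n|rewrite ex_tp; field]. Qed.
Lemma tp_mean : ex tp id = 2^-1. Proof. by rewrite ex_tp /=; field. Qed.
Definition tpb (x : R) := (x == (1 + t) / 2) || (x == (1 - t) / 2).
Lemma fsupp_tpb : fsupp tpb tp. Proof. by rewrite /fsupp /= /tpb !eqxx orbT. Qed.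
Lemma tpb01 x : tpb x -> 0 <= x <= 1.
Proof. by have h0 := t0; have h1 := t1; case/orP => /eqP ->; apply/andP; split; lra. Qed.
Lemma fsupp_tp01 : fsupp (fun x : R => 0 <= x <= 1) tp.
Proof. by apply: sub_all fsupp_tpb => z; exact: tpb01. Qed.

Lemma near_tpb x : tpb x -> near t 3 (2 * x) (2 * (1 - x)).
Proof.
have tn : `|t| = t by rewrite ger0_norm.
have t2 := sqr_ge0 t.
case/orP => /eqP ->; split.
- by have -> : 2 * ((1 + t) / 2) - 1 = t; [field|rewrite tn; lra].
- by have -> : 2 * (1 - (1 + t) / 2) - 1 = - t; [field|rewrite normrN tn; lra].
- by have -> : 2 * ((1 + t) / 2) + 2 * (1 - (1 + t) / 2) - 2 = 0; [field|rewrite normr0; lra].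
- by have -> : 2 * ((1 - t) / 2) - 1 = - t; [field|rewrite normrN tn; lra].
- by have -> : 2 * (1 - (1 - t) / 2) - 1 = t; [field|rewrite tn; lra].
- by have -> : 2 * ((1 - t) / 2) + 2 * (1 - (1 - t) / 2) - 2 = 0; [field|rewrite normr0; lra].
Qed.

Lemma near_prod l : all tpb l ->
  near t (3 ^+ size l) (2 ^+ size l * \prod_(x <- l) x) (2 ^+ size l * \prod_(x <- l) (1 - x)).
Proof.
elim: l => [|x l IH] /=.
  by move=> _; rewrite !big_nil mulr1 /near !expr0 !subrr !mul0r !normr0; split=> //; rewrite [_ - _](_ : _ = 0) ?normr0 //; ring.
case/andP=> xb /IH {}IH; rewrite !big_cons !exprS.
have -> y P : 2 * 2 ^+ size l * (y * P) = (2 * y) * (2 ^+ size l * P) :> R by ring.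
have -> y P : 2 * 2 ^+ size l * (y * P) = (2 * y) * (2 ^+ size l * P) :> R by ring.
by apply: near_mul => //; [rewrite ler1n|rewrite exprn_ege1 // ler1n|exact: near_tpb].
Qed.

Definition Ck : R := 3 ^+ k.-1.
Let Ck1 : 1 <= Ck. Proof. by rewrite exprn_ege1 // ler1n. Qed.

Lemma near_h l : size l = k.-1 -> all tpb l -> near t Ck (h1 l / q) (h2 l / q).
Proof.
move=> ls lb; have [n1 n2 n3] := near_prod lb; rewrite ls -/Ck in n1 n2 n3.
have qn := lt0r_neq0 q0; have Kn := lt0r_neq0 K0.
have uE P : u * (2 ^+ k.-1 * P) = P by rewrite mulrA /u mulVf ?mul1r // expf_neq0.
set x := 2 ^+ k.-1 * _ in n1 n3; set y := 2 ^+ k.-1 * \prod_(x <- l) (1 - x) in n2 n3.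
have K1 : K^-1 <= 1.
  rewrite invf_le1 // /K /Kk lerBrDr.
  have -> : 1 + 1 = 2 ^+ 1 :> R by rewrite expr1; ring.
  by apply: ler_weXn2l; [rewrite ler1n|case: k k3 => [|[]]].
have sc z B : `|z| <= B -> `|- (z / K)| <= B.
  move=> h; rewrite normrN normrM [`|K^-1|]ger0_norm ?invr_ge0 ?(ltW K0) //.
  by apply: le_trans h; rewrite ler_piMr.
rewrite /h1 /h2 -[\prod_(x <- l) x]uE -[\prod_(x <- l) (1 - x)]uE -/x -/y -Ku.
have e z : (1 - u * z) / (K * u) - 1 = - ((z - 1) / K).
  have un := lt0r_neq0 u0.
  have -> : 1 - u * z = K * u + u - u * z by rewrite Ku qu; ring.
  by field; rewrite Kn un.
rewrite /near !e; split; [exact: sc|exact: sc|].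
have -> : (1 - u * x) / (K * u) + (1 - u * y) / (K * u) - 2 = - ((x + y - 2) / K).
  have -> : (1 - u * x) / (K * u) = 1 - (x - 1) / K by rewrite -[LHS](subrK 1) e addrC.
  have -> : (1 - u * y) / (K * u) = 1 - (y - 1) / K by rewrite -[LHS](subrK 1) e addrC.
  by field.
exact: sc.
Qed.

Lemma near_pb g l : size l = (g * k.-1)%N -> all tpb l ->
  near t (Ck ^+ g) (pb k (@h1 R) g l / q ^+ g) (pb k (@h2 R) g l / q ^+ g).
Proof.
elim: g l => [|g IH] l ls lb /=.
  by rewrite !expr0 divr1 /near !subrr !mul0r !normr0; split=> //; rewrite [_ - _](_ : _ = 0) ?normr0 //; ring.
have qg : q ^+ g != 0 by rewrite expf_neq0 // lt0r_neq0.
have qn := lt0r_neq0 q0.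
have E (a b : R) : a * b / q ^+ g.+1 = (a / q) * (b / q ^+ g) by rewrite exprS; field; rewrite qn qg.
rewrite !E exprS; apply: near_mul => //; first by rewrite exprn_ege1.
  apply: near_h; last by have := lb; rewrite -{1}(cat_take_drop k.-1 l) all_cat => /andP[].
  by apply: size_takel; rewrite ls mulSn leq_addr.
apply: IH; last by have := lb; rewrite -{1}(cat_take_drop k.-1 l) all_cat => /andP[].
by rewrite size_drop ls mulSn addKn.
Qed.

Lemma bl_near g l : size l = (g * k.-1)%N -> all tpb l -> `|bl k g l - 1| <= Ck ^+ g * s.
Proof.
move=> ls lb; have [_ _ h] := near_pb ls lb.
have qg : q ^+ g != 0 by rewrite expf_neq0 // lt0r_neq0.
have -> : bl k g l - 1 = (pb k (@h1 R) g l / q ^+ g + pb k (@h2 R) g l / q ^+ g - 2) / 2.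
  by rewrite /bl -/q; field.
rewrite normrM (ger0_norm (_ : 0 <= 2^-1)) //.
have key (X C s' : R) : 0 <= s' -> 1 <= C -> X <= (C - 1) / 2 * s' -> X / 2 <= C * s'.
  by move=> a b e; have := mulr_ge0 (le_trans ler01 b) a; lra.
by apply: key h => //; rewrite exprn_ege1.
Qed.

Lemma cl_near l : size l = k -> all tpb l -> `|cl k l - 1| <= 3 ^+ k * s.
Proof.
move=> ls lb; have [_ _ h] := near_prod lb; rewrite ls -/s in h.
set x := 2 ^+ k * _ in h; set y := 2 ^+ k * \prod_(x <- l) (1 - x) in h.
have kS : k = k.-1.+1 by case: k k3.
have p0 : (2 : R) ^+ k != 0 by rewrite expf_neq0.
have uE P : u / 2 * (2 ^+ k * P) = P.
  by rewrite kS exprS /u; field; rewrite expf_neq0.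
have K1 : 1 <= K.
  rewrite /K /Kk lerBrDr.
  have -> : 1 + 1 = 2 ^+ 1 :> R by rewrite expr1; ring.
  by apply: ler_weXn2l; [rewrite ler1n|case: k k3 => [|[]]].
have un := lt0r_neq0 u0; have Kn := lt0r_neq0 K0.
have -> : cl k l - 1 = - ((x + y - 2) / (2 * K)).
  rewrite /cl -/q -[\prod_(x <- l) x]uE -[\prod_(x <- l) (1 - x)]uE -/x -/y -Ku.
  have -> : 1 - u / 2 * x - u / 2 * y = K * u + u - u / 2 * x - u / 2 * y by rewrite Ku qu; ring.
  by field; rewrite Kn un.
rewrite normrN normrM (ger0_norm (_ : 0 <= (2 * K)^-1)); last by rewrite invr_ge0 mulr_ge0 // ltW.
rewrite ler_pdivrMr ?mulr_gt0 //; apply: le_trans h _.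
have key (C s' K' : R) : 0 <= s' -> 1 <= C -> 1 <= K' -> (C - 1) / 2 * s' <= C * s' * (2 * K').
  move=> a b e; have Cs : 0 <= C * s' by rewrite mulr_ge0 //; lra.
  have := ler_wpM2l Cs e; lra.
by apply: key => //; rewrite exprn_ege1 // ler1n.
Qed.

(** Relative excess of the second moments of [h1] and [h2]; the mixed moment has the deficit [as'].
    Both are [(k - 1) s / K^2] to first order, so the variance of [bl] is of order [s^2]. *)
Definition as_ : R := ((1 + s) ^+ k.-1 - 1) / K ^+ 2.
Definition as' : R := (1 - (1 - s) ^+ k.-1) / K ^+ 2.

Let tP := isprob_tp.

Lemma ex_pbM (h h' : seq R -> R) g (l : seq R) : pb k h g l * pb k h' g l = pb k (fun l => h l * h' l) g l :> R.
Proof. by elim: g l => [|g IH] l /=; rewrite ?mulr1 // mulrACA IH. Qed.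

Let Eprod f c : ex tp f = c -> ex (iid tp k.-1) (fun l => \prod_(x <- l) f x) = c ^+ k.-1.
Proof. by move=> <-; exact: ex_prod. Qed.

Lemma ex_hh : [/\ ex (iid tp k.-1) (fun l => h1 l * h1 l) = q ^+ 2 * (1 + as_),
  ex (iid tp k.-1) (fun l => h2 l * h2 l) = q ^+ 2 * (1 + as_) &
  ex (iid tp k.-1) (fun l => h1 l * h2 l) = q ^+ 2 * (1 - as')].
Proof.
have iP := isprob_iid k.-1 tP; have Kn := lt0r_neq0 K0; have un := lt0r_neq0 u0.
have e1 : ex (iid tp k.-1) (fun l => \prod_(x <- l) x) = u.
  by rewrite (Eprod (f := id) tp_mean) exprVn.
have e2 : ex (iid tp k.-1) (fun l => \prod_(x <- l) (1 - x)) = u.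
  by rewrite (Eprod (f := fun x => 1 - x) (c := 2^-1)) ?exprVn // ex_tp; field.
have uu c : (c / 4) ^+ k.-1 = u ^+ 2 * c ^+ k.-1.
  have u4 : u ^+ 2 = 4^-1 ^+ k.-1.
    by rewrite /u -exprVn -exprM mulnC exprM; congr (_ ^+ _); field.
  by rewrite exprMn u4 mulrC.
have e3 : ex (iid tp k.-1) (fun l => \prod_(x <- l) (x * x)) = u ^+ 2 * (1 + s) ^+ k.-1.
  by rewrite -uu; apply: (Eprod (f := fun x => x * x)); rewrite ex_tp /s; field.
have e4 : ex (iid tp k.-1) (fun l => \prod_(x <- l) ((1 - x) * (1 - x))) = u ^+ 2 * (1 + s) ^+ k.-1.
  by rewrite -uu; apply: (Eprod (f := fun x => (1 - x) * (1 - x))); rewrite ex_tp /s; field.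
have e5 : ex (iid tp k.-1) (fun l => \prod_(x <- l) (x * (1 - x))) = u ^+ 2 * (1 - s) ^+ k.-1.
  by rewrite -uu; apply: (Eprod (f := fun x => x * (1 - x))); rewrite ex_tp /s; field.
have ex3 (f g h : seq R -> R) a b c : ex (iid tp k.-1) f = a -> ex (iid tp k.-1) g = b -> ex (iid tp k.-1) h = c ->
  ex (iid tp k.-1) (fun l => 1 - f l - g l + h l) = 1 - a - b + c.
  by move=> <- <- <-; rewrite exD !exB ex_cst.
have fin1 : 1 - u - u + u ^+ 2 * (1 + s) ^+ k.-1 = q ^+ 2 * (1 + as_).
  rewrite /as_; have -> : q ^+ 2 * (1 + ((1 + s) ^+ k.-1 - 1) / K ^+ 2) = q ^+ 2 + u ^+ 2 * ((1 + s) ^+ k.-1 - 1).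
    by rewrite -Ku; field.
  rewrite qu; ring.
split.
- rewrite -fin1 -(ex3 _ _ _ _ _ _ e1 e1 e3); apply: eq_ex => l; rewrite /h1 big_split /=; ring.
- rewrite -fin1 -(ex3 _ _ _ _ _ _ e2 e2 e4); apply: eq_ex => l; rewrite /h2 big_split /=; ring.
have fin2 : 1 - u - u + u ^+ 2 * (1 - s) ^+ k.-1 = q ^+ 2 * (1 - as').
  rewrite /as'; have -> : q ^+ 2 * (1 - (1 - (1 - s) ^+ k.-1) / K ^+ 2) = q ^+ 2 + u ^+ 2 * ((1 - s) ^+ k.-1 - 1).
    by rewrite -Ku; field.
  rewrite qu; ring.
rewrite -fin2 -(ex3 _ _ _ _ _ _ e1 e2 e5); apply: eq_ex => l; rewrite /h1 /h2 big_split /=; ring.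
Qed.

Lemma ex_bl2 g : ex (iid tp (g * k.-1)) (fun l => bl k g l ^+ 2) = ((1 + as_) ^+ g + (1 - as') ^+ g) / 2.
Proof.
have [e1 e2 e3] := ex_hh; have qg : q ^+ g != 0 by rewrite expf_neq0 // lt0r_neq0.
rewrite (@eq_ex _ _ _ _ (fun l => (pb k (fun l => h1 l * h1 l) g l + pb k (fun l => h2 l * h2 l) g l
   + 2 * pb k (fun l => h1 l * h2 l) g l) * (4 * (q ^+ 2) ^+ g)^-1)); last first.
  by move=> l; rewrite -!ex_pbM /bl -/q exprAC; field.
rewrite exZr !exD exZ (ex_pb g e1) (ex_pb g e2) (ex_pb g e3) !(exprMn g (q ^+ 2)).
have q2 : (q ^+ 2) ^+ g != 0 by rewrite exprAC expf_neq0.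
move: ((q ^+ 2) ^+ g) q2 => Q Q0; field; exact: Q0.
Qed.

(** Second-order expansion of [Lambda] around the mean one. [bl - 1] is of order [s], so the
    remainder is cubic in [s] and geometric in [g]. *)
Lemma VP_ge g : (((1 + as_) ^+ g + (1 - as') ^+ g) / 2 - 1) / 2 - s ^+ 3 * (Ck ^+ 3) ^+ g <= VP k tp g.
Proof.
have iP := isprob_iid (g * k.-1) tP.
apply: le_trans (_ : ex (iid tp (g * k.-1)) (fun l => (bl k g l - 1) + (bl k g l ^+ 2 - 2 * bl k g l + 1) / 2 - s ^+ 3 * (Ck ^+ 3) ^+ g) <= _).
  rewrite (@eq_ex _ _ _ _ (fun l => 2^-1 * bl k g l ^+ 2 + (- 2^-1 - s ^+ 3 * (Ck ^+ 3) ^+ g))); last by move=> l; field.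
  by rewrite exD exZ ex_bl2 (ex_cst iP) le_eqVlt; apply/orP; left; apply/eqP; field.
have fs : fsupp (fun l : seq R => (size l == (g * k.-1)%N) && all tpb l) (iid tp (g * k.-1)).
  elim: (g * k.-1)%N => [|m IH] /=; first by [].
  apply: fsupp_bind fsupp_tpb _ => x xb; rewrite /fsupp all_map; apply: sub_all IH => z /=.
  by rewrite eqSS xb.
apply: (ex_le_supp iP fs) => l /andP[/eqP ls lb].
have b1 := bl_near ls lb; have /andP[b0 _] : 0 <= bl k g l <= (qk R k)^-1 ^+ g.
  by apply: (bl_bounds k3 g); apply: sub_all lb => x; exact: tpb01.
have := @Lambda_taylor_ge R (bl k g l - 1); rewrite [1 + _](_ : _ = bl k g l); last by ring.
have y1 : -1 <= bl k g l - 1 by lra.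
move=> /(_ y1); apply: le_trans.
have -> : bl k g l ^+ 2 - 2 * bl k g l + 1 = (bl k g l - 1) ^+ 2 by ring.
rewrite lerD2l lerN2; apply: le_trans (_ : (Ck ^+ g * s) ^+ 3 <= _).
  by rewrite lerXn2r ?nnegrE ?normr_ge0 // (le_trans _ b1).
by rewrite exprMn mulrC exprAC.
Qed.

Lemma TP_le : TP k tp <= gk k s / 2 + (3 ^+ k) ^+ 3 * s ^+ 3.
Proof.
have iP := isprob_iid k tP.
have Kn := lt0r_neq0 K0; have un := lt0r_neq0 u0.
have kS : k = k.-1.+1 by case: k k3.
have Ek f c : ex tp f = c -> ex (iid tp k) (fun l => \prod_(x <- l) f x) = c ^+ k by move=> <-; exact: ex_prod.
have u2 : (2^-1 : R) ^+ k = u / 2 by rewrite kS exprS /u exprVn mulrC.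
have uu c : (c / 4) ^+ k = (u / 2) ^+ 2 * c ^+ k.
  have u4 : (u / 2) ^+ 2 = 4^-1 ^+ k.
    by rewrite -u2 -exprM mulnC exprM; congr (_ ^+ _); field.
  by rewrite exprMn u4 mulrC.
have m1 : ex (iid tp k) (fun l => \prod_(x <- l) x) = u / 2 by rewrite (Ek id _ tp_mean).
have m2 : ex (iid tp k) (fun l => \prod_(x <- l) (1 - x)) = u / 2.
  by rewrite (Ek (fun x => 1 - x) 2^-1) // ex_tp; field.
have m3 : ex (iid tp k) (fun l => \prod_(x <- l) (x * x)) = (u / 2) ^+ 2 * (1 + s) ^+ k.
  by rewrite -uu; apply: (Ek (fun x => x * x)); rewrite ex_tp /s; field.
have m4 : ex (iid tp k) (fun l => \prod_(x <- l) ((1 - x) * (1 - x))) = (u / 2) ^+ 2 * (1 + s) ^+ k.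
  by rewrite -uu; apply: (Ek (fun x => (1 - x) * (1 - x))); rewrite ex_tp /s; field.
have m5 : ex (iid tp k) (fun l => \prod_(x <- l) (x * (1 - x))) = (u / 2) ^+ 2 * (1 - s) ^+ k.
  by rewrite -uu; apply: (Ek (fun x => x * (1 - x))); rewrite ex_tp /s; field.
have e2 : ex (iid tp k) (fun l => cl k l ^+ 2) = 1 + gk k s.
  rewrite (@eq_ex _ _ _ _ (fun l => (1 - 2 * \prod_(x <- l) x - 2 * \prod_(x <- l) (1 - x) + \prod_(x <- l) (x * x)
    + \prod_(x <- l) ((1 - x) * (1 - x)) + 2 * \prod_(x <- l) (x * (1 - x))) * (q ^+ 2)^-1)); last first.
    by move=> l; rewrite /cl -/q !big_split /=; field; exact: lt0r_neq0.
  rewrite exZr !exD !exN !exZ (ex_cst iP) m1 m2 m3 m4 m5 /gk -/K.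
  have -> : 1 - 2 * (u / 2) - 2 * (u / 2) + (u / 2) ^+ 2 * (1 + s) ^+ k + (u / 2) ^+ 2 * (1 + s) ^+ k + 2 * ((u / 2) ^+ 2 * (1 - s) ^+ k)
    = q ^+ 2 + u ^+ 2 * (((1 + s) ^+ k + (1 - s) ^+ k) / 2 - 1) by rewrite qu; field.
  by rewrite -Ku; field; rewrite Kn un.
apply: le_trans (_ : _ <= ex (iid tp k) (fun l => (cl k l - 1) + (cl k l ^+ 2 - 2 * cl k l + 1) / 2 + (3 ^+ k) ^+ 3 * s ^+ 3)) _; last first.
  rewrite (@eq_ex _ _ _ _ (fun l => 2^-1 * cl k l ^+ 2 + (- 2^-1 + (3 ^+ k) ^+ 3 * s ^+ 3))); last by move=> l; field.
  by rewrite exD exZ e2 (ex_cst iP) le_eqVlt; apply/orP; left; apply/eqP; field.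
have fs : fsupp (fun l : seq R => (size l == k) && all tpb l) (iid tp k).
  elim: (k) => [|m IH] /=; first by [].
  apply: fsupp_bind fsupp_tpb _ => x xb; rewrite /fsupp all_map; apply: sub_all IH => z /=.
  by rewrite eqSS xb.
apply: (ex_le_supp iP fs) => l /andP[/eqP ls lb].
have b1 := cl_near ls lb; have /andP[b0 _] : 0 <= cl k l <= (qk R k)^-1.
  apply: (cl_bounds k3); first by apply: sub_all lb => x; exact: tpb01.
  by rewrite -size_eq0 ls; case: k k3.
have := @Lambda_taylor_le R (cl k l - 1); rewrite [1 + _](_ : _ = cl k l); last by ring.
have y1 : -1 <= cl k l - 1 by lra.
move=> /(_ y1) h; apply: le_trans h _.
have -> : cl k l ^+ 2 - 2 * cl k l + 1 = (cl k l - 1) ^+ 2 by ring.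
rewrite lerD2l -exprMn.
by rewrite lerXn2r ?nnegrE ?normr_ge0 // (le_trans _ b1).
Qed.

End Fixed_t.
End TwoPoint.

(** * The Kesten-Stigum bound *)

Section KestenStigum.
Variables (R : realType) (k : nat).
Hypothesis k3 : (3 <= k)%N.

Lemma bin2R j : ('C(j.+1, 2)%:R : R) = j.+1%:R * j%:R / 2 :> R.
Proof.
elim: j => [|j IH]; first by rewrite bin_small // mulr0 mul0r.
by rewrite binS bin1 natrD IH -[j.+2%:R]natr1 -![j.+1%:R]natr1; field.
Qed.

Lemma dom_pow (c : R) : 0 <= c -> dom (fun g => c ^+ g).
Proof. by move=> c0; exists 1, c; split=> // g; rewrite mul1r ger0_norm // exprn_ge0. Qed.

Lemma odd_part_ge (s : R) j : 0 <= s <= 1 -> 2 * j%:R * s <= (1 + s) ^+ j - (1 - s) ^+ j.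
Proof.
move=> /andP[s0 s1]; elim: j => [|j IH]; first by rewrite mulr0 mul0r subrr.
have e : -1 <= s <= 1 by apply/andP; split; lra.
have h := ek_ge j e; have c0 : 0 <= 'C(j, 2)%:R * s ^+ 2 by rewrite mulr_ge0 // sqr_ge0.
have e1 : 2 <= (1 + s) ^+ j + (1 - s) ^+ j by lra.
have := ler_wpM2l s0 e1; rewrite !exprS -[j.+1%:R]natr1; lra.
Qed.

Lemma pow_1D_le (s : R) j : 0 <= s <= 1 -> (1 + s) ^+ j <= 1 + (2 ^+ j - 1) * s.
Proof.
move=> /andP[s0 s1]; elim: j => [|j IH]; first by rewrite !expr0 subrr mul0r addr0.
rewrite !exprS; have h0 : 0 <= 1 + s by lra.
apply: le_trans (ler_wpM2l h0 IH) _.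
have P1 : 1 <= 2 ^+ j :> R by rewrite exprn_ege1 // ler1n.
have : (2 ^+ j - 1) * (s * s) <= (2 ^+ j - 1) * s by apply: ler_wpM2l; [lra|rewrite ler_piMl].
lra.
Qed.

(** Both sides of the condensation inequality at the two-point law start at order [s^2]. [Q] and
    [Q'] are the coefficients of the variable and of the clause term. *)
Lemma kesten_stigum (d : R) : 0 < d -> (d%:E < dcond R k)%E -> d * (k.-1)%:R <= Kk R k ^+ 2.
Proof.
move=> d0 dc; have d0' := ltW d0; have K0 := Kk_gt0 R k3; set K := Kk R k in K0 *.
have [j kE] : exists j, k = j.+1 by case: k k3 => // j _; exists j.
have j0 : 0 < j%:R :> R by rewrite ltr0n; have := k3; rewrite kE; case: (j).
set Q := d * ('C(j, 2)%:R / (2 * K ^+ 2)) + d ^+ 2 * j%:R ^+ 2 / (4 * K ^+ 4).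
set Q' := d * j%:R / k%:R * ('C(k, 2)%:R / (2 * K ^+ 2)).
have : Q <= Q'.
  apply: (@quad_cubic R Q Q' (expR (d * (Ck R k ^+ 3 - 1)) + d * j%:R / k%:R * ('C(k, 2)%:R / (2 * K ^+ 2) * 2 ^+ k + (3 ^+ k) ^+ 3))).
  move=> t t01; set s := t ^+ 2.
  have s0 : 0 <= s by exact: sqr_ge0.
  have s1 : s <= 1 by case/andP: t01 => a b; apply: exprn_ile1 => //; exact: ltW.
  have s01 : 0 <= s <= 1 by rewrite s0.
  have kp : 0 < k%:R :> R by rewrite ltr0n kE.
  have ub := VP_TP_bound k3 d0 dc (isprob_tp t) (fsupp_tp01 t01) (tp_mean t).
  set a := as_ k t; set a' := as' k t.
  have jk : k.-1 = j by rewrite kE.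
  have aE : a = ((1 + s) ^+ j - 1) / K ^+ 2 by rewrite /a /as_ jk.
  have a'E : a' = (1 - (1 - s) ^+ j) / K ^+ 2 by rewrite /a' /as' jk.
  have K2 : 0 < K ^+ 2 by rewrite exprn_gt0.
  have KV : 0 < (K ^+ 2)^-1 by rewrite invr_gt0.
  have K1 : 1 <= K ^+ 2.
    rewrite exprn_ege1 // /K /Kk lerBrDr; have -> : 1 + 1 = 2 ^+ 1 :> R by rewrite expr1; ring.
    by apply: ler_weXn2l; [rewrite ler1n|case: k k3 => [|[]]].
  have sj : 0 <= (1 - s) ^+ j by rewrite exprn_ge0 // subr_ge0.
  have a'1 : 0 <= 1 - a'.
    rewrite a'E subr_ge0 ler_pdivrMr // mul1r; lra.
  have a1 : 0 <= 1 + a.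
    rewrite aE addr_ge0 // divr_ge0 ?(ltW K2) // subr_ge0 exprn_ege1 //; lra.
  have C0 : 0 <= Ck R k ^+ 3 by rewrite !exprn_ge0.
  have lb : 4^-1 * expR (d * a) + 4^-1 * expR (- (d * a')) - 2^-1 - s ^+ 3 * expR (d * (Ck R k ^+ 3 - 1)) <= pe d (VP k (tp t)).
    have d1 : dom (fun g => 4^-1 * (1 + a) ^+ g) := dom_exp _ a1.
    have d2 : dom (fun g => 4^-1 * (1 - a') ^+ g) := dom_exp _ a'1.
    have d3 : dom (fun g => - s ^+ 3 * (Ck R k ^+ 3) ^+ g) := dom_exp _ C0.
    have dd1 : dom (fun g => (1 + a) ^+ g) := dom_pow a1.
    have dd2 : dom (fun g => (1 - a') ^+ g) := dom_pow a'1.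
    have dd3 : dom (fun g => (Ck R k ^+ 3) ^+ g) := dom_pow C0.
    apply: le_trans (_ : pe d (fun g => (4^-1 * (1 + a) ^+ g + 4^-1 * (1 - a') ^+ g) + (- 2^-1 + - s ^+ 3 * (Ck R k ^+ 3) ^+ g)) <= _).
      rewrite (peD d0' (domD d1 d2) (domD (dom_cst _) d3)) (peD d0' d1 d2) (peD d0' (dom_cst _) d3).
      rewrite !peZ // !pe_exp pe_cst //.
      have -> : 1 + a - 1 = a by ring.
      have -> : 1 - a' - 1 = - a' by ring.
      rewrite mulrN; lra.
    apply: pe_le => //; [by apply: domD; [apply: domD|apply: domD => //; exact: dom_cst]|exact: (dom_VP k3 (isprob_tp t) (fsupp_tp01 t01) (tp_mean t))|].
    move=> g; have := VP_ge k3 t01 g; rewrite -/a -/a' -/s; lra.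
  have es : -1 <= s <= 1 by apply/andP; split; lra.
  have ev : 2 * ('C(j, 2)%:R * s ^+ 2 / K ^+ 2) <= a - a'.
    rewrite aE a'E -mulrBl mulrA ler_pM2r //; have := ek_ge j es; lra.
  have od : 2 * (j%:R * s / K ^+ 2) <= a + a'.
    rewrite aE a'E -mulrDl mulrA ler_pM2r //; have := odd_part_ge j s01; lra.
  have cj : 0 <= 'C(j, 2)%:R * s ^+ 2 / K ^+ 2 by apply: divr_ge0; [apply: mulr_ge0 => //; exact: sqr_ge0|exact: ltW].
  have js : 0 <= j%:R * s / K ^+ 2 by apply: divr_ge0; [exact: mulr_ge0|exact: ltW].
  set w := d * (a - a') / 2; set z := d * (a + a') / 2.
  have w0 : 0 <= w by apply: divr_ge0 => //; apply: mulr_ge0 => //; lra.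
  have z1 : d * (j%:R * s / K ^+ 2) <= z.
    by rewrite /z -[leRHS]mulrA; apply: ler_wpM2l => //; lra.
  have z00 : 0 <= d * (j%:R * s / K ^+ 2) by apply: mulr_ge0.
  have z0 : 0 <= z by apply: le_trans z1.
  have e1 : expR (d * a) + expR (- (d * a')) = expR w * (expR z + expR (- z)).
    by rewrite mulrDr -!expRD; congr (expR _ + expR _); rewrite /w /z; field.
  have e2 : 2 + 2 * w + z ^+ 2 <= expR (d * a) + expR (- (d * a')).
    rewrite e1; have zz := sqr_ge0 z.
    apply: le_trans (_ : (1 + w) * (2 + z ^+ 2) <= _).
      have := mulr_ge0 w0 zz; lra.
    apply: ler_pM; [lra|lra|exact: expR_ge1Dx|]; have := cosh_ge z0; lra.
  have zz : (d * (j%:R * s / K ^+ 2)) ^+ 2 <= z ^+ 2 by rewrite lerXn2r ?nnegrE.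
  have up := TP_le k3 t01; rewrite -/s in up.
  have gs : gk k s <= 'C(k, 2)%:R / K ^+ 2 * s ^+ 2 * (1 + 2 ^+ k * s).
    rewrite /gk -/K; have sa : `|s| <= s by rewrite ger0_norm.
    have h1 := ek_le k s01 sa; have h2 := pow_1D_le k s01.
    have cs : 0 <= 'C(k, 2)%:R * s ^+ 2 by apply: mulr_ge0 => //; exact: sqr_ge0.
    have h3 : (1 + s) ^+ k <= 1 + 2 ^+ k * s by lra.
    have h4 := ler_wpM2l cs h3.
    have -> : 'C(k, 2)%:R / K ^+ 2 * s ^+ 2 * (1 + 2 ^+ k * s) = 'C(k, 2)%:R * s ^+ 2 * (1 + 2 ^+ k * s) / K ^+ 2 by ring.
    rewrite ler_pM2r //; lra.
  have dk : 0 <= d * j%:R / k%:R by rewrite divr_ge0 ?mulr_ge0 // ltW.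
  rewrite jk in ub.
  have ub2 := ler_wpM2l dk up.
  have ub3 := ler_wpM2l dk gs.
  have lhs : Q * s ^+ 2 = (2 * (d * (2 * ('C(j, 2)%:R * s ^+ 2 / K ^+ 2)) / 2) + (d * (j%:R * s / K ^+ 2)) ^+ 2) / 4.
    by rewrite /Q; field; exact: lt0r_neq0.
  have dev := ler_wpM2l d0' ev.
  have l1 : Q * s ^+ 2 <= (2 * w + z ^+ 2) / 4 by rewrite lhs /w; lra.
  have r1 : Q' * s ^+ 2 = d * j%:R / k%:R * ('C(k, 2)%:R / K ^+ 2 * s ^+ 2) / 2.
    by rewrite /Q'; field; rewrite !lt0r_neq0.
  have r2 : d * j%:R / k%:R * ('C(k, 2)%:R / (2 * K ^+ 2) * 2 ^+ k) * s ^+ 3 = d * j%:R / k%:R * ('C(k, 2)%:R / K ^+ 2 * s ^+ 2 * (2 ^+ k * s)) / 2.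
    by field; rewrite !lt0r_neq0.
  have split_rhs (X E Y Z s3 : R) : X + (E + Y * (Z + (3 ^+ k) ^+ 3)) * s3 = X + E * s3 + Y * Z * s3 + Y * ((3 ^+ k) ^+ 3 * s3) by ring.
  rewrite split_rhs r1 r2.
  rewrite mulrDr in ub2; rewrite mulrDr mulr1 in ub3; rewrite mulrDr in ub3.
  rewrite [s ^+ 3 * expR _]mulrC in lb.
  move: ub ub2 ub3 lb e2 l1.
  move: (pe d _) (TP k _) (gk k s) (expR (d * a)) (expR (- (d * a'))) (expR (d * (_ - 1))) => A1 A2 A3 A4 A5 A6.
  have : d * j%:R / k%:R * (A3 / 2) = d * j%:R / k%:R * A3 / 2 by ring.
  move=> ->; lra.
(* After cancelling [d j / (4 K^4)] the comparison reads [(j - 1) K^2 + d j <= j K^2]. *)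
rewrite /Q /Q' kE bin2R /=.
have [i jE] : exists i, j = i.+1 by move: j0; rewrite ltr0n; case: (j) => // i _; exists i.
have -> : 'C(j, 2)%:R = j%:R * (j%:R - 1) / 2 :> R.
  by rewrite jE bin2R -[i.+1%:R]natr1; field.
have Kn := lt0r_neq0 K0; have kn : j.+1%:R != 0 :> R by rewrite pnatr_eq0.
have gen (J : R) : J != 0 -> d * j%:R / J * (J * j%:R / 2 / (2 * K ^+ 2)) = d * j%:R / (4 * K ^+ 4) * (j%:R * K ^+ 2).
  by move=> Jn; field; rewrite Kn Jn.
rewrite gen //.
have -> : d * (j%:R * (j%:R - 1) / 2 / (2 * K ^+ 2)) + d ^+ 2 * j%:R ^+ 2 / (4 * K ^+ 4) =
   d * j%:R / (4 * K ^+ 4) * ((j%:R - 1) * K ^+ 2 + d * j%:R) by field.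
rewrite ler_pM2l; last by rewrite divr_gt0 ?mulr_gt0 ?exprn_gt0.
lra.
Qed.

End KestenStigum.

(** * Gaussian-type moments of the overlap of independent states *)

Section Rademacher.
Variable R : realType.

(** Odd terms of the exponential series cancel, and even terms are compared one by one through
    [2^N N! <= (2 N)!]. *)
Lemma cosh_le (x : R) : (expR x + expR (- x)) / 2 <= expR (x ^+ 2 / 2).
Proof.
have part N : series (exp_coeff x) N.*2 + series (exp_coeff (- x)) N.*2 <= 2 * series (exp_coeff (x ^+ 2 / 2)) N.
  elim: N => [|N IH]; first by rewrite /series /= !big_geq // mulr0 addr0.
  rewrite doubleS /series /= !big_nat_recr //= -!/(series _ _).
  have odd_ : exp_coeff x N.*2.+1 + exp_coeff (- x) N.*2.+1 = 0.
    rewrite /exp_coeff /= exprNn -signr_odd /= odd_double /= expr1 mulN1r mulNr subrr //.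
  have even_ : exp_coeff x N.*2 + exp_coeff (- x) N.*2 <= 2 * exp_coeff (x ^+ 2 / 2) N.
    rewrite /exp_coeff /= exprNn -signr_odd odd_double expr0 mul1r.
    rewrite -mul2n exprM expr_div_n; set y := (x ^+ 2) ^+ N.
    have y0 : 0 <= y by rewrite exprn_ge0 // sqr_ge0.
    have -> : y / (2 * N)`!%:R + y / (2 * N)`!%:R = 2 * (y * (2 * N)`!%:R^-1) by ring.
    rewrite ler_pM2l // -mulrA -invfM; apply: ler_wpM2l => //.
    rewrite lef_pV2 ?posrE ?mulr_gt0 ?exprn_gt0 ?ltr0n ?fact_gt0 // -natrX -natrM ler_nat.
    elim: N {y y0 IH odd_} => // N IH; rewrite mulnS !factS expnS.
    have : (2 ^ N * N`! <= (2 * N)`!)%N := IH.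
    set F := (2 * N)`!; set E := (2 ^ N)%N; set G := N`! => h.
    have -> : (2 * E * (N.+1 * G) = (2 * N.+1) * (E * G))%N by ring.
    rewrite [X in (_ <= X)%N]mulnA; apply: leq_mul => //; nia.
  move: IH; rewrite /series /=; lra.
rewrite ler_pdivrMr // [leRHS]mulrC.
have cx (y : R) : series (exp_coeff y) N.*2 @[N --> \oo] --> limn (series (exp_coeff y)).
  have := is_cvg_series_exp_coeff y => h.
  apply: (@cvg_comp _ _ _ (fun N => N.*2) (series (exp_coeff y)) _ \oo) h.
  apply/cvgnyPge => M; near=> N; apply: leq_trans (_ : N <= _)%N; last by rewrite -addnn leq_addr.
  by near: N; exact: nbhs_infty_ge.
have l1 : (fun N => series (exp_coeff x) N.*2 + series (exp_coeff (- x)) N.*2) @ \oo --> limn (series (exp_coeff x)) + limn (series (exp_coeff (- x))).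
  by apply: cvgD; exact: cx.
have l2 : 2 * series (exp_coeff (x ^+ 2 / 2)) N @[N --> \oo] --> 2 * limn (series (exp_coeff (x ^+ 2 / 2))).
  by apply: cvgMr; exact: is_cvg_series_exp_coeff.
suff le12 : limn (series (exp_coeff x)) + limn (series (exp_coeff (- x))) <=
  2 * limn (series (exp_coeff (x ^+ 2 / 2))) by exact: le12.
by apply: (ler_cvg_to l1 l2); near=> N; exact: part.
Unshelve. all: by end_near. Qed.

Definition SS n (s t : nat -> bool) : R := \sum_(v < n) spin R (s v) * spin R (t v).

(** Averaging one spin by [cosh_le] costs [expR b] and turns [b] into [b (1 + 2 b)], which lowers
    [1 / b] by at most 2. The hypothesis keeps [b] below [B] throughout. *)
Lemma rademacher_moment n s (b B : R) : 0 < b -> 0 < B -> B^-1 + 2 * n%:R <= b^-1 ->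
  ex (spins R n) (fun t => expR (b * SS n s t ^+ 2)) <= expR (n%:R * B).
Proof.
elim: n b => [|n IH] b b0 B0 h.
  by rewrite /ex big_seq1 /= mul1r /SS big_ord0 expr0n mulr0 mul0r.
have bB : b <= B.
  rewrite -[b]invrK -[B]invrK lef_pV2 ?posrE ?invr_gt0 //.
  by apply: le_trans h; rewrite lerDl mulr_ge0.
have b1 : 0 < 1 + 2 * b by rewrite addr_gt0 // mulr_gt0.
have b'0 : 0 < b * (1 + 2 * b) by rewrite mulr_gt0.
rewrite ex_spinsS; apply: le_trans (_ : expR b * ex (spins R n) (fun t => expR (b * (1 + 2 * b) * SS n s t ^+ 2)) <= _).
  rewrite -exZ; apply: (ex_le (isprob_spins R n)) => t.
  have loc c : SS n.+1 s (upd t n c) = SS n s t + spin R (s n) * spin R c.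
    rewrite /SS big_ord_recr /= /upd eqxx; congr (_ + _); apply: eq_bigr => v _.
    by rewrite ltn_eqF.
  rewrite !loc; set x := SS n s t.
  have sg : spin R (s n) * spin R true = - (spin R (s n) * spin R false) by rewrite /spin; ring.
  rewrite sg; set y := spin R (s n) * spin R false.
  have y2 : y ^+ 2 = 1.
    have -> : y ^+ 2 = (spin R (s n) * spin R (s n)) * (spin R false * spin R false) by rewrite /y; ring.
    by rewrite !spin_sqr mulr1.
  have eM : b * (x - y) ^+ 2 = b * (x ^+ 2 + y ^+ 2) + - (2 * b * x * y) by ring.
  have eP : b * (x + y) ^+ 2 = b * (x ^+ 2 + y ^+ 2) + 2 * b * x * y by ring.
  rewrite eM eP y2 !expRD -mulrDr -mulrA [X in _ * (X / 2)]addrC.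
  apply: le_trans (ler_wpM2l (expR_ge0 _) (cosh_le _)) _.
  rewrite -!expRD ler_expR.
  have -> : (2 * b * x * y) ^+ 2 = 4 * b ^+ 2 * x ^+ 2 * y ^+ 2 by ring.
  rewrite y2; lra.
have -> : n.+1%:R * B = B + n%:R * B by rewrite -[n.+1%:R]natr1; ring.
rewrite [expR (B + _)]expRD; apply: ler_pM; rewrite ?expR_ge0 ?ler_expR //.
  by apply: (ex_ge0 (isprob_spins R n)) => t; exact: expR_ge0.
apply: IH => //.
have : b^-1 - 2 <= (b * (1 + 2 * b))^-1.
  rewrite -[leRHS]mul1r ler_pdivlMr //.
  have -> : (b^-1 - 2) * (b * (1 + 2 * b)) = 1 - 4 * b ^+ 2 by field; exact: lt0r_neq0.
  have := sqr_ge0 b; lra.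
move: h; rewrite -[n.+1%:R]natr1; lra.
Qed.

Lemma ov_SS n s t : ov R n s t = SS n s t / n%:R.
Proof. by rewrite /ov ex_vars mulrC. Qed.

Lemma ex_exp_ov n s (be : R) : (0 < n)%N -> 0 < be -> be < 1 / 2 ->
  ex (spins R n) (fun t => expR (be * n%:R * ov R n s t ^+ 2)) <= expR (be / (1 - 2 * be)).
Proof.
move=> n0 b0 b1; have np : 0 < n%:R :> R by rewrite ltr0n.
have nn := lt0r_neq0 np; have b2 : 0 < 1 - 2 * be by lra.
have := @rademacher_moment n s (be / n%:R) (be / (1 - 2 * be) / n%:R).
have -> : n%:R * (be / (1 - 2 * be) / n%:R) = be / (1 - 2 * be) by field; rewrite nn lt0r_neq0.
move=> h; apply: le_trans (h _ _ _).
- by apply: (ex_le (isprob_spins R n)) => t; rewrite ov_SS ler_expR le_eqVlt; apply/orP; left; apply/eqP; field.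
- exact: divr_gt0.
- by rewrite divr_gt0 // divr_gt0.
rewrite le_eqVlt; apply/orP; left; apply/eqP; field; by rewrite nn !lt0r_neq0.
Qed.

End Rademacher.

(** * The second moment restricted to small overlaps *)

Section ExponentialOverlap.
Variables (R : realType) (k : nat).
Hypothesis k3 : (3 <= k)%N.

Definition Fexp n (a eps : R) W := DE (spins R n) W (fun s t => expR (a * n%:R * ov R n s t ^+ 2) * (`|ov R n s t| <= eps)%R%:R).

(** For overlaps below [eps] the clause correlations have exponent about [d (k - 1) / (2 K^2)] times
    [n r^2]. Kesten-Stigum at a larger [d'] puts this strictly below the Gaussian limit [1 / 2],
    with room for the tilt [a]. *)
Lemma Em_Fexp (d : R) : 0 < d -> (d%:E < dcond R k)%E ->
  exists a eps C : R, [/\ 0 < a, 0 < eps < 1, 0 < C & forall n m, (0 < n)%N -> m%:R <= d * n%:R / k%:R ->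
    Em k n m (Fexp n a eps) <= C].
Proof.
move=> d0 dc; have [d' dd' dc'] := dcond_room dc; have d'0 := lt_trans d0 dd'.
have KS := kesten_stigum k3 d'0 dc'; have K0 := Kk_gt0 R k3; set K := Kk R k in KS K0.
have [j kE] : exists j, k = j.+1 by case: k k3 => // j _; exists j.
have kp : 0 < k%:R :> R by rewrite ltr0n kE.
pose th := d / d'; have th0 : 0 < th by exact: divr_gt0.
have th1 : th < 1 by rewrite /th ltr_pdivrMr // mul1r.
pose eps := (1 - th) / (4 * 2 ^+ k).
have P1 : 1 <= 2 ^+ k :> R by rewrite exprn_ege1 // ler1n.
have P0 : 0 < 4 * 2 ^+ k :> R by rewrite mulr_gt0 // exprn_gt0.
have e0 : 0 < eps by apply: divr_gt0 => //; rewrite subr_gt0.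
have e1 : eps < 1 by rewrite /eps ltr_pdivrMr //; lra.
have eP : 2 ^+ k * eps = (1 - th) / 4 by rewrite /eps; field; rewrite lt0r_neq0 // exprn_gt0.
pose a := (1 - th) / 8; have a0 : 0 < a by apply: divr_gt0 => //; rewrite subr_gt0.
(* The total coefficient of [n r^2]; [eps] and [a] are small against [1 - th] so that
   [be < 1 / 2]. *)
pose be := th / 2 * (1 + 2 ^+ k * eps) + a.
have be1 : be < 1 / 2.
  rewrite /be /a eP; have : 0 < (1 - th) ^+ 2 by rewrite exprn_gt0 // subr_gt0.
  lra.
have be0 : 0 < be by rewrite /be eP; apply: addr_gt0 => //; rewrite mulr_gt0 ?divr_gt0 //; lra.
exists a, eps, (expR (be / (1 - 2 * be))); split=> //; [by rewrite e0|exact: expR_gt0|].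
move=> n m n0 md; have muP := isprob_spins R n.
rewrite /Em /Fexp DE_iter.
apply: le_trans (_ : DE (spins R n) (fun=> 1) (fun s t => expR (be * n%:R * ov R n s t ^+ 2)) <= _); last first.
  rewrite /DE -[leRHS](ex_cst muP); apply: (ex_le muP) => s; rewrite mul1r.
  by rewrite (eq_ex _ (fun t => mul1r _)); exact: ex_exp_ov.
apply: (DE_le muP) => [s|s t]; first exact: ler01.
rewrite ex_Lcl2 //; set r := ov R n s t.
have r1 : -1 <= r <= 1 := ov_le1 R n0 s t.
have [re|_] := boolP (`|r| <= eps); last by rewrite !mulr0 expR_ge0.
rewrite mulr1; have e01 : 0 <= eps <= 1 by rewrite !ltW.
have h1 := ek_le k e01 re; have h2 := pow_1D_le k e01.
have r2 := sqr_ge0 r.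
have cs : 0 <= 'C(k, 2)%:R * r ^+ 2 by rewrite mulr_ge0.
have h3 : (1 + eps) ^+ k <= 1 + 2 ^+ k * eps by lra.
have h4 := ler_wpM2l cs h3.
have K2 : 0 < K ^+ 2 by rewrite exprn_gt0.
have g1 : gk k r <= 'C(k, 2)%:R * r ^+ 2 * (1 + 2 ^+ k * eps) / K ^+ 2.
  rewrite /gk -/K ler_pM2r ?invr_gt0 //; lra.
have g0 : 0 <= gk k r.
  apply: le_trans (gk_ge k3 r1); rewrite divr_ge0 // ltW //.
have G0 : 0 <= 'C(k, 2)%:R * r ^+ 2 * (1 + 2 ^+ k * eps) / K ^+ 2 by apply: le_trans g1.
apply: le_trans (_ : expR (m%:R * gk k r) * expR (a * n%:R * r ^+ 2) <= _).
  apply: ler_wpM2r; first exact: expR_ge0.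
  rewrite mulrC expRM_natr; apply: lerXn2r; rewrite ?nnegrE ?expR_ge0 ?expR_ge1Dx //; lra.
rewrite -expRD ler_expR.
have m1 : m%:R * gk k r <= d * n%:R / k%:R * ('C(k, 2)%:R * r ^+ 2 * (1 + 2 ^+ k * eps) / K ^+ 2) by apply: ler_pM.
have m2 : d * n%:R / k%:R * ('C(k, 2)%:R * r ^+ 2 * (1 + 2 ^+ k * eps) / K ^+ 2) =
   (d * (k.-1)%:R / K ^+ 2) * (n%:R * r ^+ 2 * (1 + 2 ^+ k * eps) / 2).
  by rewrite kE bin2R /=; field; rewrite !lt0r_neq0 // -kE.
have m3 : d * (k.-1)%:R / K ^+ 2 <= th.
  rewrite ler_pdivrMr // /th; have := ler_wpM2l (ltW th0) KS; rewrite /th.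
  have -> : d / d' * (d' * (k.-1)%:R) = d * (k.-1)%:R by field; exact: lt0r_neq0.
  by [].
have X0 : 0 <= n%:R * r ^+ 2 * (1 + 2 ^+ k * eps) / 2.
  by apply: divr_ge0 => //; apply: mulr_ge0; [exact: mulr_ge0|rewrite eP; lra].
have := ler_wpM2r X0 m3; rewrite /be; lra.
Qed.

End ExponentialOverlap.

Ltac pos := repeat first [by [] | exact: ltW | apply: addr_ge0 | apply: divr_ge0
  | apply: mulr_ge0 | apply: exprn_ge0 | rewrite invr_ge0].

(** * Clauses that nearly destroy the density *)

Section BadClauses.
Variables (R : realType) (k n : nat).
Hypotheses (k3 : (3 <= k)%N) (n0 : (0 < n)%N).
Let mu := spins R n.
Let muP : isprob mu. Proof. exact: isprob_spins. Qed.

Definition pairc (v w : nat) (s : nat -> bool) : R := spin R (s v) * spin R (s w).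

(** If the clause removes most of the mass, the posterior probability that all its literals agree is
    at least [19 / 20], so any two of their spins have correlation at least [9 / 10] in absolute
    value, and [81 / 100 >= 1 / 2]. *)
Lemma bad_pairs W l1 l2 l3 r : nn W -> 0 < A mu W -> A mu (wmul W (Lcl R k [:: l1, l2, l3 & r])) < A mu W / 20 ->
  1 <= 2 * (A mu (wmul W (pairc l1.1 l2.1)) / A mu W) ^+ 2 /\
  1 <= 2 * (A mu (wmul W (pairc l1.1 l3.1)) / A mu W) ^+ 2.
Proof.
move=> w a0 bad; set c := [:: l1, l2, l3 & r] in bad.
have q0 := qk_gt0 R k3; have q1 := qk_lt1 R k.
pose M s : R := (mono (map (tr s) c))%:R.
have AM : A mu (wmul W (Lcl R k c)) = (A mu W - A mu (wmul W M)) / qk R k.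
  by rewrite /A -exB -exZr; apply: eq_ex => s; rewrite /wmul LclE -/(M s); ring.
have m1 : 19 / 20 * A mu W <= A mu (wmul W M).
  move: bad; rewrite AM ltr_pdivrMr // => bad.
  have : A mu W / 20 * qk R k <= A mu W / 20 * 1 by apply: ler_wpM2l; [rewrite divr_ge0 // ltW|exact: ltW].
  lra.
have big (l l' : lit) : (forall s, 2 * M s - 1 <= spin R l.2 * spin R l'.2 * pairc l.1 l'.1 s) ->
  1 <= 2 * (A mu (wmul W (pairc l.1 l'.1)) / A mu W) ^+ 2.
  move=> h; set y := A mu (wmul W (pairc l.1 l'.1)) / A mu W.
  have e : 9 / 10 <= spin R l.2 * spin R l'.2 * y.
    rewrite /y mulrA ler_pdivlMr //.
    have : A mu (wmul W (fun s => 2 * M s - 1)) <= A mu (wmul W (fun s => spin R l.2 * spin R l'.2 * pairc l.1 l'.1 s)).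
      by apply: (ex_le muP) => s; rewrite /wmul; apply: ler_wpM2l.
    have -> : A mu (wmul W (fun s => 2 * M s - 1)) = 2 * A mu (wmul W M) - A mu W.
      by rewrite /A -exZ -exB; apply: eq_ex => s; rewrite /wmul; ring.
    have -> : A mu (wmul W (fun s => spin R l.2 * spin R l'.2 * pairc l.1 l'.1 s)) = spin R l.2 * spin R l'.2 * A mu (wmul W (pairc l.1 l'.1)).
      by rewrite /A -exZ; apply: eq_ex => s; rewrite /wmul; ring.
    lra.
  have : (9 / 10) ^+ 2 <= (spin R l.2 * spin R l'.2 * y) ^+ 2 by rewrite lerXn2r ?nnegrE //; lra.
  have -> : (spin R l.2 * spin R l'.2 * y) ^+ 2 = (spin R l.2 * spin R l.2) * (spin R l'.2 * spin R l'.2) * y ^+ 2 by ring.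
  rewrite !spin_sqr !mul1r; have -> : (9 / 10 : R) ^+ 2 = 81 / 100 by field.
  lra.
by split; apply: big => s; rewrite /M /c /mono /= /pairc /tr;
  case: (s l1.1) (s l2.1) (s l3.1) (l1.2) (l2.2) (l3.2) => [] [] [] [] [] [];
  rewrite /= ?andbF ?orbF /spin; try lra; case: (all _ _) => /=; lra.
Qed.

(** Two pairs sharing their first literal are used: one alone would give the mean squared overlap,
    of order [1 / n], which does not vanish when summed over linearly many clauses. The second pair
    brings in the mean absolute overlap. *)
Lemma bad_prob W : nn W -> 0 < A mu W ->
  ex (iid (lits R n) k) (fun c => (A mu (wmul W (Lcl R k c)) < A mu W / 20)%R%:R) <=
  4 * (DE mu W (fun s t => `|ov R n s t|) / A mu W ^+ 2) * (DE mu W (fun s t => ov R n s t ^+ 2) / A mu W ^+ 2).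
Proof.
move=> w a0; have lP := isprob_lits R n0; have vP := isprob_vars R n0.
pose Y v v' := (A mu (wmul W (pairc v v')) / A mu W) ^+ 2.
have Y0 v v' : 0 <= Y v v' by exact: sqr_ge0.
have exl (f : nat -> R) : ex (lits R n) (fun l => f l.1) = ex (vars R n) f.
  by rewrite ex_lits; apply: eq_ex => v /=; field.
apply: le_trans (_ : ex (vars R n) (fun v => 4 * ex (vars R n) (Y v) * ex (vars R n) (Y v)) <= _).
  have [j kE] : exists j, k = j.+3 by case: k k3 => [|[|[|j]]] // _; exists j.
  rewrite {1}kE ex_iidS -[leRHS]exl; apply: (ex_le lP) => l1.
  have -> : 4 * ex (vars R n) (Y l1.1) * ex (vars R n) (Y l1.1) =
    ex (lits R n) (fun l2 => 4 * ex (vars R n) (Y l1.1) * Y l1.1 l2.1) by rewrite exZ exl.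
  rewrite ex_iidS; apply: (ex_le lP) => l2.
  have -> : 4 * ex (vars R n) (Y l1.1) * Y l1.1 l2.1 =
    ex (lits R n) (fun l3 => 4 * Y l1.1 l2.1 * Y l1.1 l3.1) by rewrite exZ exl mulrAC.
  rewrite ex_iidS; apply: (ex_le lP) => l3; rewrite -[leRHS](ex_cst (isprob_iid j lP)).
  apply: (ex_le (isprob_iid j lP)) => r.
  case: ltP => [bad|_]; last by apply: mulr_ge0 => //; exact: mulr_ge0.
  have [h1 h2] := bad_pairs w a0 bad; rewrite -!/(Y _ _) in h1 h2.
  have := ler_pM ler01 ler01 h1 h2; rewrite mulr1 => h; apply: le_trans h _.
  by rewrite le_eqVlt; apply/orP; left; apply/eqP; ring.
have xE v : ex (vars R n) (Y v) = DE mu W (fun s t => spin R (s v) * spin R (t v) * ov R n s t) / A mu W ^+ 2.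
  rewrite /Y (@eq_ex _ _ _ _ (fun v' => A mu (wmul W (pairc v v')) ^+ 2 * (A mu W ^+ 2)^-1)); last first.
    by move=> v'; rewrite expr_div_n.
  rewrite exZr; congr (_ / _); rewrite (quad mu (vars R n) (fun v' => pairc v v')); congr DE.
  apply/funext => s; apply/funext => t; rewrite /ov -exZ; apply: eq_ex => v'; rewrite /pairc; ring.
have A2 : 0 < A mu W ^+ 2 by rewrite exprn_gt0.
have xle v : ex (vars R n) (Y v) <= DE mu W (fun s t => `|ov R n s t|) / A mu W ^+ 2.
  rewrite xE ler_pM2r ?invr_gt0 //; apply: (DE_le muP) => // s t.
  by case: (s v) (t v) => [] []; rewrite /spin; have := ler_norm (ov R n s t); have := ler_norm (- ov R n s t); rewrite normrN; lra.
have xsum : ex (vars R n) (fun v => ex (vars R n) (Y v)) = DE mu W (fun s t => ov R n s t ^+ 2) / A mu W ^+ 2.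
  rewrite (eq_ex _ xE) exZr (ex_DE mu (vars R n)); congr (DE _ _ _ / _).
  by apply/funext => s; apply/funext => t; rewrite exZr expr2.
rewrite -xsum -exZ; apply: (ex_le vP) => v; apply: ler_wpM2r; first exact: (ex_ge0 vP).
by apply: ler_wpM2l => //; exact: xle.
Qed.

End BadClauses.

(** * The logarithmic potential *)

Section Potential.
Variables (R : realType) (k n : nat) (a eps c : R).
Hypotheses (k3 : (3 <= k)%N) (n0 : (0 < n)%N) (a0 : 0 < a) (c0 : 0 < c).
Let mu := spins R n.
Let muP : isprob mu. Proof. exact: isprob_spins. Qed.
Let ch := channel_cl R k3 n0.
Let np : 0 < n%:R :> R. Proof. by rewrite ltr0n. Qed.

(** Decreasing in [x], bounded by [ell = pot 0], and large only when [x] and [c] are both small. *)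
Definition pot (x : R) : R := ln (x + c + 1) - ln (x + c).
Definition Gt W := DE mu W (fun s t => (eps < `|ov R n s t|)%R%:R).
Let ell := pot 0.

Lemma pot_ge0 x : 0 <= x -> 0 <= pot x.
Proof.
move=> x0; have u0 : 0 < x + c by rewrite ltr_wpDl.
rewrite /pot; set u := x + c in u0 *; clearbody u.
by rewrite subr_ge0 ler_ln ?posrE ?addr_gt0 // lerDl.
Qed.

Lemma pot_anti x y : 0 <= x -> x <= y -> pot y <= pot x.
Proof.
move=> x0 xy; have u0 : 0 < x + c by rewrite ltr_wpDl.
have v0 : 0 < y + c by rewrite ltr_wpDl // (le_trans x0).
rewrite /pot; have uv : x + c <= y + c by rewrite lerD2r.
set u := x + c in u0 uv *; set v := y + c in v0 uv *; clearbody u v.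
rewrite lerBlDr addrAC lerBrDr -!lnM ?posrE ?addr_gt0 //.
by rewrite ler_ln ?posrE ?mulr_gt0 ?addr_gt0 //; lra.
Qed.

Lemma ln_le_sub1 (z : R) : 0 < z -> ln z <= z - 1.
Proof.
move=> z0; have := @le_ln1Dx R (z - 1); have -> : 1 + (z - 1) = z by ring.
by apply; lra.
Qed.

(** A second-order expansion; its linear term averages to zero over a clause. The quadratic error is
    valid while [x + c] drops by at most a factor 20; a larger drop forces [x > c] and [x' < x / 20]
    and costs at most [ell]. *)
Lemma pot_step x x' : 0 <= x -> 0 <= x' ->
  pot x' <= pot x - (x' - x) / ((x + c) * (x + c + 1)) + 20 * ((x' - x) / (x + c)) ^+ 2 + ell * (x' < x / 20)%R%:R * (c < x)%R%:R.
Proof.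
move=> x0 x'0; set u := x + c; have u0 : 0 < u by rewrite ltr_wpDl.
set u' := x' + c; have u'0 : 0 < u' by rewrite ltr_wpDl.
have dE : x' - x = u' - u by rewrite /u /u'; ring.
have uE : u = x + c by []; have u'E : u' = x' + c by []; clearbody u u'.
have un := lt0r_neq0 u0; have u1n : u + 1 != 0 by rewrite lt0r_neq0 // addr_gt0.
have l0 : 0 <= ell by exact: pot_ge0.
set b := ell * _ * _; have b0 : 0 <= b by rewrite /b !mulr_ge0.
have q0 : 0 <= 20 * ((x' - x) / u) ^+ 2 by rewrite mulr_ge0 // sqr_ge0.
have [good|bad] := leP (u / 20) u'.
  have h1 : ln (u' + 1) - ln (u + 1) <= (u' - u) / (u + 1).
    rewrite -ln_div ?posrE ?addr_gt0 //; apply: le_trans (ln_le_sub1 _) _; first by rewrite divr_gt0 ?addr_gt0.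
    by rewrite le_eqVlt; apply/orP; left; apply/eqP; field.
  have h2 : ln u - ln u' <= u / u' - 1.
    by rewrite -ln_div ?posrE //; apply: ln_le_sub1; rewrite divr_gt0.
  have h3 : u / u' - 1 <= - ((u' - u) / u) + 20 * ((u' - u) / u) ^+ 2.
    have -> : u / u' - 1 = - ((u' - u) / u) + (u / u') * ((u' - u) / u) ^+ 2 by field; rewrite !lt0r_neq0.
    rewrite lerD2l; apply: ler_wpM2r; first exact: sqr_ge0.
    rewrite ler_pdivrMr //; lra.
  have e : (u' - u) / (u + 1) - (u' - u) / u = - ((u' - u) / (u * (u + 1))) by field; rewrite un u1n.
  rewrite /pot -uE -u'E dE; lra.
rewrite uE u'E in bad.
have aux (p q r : R) : 0 < r -> 0 <= q -> q + r < (p + r) / 20 -> r < p /\ q < p / 20.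
  by move=> r0 q0' hh; split; lra.
have [xc xb] := aux _ _ _ c0 x'0 bad.
have hb : b = ell by rewrite /b xc xb !mulr1.
have lin : 0 <= - ((x' - x) / (u * (u + 1))).
  rewrite -mulNr; apply: divr_ge0; first by rewrite dE; lra.
  by rewrite mulr_ge0 ?addr_ge0 // ltW.
rewrite hb; have p1 : pot x' <= ell by apply: pot_anti.
have := pot_ge0 x0; lra.
Qed.

Variable h : R.
Hypothesis h0 : 0 < h.
Let C1 := 40 * chi R k / a.
(** The part of the one-clause error not proportional to [pot], written in the two quantities with
    known means: the truncated second moment and the planted tail. [h] is a free parameter of
    Young's inequality. *)
Definition rest W : R := C1 / n%:R * Fexp n a eps W + 20 * chi R k * (Gt W / A mu W / c) +
  ell * ((4 * h / (a ^+ 2 * n%:R ^+ 2) + 2 / (h * a * n%:R)) * (Fexp n a eps W / c ^+ 2) + (2 * h + 2 / h) * (Gt W / A mu W / c)).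

Lemma C1n_ge0 : 0 <= C1 / n%:R.
Proof.
apply: divr_ge0 => //; apply: divr_ge0; last exact: ltW.
by apply: mulr_ge0 => //; exact: ltW (chi_gt0 R k3).
Qed.

Lemma Fexp_ge0 W : nn W -> 0 <= Fexp n a eps W.
Proof. by move=> w; apply: (DE_ge0 muP) => // s t; rewrite mulr_ge0 // expR_ge0. Qed.

Lemma Gt_ge0 W : nn W -> 0 <= Gt W.
Proof. by move=> w; apply: (DE_ge0 muP). Qed.

Lemma rest_ge0 W : nn W -> 0 <= rest W.
Proof.
move=> w; have f0 := Fexp_ge0 w; have g0 : 0 <= Gt W / A mu W / c.
  by apply: divr_ge0; [apply: divr_ge0; [exact: Gt_ge0|exact: A_ge0]|exact: ltW].
have x0 := chi_gt0 R k3; have l0 : 0 <= ell by exact: pot_ge0.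
have C10 := C1n_ge0.
have s1 : 0 <= 4 * h / (a ^+ 2 * n%:R ^+ 2) + 2 / (h * a * n%:R).
  by pos.
have s2 : 0 <= 2 * h + 2 / h by pos.
have s3 : 0 <= Fexp n a eps W / c ^+ 2 by pos.
rewrite /rest; apply: addr_ge0; first apply: addr_ge0.
- exact: mulr_ge0.
- by apply: mulr_ge0 => //; pos.
- by apply: mulr_ge0 => //; apply: addr_ge0; exact: mulr_ge0.
Qed.

Lemma ov_split W f b : nn W -> (forall r : R, -1 <= r <= 1 -> f r <= 1) ->
  (forall r, f r <= b * expR (a * n%:R * r ^+ 2)) ->
  DE mu W (fun s t => f (ov R n s t)) <= b * Fexp n a eps W + Gt W.
Proof.
move=> w f1 fb; rewrite /Fexp /Gt -DEZ -DED; apply: (DE_le muP) => // s t.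
set r := ov R n s t; have r1 : -1 <= r <= 1 := ov_le1 R n0 s t.
have [re|re] := leP `|r| eps; rewrite ?mulr1 ?addr0 ?mulr0 ?add0r; first exact: fb.
exact: f1.
Qed.

(** The quadratic error is the mean squared overlap over [(A + c)^2], which would be large for small
    [A]. It is converted into [pot / n], so that the potential controls its own growth. *)
Lemma pot_Tr W : nn W -> Tr (iid (lits R n) k) (@Lcl R k) (fun V => pot (A mu V)) W <=
  (1 + C1 / n%:R) * pot (A mu W) + rest W.
Proof.
move=> w; have aw := A_ge0 muP w; have [pP L0 _] := ch.
have x0 := chi_gt0 R k3; have l0 : 0 <= ell by exact: pot_ge0.
have C10 := C1n_ge0.
have [az|an] := eqVneq (A mu W) 0.
  have -> : Tr (iid (lits R n) k) (@Lcl R k) (fun V => pot (A mu V)) W = pot (A mu W).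
    by rewrite -[RHS](ex_cst pP); apply: eq_ex => l; rewrite A_null // az.
  have := mulr_ge0 C10 (pot_ge0 aw); have := rest_ge0 w; lra.
have ap : 0 < A mu W by rewrite lt_def an.
set x := A mu W in aw an ap *; set u := x + c; have u0 : 0 < u by rewrite addr_gt0.
set B := ex (iid (lits R n) k) (fun l => (A mu (wmul W (Lcl R k l)) < x / 20)%R%:R).
have main : Tr (iid (lits R n) k) (@Lcl R k) (fun V => pot (A mu V)) W <=
   pot x + 20 * (DE mu W (gch (iid (lits R n) k) (@Lcl R k)) / u ^+ 2) + ell * B * (c < x)%R%:R.
  apply: le_trans (_ : ex (iid (lits R n) k) (fun l => (pot x + (- (u * (u + 1))^-1) * (A mu (wmul W (Lcl R k l)) - x)
     + (20 / u ^+ 2) * (A mu (wmul W (Lcl R k l)) - x) ^+ 2) + (ell * (c < x)%R%:R) * (A mu (wmul W (Lcl R k l)) < x / 20)%R%:R) <= _).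
    apply: (ex_le pP) => l; have x'0 : 0 <= A mu (wmul W (Lcl R k l)) by apply: (A_ge0 muP); exact: nn_wmul.
    have := pot_step aw x'0; rewrite -/u expr_div_n; lra.
  have dev0 : ex (iid (lits R n) k) (fun l => A mu (wmul W (Lcl R k l)) - x) = 0.
    by rewrite exB (ex_AL mu ch) (ex_cst pP) subrr.
  rewrite exD exD exD !exZ dev0 (ex_cst pP) mulr0 addr0 (ex_sqr_AL mu ch) -/B.
  by rewrite le_eqVlt; apply/orP; left; apply/eqP; field; exact: lt0r_neq0.
apply: le_trans main _.
set F := Fexp n a eps W; set G := Gt W.
have F0 : 0 <= F := Fexp_ge0 w; have G0 : 0 <= G := Gt_ge0 w.
have gG : 0 <= G / x / c by apply: divr_ge0; [exact: divr_ge0|exact: ltW].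
have u2 : 0 < u ^+ 2 by rewrite exprn_gt0.
have pot0 := pot_ge0 aw.
have g1 : DE mu W (gch (iid (lits R n) k) (@Lcl R k)) <= chi R k * DE mu W (fun s t => ov R n s t ^+ 2).
  rewrite -DEZ; apply: (DE_le muP) => // s t; rewrite /gch ex_Lcl2 // [1 + _]addrC addrK.
  by apply: gk_le_chi => //; exact: ov_le1.
have young : DE mu W (fun s t => ov R n s t ^+ 2) / u ^+ 2 <= (2 * pot x + F) / (a * n%:R) + G / x / c.
  apply: le_trans (_ : ((a * n%:R)^-1 * (2 * pot x * x ^+ 2 + u ^+ 2 * F) + G) / u ^+ 2 <= _).
    rewrite ler_pM2r ?invr_gt0 // /x -(DE1 mu) /F /G /Fexp /Gt -!DEZ -DED -DEZ -DED.
    apply: (DE_le muP) => // s t; set r := ov R n s t; have r1 : -1 <= r <= 1 := ov_le1 R n0 s t.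
    have r2 : r ^+ 2 <= 1.
      by rewrite -[r ^+ 2]real_normK ?num_real // exprn_ile1 // ler_norml.
    have an0 : 0 < a * n%:R by rewrite mulr_gt0.
    have p2 : 0 <= 2 * pot x by rewrite mulr_ge0.
    have [re|re] := leP `|r| eps; rewrite ?mulr1 ?addr0 ?mulr0 ?add0r; last first.
      by apply: le_trans r2 _; rewrite lerDr; pos.
    rewrite ler_pdivlMl //.
    (* The tangent inequality for the exponential at [z + 2 ln u] gives [z <= u^2 expR z - 2 ln u],
       and [- ln u] is at most the potential. *)
    set z := a * n%:R * r ^+ 2.
    have : 1 + (z + 2 * ln u) <= expR (z + 2 * ln u) by exact: expR_ge1Dx.
    have -> : expR (z + 2 * ln u) = u ^+ 2 * expR z.
      have e2 : expR (2 * ln u) = u ^+ 2 by rewrite expRM_natl lnK.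
      by rewrite expRD e2 mulrC.
    have : - ln u <= pot x by rewrite /pot -/u lerDr ln_ge0 // lerDr ltW.
    lra.
  rewrite mulrDl; apply: lerD.
    have -> : (a * n%:R)^-1 * (2 * pot x * x ^+ 2 + u ^+ 2 * F) / u ^+ 2 = (2 * pot x * (x ^+ 2 / u ^+ 2) + F) / (a * n%:R).
      by field; rewrite !lt0r_neq0.
    rewrite ler_pM2r ?invr_gt0 ?mulr_gt0 // lerD2r -[leRHS]mulr1; apply: ler_wpM2l; first by rewrite mulr_ge0.
    by rewrite ler_pdivrMr // mul1r lerXn2r ?nnegrE ?(ltW u0) // lerDl ltW.
  rewrite -mulrA -invfM; apply: ler_wpM2l => //; rewrite lef_pV2 ?posrE ?mulr_gt0 //.
  have := mulr_gt0 ap c0; have := sqr_ge0 x; have := sqr_ge0 c.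
  have -> : u ^+ 2 = x ^+ 2 + 2 * (x * c) + c ^+ 2 by rewrite /u; ring.
  lra.
have t1 : 20 * (DE mu W (gch (iid (lits R n) k) (@Lcl R k)) / u ^+ 2) <= C1 / n%:R * pot x + C1 / n%:R * F + 20 * chi R k * (G / x / c).
  have := ler_wpM2l (ltW x0) young.
  have : DE mu W (gch (iid (lits R n) k) (@Lcl R k)) / u ^+ 2 <= chi R k * (DE mu W (fun s t => ov R n s t ^+ 2) / u ^+ 2).
    by rewrite mulrA ler_pM2r ?invr_gt0.
  have -> : chi R k * ((2 * pot x + F) / (a * n%:R) + G / x / c) = C1 / n%:R * pot x / 20 + C1 / n%:R * F / 40 + chi R k * (G / x / c).
    by rewrite /C1; field; rewrite !lt0r_neq0.
  have := mulr_ge0 C10 F0; lra.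
suff t2 : ell * B * (c < x)%R%:R <= ell * ((4 * h / (a ^+ 2 * n%:R ^+ 2) + 2 / (h * a * n%:R)) * (F / c ^+ 2) + (2 * h + 2 / h) * (G / x / c)).
  rewrite /rest -/F -/G -/x; lra.
rewrite -mulrA; apply: ler_wpM2l => //.
have s1 : 0 <= 4 * h / (a ^+ 2 * n%:R ^+ 2) + 2 / (h * a * n%:R).
  by pos.
have s2 : 0 <= 2 * h + 2 / h by pos.
have [cx|_] := ltP c x; last first.
  by rewrite mulr0; apply: addr_ge0; apply: mulr_ge0 => //; pos.
rewrite mulr1; apply: le_trans (bad_prob k3 n0 w ap) _; rewrite -/x -/mu.
have X2 : 0 < x ^+ 2 by rewrite exprn_gt0.
set R2 := DE mu W (fun s t => ov R n s t ^+ 2) / x ^+ 2; set R1 := _ / x ^+ 2.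
have R20 : 0 <= R2 by apply: divr_ge0; [apply: (DE_ge0 muP) => // s t; exact: sqr_ge0|exact: ltW].
(* Young's inequality trades the absolute overlap for its square; the product [R1 R2] then needs
   only second and fourth overlap moments. *)
have r12 : R1 <= h / 2 * R2 + (2 * h)^-1.
  rewrite /R1 /R2 ler_pdivrMr // mulrDl mulrA divfK ?lt0r_neq0 //.
  rewrite /x -[A mu W ^+ 2](DE1 mu) -!DEZ -DED; apply: (DE_le muP) => // s t.
  have : 0 <= (h * `|ov R n s t| - 1) ^+ 2 / (2 * h) by rewrite divr_ge0 ?sqr_ge0 // mulr_ge0 // ltW.
  have -> : (h * `|ov R n s t| - 1) ^+ 2 / (2 * h) = h / 2 * `|ov R n s t| ^+ 2 + (2 * h)^-1 * 1 - `|ov R n s t|.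
    by field; exact: lt0r_neq0.
  rewrite real_normK ?num_real //; lra.
have R22 : R2 ^+ 2 <= DE mu W (fun s t => ov R n s t ^+ 4) / x ^+ 2.
  rewrite ler_pdivlMr //.
  have : 0 <= DE mu W (fun s t => (ov R n s t ^+ 2 - R2) ^+ 2) by apply: (DE_ge0 muP) => // s t; exact: sqr_ge0.
  rewrite (_ : (fun s t => _) = fun s t => (ov R n s t ^+ 4 - 2 * R2 * ov R n s t ^+ 2) + R2 ^+ 2 * 1); last first.
    by apply/funext => s; apply/funext => t; ring.
  rewrite DED DEB !DEZ DE1 -/x.
  have -> : DE mu W (fun s t => ov R n s t ^+ 2) = R2 * x ^+ 2 by rewrite /R2 divfK // lt0r_neq0.
  lra.
have an0 : 0 < a * n%:R by rewrite mulr_gt0.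
have s4 : DE mu W (fun s t => ov R n s t ^+ 4) <= 2 / (a * n%:R) ^+ 2 * F + G.
  apply: (@ov_split W (fun r => r ^+ 4)) => // r.
    move=> r1; have -> : r ^+ 4 = (`|r| ^+ 2) ^+ 2 by rewrite real_normK ?num_real //; ring.
    by rewrite !exprn_ile1 ?sqr_ge0 // ler_norml.
  set z := a * n%:R * r ^+ 2; have z0 : 0 <= z by rewrite mulr_ge0 ?sqr_ge0 // ltW.
  have -> : r ^+ 4 = 2 / (a * n%:R) ^+ 2 * (z ^+ 2 / 2) by rewrite /z; field; rewrite !lt0r_neq0.
  apply: ler_wpM2l; first by pos.
  by have := expR_ge1Dxn 1 z0; rewrite /= => hh; apply: le_trans hh; rewrite lerDr.
have s5 : DE mu W (fun s t => ov R n s t ^+ 2) <= (a * n%:R)^-1 * F + G.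
  apply: (@ov_split W (fun r => r ^+ 2)) => // r.
    by move=> r1; rewrite -[r ^+ 2]real_normK ?num_real // exprn_ile1 // ler_norml.
  rewrite ler_pdivlMl //; apply: le_trans (expR_ge1Dx _); lra.
have x1 : (x ^+ 2)^-1 <= (c ^+ 2)^-1 by rewrite lef_pV2 ?posrE ?exprn_gt0 // lerXn2r ?nnegrE // ltW.
have FG e : 0 <= e -> (e * F + G) / x ^+ 2 <= e * (F / c ^+ 2) + G / x / c.
  move=> e0; rewrite mulrDl; apply: lerD.
    by rewrite -mulrA; apply: ler_wpM2l => //; apply: ler_wpM2l.
  rewrite -mulrA -invfM; apply: ler_wpM2l => //; rewrite lef_pV2 ?posrE ?exprn_gt0 ?mulr_gt0 //.
  by rewrite expr2 ler_pM2l // ltW.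
have R4 : R2 ^+ 2 <= 2 / (a * n%:R) ^+ 2 * (F / c ^+ 2) + G / x / c.
  apply: le_trans R22 _; apply: le_trans (FG _ _); first by rewrite ler_pM2r ?invr_gt0.
  by pos.
have R5 : R2 <= (a * n%:R)^-1 * (F / c ^+ 2) + G / x / c.
  by apply: le_trans (FG _ _); [rewrite /R2 ler_pM2r ?invr_gt0|rewrite invr_ge0 ltW].
have e1 : 4 * R1 * R2 <= 2 * h * R2 ^+ 2 + 2 / h * R2.
  have := ler_wpM2r R20 r12.
  have gen (r2 : R) : (h / 2 * r2 + (2 * h)^-1) * r2 = h / 2 * r2 ^+ 2 + h^-1 / 2 * r2.
    by field; exact: lt0r_neq0.
  rewrite gen.
  lra.
apply: le_trans e1 _.
have h2 : 0 <= 2 * h by pos.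
have h2' : 0 <= 2 / h by pos.
have := ler_wpM2l h2 R4; have := ler_wpM2l h2' R5.
have -> : 2 / h * ((a * n%:R)^-1 * (F / c ^+ 2) + G / x / c) = 2 / (h * a * n%:R) * (F / c ^+ 2) + 2 / h * (G / x / c).
  by rewrite mulrDr; congr (_ + _); field; rewrite !lt0r_neq0.
have -> : 2 * h * (2 / (a * n%:R) ^+ 2 * (F / c ^+ 2) + G / x / c) = 4 * h / (a ^+ 2 * n%:R ^+ 2) * (F / c ^+ 2) + 2 * h * (G / x / c).
  by rewrite mulrDr; congr (_ + _); field; rewrite !lt0r_neq0.
lra.
Qed.

(** A discrete Gronwall inequality, started from [pot 1 <= 1]. *)
Lemma Em_pot m B : (forall i, (i < m)%N -> Em k n i rest <= B) -> 0 <= B ->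
  Em k n m (fun W => pot (A mu W)) <= (1 + C1 / n%:R) ^+ m * (1 + m%:R * B).
Proof.
move=> + B0; have x0 := chi_gt0 R k3.
have C10 := C1n_ge0.
have e1 : 1 <= 1 + C1 / n%:R by rewrite lerDl.
elim: m => [|m IH] hB.
  rewrite /Em /= A1 // mul1r mul0r addr0 /pot.
  have c1 : 0 < 1 + c by rewrite addr_gt0.
  rewrite -ln_div ?posrE ?addr_gt0 //; apply: le_trans (ln_le_sub1 _) _; first by rewrite divr_gt0 ?addr_gt0.
  rewrite lerBlDr ler_pdivrMr //.
  rewrite -subr_ge0 (_ : (1 + 1) * (1 + c) - (1 + c + 1) = c); last by ring.
  exact: ltW.
have st : Em k n m.+1 (fun W => pot (A mu W)) <= (1 + C1 / n%:R) * Em k n m (fun W => pot (A mu W)) + Em k n m rest.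
  rewrite /Em iterSr.
  apply: le_trans (_ : iter m (Tr (iid (lits R n) k) (@Lcl R k)) (fun W => (1 + C1 / n%:R) * pot (A mu W) + rest W) (fun=> 1) <= _).
    by apply: (iterTr_le ch) => [s|V v]; [exact: ler01|exact: pot_Tr].
  by rewrite iterTrD iterTrZ.
apply: le_trans st _.
have IH' := IH (fun i im => hB i (ltnW im)).
have h1 := ler_wpM2l (le_trans ler01 e1) IH'; have h2 := hB m (leqnn _).
have P1 : 1 <= (1 + C1 / n%:R) ^+ m.+1 by rewrite exprn_ege1.
have := ler_wpM2r B0 P1; rewrite mulrA -exprS in h1; rewrite -[m.+1%:R]natr1; lra.
Qed.

End Potential.

(** * Overlaps and vanishing density in the null model *)

Section NullModel.
Variables (R : realType) (k : nat).
Hypothesis k3 : (3 <= k)%N.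
Let kp : 0 < k%:R :> R. Proof. by rewrite ltr0n; case: k k3. Qed.

Lemma sqr_expRN_le (c n : R) : 0 < c -> 0 < n -> n ^+ 2 * expR (- (c * n)) <= 6 / (c ^+ 3 * n).
Proof.
move=> c0 n0; have z0 : 0 <= c * n by rewrite mulr_ge0 // ltW.
have := expR_ge1Dxn 2 z0; rewrite /= => h.
have h' : (c * n) ^+ 3 / 6 <= expR (c * n).
  by apply: le_trans h; rewrite (_ : (3`!)%:R = 6 :> R) ?lerDr // /factorial /=.
have cn : 0 < (c * n) ^+ 3 / 6 by rewrite divr_gt0 // exprn_gt0 // mulr_gt0.
rewrite expRN; apply: le_trans (_ : n ^+ 2 * ((c * n) ^+ 3 / 6)^-1 <= _).
  by apply: ler_wpM2l; [exact: sqr_ge0|rewrite lef_pV2 ?posrE ?expR_gt0].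
by rewrite le_eqVlt; apply/orP; left; apply/eqP; field; rewrite !lt0r_neq0.
Qed.

(** Markov's inequality for the potential: its mean is at most [Mt], while [A <= c] makes it at
    least [- ln (2 c) = Mt / del]. *)
Lemma null_small (d del : R) : 0 < d -> (d%:E < dcond R k)%E -> 0 < del ->
  exists2 c, 0 < c & exists N, forall n m, (N <= n)%N -> m%:R <= d * n%:R / k%:R ->
    Em k n m (fun W => (A (spins R n) W <= c)%R%:R) <= del.
Proof.
move=> d0 dc del0; have [a [eps [C [a0 eps01 C0 hF]]]] := Em_Fexp k3 d0 dc.
have [c' c'0 [N1 hN1]] := Em_overlap_tail k3 d0 dc eps01.
have x0 := chi_gt0 R k3; set chi := chi R k in x0.
pose C1 := 40 * chi / a; have C10 : 0 < C1 by apply: divr_gt0 => //; exact: mulr_gt0.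
pose D := d / k%:R; have D0 : 0 < D by exact: divr_gt0.
(* This bound must not depend on [c], which is chosen from it. The terms involving [c] vanish as [n]
   grows and are absorbed in the constant 2. *)
pose Mt := expR (C1 * D) * (2 + D * (C1 * C)).
have Mt0 : 0 < Mt.
  apply: mulr_gt0; first exact: expR_gt0.
  by apply: addr_gt0 => //; apply: mulr_gt0 => //; exact: mulr_gt0.
pose c := expR (- (Mt / del)) / 2; have c0 : 0 < c by apply: divr_gt0 => //; exact: expR_gt0.
exists c => //.
pose ell := pot c 0; have l0 : 0 <= ell by apply: pot_ge0.
pose M := ell * (C / c ^+ 2 * (4 / a ^+ 2 + 2 / a)) + (20 * chi + 4 * ell) / c * (11 * (6 / c' ^+ 3)).
have M0 : 0 <= M.
  rewrite /M; clearbody ell C1 D Mt c chi; pos.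
have [N2 _ hN2] := nat_above ((D * M) ^+ 2).
exists (N1 + N2).+1 => n m nN md.
have n0 : (0 < n)%N by apply: leq_ltn_trans nN.
have nN1 : (N1 <= n)%N by rewrite (leq_trans _ nN) // ltnW // ltnS leq_addr.
have nN2 : (N2 <= n)%N by rewrite (leq_trans _ nN) // ltnW // ltnS leq_addl.
have np : 0 < n%:R :> R by rewrite ltr0n.
have n1 : 1 <= n%:R :> R by rewrite ler1n.
have muP := isprob_spins R n; have ch := channel_cl R k3 n0.
(* Balances [h / n^2] against [1 / (h n)]: both are [n^(-3/2)], so their sum over linearly many
   clauses tends to zero. *)
pose h : R := Num.sqrt n%:R; have h0 : 0 < h by rewrite sqrtr_gt0.
have hh : h ^+ 2 = n%:R by rewrite sqr_sqrtr // ltW.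
have h1 : 1 <= h by rewrite -sqrtr1 ler_sqrt.
have hn : h <= n%:R by rewrite -hh expr2 ler_peMl // ltW.
have DMh : D * M <= h.
  have h2 : 0 <= D * M by apply: mulr_ge0 => //; exact: ltW.
  rewrite -(ler_pXn2r (n := 2)) ?nnegrE ?(ltW h0) // hh; apply: le_trans hN2 _.
  by rewrite ler_nat.
set tau := 11 * expR (- (c' * n%:R)).
have tau0 : 0 <= tau by rewrite mulr_ge0 // expR_ge0.
pose B := C1 / n%:R * C + 20 * chi * (tau / c) +
  ell * ((4 * h / (a ^+ 2 * n%:R ^+ 2) + 2 / (h * a * n%:R)) * (C / c ^+ 2) + (2 * h + 2 / h) * (tau / c)).
have B0 : 0 <= B.
  rewrite /B; clearbody ell C1 D Mt c chi h tau; pos.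
have mD : m%:R <= D * n%:R by rewrite /D mulrAC.
have EB i : (i < m)%N -> Em k n i (rest k n a eps c h) <= B.
  move=> im; have id_ : i%:R <= d * n%:R / k%:R by apply: le_trans md; rewrite ler_nat ltnW.
  have e1 := hF n i n0 id_; have e2 := hN1 n i nN1 id_.
  rewrite (_ : rest k n a eps c h = fun W => (C1 / n%:R + ell * ((4 * h / (a ^+ 2 * n%:R ^+ 2) + 2 / (h * a * n%:R)) / c ^+ 2)) * Fexp n a eps W
     + (20 * chi / c + ell * ((2 * h + 2 / h) / c)) * (Gt n eps W / A (spins R n) W)); last first.
    by apply/funext => W; rewrite /rest -/ell -/chi -/C1; ring.
  rewrite /Em iterTrD !iterTrZ -!/(Em _ _ _ _).
  have -> : B = (C1 / n%:R + ell * ((4 * h / (a ^+ 2 * n%:R ^+ 2) + 2 / (h * a * n%:R)) / c ^+ 2)) * C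
     + (20 * chi / c + ell * ((2 * h + 2 / h) / c)) * tau by rewrite /B; ring.
  apply: lerD; apply: ler_wpM2l => //; clearbody ell C1 D Mt c chi h tau; pos.
have mB : m%:R * B <= D * (C1 * C) + 1.
  apply: le_trans (_ : D * n%:R * B <= _); first exact: ler_wpM2r.
  have E : n%:R * B = C1 * C + (ell * (C / c ^+ 2 * (4 / a ^+ 2 + 2 / a)) / h +
     (n%:R * 20 * chi + ell * n%:R * (2 * h + 2 / h)) / c * tau).
    rewrite /B -hh; field; by rewrite !lt0r_neq0.
  have h2 : 2 * h + 2 / h <= 4 * n%:R.
    have : h^-1 <= 1 by rewrite invf_le1.
    lra.
  have tn : (n%:R * 20 * chi + ell * n%:R * (2 * h + 2 / h)) / c * tau <= (20 * chi + 4 * ell) / c * (11 * (6 / c' ^+ 3)) / h.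
    apply: le_trans (_ : (20 * chi + 4 * ell) / c * (11 * (n%:R ^+ 2 * expR (- (c' * n%:R)))) <= _).
      have -> : (20 * chi + 4 * ell) / c * (11 * (n%:R ^+ 2 * expR (- (c' * n%:R)))) = (n%:R ^+ 2 * (20 * chi) + ell * n%:R * (4 * n%:R)) / c * tau.
        by rewrite /tau; ring.
      apply: ler_wpM2r => //; rewrite ler_pM2r ?invr_gt0 //; apply: lerD.
        rewrite -mulrA; apply: ler_wpM2r; first by rewrite mulr_ge0 // ltW.
        by rewrite expr2 ler_peMl // ltW.
      by apply: ler_wpM2l => //; rewrite mulr_ge0 // ltW.
    rewrite -[leRHS]mulrA; apply: ler_wpM2l; first by clearbody ell C1 D Mt c chi h tau; pos.
    rewrite -[leRHS]mulrA ler_pM2l //; apply: le_trans (sqr_expRN_le c'0 np) _.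
    rewrite invfM mulrA; apply: ler_wpM2l; first by rewrite divr_ge0 ?exprn_ge0 // ltW.
    by rewrite lef_pV2 ?posrE.
  have le1 : n%:R * B <= C1 * C + M / h.
    by rewrite E lerD2l /M [leRHS]mulrDl; apply: lerD.
  rewrite -mulrA; apply: le_trans (ler_wpM2l (ltW D0) le1) _.
  rewrite mulrDr lerD2l mulrA ler_pdivrMr // mul1r //.
have pm := Em_pot k3 n0 a0 c0 h0 EB B0.
have p1 : (1 + C1 / n%:R) ^+ m <= expR (C1 * D).
  apply: le_trans (_ : expR (C1 / n%:R) ^+ m <= _).
    by apply: lerXn2r; rewrite ?nnegrE ?expR_ge0 ?expR_ge1Dx // addr_ge0 // divr_ge0 // ltW.
  rewrite -expRM_natr ler_expR; have := ler_wpM2l (divr_ge0 (ltW C10) (ltW np)) mD.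
  have -> : C1 / n%:R * (D * n%:R) = C1 * D by field; exact: lt0r_neq0.
  by [].
have tot : Em k n m (fun W => pot c (A (spins R n) W)) <= Mt.
  apply: le_trans pm _; rewrite -/C1 /Mt; apply: ler_pM => //; [by rewrite exprn_ge0 // addr_ge0 // divr_ge0 // ltW|by rewrite addr_ge0 // mulr_ge0|lra].
have pc : Mt / del <= pot c c.
  rewrite /pot; have -> : c + c = expR (- (Mt / del)) by rewrite /c; field.
  by rewrite expRK opprK lerDr ln_ge0 // lerDr expR_ge0.
have pcp : 0 < Mt / del by apply: divr_gt0.
apply: le_trans (_ : Em k n m (fun W => (Mt / del)^-1 * pot c (A (spins R n) W)) <= _).
  apply: (Em_le k3 n0) => W w; have aw := A_ge0 muP w.
  have p0 : 0 <= (Mt / del)^-1 * pot c (A (spins R n) W).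
    by apply: mulr_ge0; [rewrite invr_ge0 ltW|exact: pot_ge0].
  case: (leP (A (spins R n) W) c) => [ac|_] //.
  have key : 1 <= (Mt / del)^-1 * pot c (A (spins R n) W).
    by rewrite ler_pdivlMl // mulr1; apply: le_trans pc _; exact: (pot_anti c0 aw ac).
  exact: key.
rewrite /Em iterTrZ -/(Em _ _ _ _) ler_pdivrMl //.
by have -> : Mt / del * del = Mt; [field; exact: lt0r_neq0|].
Qed.

Definition Rv n W : R := DE (spins R n) W (fun s t => `|ov R n s t|) / A (spins R n) W ^+ 2.

(** Densities with [A <= c] are rare. On the others, overlaps below [eps] contribute at most [eps],
    and one factor [1 / A <= 1 / c] turns the null mean of larger overlaps into the planted tail. *)
Lemma Em_small (d del : R) : 0 < d -> (d%:E < dcond R k)%E -> 0 < del ->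
  exists N, forall n m, (N <= n)%N -> m%:R <= d * n%:R / k%:R ->
    Em k n m (fun W => (A (spins R n) W == 0)%:R) <= del /\ Em k n m (Rv n) <= del.
Proof.
move=> d0 dc del0; have del3 : 0 < del / 3 by apply: divr_gt0.
have [c c0 [N1 hN1]] := null_small d0 dc del3.
pose eps := Num.min (1 / 2) (c * (del / 3)).
have e0 : 0 < eps by rewrite /eps lt_min divr_gt0 //= mulr_gt0.
have e1 : eps < 1 by rewrite /eps gt_min; apply/orP; left; lra.
have ec : eps <= c * (del / 3) by rewrite /eps ge_min lexx orbT.
have e01 : 0 < eps < 1 by rewrite e0.
have [c' c'0 [N2 hN2]] := Em_overlap_tail k3 d0 dc e01.
have cd0 : 0 < c * c' * del by rewrite !mulr_gt0.
have [N3 hN3] := big_enough 33 cd0.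
exists (N1 + N2 + N3).+1 => n m nN md.
have n0 : (0 < n)%N by apply: leq_ltn_trans nN.
have nN1 : (N1 <= n)%N by lia.
have nN2 : (N2 <= n)%N by lia.
have nN3 : (N3 <= n)%N by lia.
have np : 0 < n%:R :> R by rewrite ltr0n.
have muP := isprob_spins R n.
have h1 := hN1 n m nN1 md; have h2 := hN2 n m nN2 md; have h3 := hN3 n nN3.
have hE : Em k n m (fun W => (A (spins R n) W == 0)%:R) <= del / 3.
  apply: le_trans h1; apply: (Em_le k3 n0) => W w; case: (eqVneq (A (spins R n) W) 0) => [->|_] //.
  by rewrite (ltW c0).
split; first by lra.
apply: le_trans (_ : Em k n m (fun W => (A (spins R n) W <= c)%R%:R + (eps / c * A (spins R n) W + c^-1 * (Gt n eps W / A (spins R n) W))) <= _).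
  apply: (Em_le k3 n0) => W w; have aw := A_ge0 muP w; have g0 : 0 <= Gt n eps W by apply: (DE_ge0 muP).
  have [az|an] := eqVneq (A (spins R n) W) 0.
    rewrite /Rv az expr0n invr0 !mulr0 !addr0; exact: ler0n.
  have ap : 0 < A (spins R n) W by rewrite lt_def an.
  have A2 : 0 < A (spins R n) W ^+ 2 by rewrite exprn_gt0.
  have r1 : Rv n W <= 1.
    rewrite /Rv ler_pdivrMr // mul1r -(DE1 (spins R n)); apply: (DE_le muP) => // s t.
    by rewrite ler_norml; exact: ov_le1.
  have t0 : 0 <= eps / c * A (spins R n) W + c^-1 * (Gt n eps W / A (spins R n) W).
    by apply: addr_ge0; apply: mulr_ge0; rewrite ?divr_ge0 ?invr_ge0 // ltW.
  case: (leP (A (spins R n) W) c) => [_|ca]; first by apply: le_trans r1 _; rewrite lerDl.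
  rewrite add0r /Rv.
  apply: le_trans (_ : (eps * A (spins R n) W ^+ 2 + Gt n eps W) / A (spins R n) W ^+ 2 <= _).
    rewrite ler_pM2r ?invr_gt0 // -(DE1 (spins R n)) -DEZ -DED; apply: (DE_le muP) => // s t; rewrite mulr1.
    case: (ltP eps `|ov R n s t|) => h /=; last by rewrite addr0.
    have : `|ov R n s t| <= 1 by rewrite ler_norml; exact: ov_le1.
    by move=> h'; apply: le_trans h' _; rewrite lerDr ltW.
  have -> : (eps * A (spins R n) W ^+ 2 + Gt n eps W) / A (spins R n) W ^+ 2 = eps + (A (spins R n) W)^-1 * (Gt n eps W / A (spins R n) W).
    by field.
  apply: lerD; last by apply: ler_wpM2r; [exact: divr_ge0|rewrite lef_pV2 ?posrE // ltW].
  by rewrite mulrAC -mulrA; apply: ler_peMr; [exact: ltW|rewrite ler_pdivlMr // mul1r ltW].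
rewrite /Em !iterTrD !iterTrZ (iterTr_A _ (channel_cl R k3 n0)) A1 // mulr1 -!/(Em _ _ _ _).
have i1 : eps / c <= del / 3 by rewrite ler_pdivrMr // mulrC.
have i2 : c^-1 * (11 * expR (- (c' * n%:R))) <= del / 3.
  rewrite ler_pdivrMl // expRN ler_pdivrMr ?expR_gt0 //.
  have : 1 + c' * n%:R <= expR (c' * n%:R) by exact: expR_ge1Dx.
  have cd : 0 < c * (del / 3) by rewrite mulr_gt0.
  move=> /(ler_wpM2l (ltW cd)); apply: le_trans; lra.
have cV : 0 <= c^-1 by rewrite invr_ge0 ltW.
have := ler_wpM2l cV h2; rewrite -/(Gt _ _ _); move: h1 i1 i2.
rewrite /Gt; lra.
Qed.

End NullModel.

(* [Z] and [avgF] count classical sets, not finsets. *)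
Lemma card_classic (T : finType) (P : pred T) :
  #|([set x : T | P x])%classic| = (\sum_(x | P x) 1)%N.
Proof.
rewrite sum1_card; apply: eq_card => x.
by apply/idP/idP => [/set_mem|h] //; apply/mem_set.
Qed.

(** * Finite laws as sums over finite functions *)

Section FiniteFunctions.
Variable R : realType.

(** The position [h] is a parameter because lists grow at the front while spins are added at the
    last index. *)
Definition fins (I : finType) m (h : 'I_m.+1) (x : I) (g : {ffun 'I_m -> I}) : {ffun 'I_m.+1 -> I} :=
  [ffun j => if unlift h j is Some j' then g j' else x].

Lemma sum_ffunS (I : finType) m (h : 'I_m.+1) (F : {ffun 'I_m.+1 -> I} -> R) :
  \sum_g F g = \sum_(x : I) \sum_(g : {ffun 'I_m -> I}) F (fins h x g).
Proof.
rewrite pair_big /=; apply: (reindex (fun p => fins h p.1 p.2)).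
exists (fun g : {ffun 'I_m.+1 -> I} => (g h, [ffun j => g (lift h j)])) => [[x g] _|g _] /=.
  congr pair; first by rewrite ffunE unlift_none.
  by apply/ffunP => j; rewrite !ffunE liftK.
by apply/ffunP => j; rewrite ffunE; case: unliftP => [j' ->|->] //; rewrite ffunE.
Qed.

Lemma sum_ffun0 (I : finType) (F : {ffun 'I_0 -> I} -> R) g0 : \sum_g F g = F g0.
Proof.
rewrite (eq_bigr (fun=> F g0)) => [|g _]; last by congr F; apply/ffunP => -[].
by rewrite sumr_const card_ffun card_ord expn0.
Qed.

Lemma ex_iid_ffun (I : finType) T (e : I -> T) (p : fd R T) :
  (forall f, ex p f = #|I|%:R^-1 * \sum_i f (e i)) -> forall m f,
  ex (iid p m) f = #|{ffun 'I_m -> I}|%:R^-1 * \sum_(g : {ffun 'I_m -> I}) f [seq e (g j) | j <- enum 'I_m].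
Proof.
move=> hp m f; rewrite card_ffun card_ord natrX -exprVn.
elim: m f => [|m IH] f.
  have g0 : {ffun 'I_0 -> I} by apply: finfun; case.
  by rewrite ex_iid0 (sum_ffun0 _ g0) enum_ord0 expr0 mul1r.
rewrite ex_iidS hp (sum_ffunS ord0) exprS -[RHS]mulrA; congr (_ * _).
rewrite mulr_sumr; apply: eq_bigr => x _.
rewrite IH; congr (_ * _); apply: eq_bigr => g _; congr f.
rewrite enum_ordSl /= ffunE unlift_none -map_comp; congr cons.
by apply: eq_map => j /=; rewrite ffunE liftK.
Qed.

Definition lit_of n (l : 'I_n * bool) : lit := (nat_of_ord l.1, l.2).
Definition clause_of k n (c : clause k n) : seq lit := [seq lit_of (c i) | i <- enum 'I_k].
Definition formula_of k n m (F : formula k n m) : seq (seq lit) := [seq clause_of (F j) | j <- enum 'I_m].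

Lemma ex_lits_sum n f : ex (lits R n) f = #|{: 'I_n * bool}|%:R^-1 * \sum_(l : 'I_n * bool) f (lit_of l).
Proof.
rewrite ex_lits ex_vars; have -> : #|{: 'I_n * bool}| = (n * 2)%N by rewrite card_prod card_ord card_bool.
rewrite natrM invfM -[RHS]mulrA; congr (_ * _).
rewrite -(pair_big xpredT xpredT (fun v b => f (lit_of (v, b)))) mulr_sumr; apply: eq_bigr => v _.
by rewrite big_bool /lit_of /= mulrC.
Qed.

Lemma ex_formula k n m f : ex (iid (iid (lits R n) k) m) f =
  #|{: formula k n m}|%:R^-1 * \sum_(F : formula k n m) f (formula_of F).
Proof.
apply: (@ex_iid_ffun _ _ (@clause_of k n)) => g.
exact: (@ex_iid_ffun _ _ (@lit_of n) _ (@ex_lits_sum n)).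
Qed.

Definition ext n (s : assignment n) (v : nat) : bool := if insub v is Some i then s i else false.

Lemma ext_ord n (s : assignment n) (i : 'I_n) : ext s i = s i.
Proof. by rewrite /ext valK. Qed.

Lemma ext_out n (s : assignment n) v : (n <= v)%N -> ext s v = false.
Proof. by move=> nv; rewrite /ext insubN // -leqNgt. Qed.

Lemma ext_fins n (g : assignment n) x : ext (fins ord_max x g : assignment n.+1) = upd (ext g) n x.
Proof.
apply/funext => v; rewrite /upd; have [vn|nv] := ltnP v n.+1; last first.
  by rewrite ext_out // gtn_eqF // ext_out // ltnW.
rewrite -[v]/(nat_of_ord (Ordinal vn)) ext_ord ffunE.
case: unliftP => [j ->|->]; last by rewrite /= eqxx.
by rewrite lift_max ltn_eqF // ext_ord.
Qed.

Lemma ex_spins_sum n f : ex (spins R n) f = 2 ^- n * \sum_(s : assignment n) f (ext s).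
Proof.
elim: n f => [|n IH] f.
  have g0 : assignment 0 by apply: finfun; case.
  rewrite /ex big_seq1 /= (sum_ffun0 _ g0) expr0 invr1 !mul1r.
  by congr f; apply/funext => v; rewrite ext_out.
rewrite ex_spinsS IH (sum_ffunS ord_max) big_bool /= -big_split /= exprSr invfM -[RHS]mulrA.
congr (_ * _); rewrite mulr_sumr; apply: eq_bigr => s _; by rewrite !ext_fins mulrC.
Qed.

End FiniteFunctions.

(** * From densities to formulas with distinct variables *)

Section Bridge.
Variables (R : realType) (k : nat).
Hypothesis k3 : (3 <= k)%N.

Lemma iterTr_iid S I (p : fd R I) (L : I -> S -> R) m Phi W :
  iter m (Tr p L) Phi W = ex (iid p m) (fun l => Phi (foldl (fun V i => wmul V (L i)) W l)).
Proof.
elim: m W => [|m IH] W; first by rewrite ex_iid0.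
by rewrite ex_iidS /= /Tr; apply: eq_ex => i; rewrite IH.
Qed.

Definition wF n m (F : formula k n m) : (nat -> bool) -> R :=
  foldl (fun V c => wmul V (Lcl R k c)) (fun=> 1) (formula_of F).

Lemma Em_formula n m Phi : Em k n m Phi = #|{: formula k n m}|%:R^-1 * \sum_(F : formula k n m) Phi (wF F).
Proof. by rewrite /Em iterTr_iid ex_formula. Qed.

Lemma foldl_wmul S I (L : I -> S -> R) l W s :
  foldl (fun V i => wmul V (L i)) W l s = W s * \prod_(i <- l) L i s.
Proof.
elim: l W => [|i l IH] W /=; first by rewrite big_nil mulr1.
by rewrite IH big_cons mulrA.
Qed.

Lemma NAE_mono n m (s : assignment n) (F : formula k n m) :
  NAE s F = [forall j, ~~ mono (map (tr (ext s)) (clause_of (F j)))].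
Proof.
have trE (l : 'I_n * bool) : tr (ext s) (lit_of l) = lit_true s l by rewrite /tr /= ext_ord.
have h1 c : satisfies_clause s c = has id (map (tr (ext s)) (@clause_of k n c)).
  apply/existsP/hasP => [[i si]|[b]].
    by exists true => //; rewrite -map_comp; apply/mapP; exists i; rewrite ?mem_enum //= trE si.
  by rewrite -map_comp => /mapP[i _ ->] /=; rewrite trE => h; exists i.
have h2 c : satisfies_clause (inverse s) c = has negb (map (tr (ext s)) (@clause_of k n c)).
  have inv (l : 'I_n * bool) : lit_true (inverse s) l = ~~ lit_true s l.
    by rewrite /lit_true ffunE; case: (s _) (l.2) => [] [].
  apply/existsP/hasP => [[i si]|[b]].
    by exists false => //; rewrite -map_comp; apply/mapP; exists i; rewrite ?mem_enum //= trE; move: si; rewrite inv => /negbTE.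
  by rewrite -map_comp => /mapP[i _ ->] /=; rewrite trE => h; exists i; rewrite inv.
have mE c : ~~ mono (map (tr (ext s)) (@clause_of k n c)) = satisfies_clause s c && satisfies_clause (inverse s) c.
  rewrite h1 h2 /mono negb_or andbC -!has_predC; congr (_ && _); apply: eq_has => b //=; exact: negbK.
apply/andP/forallP => [[/forallP a /forallP b] j|h]; first by rewrite mE a b.
by split; apply/forallP => j; have := h j; rewrite mE => /andP[].
Qed.

Lemma wF_ext n m (F : formula k n m) s : wF F (ext s) = (NAE s F)%:R * (qk R k)^-1 ^+ m.
Proof.
rewrite /wF foldl_wmul mul1r big_map big_enum /=.
rewrite (eq_bigr (fun j => (~~ mono (map (tr (ext s)) (clause_of (F j))))%:R * (qk R k)^-1)); last first.
  by move=> j _; rewrite /Lcl; case: (mono _); rewrite ?mul0r ?mul1r.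
rewrite big_split /= prodr_const card_ord; congr (_ * _); rewrite NAE_mono.
case: (boolP [forall j, _]) => [/forallP h|]; first by rewrite big1 // => j _; rewrite h.
by rewrite negb_forall => /existsP[j /negbTE hj]; rewrite (bigD1 j) //= hj mul0r.
Qed.

Lemma nn_wF n m (F : formula k n m) : nn (wF F).
Proof. by move=> s; rewrite /wF foldl_wmul mul1r; apply: prodr_ge0 => c _; exact: Lcl_ge0. Qed.

Lemma A_wF n m (F : formula k n m) : A (spins R n) (wF F) = 2 ^- n * (qk R k)^-1 ^+ m * (Z F)%:R.
Proof.
rewrite /A ex_spins_sum (eq_bigr _ (fun s _ => wF_ext F s)) -mulr_suml -mulrA; congr (_ * _).
rewrite mulrC; congr (_ * _); rewrite /Z card_classic natr_sum [RHS]big_mkcond /=.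
by apply: eq_bigr => s _; case: (NAE s F).
Qed.

Lemma ov_ext n (s t : assignment n) : ov R n (ext s) (ext t) = dot R s t / n%:R.
Proof.
rewrite /ov ex_vars mulrC; congr (_ / _); apply: eq_bigr => v _; by rewrite !ext_ord.
Qed.

Lemma Rv_wF n m (F : formula k n m) : (0 < n)%N -> Rv n (wF F) = gibbs_abs_overlap R F / n%:R.
Proof.
move=> n0; have np : 0 < n%:R :> R by rewrite ltr0n.
set a : R := 2 ^- n; set K : R := (qk R k)^-1 ^+ m.
have a0 : a != 0 by rewrite invr_eq0 expf_neq0.
have K0 : K != 0 by rewrite expf_neq0 // invr_eq0 lt0r_neq0 // qk_gt0.
rewrite /Rv A_wF -/a -/K /gibbs_abs_overlap.
have -> : DE (spins R n) (wF F) (fun s t => `|ov R n s t|) =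
   (a * K) ^+ 2 / n%:R * \sum_(s : assignment n | NAE s F) \sum_(t : assignment n | NAE t F) `|dot R s t|.
  rewrite /DE ex_spins_sum -/a.
  rewrite (eq_bigr (fun s : assignment n => a * K ^+ 2 / n%:R * (if NAE s F then \sum_(t : assignment n | NAE t F) `|dot R s t| else 0))); last first.
    move=> s _; rewrite wF_ext ex_spins_sum -/a -/K; case: (NAE s F); last by rewrite !mul0r mulr0.
    rewrite mul1r; have -> : \sum_(t : assignment n) wF F (ext t) * `|ov R n (ext s) (ext t)| =
       K / n%:R * \sum_(t : assignment n | NAE t F) `|dot R s t|.
      rewrite [in RHS]big_mkcond mulr_sumr; apply: eq_bigr => t _; rewrite wF_ext -/K ov_ext.
      case: (NAE t F); last by rewrite !mul0r mulr0.
      by rewrite normrM normfV (ger0_norm (ltW np)) mul1r; ring.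
    by ring.
  rewrite -mulr_sumr -big_mkcond; ring.
have [z0|zn] := eqVneq ((Z F)%:R : R) 0; first by rewrite z0 mulr0 expr0n /= invr0 !mulr0 mul0r.
by field; rewrite a0 K0 zn lt0r_neq0.
Qed.

Lemma A_wF_eq0 n m (F : formula k n m) : (A (spins R n) (wF F) == 0) = ~~ (0 < Z F)%N.
Proof.
have c0 : 0 < 2 ^- n * (qk R k)^-1 ^+ m :> R.
  by apply: mulr_gt0; [rewrite invr_gt0 exprn_gt0|rewrite exprn_gt0 // invr_gt0 qk_gt0].
by rewrite A_wF mulf_eq0 (gt_eqF c0) /= pnatr_eq0 -leqNgt leqn0.
Qed.

Definition validl (c : seq lit) := uniq (map fst c).

Lemma valid_formulaE n m (F : formula k n m) : valid_formula F = all validl (formula_of F).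
Proof.
have vE (c : clause k n) : valid_clause c = validl (clause_of c).
  rewrite /validl /clause_of -map_comp /valid_clause /injectiveb /dinjectiveb.
  by rewrite -(map_inj_uniq val_inj) -map_comp.
apply/forallP/allP => [h c /mapP[j _ ->]|h j]; first by rewrite -vE.
by rewrite vE; apply: h; apply/mapP; exists j; rewrite ?mem_enum.
Qed.

Lemma ex_mem n (s : seq nat) : ex (lits R n) (fun l => (l.1 \in s)%:R) <= (size s)%:R / n%:R.
Proof.
rewrite ex_lits (@eq_ex _ _ _ _ (fun v => (v \in s)%:R)); last by move=> v /=; field.
rewrite ex_vars mulrC; apply: ler_wpM2r; first by rewrite invr_ge0.
rewrite -natr_sum ler_nat; elim: s => [|w s IH]; first by rewrite big1.
apply: leq_trans (_ : \sum_(v < n) ((val v == w) + (val v \in s)) <= _)%N.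
  by apply: leq_sum => v _; rewrite inE; case: (_ == _) (_ \in _) => [] [].
rewrite big_split /= -add1n leq_add //; have [wn|nw] := ltnP w n.
  rewrite (bigD1 (Ordinal wn)) //= eqxx big1 // => v; rewrite -val_eqE /= => /negbTE ->; by [].
by rewrite big1 // => v _; rewrite ltn_eqF // (leq_trans (ltn_ord v)).
Qed.

(** The birthday bound, one literal at a time. *)
Lemma ex_invalid n j : (0 < n)%N -> ex (iid (lits R n) j) (fun c => (~~ validl c)%:R) <= j%:R ^+ 2 / n%:R.
Proof.
move=> n0; have lP := isprob_lits R n0; elim: j => [|j IH]; first by rewrite ex_iid0 expr0n mul0r.
rewrite ex_iidS ex_exchange; apply: le_trans (_ : ex (iid (lits R n) j) (fun c => j%:R / n%:R + (~~ validl c)%:R) <= _).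
  apply: (ex_le_iid lP) => c cj.
  apply: le_trans (_ : ex (lits R n) (fun l => (l.1 \in map fst c)%:R + (~~ validl c)%:R) <= _).
    by apply: (ex_le lP) => l; rewrite /validl /= negb_and negbK; case: (_ \in _) (uniq _) => [] [] /=; rewrite ?addr0 ?add0r ?lerDl.
  rewrite exD (ex_cst lP) lerD2r; apply: le_trans (ex_mem n (map fst c)) _.
  by rewrite size_map cj.
rewrite exD (ex_cst (isprob_iid j lP)); apply: le_trans (lerD (lexx _) IH) _.
rewrite -mulrDl; apply: ler_wpM2r; first by rewrite invr_ge0.
have := ler0n R j; rewrite -[j.+1%:R]natr1; lra.
Qed.

(** All [m] clauses are valid with probability at least [(1 - k^2 / n)^m], and conditioning raises a
    nonnegative mean at most by the inverse. Its positivity also shows that valid formulas exist. *)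
Lemma avgF_le n m Phi : (0 < n)%N -> k%:R ^+ 2 / n%:R <= 1 / 2 :> R -> (forall W, nn W -> 0 <= Phi W) ->
  (0 < #|[set F : formula k n m | valid_formula F]|)%N /\
  avgF (fun F : formula k n m => Phi (wF F)) <= expR (2 * (k%:R ^+ 2 / n%:R) * m%:R) * Em k n m Phi.
Proof.
move=> n0 kn P0; have lP := isprob_iid k (isprob_lits R n0).
set x := k%:R ^+ 2 / n%:R in kn *.
have x0 : 0 <= x by rewrite divr_ge0 // exprn_ge0.
set pv := ex (iid (lits R n) k) (fun c => (validl c)%:R).
have pvx : 1 - x <= pv.
  have := ex_invalid k n0; rewrite (@eq_ex _ _ _ _ (fun c => 1 - (validl c)%:R)).
    by rewrite exB (ex_cst lP) -/pv -/x; lra.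
  by move=> c; case: (validl c); rewrite ?subrr ?subr0.
have e1 : expR (- (2 * x)) <= pv.
  apply: le_trans pvx; rewrite expRN -[leLHS]mul1r ler_pdivrMr ?expR_gt0 //.
  apply: le_trans (_ : (1 - x) * (1 + 2 * x) <= _).
    have : 0 <= x * (1 - 2 * x) by rewrite mulr_ge0 //; lra.
    lra.
  by apply: ler_wpM2l; [lra|exact: expR_ge1Dx].
have pv0 : 0 < pv by apply: lt_le_trans e1; exact: expR_gt0.
set N := #|{: formula k n m}|.
set V := #|[set F : formula k n m | valid_formula F]|.
have VE : (V%:R : R) = \sum_(F : formula k n m) (valid_formula F)%:R.
  rewrite /V card_classic natr_sum [LHS]big_mkcond; apply: eq_bigr => F _; by case: (valid_formula F).
have pvE : pv ^+ m = N%:R^-1 * V%:R.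
  rewrite -(ex_prod (iid (lits R n) k) m) ex_formula -/N VE; congr (_ * _); apply: eq_bigr => F _.
  rewrite valid_formulaE; elim: (formula_of F) => [|c l IH]; first by rewrite big_nil.
  by rewrite big_cons IH /=; case: (validl c); rewrite ?mul1r ?mul0r.
have pm0 : 0 < pv ^+ m by rewrite exprn_gt0.
have V0 : (0 < V)%N.
  by rewrite lt0n; apply/negP => /eqP V0; move: pm0; rewrite pvE V0 mulr0 ltxx.
have N0 : 0 < N%:R^-1 :> R.
  by move: pm0; rewrite pvE pmulr_lgt0 // ltr0n.
split=> //; rewrite /avgF -/V.
have Vp : 0 < V%:R :> R by rewrite ltr0n.
have EmE := Em_formula n m Phi; rewrite -/N in EmE.
have S0 : \sum_(F : formula k n m | valid_formula F) Phi (wF F) <= \sum_(F : formula k n m) Phi (wF F).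
  rewrite big_mkcond; apply: ler_sum => F _; case: ifP => // _; apply: P0; exact: nn_wF.
apply: le_trans (_ : (pv ^+ m)^-1 * Em k n m Phi <= _).
  rewrite pvE EmE invfM invrK; rewrite ler_pdivrMr //; apply: le_trans S0 _.
  rewrite le_eqVlt; apply/orP; left; apply/eqP.
  have Nn : N%:R != 0 :> R by rewrite -invr_eq0 lt0r_neq0.
  by field; rewrite Nn lt0r_neq0.
have Em0 : 0 <= Em k n m Phi.
  by rewrite EmE mulr_ge0 ?(ltW N0) // sumr_ge0 // => F _; apply: P0; exact: nn_wF.
apply: ler_wpM2r => //; rewrite -[leRHS]invrK -expRN lef_pV2 ?posrE ?expR_gt0 //.
by rewrite -mulNr expRM_natr; apply: lerXn2r; rewrite ?nnegrE ?expR_ge0 // ltW.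
Qed.

End Bridge.

(** * Poisson number of clauses and the conditional expectation *)

Section Assembly.
Variables (R : realType) (k : nat).
Hypothesis k3 : (3 <= k)%N.
Let kp : 0 < k%:R :> R. Proof. by rewrite ltr0n; case: k k3. Qed.

Lemma rseries_pe (lam : R) a : 0 < lam -> rseries (fun m => poisson_pmf lam m * a m) = pe lam a.
Proof.
move=> l0; rewrite /rseries /pe; congr (limn _); apply/funext => N; apply: eq_bigr => i _.
by rewrite /poisson_pmf l0.
Qed.

(** Chernoff's method: beyond [x] the value of [p] is bounded by [K^(m - x)]. *)
Lemma pe_tail (lam x y K eta : R) p : 0 <= lam -> 1 < K -> (forall m, 0 <= p m <= 1) ->
  (forall m : nat, m%:R <= x -> p m <= eta) -> 0 <= eta ->
  pe lam p <= eta + expR (lam * (K - 1) - x * ln K).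
Proof.
move=> l0 K1 p01 ps eta0; have K0 : 0 < K by apply: lt_trans K1.
have lK : 0 <= ln K by rewrite ln_ge0 // ltW.
have dp : dom p.
  by apply: dom_le (dom_cst 1) _ => m; have /andP[a b] := p01 m; rewrite ger0_norm.
have dK : dom (fun m => expR (- (x * ln K)) * K ^+ m) by apply: dom_exp; exact: ltW.
have dK1 : dom (fun m => K ^+ m) := dom_pow (ltW K0).
apply: le_trans (_ : pe lam (fun m => eta + expR (- (x * ln K)) * K ^+ m) <= _).
  apply: pe_le => //; first by apply: domD => //; exact: dom_cst.
  move=> m; have e0 : 0 <= expR (- (x * ln K)) * K ^+ m by rewrite mulr_ge0 ?expR_ge0 // exprn_ge0 // ltW.
  have [mx|xm] := leP m%:R x; first by apply: le_trans (ps m mx) _; rewrite lerDl.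
  have /andP[_ p1] := p01 m; apply: le_trans p1 _.
  have -> : K ^+ m = expR (ln K * m%:R) by rewrite expRM_natr lnK.
  rewrite -expRD; have : 1 <= expR (- (x * ln K) + ln K * m%:R).
    rewrite -[leLHS]expR0 ler_expR; have := ler_wpM2l lK (ltW xm); lra.
  lra.
rewrite peD //; last exact: dom_cst.
by rewrite pe_cst // peZ // pe_exp -expRD lerD2l ler_expR; lra.
Qed.

(** Numbers of clauses up to [d' n / k] are covered by the estimates at [d' > d], larger ones by the
    Poisson tail. The probability of having a solution is then at least [1 / 2]. *)
Lemma overlap_vanishes (d e : R) : 0 < d -> (d%:E < dcond R k)%E -> 0 < e ->
  exists N, forall n, (N <= n)%N -> `|cond_overlap k d n / n%:R| <= e.
Proof.
move=> d0 dc e0; have [d' dd' dc'] := dcond_room dc; have d'0 := lt_trans d0 dd'.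
pose eta := Num.min (1 / 4) (e / 4).
have eta0 : 0 < eta by rewrite /eta lt_min !divr_gt0.
have eta4 : eta <= 1 / 4 by rewrite /eta ge_min lexx.
have etae : eta <= e / 4 by rewrite /eta ge_min lexx orbT.
clearbody eta.
(* The conditioning cost in [avgF_le] at [m = d' n / k]. *)
pose Cv := expR (2 * k%:R * d'); have Cv0 : 0 < Cv := expR_gt0 _.
have [N1 hN1] := Em_small k3 d'0 dc' (divr_gt0 eta0 Cv0).
(* Strictly between 1 and [d' / d], which makes the Chernoff rate [kap] positive through
   [1 - K^-1 <= ln K]. *)
pose K := (1 + d' / d) / 2.
have y1 : 1 < d' / d by rewrite ltr_pdivlMr // mul1r.
have K1 : 1 < K by rewrite /K; lra.
have K0 : 0 < K by apply: lt_trans K1.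
have Kd : K * d < d'.
  have : K < d' / d by rewrite /K; lra.
  by rewrite ltr_pdivlMr.
pose kap := (K - 1) * (d' / K - d) / k%:R.
have kap0 : 0 < kap.
  by rewrite /kap; apply: divr_gt0 => //; apply: mulr_gt0; rewrite subr_gt0 // ltr_pdivlMr // mulrC.
have [N2 hN2] := big_enough (eta^-1) kap0.
have [N3 hN3] := big_enough (2 * k%:R ^+ 2 : R) ltr01.
exists (N1 + N2 + N3).+1 => n nN.
have n0 : (0 < n)%N by apply: leq_ltn_trans nN.
have nN1 : (N1 <= n)%N by apply: leq_trans (ltnW nN); rewrite -addnA leq_addr.
have nN2 : (N2 <= n)%N by apply: leq_trans (ltnW nN); rewrite -addnA addnCA leq_addr.
have nN3 : (N3 <= n)%N by apply: leq_trans (ltnW nN); rewrite leq_addl.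
have np : 0 < n%:R :> R by rewrite ltr0n.
set lam := d * n%:R / k%:R; have lam0 : 0 < lam by apply: divr_gt0 => //; exact: mulr_gt0.
have kn : k%:R ^+ 2 / n%:R <= 1 / 2 :> R.
  by rewrite ler_pdivrMr //; have := hN3 n nN3; lra.
set x := d' * n%:R / k%:R.
have tail : expR (lam * (K - 1) - x * ln K) <= eta.
  have l1 := ln_ge1V K0.
  have x0 : 0 <= x by rewrite /x; apply: divr_ge0; [apply: mulr_ge0|]; exact: ltW.
  apply: le_trans (_ : expR (- (kap * n%:R)) <= _).
    rewrite ler_expR; have := ler_wpM2l x0 l1.
    have -> : - (kap * n%:R) = lam * (K - 1) - x * (1 - K^-1).
      by rewrite /kap /lam /x; field; rewrite !lt0r_neq0.
    lra.
  rewrite expRN -[eta]invrK lef_pV2 ?posrE ?invr_gt0 ?expR_gt0 //.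
  apply: le_trans (hN2 n nN2) _; apply: le_trans (expR_ge1Dx _); lra.
have cv m : m%:R <= x -> expR (2 * (k%:R ^+ 2 / n%:R) * m%:R) <= Cv.
  move=> mx; rewrite ler_expR.
  have c0 : 0 <= 2 * (k%:R ^+ 2 / n%:R) :> R by rewrite mulr_ge0 // divr_ge0 // exprn_ge0.
  apply: le_trans (ler_wpM2l c0 mx) _; rewrite /x le_eqVlt; apply/orP; left; apply/eqP; field.
  by rewrite !lt0r_neq0.
have muP := isprob_spins R n.
pose p m := avgF (fun F : formula k n m => Rv n (wF R F)).
pose q m : R := avgF (fun F : formula k n m => (A (spins R n) (wF R F) == 0)%:R).
have Rv0 (W : (nat -> bool) -> R) : nn W -> 0 <= Rv n W.
  by move=> w; apply: divr_ge0; [exact: (DE_ge0 muP)|exact: sqr_ge0].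
have Rv1 (W : (nat -> bool) -> R) : nn W -> Rv n W <= 1.
  move=> w; have [az|an] := eqVneq (A (spins R n) W) 0.
    by rewrite /Rv az expr0n invr0 mulr0.
  rewrite /Rv ler_pdivrMr; last by rewrite exprn_even_gt0.
  rewrite mul1r -(DE1 (spins R n)); apply: (DE_le muP) => // s t.
  by rewrite ler_norml; exact: ov_le1.
have V0 m : (0 < #|[set F : formula k n m | valid_formula F]|)%N.
  by have [] := @avgF_le R k k3 n m (fun=> 0) n0 kn (fun _ _ => lexx 0).
have avg01 m (X : formula k n m -> R) : (forall F, 0 <= X F <= 1) -> 0 <= avgF X <= 1.
  move=> X01; have Vp : 0 < #|[set F : formula k n m | valid_formula F]|%:R :> R by rewrite ltr0n.
  rewrite /avgF; apply/andP; split.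
    by apply: divr_ge0; [apply: sumr_ge0 => F _; case/andP: (X01 F)|exact: ltW].
  rewrite ler_pdivrMr // mul1r card_classic natr_sum; apply: ler_sum => F _; by case/andP: (X01 F).
have p01 m : 0 <= p m <= 1.
  by apply: avg01 => F; rewrite Rv0 ?Rv1 //; exact: nn_wF.
have q01 m : 0 <= q m <= 1.
  by apply: avg01 => F; case: (_ == _); rewrite ?ler01 ?lexx.
have ps m : m%:R <= x -> p m <= eta.
  move=> mx; have [_ h2] := hN1 n m nN1 mx.
  have [_ h] := @avgF_le R k k3 n m (Rv n) n0 kn Rv0; apply: le_trans h _.
  apply: le_trans (_ : Cv * (eta / Cv) <= _); last by rewrite mulrC divfK // lt0r_neq0.
  apply: ler_pM; [exact: expR_ge0| |exact: cv|exact: h2].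
  by rewrite Em_formula mulr_ge0 ?invr_ge0 // sumr_ge0 // => F _; apply: Rv0; exact: nn_wF.
have qs m : m%:R <= x -> q m <= eta.
  move=> mx; have [h1 _] := hN1 n m nN1 mx.
  have [_ h] := @avgF_le R k k3 n m (fun W => (A (spins R n) W == 0)%:R) n0 kn (fun _ _ => ler0n R _).
  apply: le_trans h _.
  apply: le_trans (_ : Cv * (eta / Cv) <= _); last by rewrite mulrC divfK // lt0r_neq0.
  apply: ler_pM; [exact: expR_ge0| |exact: cv|exact: h1].
  by rewrite Em_formula mulr_ge0 ?invr_ge0 // sumr_ge0.
have dom01 f : (forall m, 0 <= f m <= 1) -> dom f.
  by move=> f01; apply: dom_le (dom_cst 1) _ => m; have /andP[a b] := f01 m; rewrite ger0_norm.
have l0 := ltW lam0; have eta0' := ltW eta0.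
have PE : pe lam p <= 2 * eta.
  apply: le_trans (pe_tail 0 l0 K1 p01 ps eta0') _; lra.
have QE : pe lam q <= 2 * eta.
  apply: le_trans (pe_tail 0 l0 K1 q01 qs eta0') _; lra.
have P0 : 0 <= pe lam p by apply: pe_ge0 => // [|m]; [exact: dom01|case/andP: (p01 m)].
have num : rseries (fun m => poisson_pmf lam m * avgF (fun F : formula k n m => (0 < Z F)%:R * gibbs_abs_overlap R F)) = n%:R * pe lam p.
  rewrite rseries_pe // -peZ //; last exact: dom01.
  congr pe; apply/funext => m; rewrite /p /avgF mulrA mulr_sumr; congr (_ / _); apply: eq_bigr => F _.
  (* Without solutions the Gibbs average is 0 as a division by zero, so the indicator of [0 < Z F]
     changes nothing. *)
  rewrite Rv_wF // [RHS]mulrC divfK ?lt0r_neq0 //; case: posnP => [z0|zp]; last by rewrite mul1r.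
  by rewrite mul0r /gibbs_abs_overlap z0 expr0n /= invr0 mulr0.
have den : rseries (fun m => poisson_pmf lam m * avgF (fun F : formula k n m => (0 < Z F)%:R)) = 1 - pe lam q.
  rewrite rseries_pe //.
  have -> : 1 - pe lam q = pe lam (fun m => 1 + (-1) * q m).
    rewrite peD // ?pe_cst ?peZ ?mulN1r //; [exact: dom01|exact: dom_cst|by apply: domZ; exact: dom01].
  congr pe; apply/funext => m; rewrite /q /avgF.
  have Vn : #|[set F : formula k n m | valid_formula F]|%:R != 0 :> R by rewrite pnatr_eq0 -lt0n.
  apply: (mulIf Vn); rewrite divfK // mulrDl mul1r mulN1r mulNr divfK //.
  rewrite card_classic natr_sum -sumrB; apply: eq_bigr => F _.
  by rewrite A_wF_eq0 //; case: (0 < Z F)%N; rewrite /= ?subr0 ?subrr.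
rewrite /cond_overlap -/lam num den.
have D0 : 1 / 2 <= 1 - pe lam q by lra.
have Dp : 0 < 1 - pe lam q by lra.
have -> : n%:R * pe lam p / (1 - pe lam q) / n%:R = pe lam p / (1 - pe lam q).
  by field; rewrite !lt0r_neq0.
rewrite ger0_norm; last by rewrite divr_ge0 // ltW.
rewrite ler_pdivrMr //; have := ler_wpM2l (ltW e0) D0; lra.
Qed.

End Assembly.

Unset Implicit Arguments.

Theorem theorem1p2 (R : realType) (k : nat) (d : R) :
  (3 <= k)%N -> 0 < d -> (d%:E < dcond R k)%E ->
  (fun n : nat => cond_overlap k d n / n%:R) @ \oo --> (0 : R).
Proof.
move=> k3 d0 dc; apply/cvgrPdist_le => e e0.
have [N hN] := overlap_vanishes k3 d0 dc e0.
by exists N => // n /= nN; rewrite sub0r normrN; exact: hN.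
Qed.
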